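(* Let $\gamma>1$, let $\Omega\subset\mathbb{R}^d$ be a domain and $T>0$. Let $(R,U)$ be a local strong solution in $\Omega\times[0,T]$ of the isentropic compressible Euler equations with exponent $\gamma$, and let $(\rho,u)$ be an admissible weak solution in $\Omega\times[0,T]$ of the same system (in particular satisfying the local energy inequality on $\Omega\times[0,T]$) with initial data $(R(0),U(0))$ in $\Omega$. Suppose further there exist numbers $0\leq\underline{r}<\overline{r}<\infty$ (with $\underline{r}>0$ if $\gamma<2$) and $v>0$ such that $$\underline{r}\leq R,\rho\leq\overline{r}\quad\text{and}\quad |U|,|u|\leq v\quad\text{almost everywhere in }\Omega\times(0,T).$$ Then for every point $x_0\in\Omega$ there exist a domain $\Omega'\subset\Omega$ with $x_0\in\Omega'$ and a time $0<T'\leq T$ such that, for almost every $(x,t)\in\Omega'\times(0,T')$, either $R(x,t)=\rho(x,t)=0$, or $R(x,t)=\rho(x,t)$ and $U(x,t)=u(x,t)$.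
   Context: The domain $\Omega$ is not necessarily bounded and no boundary conditions are imposed. The isentropic compressible Euler equations with adiabatic exponent $\gamma>1$ are $$\partial_t(\rho u)+\operatorname{div}(\rho u\otimes u)+\nabla\rho^\gamma=0,\qquad \partial_t\rho+\operatorname{div}(\rho u)=0,$$ with density $\rho\ge0$ and velocity $u$ ($\mathbb{R}^d$-valued). Local strong solution in $\Omega\times[0,T]$: a pair $(R,U)\in C^1(\overline{\Omega\times[0,T]})$ (values and first derivatives continuous up to the closure) satisfying the equations pointwise. Admissible weak solution in $\Omega\times[0,T]$ with initial datum $(\rho^0,u^0)$ (where $\rho^0\ge0$, $\rho^0\in L^\gamma_{loc}(\Omega)$, $\rho^0|u^0|^2\in L^1_{loc}(\Omega)$): a pair $(\rho,u)$ with $\rho\in L^\gamma_{loc}(\Omega\times[0,T])$, $\rho|u|^2\in L^1_{loc}(\Omega\times[0,T])$ such that for almost every $\tau\in(0,T)$, every $\psi\in C_c^1(\Omega\times[0,T])$ and every $\eta\in C_c^1(\Omega\times[0,T];\mathbb{R}^d)$ (test functions need not vanish at $t=0$ or $t=T$), $$\int_0^\tau\!\!\int_{\Omega}\partial_t\psi\,\rho+\nabla\psi\cdot\rho u\,dx\,dt+\int_{\Omega}\psi(x,0)\rho^0-\psi(x,\tau)\rho(x,\tau)\,dx=0,$$ $$\int_0^\tau\!\!\int_{\Omega}\partial_t\eta\cdot\rho u+\nabla\eta:(\rho u\otimes u)+\rho^\gamma\operatorname{div}\eta\,dx\,dt+\int_{\Omega}\eta(x,0)\cdot\rho^0u^0-\eta(x,\tau)\cdot\rho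 u(x,\tau)\,dx=0,$$ and such that the local energy inequality holds: for almost every $\tau\in(0,T)$ and every nonnegative $\chi\in C_c^1(\Omega\times[0,T])$, $$\begin{aligned}\int_\Omega\frac12\chi(\tau)\rho(\tau)|u(\tau)|^2+\frac{1}{\gamma-1}\chi(\tau)\rho(\tau)^\gamma dx\le&\int_\Omega\frac12\chi(0)\rho^0|u^0|^2+\frac{1}{\gamma-1}\chi(0)(\rho^0)^\gamma dx\\&+\int_0^\tau\!\!\int_\Omega\partial_t\chi\left(\frac{\rho|u|^2}{2}+\frac{\rho^\gamma}{\gamma-1}\right)+\left(\frac{\rho|u|^2}{2}+\frac{\gamma}{\gamma-1}\rho^\gamma\right)\nabla\chi\cdot u\,dx\,dt,\end{aligned}$$ where it is part of the definition that all these integrals are well-defined. *)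

(* Defs.v *)
From HB Require Import structures.
From mathcomp Require Import all_boot all_order all_algebra.
From mathcomp Require Import all_classical all_reals all_analysis.
Set Implicit Arguments.
Unset Strict Implicit.
Unset Printing Implicit Defensive.
Import Order.TTheory GRing.Theory Num.Theory.
Import numFieldNormedType.Exports.
Local Open Scope classical_set_scope.
Local Open Scope ring_scope.

(* 'rV[R]_n with the sigma-algebra generated by the coordinate maps, that is,
   the Borel sigma-algebra of R^n. *)
Fact rV_display : measure_display.
Proof. exact: default_measure_display. Qed.

Section measurable_rV.
Context {R : realType} (n : nat).

Let coords (i : 'I_n) (x : 'rV[R]_n) : R := x ord0 i.

Let rV0 : g_sigma_preimage coords set0.
Proof. exact: sigma_algebra0. Qed.

Let rVC A : g_sigma_preimage coords A -> g_sigma_preimage coords (~` A).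
Proof. exact: sigma_algebraC. Qed.

Let rV_bigcup (F : _^nat) : (forall i, g_sigma_preimage coords (F i)) ->
  g_sigma_preimage coords (\bigcup_i (F i)).
Proof. exact: sigma_algebra_bigcup. Qed.

HB.instance Definition _ := @isMeasurable.Build rV_display
  'rV[R]_n (g_sigma_preimage coords) rV0 rVC rV_bigcup.
End measurable_rV.

Lemma measurable_rV_coord (R : realType) (n : nat) (i : 'I_n) :
  measurable_fun [set: 'rV[R]_n] (fun x : 'rV[R]_n => x ord0 i).
Proof.
move=> _ Y mY; rewrite setTI; apply: sub_sigma_algebra => /=.
rewrite -bigcup_seq/=; exists i => /=; first by rewrite mem_index_enum.
by exists Y => //; rewrite setTI.
Qed.

Lemma measurable_fun_rV (R : realType) (n : nat) d (T : measurableType d)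
    (f : T -> 'rV[R]_n) :
  (forall i, measurable_fun [set: T] (fun t => f t ord0 i)) ->
  measurable_fun [set: T] f.
Proof.
move=> mf.
suff mE : @measurable _ 'rV[R]_n `<=` [set Y | measurable (f @^-1` Y)].
  by move=> _ Y mY; rewrite setTI; exact: (mE _ mY).
apply: smallest_sub.
  split; rewrite /mkset.
  - by rewrite preimage_set0.
  - by move=> A mA; rewrite setTD preimage_setC; exact: measurableC.
  - by move=> F mF; rewrite preimage_bigcup; exact: bigcup_measurable.
move=> Y; rewrite -bigcup_seq => -[i /= _] [B mB <-]; rewrite setTI.
by rewrite -[X in measurable X]setTI; exact: mf.
Qed.

Section lebesgue_step.
Context {R : realType} {n : nat}.

Definition rV_cons (p : measurableTypeR R * 'rV[R]_n) : 'rV[R]_n.+1 :=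
  row_mx (const_mx p.1 : 'rV_1) p.2.

Lemma rV_cons0 p : rV_cons p ord0 ord0 = p.1.
Proof.
rewrite /rV_cons (_ : ord0 = lshift n (ord0 : 'I_1)); last exact/val_inj.
by rewrite (row_mxEl (const_mx p.1 : 'rV_1) p.2) mxE.
Qed.

Lemma rV_consS p (i : 'I_n) : rV_cons p ord0 (lift ord0 i) = p.2 ord0 i.
Proof.
rewrite /rV_cons (_ : lift ord0 i = rshift 1 i); last exact/val_inj.
by rewrite (row_mxEr (const_mx p.1 : 'rV_1) p.2).
Qed.

Lemma measurable_rV_cons : measurable_fun setT rV_cons.
Proof.
apply: measurable_fun_rV => i.
have [j ->|->] := unliftP ord0 i.
- have -> : (fun p => rV_cons p ord0 (lift ord0 j)) =
            (fun x : 'rV[R]_n => x ord0 j) \o snd.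
    by apply/funext => p; rewrite rV_consS.
  apply: measurableT_comp; [exact: measurable_rV_coord|exact: measurable_snd].
- have -> : (fun p => rV_cons p ord0 ord0) = fst.
    by apply/funext => p; rewrite rV_cons0.
  exact: measurable_fst.
Qed.

Variable mu : {sigma_finite_measure set 'rV[R]_n -> \bar R}.

Definition lebesgue_step : set 'rV[R]_n.+1 -> \bar R :=
  pushforward (@lebesgue_measure R \x mu)%E rV_cons.

Let prodmu :
    {measure set (measurableTypeR R * 'rV[R]_n)%type -> \bar R} :=
  (@lebesgue_measure R \x mu)%E.

Let step0 : lebesgue_step set0 = 0%E.
Proof.
by rewrite /lebesgue_step /pushforward preimage_set0; exact: (measure0 prodmu).
Qed.

Let step_ge0 A : (0 <= lebesgue_step A)%E.
Proof. exact: (measure_ge0 prodmu). Qed.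

Let step_sigma_additive : semi_sigma_additive lebesgue_step.
Proof.
move=> F mF tF mUF; rewrite /lebesgue_step /pushforward preimage_bigcup.
apply: (@measure_semi_sigma_additive _ _ _ prodmu).
- by move=> k; rewrite -[X in measurable X]setTI; exact: measurable_rV_cons.
- apply/trivIsetP => /= i j _ _ ij; rewrite -preimage_setI.
  by move/trivIsetP : tF => /(_ _ _ _ _ ij) ->//; rewrite preimage_set0.
- rewrite -preimage_bigcup -[X in measurable X]setTI.
  exact: measurable_rV_cons.
Qed.

HB.instance Definition _ := isMeasure.Build _ _ _ lebesgue_step
  step0 step_ge0 step_sigma_additive.

Let step_sigma_finite : sigma_finite setT lebesgue_step.
Proof.
have /sigma_finiteP[F [TF ndF Foo]] := sigma_finiteT (@lebesgue_measure R).
have /sigma_finiteP[G [TG ndG Goo]] := sigma_finiteT mu.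
pose g (x : 'rV[R]_n.+1) : measurableTypeR R * 'rV[R]_n :=
  (x ord0 ord0, \row_i x ord0 (lift ord0 i)).
have gK : cancel rV_cons g.
  move=> [a x]; rewrite /g rV_cons0; congr pair.
  by apply/rowP => i; rewrite mxE rV_consS.
have mg : measurable_fun setT g.
  apply: measurable_fun_pair; first exact: measurable_rV_coord.
  apply: measurable_fun_rV => i; under eq_fun do rewrite mxE.
  exact: measurable_rV_coord.
exists (fun k => g @^-1` (F k `*` G k)).
  rewrite -preimage_bigcup -(preimage_setT g); congr (_ @^-1` _).
  apply/esym/seteqP; split=> // -[a x] _.
  have [i _ Fi] : (\bigcup_i F i) a by rewrite -TF.
  have [j _ Gj] : (\bigcup_i G i) x by rewrite -TG.
  exists (maxn i j) => //; split => /=.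
    by move: a Fi; exact/subsetPset/ndF/leq_maxl.
  by move: x Gj; exact/subsetPset/ndG/leq_maxr.
move=> k; have [mFk Fk] := Foo k; have [mGk Gk] := Goo k.
have mFG : measurable (F k `*` G k) by exact: measurableX.
split; first by rewrite -[X in measurable X]setTI; exact: mg.
rewrite /lebesgue_step /pushforward -comp_preimage.
rewrite (_ : g \o rV_cons = id); last by apply/funext => p /=; rewrite gK.
by rewrite preimage_id product_measure1E// lte_mul_pinfty// ge0_fin_numE.
Qed.

HB.instance Definition _ := Measure_isSigmaFinite.Build _ _ _ lebesgue_step
  step_sigma_finite.

End lebesgue_step.

(* Lebesgue measure on R^n as an iterated product; see [lebesgue_rV_box]. *)
Fixpoint lebesgue_rV (R : realType) (n : nat) :
    {sigma_finite_measure set 'rV[R]_n -> \bar R} :=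
  match n with
  | 0 => \d_(0 : 'rV[R]_0)
  | n'.+1 => lebesgue_step (lebesgue_rV R n')
  end.

Lemma lebesgue_rV_box (R : realType) (n : nat)
    (A : 'I_n -> set (measurableTypeR R)) :
  (forall i, measurable (A i)) ->
  lebesgue_rV R n [set x | forall i, A i (x ord0 i)] =
  (\prod_(i < n) lebesgue_measure (A i))%E.
Proof.
elim: n A => [|n IH] A mA.
  by rewrite big_ord0 /= diracE mem_set// => -[m] //.
rewrite big_ord_recl -IH//= /lebesgue_step /pushforward.
set B := (X in (_ * lebesgue_rV R n X)%E).
have mB : measurable B.
  rewrite (_ : B = \bigcap_(i in [set: 'I_n])
      ((fun x : 'rV[R]_n => x ord0 i) @^-1` A (lift ord0 i))).
    apply: fin_bigcap_measurable => // i _.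
    rewrite -[X in measurable X]setTI.
    exact: (measurable_rV_coord i measurableT (mA (lift ord0 i))).
  by apply/seteqP; split=> x /= Ax i; [move=> _; exact: Ax|exact: Ax].
rewrite -product_measure1E//.
congr (_ _); apply/seteqP; split=> -[a x] /=.
  move=> Aax; split=> [|i]; first by have := Aax ord0; rewrite rV_cons0.
  by have := Aax (lift ord0 i); rewrite rV_consS.
move=> [Aa Ax] i; have [j ->|->] := unliftP ord0 i.
  by rewrite rV_consS; exact: Ax.
by rewrite rV_cons0.
Qed.

Definition lebesgue_xt (R : realType) (d : nat) :
    {measure set ('rV[R]_d * measurableTypeR R)%type -> \bar R} :=
  (lebesgue_rV R d \x @lebesgue_measure R)%E.

Section euler.
Context {R : realType} {d : nat}.
Implicit Types (Omega : set 'rV[R]_d) (T tau gamma : R).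

Definition is_domain Omega := [/\ Omega !=set0, open Omega & connected Omega].

Definition dotv (u v : 'rV[R]_d) : R := \sum_(i < d) u ord0 i * v ord0 i.

(* The norm of 'rV[R]_d in the library is the sup norm. *)
Definition euclid_norm (u : 'rV[R]_d) : R := Num.sqrt (dotv u u).

Section derivatives.
Context {W : normedModType R}.
Implicit Types (f : 'rV[R]_d * R -> W).

Definition dt f (z : 'rV[R]_d * R) : W := 'D_((0, 1)) f z.

Definition dx (j : 'I_d) f (z : 'rV[R]_d * R) : W :=
  'D_((delta_mx ord0 j, 0)) f z.

(* C^1 on the open set O, where f and its first derivatives are continuous up
   to A. The values of f outside A are irrelevant when O is contained in A. *)
Definition C1_upto (O A : set ('rV[R]_d * R)) f : Prop :=
  [/\ {within A, continuous f},
      (forall z, O z -> differentiable f z) &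
      forall v, exists g : 'rV[R]_d * R -> W,
        {within A, continuous g} /\ (forall z, O z -> g z = 'D_v f z)].

(* C^1_c(Omega x [0,T]): the support may reach t = 0 and t = T. *)
Definition C1c Omega T f : Prop :=
  C1_upto (Omega `*` `]0, T[) (Omega `*` `[0, T]) f /\
  exists K : set ('rV[R]_d * R), [/\ compact K, K `<=` Omega `*` `[0, T] &
    forall z, (Omega `*` `[0, T]) z -> ~ K z -> f z = 0].

End derivatives.

(* The derivatives up to the closure are extensions of those on the open
   cylinder, so the equations on the latter extend to t = 0 and t = T. *)
Definition local_strong_solution gamma Omega T
    (rho : 'rV[R]_d * R -> R) (u : 'rV[R]_d * R -> 'rV[R]_d) : Prop :=
  let QT := (Omega `*` `]0, T[) in
  let cQT := closure (Omega `*` `[0, T]) in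
  [/\ C1_upto QT cQT rho /\ C1_upto QT cQT u,
      (forall z, (Omega `*` `[0, T]) z -> 0 <= rho z),
      (forall z, QT z ->
        dt rho z + \sum_(j < d) dx j (fun w => rho w * u w ord0 j) z = 0) &
      (forall z, QT z -> forall i : 'I_d,
        dt (fun w => rho w * u w ord0 i) z
        + \sum_(j < d) dx j (fun w => rho w * u w ord0 i * u w ord0 j) z
        + dx i (fun w => rho w `^ gamma) z = 0)].

Definition L1loc_x Omega (f : 'rV[R]_d -> R) : Prop :=
  forall K, compact K -> K `<=` Omega ->
    (lebesgue_rV R d).-integrable K (EFin \o f).

Definition L1loc_xt Omega T (f : 'rV[R]_d * R -> R) : Prop :=
  forall K : set ('rV[R]_d * R), compact K -> K `<=` Omega `*` `[0, T] ->
    (lebesgue_xt R d).-integrable K (EFin \o f).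

Definition initial_datum gamma Omega
    (rho0 : 'rV[R]_d -> R) (u0 : 'rV[R]_d -> 'rV[R]_d) : Prop :=
  [/\ measurable_fun Omega rho0 /\ measurable_fun Omega u0,
      (\forall x \ae lebesgue_rV R d, Omega x -> 0 <= rho0 x),
      L1loc_x Omega (fun x => `|rho0 x| `^ gamma) &
      L1loc_x Omega (fun x => rho0 x * dotv (u0 x) (u0 x))].

(* [Rintegral] is 0 on integrals that are not finite, so each identity also
   states that its integrands are integrable. *)
Section weak_formulation.
Variables (gamma : R) (Omega : set 'rV[R]_d) (tau : R).
Variables (rho : 'rV[R]_d * R -> R) (u : 'rV[R]_d * R -> 'rV[R]_d).
Variables (rho0 : 'rV[R]_d -> R) (u0 : 'rV[R]_d -> 'rV[R]_d).

Let mux := lebesgue_rV R d.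
Let muxt := lebesgue_xt R d.
Let Qtau : set ('rV[R]_d * measurableTypeR R) := Omega `*` `]0, tau[.

Definition mass_balance (psi : 'rV[R]_d * R -> R) : Prop :=
  let F z := dt psi z * rho z + \sum_(j < d) dx j psi z * (rho z * u z ord0 j) in
  let G x := psi (x, 0) * rho0 x - psi (x, tau) * rho (x, tau) in
  [/\ muxt.-integrable Qtau (EFin \o F),
      mux.-integrable Omega (EFin \o G) &
      \int[muxt]_(z in Qtau) F z + \int[mux]_(x in Omega) G x = 0].

Definition momentum_balance (eta : 'rV[R]_d * R -> 'rV[R]_d) : Prop :=
  let F z := dotv (dt eta z) (rho z *: u z)
    + \sum_(i < d) \sum_(j < d)
        dx j eta z ord0 i * (rho z * u z ord0 i * u z ord0 j)
    + rho z `^ gamma * \sum_(i < d) dx i eta z ord0 i in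
  let G x := dotv (eta (x, 0)) (rho0 x *: u0 x)
    - dotv (eta (x, tau)) (rho (x, tau) *: u (x, tau)) in
  [/\ muxt.-integrable Qtau (EFin \o F),
      mux.-integrable Omega (EFin \o G) &
      \int[muxt]_(z in Qtau) F z + \int[mux]_(x in Omega) G x = 0].

Definition energy_inequality (chi : 'rV[R]_d * R -> R) : Prop :=
  let E1 x := 2^-1 * chi (x, tau) * rho (x, tau) * dotv (u (x, tau)) (u (x, tau))
    + (gamma - 1)^-1 * chi (x, tau) * rho (x, tau) `^ gamma in
  let E0 x := 2^-1 * chi (x, 0) * rho0 x * dotv (u0 x) (u0 x)
    + (gamma - 1)^-1 * chi (x, 0) * rho0 x `^ gamma in
  let F z :=
    dt chi z * (rho z * dotv (u z) (u z) / 2 + rho z `^ gamma / (gamma - 1))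
    + (rho z * dotv (u z) (u z) / 2 + gamma / (gamma - 1) * rho z `^ gamma)
      * \sum_(j < d) dx j chi z * u z ord0 j in
  [/\ mux.-integrable Omega (EFin \o E1),
      mux.-integrable Omega (EFin \o E0),
      muxt.-integrable Qtau (EFin \o F) &
      \int[mux]_(x in Omega) E1 x
        <= \int[mux]_(x in Omega) E0 x + \int[muxt]_(z in Qtau) F z].

End weak_formulation.

Definition admissible_weak_solution gamma Omega T
    (rho : 'rV[R]_d * R -> R) (u : 'rV[R]_d * R -> 'rV[R]_d)
    (rho0 : 'rV[R]_d -> R) (u0 : 'rV[R]_d -> 'rV[R]_d) : Prop :=
  let OT : set ('rV[R]_d * measurableTypeR R) := Omega `*` `[0, T] in
  [/\ initial_datum gamma Omega rho0 u0,
      [/\ measurable_fun OT rho, measurable_fun OT u,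
          (\forall z \ae lebesgue_xt R d, OT z -> 0 <= rho z),
          L1loc_xt Omega T (fun z => `|rho z| `^ gamma) &
          L1loc_xt Omega T (fun z => rho z * dotv (u z) (u z))],
      (\forall tau \ae @lebesgue_measure R, 0 < tau < T ->
        (forall psi : 'rV[R]_d * R -> R, C1c Omega T psi ->
          mass_balance Omega tau rho u rho0 psi) /\
        (forall eta : 'rV[R]_d * R -> 'rV[R]_d, C1c Omega T eta ->
          momentum_balance gamma Omega tau rho u rho0 u0 eta)) &
      (\forall tau \ae @lebesgue_measure R, 0 < tau < T ->
        forall chi : 'rV[R]_d * R -> R, C1c Omega T chi ->
          (forall z, (Omega `*` `[0, T]) z -> 0 <= chi z) ->
          energy_inequality gamma Omega tau rho u rho0 u0 chi)].

End euler.

(* Main.v *)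
Require Import Defs.
From HB Require Import structures.
From mathcomp Require Import all_boot all_order all_algebra.
From mathcomp Require Import all_classical all_reals all_analysis.
From mathcomp Require Import measurable_realfun.
From mathcomp Require Import ring lra.
Set Implicit Arguments.
Unset Strict Implicit.
Unset Printing Implicit Defensive.
Import Order.TTheory GRing.Theory Num.Theory.
Import numFieldNormedType.Exports.
Local Open Scope classical_set_scope.
Local Open Scope ring_scope.

(** The proof is a relative energy argument. The weak solution is compared with the density
    [rs] and a velocity field V of class C^1 through the relative energy
      E = 1/2 rho |u - V|^2 + relP g rho rs,
    where [relP] is the excess of the pressure potential s^g/(g - 1) over its tangent at [rs].
    With h the enthalpy g/(g - 1) rs^(g - 1) and a cutoff chi, the energy inequality for chi,
    minus the momentum balance tested with chi V, plus the mass balance tested with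
    chi (|V|^2/2 - h), plus the divergence theorem ([test_balance]) for the density chi rs^g
    with the flux chi rs^g V, is an inequality for the integral of chi E. Its rate is computed
    in [rel_rateE]: besides
      dt chi E + grad chi . (u E + (rho^g - rs^g) (u - V))
    it contains chi times terms that are bounded by E, the gradient of V and the residuals of V
    in the two transport equations
      dt V + V . grad V + grad h = 0,   dt h + V . grad h + (g - 1) h div V = 0
    ([accel], [mass_residual], [source_le]).

    The cutoff is the squared positive part of r^2 - |x - x0|^2 - c t, which lives on a
    backward cone. For a large speed c the terms with derivatives of chi have a negative sum
    ([cone_flux_le]), since |rho^g - rs^g| |u - V| is bounded by a multiple of E
    ([pressure_flux_le]). This rests on the convexity of the pressure potential, uniform on the
    given range of densities because the range avoids the vacuum if g < 2. On a short time
    interval the energy inequality then absorbs its own right-hand side ([rel_energy_small])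
    and bounds the integral of chi E by the residuals of V and the initial distance of V
    from [us].

    If the density [rs] is positive one takes V = us, whose residuals vanish. In a vacuum of
    the strong solution, possible for g >= 2 only, the momentum balance is void and the momentum
    residual of [us] is arbitrary, so the estimate fails for V = us. It is enough to have, for
    every eps, a field V with both residuals at most eps, with |V - us| <= eps where rs > 0, and
    with a gradient bounded independently of eps ([velocity_approximation]). In the vacuum the
    enthalpy and its gradient vanish and the equation for V is the Burgers equation. Let W be an
    approximate solution of it, with a time slice of [us] as initial data ([transport]). Where
    the density is small but positive the enthalpy gradient is small ([enthalpy_small]), so that
    [us] almost solves the Burgers equation too, and us - W stays small along the flow of [us].
    The flow lines do not leave the region of positive density, and the maximum
    principle [max_principle_vanishing_set] carries the smallness to the boundary of the vacuum
    ([deviation_small_at_vacuum_boundary]). There us - W can therefore be cut off at a small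
    size: V is [us] minus this cut off deviation, and W in the vacuum ([blended]).

    As eps tends to zero, relP g rho rs and rs rho |u - us|^2 vanish almost everywhere in the cone
    ([gap_eq0]), and by the coercivity of [relP] the solutions coincide there in the stated
    sense ([gap_zero_coincide]). The cone contains a cylinder over a ball around [x0]. *)

(** * Functions of class C^1 up to part of the boundary *)

Section differentiable_criteria.
Context {R : realType} {E W : normedModType R}.
Implicit Types (f g : E -> W) (z : E).

Lemma differentiable_of_littleo f z (df : {linear E -> W}) :
  continuous df ->
  (forall e : R, 0 < e -> \forall h \near (0 : E),
    `|f (z + h) - (f z + df h)| <= e * `|h|) ->
  differentiable f z /\ 'd f z = df :> (E -> W).
Proof.
move=> cdf fE.
have fo : f \o shift z = cst (f z) + df +o_ (0 : E) id.
  apply/eqaddoP => e e0; have := fE e e0; apply: filterS => h.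
  rewrite [X in _ -> `|X| <= _](_ : _ = f (z + h) - (f z + df h)) //.
  by rewrite [z + h]addrC.
have dE := diff_unique cdf fo.
by split=> //; apply/diff_locallyP; rewrite dE.
Qed.

Lemma differentiable_littleo f z : differentiable f z ->
  forall e : R, 0 < e -> \forall h \near (0 : E),
    `|f (z + h) - (f z + 'd f z h)| <= e * `|h|.
Proof.
move=> df e e0; have /eqaddoP/(_ e e0) := diff_locally df; apply: filterS => h.
rewrite [X in `|X| <= _ -> _](_ : _ = f (z + h) - (f z + 'd f z h)) //.
by rewrite [z + h]addrC.
Qed.

Lemma near_eq_differentiable f g z :
  (\forall w \near z, f w = g w) -> differentiable f z -> differentiable g z.
Proof.
move=> fg df.
have [|//] := @differentiable_of_littleo g z ('d f z) (diff_continuous df).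
move=> e e0; have fo := differentiable_littleo df e0.
have fg0 := nbhs_singleton fg.
have {}fg : \forall h \near (0 : E), f (z + h) = g (z + h).
  move: fg; rewrite (near_shift 0 z) /=; apply: filterS => h.
  by rewrite subr0 addrC.
near=> h; rewrite -fg0 -(near fg h) //.
by near: h.
Unshelve. all: by end_near. Qed.

End differentiable_criteria.

Section continuity_at.
Context {R : realType} {E W : normedModType R}.
Implicit Types (x : E) (f g : E -> W) (k l : E -> R).

Lemma continuous_at_cst (c : W) x : {for x, continuous (fun _ : E => c)}.
Proof. exact: cvg_cst. Qed.

Lemma continuous_at_add f g x : {for x, continuous f} -> {for x, continuous g} ->
  {for x, continuous (fun y => f y + g y)}.
Proof. by move=> cf cg; exact: cvgD. Qed.

Lemma continuous_at_sub f g x : {for x, continuous f} -> {for x, continuous g} ->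
  {for x, continuous (fun y => f y - g y)}.
Proof. by move=> cf cg; exact: cvgB. Qed.

Lemma continuous_at_scale k f x : {for x, continuous k} -> {for x, continuous f} ->
  {for x, continuous (fun y => k y *: f y)}.
Proof. by move=> ck cf; exact: cvgZ. Qed.

Lemma continuous_at_mul k l x : {for x, continuous k} -> {for x, continuous l} ->
  {for x, continuous (fun y => k y * l y)}.
Proof. by move=> ck cf; exact: cvgM. Qed.

Lemma continuous_at_sum n (F : 'I_n -> E -> W) x :
  (forall i, {for x, continuous (F i)}) -> {for x, continuous (fun y => \sum_(i < n) F i y)}.
Proof.
move=> cF; apply: (@cvg_big _ _ +%R 0 xpredT) => [|i _]; last exact: cF.
exact: add_continuous.
Qed.

Lemma continuous_at_eq f g x : (\forall y \near x, f y = g y) ->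
  {for x, continuous f} -> {for x, continuous g}.
Proof.
move=> fg cf; have fgx : f x = g x by exact: nbhs_singleton fg.
suff : g @ x --> f x by rewrite fgx.
by apply: cvg_trans cf; exact: near_eq_cvg.
Qed.

End continuity_at.

Section C1at.
Context {R : realType} {E : normedModType R}.

(** The local form of [C1_upto]. It sees [f] only near [z], so that functions which are
    defined by cases or cut off can be treated point by point; the existence of limits
    of the derivatives replaces the continuous extensions. *)
Definition C1at {W : normedModType R} (O A : set E) (f : E -> W) (z : E) :=
  [/\ f @ within A (nbhs z) --> f z,
      \forall w \near z, O w -> differentiable f w &
      forall v, cvg ('D_v f @ within O (nbhs z))].

Lemma within_nbhs (O : set E) (z : E) : nbhs z O -> within O (nbhs z) = nbhs z.
Proof.
move=> Oz; apply/seteqP; split=> S; last exact: cvg_within.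
by move=> OS; apply: filterS2 Oz OS => w Ow; exact.
Qed.

Section generic.
Context {W : normedModType R} (O A : set E).
Hypotheses (oO : open O) (OA : O `<=` A).
Implicit Types (f g : E -> W).

Lemma C1at_differentiable f z : O z -> C1at O A f z -> differentiable f z.
Proof. by move=> Oz [_ /nbhs_singleton df _]; exact: df. Qed.

Lemma C1at_derive_continuous f z v : O z -> C1at O A f z ->
  'D_v f @ z --> 'D_v f z.
Proof.
move=> Oz [_ _ /(_ v)]; rewrite within_nbhs; last exact: open_nbhs_nbhs.
move=> /cvg_ex[/= l fl]; suff <- : l = 'D_v f z by [].
apply/eqP; rewrite -subr_eq0 -normr_le0; apply/ler_addgt0Pr => e e0.
move/cvgrPdist_le : fl => /(_ e e0) /nbhs_singleton /=.
by rewrite add0r.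
Qed.

Lemma C1at_cst (c : W) z : C1at O A (cst c) z.
Proof.
split; [exact: cvg_cst| by near=> w|move=> v].
by apply/cvg_ex; exists 0; under eq_fun do rewrite derive_cst; exact: cvg_cst.
Unshelve. all: by end_near. Qed.

Lemma C1at_eq f g z : A z -> (\forall w \near z, A w -> f w = g w) ->
  C1at O A f z -> C1at O A g z.
Proof.
move=> Az fg [cf df Df].
have fgO : \forall w \near z, O w -> \forall y \near w, f y = g y.
  have /near_join := fg; apply: filterS => w fgw Ow.
  have Ow' : nbhs w O by exact: open_nbhs_nbhs.
  by apply: filterS2 Ow' fgw => y /OA Ay; exact.
split.
- rewrite -(nbhs_singleton fg Az); apply: cvg_trans cf; apply: near_eq_cvg.
  exact: fg.
- apply: filterS2 df fgO => w dfw fgw Ow.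
  exact: near_eq_differentiable (fgw Ow) (dfw Ow).
- move=> v; have /cvg_ex[/= l fl] := Df v; apply/cvg_ex; exists l.
  apply: cvg_trans fl; apply: near_eq_cvg.
  by apply: filterS fgO => w fgw Ow; exact/near_eq_derive/fgw.
Qed.

Lemma C1at_subset (O' A' : set E) f z : O `<=` O' -> A `<=` A' ->
  C1at O' A' f z -> C1at O A f z.
Proof.
move=> OO' AA' [cf df Df]; split.
- apply: cvg_trans cf; apply: cvg_app; exact: within_subset.
- by apply: filterS df => w dfw /OO'/dfw.
- move=> v; have /cvg_ex[/= l fl] := Df v; apply/cvg_ex; exists l.
  by apply: cvg_trans fl; apply: cvg_app; exact: within_subset.
Qed.

Lemma C1atD f g z : C1at O A f z -> C1at O A g z -> C1at O A (f + g) z.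
Proof.
move=> [cf df Df] [cg dg Dg]; split.
- exact: cvgD.
- by apply: filterS2 df dg => w dfw dgw Ow; apply: differentiableD; [exact: dfw|exact: dgw].
- move=> v; have /cvg_ex[/= a fa] := Df v; have /cvg_ex[/= b gb] := Dg v.
  apply/cvg_ex; exists (a + b); apply: cvg_trans (cvgD fa gb).
  apply: near_eq_cvg; apply: filterS2 df dg => w dfw dgw Ow.
  by rewrite /= deriveD //; apply: diff_derivable; [exact: dfw|exact: dgw].
Qed.

Lemma C1atN f z : C1at O A f z -> C1at O A (- f) z.
Proof.
move=> [cf df Df]; split.
- exact: cvgN.
- by apply: filterS df => w dfw Ow; apply: differentiableN; exact: dfw.
- move=> v; have /cvg_ex[/= a fa] := Df v.
  apply/cvg_ex; exists (- a); apply: cvg_trans (cvgN fa).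
  apply: near_eq_cvg; apply: filterS df => w dfw Ow.
  by rewrite /= deriveN //; apply: diff_derivable; exact: dfw.
Qed.

End generic.

Lemma derive_comp (phi : R -> R) (f : E -> R) z v :
  derivable phi (f z) 1 -> differentiable f z ->
  'D_v (phi \o f) z = (phi^`())%classic (f z) * 'D_v f z.
Proof.
move=> /derivable1_diffP dphi df.
rewrite deriveE; last exact: differentiable_comp.
by rewrite diff_comp //= (diff1E dphi) /= -deriveE // mulrC.
Qed.

Section scalar.
Context (O A : set E).
Hypotheses (oO : open O) (OA : O `<=` A).
Implicit Types (f g : E -> R).

Lemma C1atM f g z : C1at O A f z -> C1at O A g z -> C1at O A (f * g) z.
Proof.
move=> [cf df Df] [cg dg Dg]; split.
- exact: cvgM.
- by apply: filterS2 df dg => w dfw dgw Ow; apply: differentiableM; [exact: dfw|exact: dgw].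
- move=> v.
  have /cvg_ex[/= a Da] := Df v; have /cvg_ex[/= b Db] := Dg v.
  have wOA := within_subset (nbhs_filter z) OA.
  have cf' : f @ within O (nbhs z) --> f z by apply: cvg_trans cf; exact: cvg_app.
  have cg' : g @ within O (nbhs z) --> g z by apply: cvg_trans cg; exact: cvg_app.
  apply/cvg_ex; exists (f z * b + g z * a) => /=.
  apply: cvg_trans (cvgD (cvgM cf' Db) (cvgM cg' Da)).
  apply: near_eq_cvg; apply: filterS2 df dg => w dfw dgw Ow.
  by rewrite /= deriveM //; apply: diff_derivable; [exact: dfw|exact: dgw].
Qed.

Lemma C1at_comp (phi : R -> R) f z :
  (\forall s \near f z, derivable phi s 1) ->
  {for f z, continuous (phi^`())%classic} ->
  C1at O A f z -> C1at O A (phi \o f) z.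
Proof.
move=> dphi cphi [cf df Df].
have wOA := within_subset (nbhs_filter z) OA.
have cf' : f @ within O (nbhs z) --> f z by apply: cvg_trans cf; exact: cvg_app.
have dw : \forall w \near z, O w -> derivable phi (f w) 1 := cf' _ dphi.
split.
- apply: (cvg_comp _ _ cf); apply: (@differentiable_continuous _ _ _ (f z)).
  exact/derivable1_diffP/(nbhs_singleton dphi).
- apply: filterS2 df dw => w dfw dphiw Ow; apply: differentiable_comp.
    exact: dfw.
  exact/derivable1_diffP/dphiw.
- move=> v.
  have /cvg_ex[/= a Da] := Df v.
  apply/cvg_ex; exists ((phi^`())%classic (f z) * a) => /=.
  have c1 : ((phi^`())%classic \o f) @ within O (nbhs z) --> (phi^`())%classic (f z) by apply: cvg_comp cf' _; exact: cphi.
  apply: cvg_trans (cvgM c1 Da).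
  apply: near_eq_cvg; apply: filterS2 df dw => w dfw dphiw Ow.
  by rewrite derive_comp //; [exact: dphiw|exact: dfw].
Qed.

End scalar.
End C1at.

Section extension.
Context {R : realType} {E W : normedModType R} (O A : set E).
Hypotheses (oO : open O) (OA : O `<=` A) (AO : A `<=` closure O).
Implicit Types (f : E -> W).

Lemma C1_extension_C1at f :
  [/\ {within A, continuous f}, (forall z, O z -> differentiable f z) &
      forall v, exists g : E -> W,
        {within A, continuous g} /\ (forall z, O z -> g z = 'D_v f z)] ->
  forall z, A z -> C1at O A f z.
Proof.
move=> [/subspace_continuousP cf df Df] z Az; split; first exact: cf.
  by apply: nearW => w Ow; exact: df.
move=> v; have [g [/subspace_continuousP/(_ _ Az) cg gE]] := Df v.
apply/cvg_ex; exists (g z).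
have cg' : g @ within O (nbhs z) --> g z.
  by apply: cvg_trans cg; apply: cvg_app; exact: within_subset.
apply: cvg_trans cg'; apply: near_eq_cvg.
have : \forall w \near z, O w -> g w = 'D_v f w by apply: nearW => w; exact: gE.
exact.
Qed.

(** The limits of a derivative define its extension, which is continuous: near [z] the
    derivative is close to its limit at [z], hence so are its limits at the nearby
    points. *)
Lemma C1at_C1_extension f : (forall z, A z -> C1at O A f z) ->
  [/\ {within A, continuous f}, (forall z, O z -> differentiable f z) &
      forall v, exists g : E -> W,
        {within A, continuous g} /\ (forall z, O z -> g z = 'D_v f z)].
Proof.
move=> Af; split.
- by apply/subspace_continuousP => z /Af[].
- by move=> z Oz; apply: C1at_differentiable Oz (Af _ (OA Oz)).
- move=> v; pose g (z : E) := lim ('D_v f @ within O (nbhs z)).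
  have gP z : A z -> 'D_v f @ within O (nbhs z) --> g z by move=> /Af[_ _].
  exists g; split; last first.
    move=> z Oz; have := gP z (OA Oz).
    rewrite within_nbhs; last exact: open_nbhs_nbhs.
    move=> gz; apply: (cvg_unique (@norm_hausdorff R W) gz).
    exact: (C1at_derive_continuous oO Oz (Af _ (OA Oz))).
  apply/subspace_continuousP => z Az; apply/cvgrPdist_le => e e0.
  have /cvgrPdist_le/(_ (e / 2)) := gP _ Az.
  rewrite divr_gt0 // => /(_ isT) H.
  have {}H : \forall w \near z, O w -> `|g z - 'D_v f w| <= e / 2 by exact: H.
  have /near_join := H; rewrite /within /=; apply: filterS => w Hw Aw.
  have PF : ProperFilter (within O (nbhs w)) by apply: within_nbhs_proper; exact: AO.
  have /cvgrPdist_le/(_ (e / 2)) := gP _ Aw.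
  rewrite divr_gt0 // => /(_ isT) Gw.
  have Hw' : \forall y \near within O (nbhs w), `|g z - 'D_v f y| <= e / 2 by exact: Hw.
  have [y [y1 y2]] := filter_ex (filterI Gw Hw').
  rewrite [e]splitr -(subrKA ('D_v f y)) (le_trans (ler_normD _ _)) // lerD //.
  by rewrite distrC.
Qed.
End extension.

Lemma C1at_coord {R : realType} {E : normedModType R} d (O A : set E) (f : E -> 'rV[R]_d) z :
  open O -> O `<=` A ->
  (C1at O A f z <-> forall i, C1at O A (fun z => f z ord0 i) z).
Proof.
move=> oO OA; split.
- move=> [cf df Df] i.
  have dc (y : 'rV[R]_d) : differentiable (fun x : 'rV[R]_d => x ord0 i : R) y.
    exact: differentiable_coord.
  split.
  + by apply: (@cvg_comp _ _ _ f (fun x : 'rV[R]_d => x ord0 i) _ _ _ cf); exact: coord_continuous.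
  + apply: filterS df => w dfw Ow.
    exact: (@differentiable_comp _ _ _ _ f (fun x : 'rV[R]_d => x ord0 i : R) w (dfw Ow) (dc _)).
  + move=> v; have /cvg_ex[/= l fl] := Df v; apply/cvg_ex; exists (l ord0 i).
    have c1 : (fun w => 'D_v f w ord0 i) @ within O (nbhs z) --> l ord0 i.
      by apply: (@cvg_comp _ _ _ ('D_v f) (fun x : 'rV[R]_d => x ord0 i) _ _ _ fl); exact: coord_continuous.
    apply: cvg_trans c1; apply: near_eq_cvg.
    apply: filterS df => w dfw Ow /=.
    by rewrite derive_mx ?mxE //; apply: diff_derivable; exact: dfw.
- move=> fi; have fE : f = \sum_(i < d) (fun w => f w ord0 i *: delta_mx ord0 i).
    apply/funext => w; rewrite fct_sumE; apply/rowP => j.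
    rewrite summxE (bigD1 j) //= !mxE !eqxx mulr1 big1 ?addr0 // => i ij.
    by rewrite !mxE eqxx /= eq_sym (negbTE ij) mulr0.
  have df : \forall w \near z, O w -> differentiable f w.
    have : \forall w \near z, forall i, O w -> differentiable (fun z => f z ord0 i) w.
      by apply: filter_forall => i; have [_ df _] := fi i; exact: df.
    apply: filterS => w dfw Ow; rewrite fE; apply: differentiable_sum => i.
    by apply: differentiableZl; exact: dfw.
  split=> //.
  + apply/cvgrPdist_le => e e0; near=> w.
    rewrite /Num.Def.normr/= mx_normrE (bigmax_le _ (ltW e0))//= => -[i j] _.
    rewrite !mxE/= (ord1 i); move: {i} j; near: w.
    by apply: filter_forall => j; have [/cvgrPdist_le/(_ e e0)] := fi j.
  + move=> v; have li j : {l : R | 'D_v (fun z => f z ord0 j) @ within O (nbhs z) --> l}.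
      by apply/cid; have [_ _ /(_ v) /cvg_ex] := fi j.
    apply/cvg_ex; exists (\row_j sval (li j)).
    have df' : \forall w \near within O (nbhs z), differentiable f w := df.
    apply/cvgrPdist_le => e e0; near=> w.
    have dfw : derivable f w v.
      by apply: diff_derivable; near: w; exact: df'.
    rewrite /Num.Def.normr/= mx_normrE (bigmax_le _ (ltW e0))//= => -[i j] _.
    rewrite derive_mx // !mxE/= (ord1 i); move: {i} j; near: w.
    by apply: filter_forall => j; exact: ((cvgrPdist_le _ _).1 (svalP (li j)) e e0).
Unshelve. all: by end_near. Qed.

Section cylinder.
Context {R : realType} {d : nat} {W : normedModType R}.
Variables (O A : set ('rV[R]_d * R)).
Hypotheses (oO : open O) (OA : O `<=` A) (AO : A `<=` closure O).
Implicit Types (f : 'rV[R]_d * R -> W).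

Lemma C1_upto_C1at f z : C1_upto O A f -> A z -> C1at O A f z.
Proof. by move=> Uf; exact: C1_extension_C1at Uf z. Qed.

Lemma C1at_C1_upto f : (forall z, A z -> C1at O A f z) -> C1_upto O A f.
Proof. by move=> Af; exact: C1at_C1_extension Af. Qed.

End cylinder.

Section directional.
Context {R : realType} {d : nat} {W : normedModType R}.
Implicit Types (f : 'rV[R]_d * R -> W).

Lemma derive_direction f z (a : 'rV[R]_d) (b : R) : differentiable f z ->
  'D_((a, b)) f z = b *: dt f z + \sum_(j < d) a ord0 j *: dx j f z.
Proof.
move=> df.
have -> : (a, b) = b *: ((0, 1) : 'rV[R]_d * R) +
    \sum_(j < d) a ord0 j *: ((delta_mx ord0 j, 0) : 'rV[R]_d * R).
  have <- : (a, 0) = \sum_(j < d) a ord0 j *: ((delta_mx ord0 j, 0) : 'rV[R]_d * R).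
    rewrite {1}[a]row_sum_delta.
    apply: (big_ind2 (fun x (y : 'rV[R]_d * R) => (x, 0) = y)) => //.
      by move=> x1 _ x2 _ <- <-; congr pair; rewrite /= addr0.
    by move=> j _; congr pair; rewrite /= scaler0.
  by congr pair; rewrite /= ?scaler0 ?add0r ?addr0 // [RHS]mulr1.
rewrite deriveE // linearD linearZ linear_sum /dt deriveE //; congr (_ + _).
by apply: eq_bigr => j _; rewrite linearZ /dx deriveE.
Qed.

End directional.

Section compactness.
Context {R : realType} {E : topologicalType}.

(** Finitely many neighbourhoods cover [K], and the largest of their bounds serves all
    of them since [P] is monotone in the bound. *)
Lemma compact_near_uniform (K : set E) (P : R -> E -> Prop) :
  compact K ->
  (forall (M M' : R) w, M <= M' -> P M w -> P M' w) ->
  (forall z, K z -> exists M, \forall w \near z, P M w) ->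
  exists M, forall w, K w -> P M w.
Proof.
move=> /compact_near_coveringP cK mP loc.
have [M H] : exists M, K `<=` P M; last by exists M.
suff H : \forall M \near +oo, K `<=` P M by have [M] := filter_ex H; exists M.
apply: cK => z Kz; have [M HM] := loc z Kz.
exists ([set w | P M w], [set M' | M <= M']) => /=; last first.
  by move=> [w M'] /= [Pw MM']; exact: mP Pw.
by split=> //; apply: nbhs_pinfty_ge; exact: num_real.
Qed.

Lemma compact_near_small (K : set E) (P : R -> E -> Prop) :
  compact K ->
  (forall (M M' : R) w, 0 < M' -> M' <= M -> P M w -> P M' w) ->
  (forall z, K z -> exists2 M : R, 0 < M & \forall w \near z, P M w) ->
  exists2 M : R, 0 < M & forall w, K w -> P M w.
Proof.
move=> /compact_near_coveringP cK mP loc.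
suff H : \forall M \near 0^'+, K `<=` P M.
  near (0 : R)^'+ => M; exists M; last by near: M.
  by near: M; exact: nbhs_right_gt.
apply: cK => z Kz; have [M M0 HM] := loc z Kz.
exists ([set w | P M w], [set M' | 0 < M' <= M]) => /=; last first.
  by move=> [w M'] /= [Pw /andP[M'0 MM']]; exact: mP Pw.
split=> //; near=> x; apply/andP; split; near: x; first exact: nbhs_right_gt.
exact: nbhs_right_le.
Unshelve. all: by end_near. Qed.

End compactness.

(** * Powers of nonnegative functions *)

Section local_minimum.
Context {R : realType} {E : normedModType R}.
Implicit Types (f : E -> R) (z v : E).

Lemma near_scale0 (P : set E) v : (\forall h \near (0 : E), P h) ->
  \forall t \near (0 : R), P (t *: v).
Proof.
move=> P0; have c : (fun t : R => t *: v) @ 0 --> (0 : E).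
  by rewrite -[X in _ --> X](scale0r v); apply: cvgZr_tmp; exact: cvg_id.
exact: c.
Qed.

Lemma near_translate (P : set E) z : (\forall w \near z, P w) ->
  \forall h \near (0 : E), P (z + h).
Proof.
by rewrite (near_shift 0 z) /=; apply: filterS => h; rewrite subr0 addrC.
Qed.

Lemma derive_local_min f z v : differentiable f z ->
  (\forall w \near z, f z <= f w) -> 'D_v f z = 0.
Proof.
move=> df fmin.
suff H u : 0 <= 'd f z u.
  apply/eqP; rewrite deriveE // eq_le H andbT -oppr_ge0 -linearN; exact: H.
apply/ler_addgt0Pr => e e0; rewrite -lerBlDr sub0r.
have [->|u0] := eqVneq u 0; first by rewrite linear0 oppr_le0 ltW.
have nu : 0 < `|u| by rewrite normr_gt0.
have fm : \forall h \near (0 : E), f z <= f (z + h).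
  exact: (near_translate (P := fun w => f z <= f w) fmin).
have H := differentiable_littleo df (divr_gt0 e0 nu).
have {H} H2 : \forall t \near (0 : R)^'+, [/\ 0 < t, f z <= f (z + t *: u) &
   `|f (z + t *: u) - (f z + 'd f z (t *: u))| <= e / `|u| * `|t *: u|].
  near=> t; split; first by near: t; exact: nbhs_right_gt.
    by near: t; apply: cvg_within; exact: near_scale0 fm.
  by near: t; apply: cvg_within; exact: near_scale0 H.
have [t [t0 ft]] := filter_ex H2.
rewrite ler_norml normrZ gtr0_norm // => /andP[_ Ht].
have E1 : e / `|u| * (t * `|u|) = t * e by rewrite mulrCA mulfVK ?gt_eqF // mulrC.
have dE : 'd f z (t *: u) = t * 'd f z u by rewrite linearZ.
move: Ht; rewrite E1 dE => Ht.
have : t * - e <= t * 'd f z u by rewrite mulrN; lra.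
by rewrite ler_pM2l.
Unshelve. all: by end_near. Qed.

End local_minimum.

Section power.
Context {R : realType} {E : normedModType R} (O A : set E).
Hypotheses (oO : open O) (OA : O `<=` A).
Variables (f : E -> R) (a : R).
Hypothesis f0 : forall w, A w -> 0 <= f w.

Lemma powR_lt_small (b e : R) : 0 < b -> 0 < e ->
  \forall s \near (0 : R), 0 <= s -> `|s `^ b| <= e.
Proof.
move=> b0 e0; have eb : 0 < e `^ b^-1 by exact: powR_gt0.
near=> s => s0; rewrite ger0_norm ?powR_ge0 //.
have -> : e = (e `^ b^-1) `^ b by rewrite -powRrM mulVf ?gt_eqF // powRr1 // ltW.
apply: ge0_ler_powR; rewrite ?nnegrE ?powR_ge0 ?invr_ge0 ?(ltW b0) ?(ltW e0) //.
apply: ltW; near: s; exact: (cvgr_lt 0).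
Unshelve. all: by end_near. Qed.

Lemma powR_within_cvg (b : R) z (B : set E) : B `<=` A ->
  f @ within B (nbhs z) --> f z -> A z -> (0 <= b \/ 0 < f z) ->
  (fun w => f w `^ b) @ within B (nbhs z) --> f z `^ b.
Proof.
move=> BA cf Az H.
have [fz|fz] := ltrP 0 (f z).
  apply: (@cvg_comp _ _ _ f (fun s => s `^ b) _ _ _ cf).
  apply: (@differentiable_continuous _ _ _ (f z)); apply/derivable1_diffP.
  by apply: derivable_powR; rewrite in_itv /= andbT.
have {}fz : f z = 0 by apply/eqP; rewrite eq_le fz f0.
case: H => [|]; last by rewrite fz ltxx.
rewrite le_eqVlt => /orP[/eqP <-|b0].
  by under eq_fun do rewrite powRr0; rewrite powRr0; exact: cvg_cst.
rewrite fz powR0 ?gt_eqF //.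
apply/cvgr0Pnorm_le => e e0.
rewrite fz in cf; have H := cf _ (powR_lt_small b0 e0).
have {}H : \forall w \near z, B w -> 0 <= f w -> `|f w `^ b| <= e by exact: H.
have {}H : \forall w \near z, B w -> `|f w `^ b| <= e.
  by apply: filterS H => w Hw Bw; apply: Hw => //; apply/f0/BA.
exact: H.
Qed.

(** A zero of [f] in the open set is a minimum, so that [f] is o(|w - z|) there and its
    powers with an exponent at least 1 inherit this. *)
Lemma powR_differentiable z : O z -> differentiable f z -> (1 <= a \/ 0 < f z) ->
  differentiable (fun w => f w `^ a) z /\
  forall v, 'D_v (fun w => f w `^ a) z = a * f z `^ (a - 1) * 'D_v f z.
Proof.
move=> Oz df H.
have [fz|fz] := ltrP 0 (f z).
  have da : derivable (fun s : R => s `^ a) (f z) 1.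
    by apply: derivable_powR; rewrite in_itv /= andbT.
  split; first by apply: (@differentiable_comp _ _ _ _ f (fun s => s `^ a)) => //; exact/derivable1_diffP.
  move=> v; rewrite (@derive_comp _ _ (fun s => s `^ a) f z v da df).
  by congr (_ * _); rewrite powR_derive1 // in_itv /= andbT.
have {}fz : f z = 0 by apply/eqP; rewrite eq_le fz f0 //; exact: OA.
case: H => [a1|]; last by rewrite fz ltxx.
have a0 : a != 0 by rewrite gt_eqF // (lt_le_trans ltr01).
have nO : \forall w \near z, O w by exact: open_nbhs_nbhs.
have Df v : 'D_v f z = 0.
  apply: derive_local_min => //; apply: filterS nO => w Ow; rewrite fz.
  by apply/f0/OA.
have df0 : 'd f z = (\0 : E -> R) :> (E -> R).
  by apply/funext => v; rewrite -deriveE.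
have cz : continuous (\0 : E -> R) by move=> y; exact: cvg_cst.
have [|dp dpE] := @differentiable_of_littleo R E R (fun w => f w `^ a) z (\0) cz.
  move=> e e0.
  have H1 := differentiable_littleo df e0; rewrite df0 fz in H1.
  have cf : f @ z --> f z by exact: differentiable_continuous.
  have H2 : \forall w \near z, f w <= 1 /\ O w.
    apply: filterI nO; move/cvgrPdist_le : cf => /(_ 1 ltr01).
    by apply: filterS => w; rewrite fz sub0r normrN ler_norml => /andP[].
  have {}H2 := near_translate H2.
  near=> h.
  have Hh : f (z + h) <= 1 /\ O (z + h) by near: h; exact: H2.
  have [fh Oh] := Hh; have fh0 := f0 (OA Oh).
  have Hn : `|f (z + h) - (0 + (\0 : E -> R) h)| <= e * `|h| by near: h; exact: H1.
  rewrite addr0 subr0 in Hn.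
  rewrite fz powR0 //= addr0 subr0 ger0_norm ?powR_ge0 //.
  have [->|fn] := eqVneq (f (z + h)) 0; first by rewrite powR0 // mulr_ge0 // ltW.
  apply: le_trans Hn; rewrite ger0_norm //.
  by apply: ge1r_powR => //; rewrite lt0r fn fh0.
split=> // v; rewrite deriveE // dpE /= Df mulr0 //.
Unshelve. all: by end_near. Qed.

Lemma C1at_powR z : A z -> (1 <= a \/ 0 < f z) -> C1at O A f z ->
  C1at O A (fun w => f w `^ a) z.
Proof.
move=> Az H [cf df Df].
have wOA := within_subset (nbhs_filter z) OA.
have cf' : f @ within O (nbhs z) --> f z by apply: cvg_trans cf; exact: cvg_app.
have H' : \forall w \near z, O w -> 1 <= a \/ 0 < f w.
  case: H => [a1|fz]; first by apply: nearW => w Ow; left.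
  have : \forall w \near z, O w -> 0 < f w by exact: (cvgr_gt (f z) cf').
  by apply: filterS => w fw Ow; right; exact: fw.
split.
- apply: powR_within_cvg => //; case: H; last by right.
  by move=> a1; left; rewrite (le_trans ler01).
- apply: filterS2 df H' => w dfw Hw Ow.
  by have [] := powR_differentiable Ow (dfw Ow) (Hw Ow).
- move=> v; have /cvg_ex[/= l Dl] := Df v.
  apply/cvg_ex; exists (a * f z `^ (a - 1) * l).
  have c1 : (fun w => f w `^ (a - 1)) @ within O (nbhs z) --> f z `^ (a - 1).
    apply: powR_within_cvg => //; case: H; last by right.
    by move=> a1; left; rewrite subr_ge0.
  apply: cvg_trans (cvgM (cvgM (cvg_cst a) c1) Dl).
  apply: near_eq_cvg; apply: filterS2 df H' => w dfw Hw Ow.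
  by have [_ ->] := powR_differentiable Ow (dfw Ow) (Hw Ow).
Qed.

End power.

(** * The relative pressure potential *)

Section convexity.
Context {R : realType}.
Implicit Types (a b s g r x w : R).

Lemma bernoulli_powR a s : 1 <= a -> 0 <= s -> 1 + a * (s - 1) <= s `^ a.
Proof.
rewrite le_eqVlt => /orP[/eqP <- s0|a1 s0]; first by rewrite powRr1 //; lra.
have a0 : 0 < a by lra.
have q0 : 0 < (1 - a^-1)^-1 by rewrite invr_gt0 subr_gt0 invf_lt1.
have := conjugate_powR s0 ler01 a0 q0; rewrite invrK subrKC => /(_ erefl).
rewrite powR1 mulr1 mul1r => H.
have : a * s <= a * (s `^ a / a + (1 - a^-1)) by rewrite ler_pM2l.
rewrite mulrDr mulrCA mulfV ?gt_eqF // mulr1 mulrBr mulfV ?gt_eqF //; lra.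
Qed.

Lemma bernoulli_powR_le b s : 0 < b -> b <= 1 -> 0 <= s -> s `^ b <= 1 + b * (s - 1).
Proof.
move=> b0 b1 s0.
have := @bernoulli_powR b^-1 (s `^ b).
rewrite invf_ge1 // b1 powR_ge0 -powRrM mulfV ?gt_eqF // powRr1 // => /(_ isT isT) H.
have : b * (1 + b^-1 * (s `^ b - 1)) <= b * s by rewrite ler_pM2l.
by rewrite mulrDr mulrA mulfV ?gt_eqF //; lra.
Qed.

(** The right-hand side is the case [r = 1] of [(g - 1) * relP g s r], to which
    [relP_scale] reduces the general case. The bound is the Bernoulli inequality with
    the exponent [g - 1], multiplied by [s]. *)
Lemma relative_power_ge2 g s : 2 <= g -> 0 <= s ->
  (g - 1) * (s - 1) ^+ 2 <= s `^ g - g * s + g - 1.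
Proof.
move=> g2 s0; have [->|sn] := eqVneq s 0.
  by rewrite powR0 ?gt_eqF //; nra.
have sp : 0 < s by rewrite lt0r sn.
have := @bernoulli_powR (g - 1) s; rewrite s0 => H.
have {}H : 1 + (g - 1) * (s - 1) <= s `^ (g - 1) by apply: H => //; lra.
rewrite -(@mulr_powRB1 _ s g s0); last by lra.
have : s * (1 + (g - 1) * (s - 1)) <= s * s `^ (g - 1) by rewrite ler_pM2l.
by rewrite expr2; nra.
Qed.

(** For [g < 2] the quadratic bound degenerates for large [s]. The weight on the
    right-hand side comes from the Bernoulli inequality for the exponent [g - 1 < 1] at
    [s^-1]. *)
Lemma relative_power_lt2 g s : 1 < g -> g < 2 -> 0 < s ->
  (g - 1) ^+ 2 * (s - 1) ^+ 2 <= (s `^ g - g * s + g - 1) * ((2 - g) * s + (g - 1)).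
Proof.
move=> g1 g2 s0; have s0' := ltW s0.
set q := (2 - g) * s + (g - 1); have q0 : 0 < q by rewrite /q; nra.
have H : s^-1 `^ (g - 1) * s <= q.
  have := @bernoulli_powR_le (g - 1) s^-1.
  rewrite invr_ge0 s0' => /(_ _ _ isT) H.
  have : s^-1 `^ (g - 1) * s <= (1 + (g - 1) * (s^-1 - 1)) * s.
    by rewrite ler_pM2r //; apply: H; lra.
  suff -> : (1 + (g - 1) * (s^-1 - 1)) * s = q by [].
  by rewrite /q; field; rewrite gt_eqF.
have sE : s `^ (g - 1) * s^-1 `^ (g - 1) = 1.
  by rewrite -powRM ?invr_ge0 // mulfV ?gt_eqF // powR1.
have gE : s `^ g = s * s `^ (g - 1) by rewrite mulr_powRB1 //; lra.
have : s * s <= s `^ g * q.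
  have -> : s * s = s `^ g * (s^-1 `^ (g - 1) * s) by rewrite gE; ring: sE.
  by rewrite ler_wpM2l ?powR_ge0.
by rewrite /q !expr2; nra.
Qed.

(** [relP g s r] is P(s) - P(r) - P'(r) (s - r) for the pressure potential
    P(s) = s^g / (g - 1), the amount by which P exceeds its tangent at r. *)
Definition relP g s r := s `^ g / (g - 1) - g / (g - 1) * r `^ (g - 1) * s + r `^ g.

Lemma relP_scale g s r : 1 < g -> 0 <= s -> 0 < r ->
  (g - 1) * relP g s r = r `^ g * ((s / r) `^ g - g * (s / r) + g - 1).
Proof.
move=> g1 s0 r0; have g0 : g - 1 != 0 by lra.
have r0' : r != 0 by rewrite gt_eqF.
have sE : s `^ g = r `^ g * (s / r) `^ g.
  by rewrite -powRM ?divr_ge0 ?(ltW r0) // [r * _]mulrC divfK.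
have rE : r `^ g = r * r `^ (g - 1) by rewrite mulr_powRB1 ?(ltW r0) //; lra.
by rewrite /relP sE rE; field; rewrite g0 r0'.
Qed.

Lemma relP_ge0 g s r : 1 < g -> 0 <= s -> 0 <= r -> 0 <= relP g s r.
Proof.
move=> g1 s0; rewrite le_eqVlt => /orP[/eqP <-|r0].
  have [g0 g1'] : g != 0 /\ g - 1 != 0 by split; lra.
  rewrite /relP !powR0 //.
  by rewrite mulr0 mul0r subr0 addr0 divr_ge0 ?powR_ge0 //; lra.
have g0 : 0 < g - 1 by lra.
rewrite -(pmulr_rge0 _ g0) relP_scale // mulr_ge0 ?powR_ge0 //.
have := @bernoulli_powR g (s / r); rewrite divr_ge0 ?(ltW r0) ?(ltW g1) // => /(_ isT isT); lra.
Qed.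

(** Multiplying by [r] makes sense of the weight r^(g - 2) also at [r = 0]. For [2 <= g]
    the bound holds down to the vacuum; otherwise the ratio of the densities must stay
    bounded. *)
Lemma relP_coercive g rmin rmax : 1 < g -> 0 <= rmin -> (g < 2 -> 0 < rmin) ->
  exists2 c : R, 0 < c & forall s r, rmin <= s <= rmax -> rmin <= r <= rmax ->
    c * (r `^ (g - 1) * (s - r) ^+ 2) <= r * relP g s r.
Proof.
move=> g1 rmin0 rmin_gt0.
have gp : 0 < g - 1 by lra.
have [g2|g2] := leP 2 g; last have {}rmin_gt0 := rmin_gt0 g2.
  exists 1 => // s r /andP[s0 _] /andP[r0 _].
  have {}s0 : 0 <= s by exact: le_trans s0.
  have {r0} : 0 <= r by exact: le_trans r0.
  rewrite le_eqVlt => /orP[/eqP <-|r0]; first by rewrite powR0 ?gt_eqF // !mul0r mulr0.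
  rewrite -(ler_pM2l gp) [X in _ <= X]mulrCA relP_scale // -(@mulr_powRB1 _ r g) ?(ltW r0) //; last by lra.
  have H := relative_power_ge2 g2 (divr_ge0 s0 (ltW r0)).
  have -> : (s - r) ^+ 2 = r ^+ 2 * (s / r - 1) ^+ 2 by rewrite -exprMn mulrBr mulr1 mulrC divfK ?gt_eqF.
  have k0 : 0 <= r * (r * r `^ (g - 1)) by rewrite !mulr_ge0 ?powR_ge0 ?(ltW r0).
  have := ler_wpM2l k0 H; rewrite !mul1r expr2; lra.
have [rm|rm] := leP rmax 0.
  by exists 1 => // s r /andP[? ?]; lra.
exists ((g - 1) * rmin / rmax); first by rewrite divr_gt0 ?mulr_gt0.
move=> s r /andP[s0 s1] /andP[r0 r1].
have {}s0 : 0 < s by lra.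
have {}r0' : 0 < r by lra.
have H := relative_power_lt2 g1 g2 (divr_gt0 s0 r0').
set f := (s / r) `^ g - _ + _ - _ in H.
have PE : (g - 1) * relP g s r = r * r `^ (g - 1) * f.
  by rewrite relP_scale ?(ltW s0) // mulr_powRB1 ?(ltW r0') //; lra.
have qM : (2 - g) * (s / r) + (g - 1) <= rmax / r.
  by rewrite -(ler_pM2r r0') divfK ?gt_eqF // mulrDl -mulrA divfK ?gt_eqF //; nra.
have f0 : 0 <= f.
  have := @bernoulli_powR g (s / r); rewrite /f divr_ge0 ?(ltW r0') ?(ltW s0) ?(ltW g1) // => /(_ isT isT); lra.
have {}H : (g - 1) ^+ 2 * (s / r - 1) ^+ 2 <= f * (rmax / r) by apply: le_trans H _; rewrite ler_wpM2l.
have {}H : (g - 1) ^+ 2 * (s - r) ^+ 2 <= f * rmax * r.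
  have -> : (s - r) ^+ 2 = r ^+ 2 * (s / r - 1) ^+ 2 by rewrite -exprMn mulrBr mulr1 mulrC divfK ?gt_eqF.
  have -> : f * rmax * r = r ^+ 2 * (f * (rmax / r)) by field; rewrite gt_eqF.
  by rewrite mulrCA ler_pM2l // exprn_gt0.
have E1 : (g - 1) * ((g - 1) * rmin / rmax * (r `^ (g - 1) * (s - r) ^+ 2)) =
   (rmin / rmax * r `^ (g - 1)) * ((g - 1) ^+ 2 * (s - r) ^+ 2) by ring.
have E2 : (g - 1) * (r * relP g s r) = r * (r * r `^ (g - 1) * f) by rewrite mulrCA PE.
rewrite -(ler_pM2l gp) E1 E2.
have k0 : 0 <= rmin / rmax * r `^ (g - 1) by rewrite mulr_ge0 ?powR_ge0 // divr_ge0 // ltW.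
apply: le_trans (ler_wpM2l k0 H) _.
have -> : rmin / rmax * r `^ (g - 1) * (f * rmax * r) = r `^ (g - 1) * f * r * rmin.
  by field; rewrite gt_eqF.
have -> : r * (r * r `^ (g - 1) * f) = r `^ (g - 1) * f * r * r by ring.
by rewrite ler_wpM2l // !mulr_ge0 ?powR_ge0 // ltW.
Qed.

(** The difference of the pressures is [(g - 1) * relP g s r] plus a term linear in [s -
    r]. Young's inequality splits the latter, multiplied by the velocity difference [w],
    into a multiple of the quadratic lower bound of [relP g s r] and one of [r * w ^+
    2]. Since [r] is the density of the other solution, it is replaced by [s] at the
    price of [|s - r| * w ^+ 2], which the bound of [w] absorbs. *)
Lemma pressure_flux_le g rmin rmax k : 1 < g -> 0 <= rmin -> (g < 2 -> 0 < rmin) ->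
  0 < k ->
  exists2 C : R, 0 < C & forall s r w, rmin <= s <= rmax -> rmin <= r <= rmax ->
    0 <= w <= k ->
    `|s `^ g - r `^ g| * w <= C * (2^-1 * s * w ^+ 2 + relP g s r).
Proof.
move=> g1 rmin0 rmin_gt0 k0.
have [c c0 Hc] := relP_coercive rmax g1 rmin0 rmin_gt0.
have gp : 0 < g - 1 by lra.
pose A := rmax `^ (g - 1); have A0 : 0 <= A by exact: powR_ge0.
exists ((g - 1) * k + g * (k / c + 2 * A / k) + 1).
  have k1 : 0 <= k / c by rewrite divr_ge0 ?(ltW k0) ?(ltW c0).
  have k2 : 0 <= 2 * A / k by rewrite divr_ge0 ?(ltW k0) // mulr_ge0.
  have k3 : 0 <= (g - 1) * k by rewrite mulr_ge0 ?(ltW k0) ?(ltW gp).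
  have k4 : 0 <= g * (k / c + 2 * A / k) by rewrite mulr_ge0 ?addr_ge0 //; lra.
  by lra.
move=> s r w Hs Hr /andP[w0 wk].
have s0 : 0 <= s by case/andP: Hs; lra.
have r0 : 0 <= r by case/andP: Hr; lra.
have P0 := relP_ge0 g1 s0 r0.
set P := relP g s r in P0 *.
have pE : s `^ g - r `^ g = (g - 1) * P + g * r `^ (g - 1) * (s - r).
  rewrite /P /relP -[r `^ g](@mulr_powRB1 _ r g) //; last by lra.
  by field; lra.
set a := r `^ (g - 1) in pE; have a0 : 0 <= a by exact: powR_ge0.
have aA : a <= A by apply: ge0_ler_powR; rewrite ?nnegrE //; case/andP: Hr; lra.
pose X := a * `|s - r| * w.
have X0 : 0 <= X by rewrite !mulr_ge0.
have XP : X <= k / c * P + A / k * (s * w ^+ 2).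
  move: r0; rewrite le_eqVlt => /orP[/eqP r0|r0].
    have -> : X = 0 by rewrite /X /a -r0 powR0 ?gt_eqF // !mul0r.
    by rewrite addr_ge0 // !mulr_ge0 ?sqr_ge0 ?invr_ge0 ?(ltW k0) ?(ltW c0).
  have aP : a * (s - r) ^+ 2 / r <= P / c.
    by rewrite ler_pdivrMr // mulrAC ler_pdivlMr // [X in X <= _]mulrC [P * r]mulrC; exact: Hc.
  have amgm : 2 * X <= k * (a * (s - r) ^+ 2 / r) + a * r * w ^+ 2 / k.
    have : 0 <= a * (k * `|s - r| - r * w) ^+ 2 / (r * k).
      apply: divr_ge0; first by apply: mulr_ge0 => //; exact: sqr_ge0.
      by rewrite mulr_ge0 ?(ltW r0) ?(ltW k0).
    have -> : a * (k * `|s - r| - r * w) ^+ 2 / (r * k) =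
      k * (a * `|s - r| ^+ 2 / r) + a * r * w ^+ 2 / k - 2 * X.
      by rewrite /X; field; rewrite !gt_eqF.
    by rewrite real_normK ?num_real // subr_ge0.
  have rw : a * r * w ^+ 2 / k <= A / k * (s * w ^+ 2) + X.
    have H1 : r <= s + `|s - r| by have := ler_norm (r - s); rewrite distrC; lra.
    have -> : A / k * (s * w ^+ 2) + X = (A * s * w ^+ 2 + k * X) / k by field; rewrite gt_eqF.
    rewrite ler_pM2r ?invr_gt0 //.
    have H2 : a * r * w ^+ 2 <= a * (s + `|s - r|) * w ^+ 2.
      by rewrite ler_wpM2r ?sqr_ge0 // ler_wpM2l.
    apply: le_trans H2 _; rewrite mulrDr mulrDl lerD //.
      by rewrite ler_wpM2r ?sqr_ge0 // ler_wpM2r.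
    have -> : a * `|s - r| * w ^+ 2 = w * X by rewrite /X; ring.
    by rewrite ler_wpM2r.
  have kP : k * (a * (s - r) ^+ 2 / r) <= k / c * P.
    have -> : k / c * P = k * (P / c) by ring.
    by rewrite ler_pM2l.
  lra.
have : `|s `^ g - r `^ g| * w <= (g - 1) * P * k + g * X.
  rewrite pE; apply: (@le_trans _ _ (((g - 1) * P + g * a * `|s - r|) * w)).
    rewrite ler_wpM2r // (le_trans (ler_normD _ _)) // lerD //.
      by rewrite ger0_norm // mulr_ge0 // (ltW gp).
    by rewrite !normrM (ger0_norm a0) gtr0_norm //; lra.
  rewrite mulrDl lerD //; first by rewrite ler_wpM2l // mulr_ge0 // (ltW gp).
  by rewrite /X; lra.
have sw : 0 <= s * w ^+ 2 by rewrite mulr_ge0 ?sqr_ge0.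
have kc : 0 <= k / c by rewrite divr_ge0 ?(ltW k0) ?(ltW c0).
have Ak : 0 <= A / k by rewrite divr_ge0 ?(ltW k0).
have -> : 2 * A / k = 2 * (A / k) by rewrite mulrA.
move: (A / k) (k / c) XP kc Ak => B D XP D0 B0 H; apply: le_trans H _.
have H1 : g * X <= g * (D * P + B * (s * w ^+ 2)) by rewrite ler_pM2l //; lra.
apply: le_trans (lerD (lexx _) H1) _.
have -> : ((g - 1) * k + g * (D + 2 * B) + 1) * (2^-1 * s * w ^+ 2 + P) =
  (g - 1) * P * k + g * (D * P + B * (s * w ^+ 2)) +
  (((g - 1) * k + g * D + 1) * (2^-1 * (s * w ^+ 2)) + (g * (2 * B) + 1) * P) by field.
have k3 : 0 <= (g - 1) * k by rewrite mulr_ge0 ?(ltW k0) ?(ltW gp).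
have k4 : 0 <= g * D by rewrite mulr_ge0 //; lra.
have k5 : 0 <= g * (2 * B) by rewrite mulr_ge0 ?mulr_ge0 //; lra.
rewrite lerDl addr_ge0 // mulr_ge0 //; [lra|lra|lra].
Qed.

End convexity.

(** * Calculus of vector fields *)

Section calculus.
Context {R : realType} {E : normedModType R} {d : nat}.
Implicit Types (f : E -> 'rV[R]_d) (k : E -> R).

Lemma differentiable_row f z :
  (forall i, differentiable (fun w => f w ord0 i) z) -> differentiable f z.
Proof.
move=> df; have -> : f = \sum_(i < d) (fun w => f w ord0 i *: delta_mx ord0 i).
  apply/funext => w; rewrite fct_sumE; apply/rowP => j.
  rewrite summxE (bigD1 j) //= !mxE !eqxx mulr1 big1 ?addr0 // => i ij.
  by rewrite !mxE eqxx /= eq_sym (negbTE ij) mulr0.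
by apply: differentiable_sum => i; apply: differentiableZl; exact: df.
Qed.

Lemma differentiable_row_coord f z i : differentiable f z -> differentiable (fun w => f w ord0 i) z.
Proof.
move=> df; apply: (@differentiable_comp _ _ _ _ f (fun x : 'rV[R]_d => x ord0 i : R)) => //.
exact: differentiable_coord.
Qed.

Lemma derive_row_coord f z v i : differentiable f z ->
  'D_v (fun w => f w ord0 i) z = 'D_v f z ord0 i.
Proof. by move=> df; rewrite derive_mx ?mxE //; exact: diff_derivable. Qed.

Lemma differentiable_scale k f z : differentiable k z -> differentiable f z ->
  differentiable (fun w => k w *: f w) z.
Proof.
move=> dk df; apply: differentiable_row => i.
have -> : (fun w => (k w *: f w) ord0 i) = k * (fun w => f w ord0 i).
  by apply/funext => w; rewrite mxE.
by apply: differentiableM => //; exact: differentiable_row_coord.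
Qed.

Lemma derive_scale k f z v : differentiable k z -> differentiable f z ->
  'D_v (fun w => k w *: f w) z = k z *: 'D_v f z + 'D_v k z *: f z.
Proof.
move=> dk df; apply/rowP => i.
rewrite -derive_row_coord; last exact: differentiable_scale.
have -> : (fun w => (k w *: f w) ord0 i) = k * (fun w => f w ord0 i).
  by apply/funext => w; rewrite mxE.
rewrite deriveM; [|exact: diff_derivable|exact/diff_derivable/differentiable_row_coord].
by rewrite derive_row_coord // !mxE /GRing.scale /= [f z ord0 i * _]mulrC.
Qed.

Lemma row_norm_le (x : 'rV[R]_d) (e : R) : 0 <= e ->
  (forall i, `|x ord0 i| <= e) -> `|x| <= e.
Proof.
move=> e0 xe; rewrite /Num.Def.normr/= mx_normrE (bigmax_le _ e0)//= => -[i j] _ /=.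
by rewrite (ord1 i).
Qed.

Lemma coord_le_norm (x : 'rV[R]_d) i : `|x ord0 i| <= `|x|.
Proof. by rewrite [leRHS]/Num.Def.normr/= mx_normrE; apply: (le_bigmax _ _ (ord0, i)). Qed.

Lemma continuous_row f : (forall i, continuous (fun w => f w ord0 i)) -> continuous f.
Proof.
move=> cf z; apply/cvgrPdist_le => e e0; near=> w.
apply: row_norm_le; first exact: ltW.
move=> i; rewrite !mxE; move: i; near: w; apply: filter_forall => i.
by have /cvgrPdist_le/(_ e e0) := cf i z.
Unshelve. all: by end_near. Qed.

Lemma segment_mvt (f : E -> R) (x v : E) :
  (forall s, 0 <= s <= 1 -> differentiable f (x + s *: v)) ->
  exists2 c, 0 <= c <= 1 & f (x + v) - f x = 'D_v f (x + c *: v).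
Proof.
move=> df; pose g (s : R) := f (x + s *: v).
have dg (s : R) : 0 <= s <= 1 -> is_derive s 1 g ('D_v f (x + s *: v)).
  move=> s01.
  have di : is_diff s (fun s : R => x + s *: v) (fun h => h *: v).
    apply: is_diff_eq (is_diffD (is_diff_cst _ _) (is_diff_scalel _ _)) _.
    by apply/funext => h; rewrite /= add0r.
  have dgs : differentiable g s.
    by apply: (@differentiable_comp _ _ _ _ (fun s : R => x + s *: v) f) => //; apply: df.
  split; first exact: diff_derivable.
  rewrite deriveE //.
  rewrite (@diff_comp _ _ _ _ (fun s : R => x + s *: v) f) //; last exact: df.
  by rewrite /= diff_val scale1r -deriveE //; exact: df.
have [] := @MVT_segment R g (fun s => 'D_v f (x + s *: v)) 0 1 ler01.
- by move=> s; rewrite in_itv /= => /andP[s0 s1]; apply: dg; rewrite !ltW.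
- apply: derivable_within_continuous => s; rewrite in_itv /= => s01.
  by have [] := dg s s01.
move=> c; rewrite in_itv /= => c01; rewrite /g scale1r scale0r addr0 subr0 mulr1 => ->.
by exists c.
Qed.

Lemma segment_le (f : E -> R) (x y : E) (M : R) :
  (forall s, 0 <= s <= 1 -> differentiable f (x + s *: (y - x))) ->
  (forall s, 0 <= s <= 1 -> `|'D_(y - x) f (x + s *: (y - x))| <= M) ->
  `|f y - f x| <= M.
Proof.
move=> df Df; have [c c01] := segment_mvt df.
by rewrite subrKC => ->; exact: Df.
Qed.

End calculus.

Section projections.
Context {R : realType} {V W : normedModType R}.

Lemma differentiable_fst (z : V * W) : differentiable (fst : V * W -> V) z.
Proof. by apply: linear_differentiable => y; exact: cvg_fst. Qed.

Lemma derive_fst (z v : V * W) : 'D_v (fst : V * W -> V) z = v.1.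
Proof.
rewrite deriveE; last exact: differentiable_fst.
by rewrite diff_lin // => y; exact: cvg_fst.
Qed.

Lemma differentiable_snd (z : V * W) : differentiable (snd : V * W -> W) z.
Proof. by apply: linear_differentiable => y; exact: cvg_snd. Qed.

Lemma derive_snd (z v : V * W) : 'D_v (snd : V * W -> W) z = v.2.
Proof.
rewrite deriveE; last exact: differentiable_snd.
by rewrite diff_lin // => y; exact: cvg_snd.
Qed.

Lemma differentiable_comp_fst {U : normedModType R} (f : V -> U) (z : V * W) :
  differentiable f z.1 -> differentiable (fun w : V * W => f w.1) z.
Proof.
move=> df; apply: (@differentiable_comp _ _ _ _ (fst : V * W -> V) f) => //.
exact: differentiable_fst.
Qed.

Lemma derive_comp_fst {U : normedModType R} (f : V -> U) (z v : V * W) :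
  differentiable f z.1 -> 'D_v (fun w : V * W => f w.1) z = 'D_(v.1) f z.1.
Proof.
move=> df; have dz := differentiable_fst z.
rewrite deriveE; last exact: differentiable_comp_fst.
rewrite (@diff_comp _ _ _ _ (fst : V * W -> V) f) //=.
by rewrite -[X in 'd f _ X]deriveE // derive_fst -deriveE.
Qed.

End projections.

Section chain_rule.
Context {R : realType} {U V W : normedModType R}.

Lemma differentiable_chain (f : U -> V) (g : V -> W) z :
  differentiable f z -> differentiable g (f z) -> differentiable (fun w => g (f w)) z.
Proof. by move=> df dg; exact: (@differentiable_comp _ _ _ _ f g). Qed.

Lemma derive_chain (f : U -> V) (g : V -> W) z v :
  differentiable f z -> differentiable g (f z) ->
  'D_v (fun w => g (f w)) z = 'D_('D_v f z) g (f z).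
Proof.
move=> df dg; rewrite deriveE; last exact: differentiable_chain.
rewrite (@diff_comp _ _ _ _ f g) //=.
by rewrite [in RHS]deriveE // [in RHS]deriveE.
Qed.

End chain_rule.

(** * Approximate solutions of the Burgers equation *)

Section numerals.
Context {R : realType}.

Lemma half_le_three_quarters n : (2^-1 : R) ^+ n <= (3 / 4) ^+ n.
Proof. by rewrite lerXn2r ?nnegrE //; lra. Qed.

Lemma burgers_contraction (x y t1 t2 t3 : R) : 0 <= x -> 0 <= y ->
  t1 <= 2 * x -> t2 <= 10 * x + 8 * y -> t3 <= 2 * x ->
  t1 + t2 + t3 <= 15 * x + 12 * y.
Proof. lra. Qed.

End numerals.

Section transport.
Context {R : realType} {d : nat}.
Local Notation E := ('rV[R]_d * R)%type.
Variables (G : 'rV[R]_d -> 'rV[R]_d) (L B : R).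
Hypotheses (L0 : 0 <= L) (B0 : 0 <= B).
Hypothesis dG : forall x, differentiable G x.
Hypothesis cG : forall v, continuous ('D_v G).
Hypothesis GL : forall x v, `|'D_v G x| <= L * `|v|.
Hypothesis GB : forall x, `|G x| <= B.

Lemma transport_lipschitz x y : `|G y - G x| <= L * `|y - x|.
Proof.
apply: row_norm_le; first by rewrite mulr_ge0.
move=> i; rewrite !mxE; apply: (@segment_le _ _ (fun w => G w ord0 i) x y).
  by move=> s _; apply: differentiable_row_coord.
move=> s _; rewrite derive_row_coord //.
by apply: le_trans (coord_le_norm _ _) _; exact: GL.
Qed.

(** The solution W of D_t W + (W . grad) W = 0 with the data [G] is constant along
    straight lines, so that it solves W(x, t) = G(x - t W(x, t)). These are the Picard
    iterates of this equation. Using them instead of the limit keeps the field explicit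
    and of class C^1, and the residual is as small as needed. *)
Fixpoint transport (k : nat) : E -> 'rV[R]_d :=
  match k with
  | 0 => fun z => G z.1
  | k'.+1 => fun z => G (z.1 - z.2 *: transport k' z)
  end.

Let foot k (z : E) := z.1 - z.2 *: transport k z.

Lemma differentiable_transport k z : differentiable (transport k) z.
Proof.
elim: k => [|k IH] /=.
  exact: differentiable_comp_fst.
have dk : differentiable (foot k) z.
  apply: differentiableB; first exact: differentiable_fst.
  by apply: differentiable_scale => //; exact: differentiable_snd.
exact: (differentiable_chain dk (dG _)).
Qed.

Let differentiable_foot k z : differentiable (foot k) z.
Proof.
apply: differentiableB; first exact: differentiable_fst.
apply: differentiable_scale; first exact: differentiable_snd.
exact: differentiable_transport.
Qed.

Lemma derive_foot k z (v : E) :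
  'D_v (foot k) z = v.1 - v.2 *: transport k z - z.2 *: 'D_v (transport k) z.
Proof.
have dk := differentiable_transport k z.
have dsc : differentiable (fun w : E => w.2 *: transport k w) z.
  by apply: differentiable_scale => //; exact: differentiable_snd.
rewrite /foot deriveB; last 2 first.
- exact/diff_derivable/differentiable_fst.
- exact: diff_derivable.
rewrite derive_scale //; last exact: differentiable_snd.
by rewrite derive_fst derive_snd [_ + v.2 *: _]addrC opprD addrA.
Qed.

Lemma derive_transportS k z (v : E) :
  'D_v (transport k.+1) z = 'D_('D_v (foot k) z) G (foot k z).
Proof.
exact: (@derive_chain _ _ _ _ (foot k) G z v (differentiable_foot k z) (dG _)).
Qed.

Lemma transport_bound k z : `|transport k z| <= B.
Proof. by case: k => [|k] /=; exact: GB. Qed.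

(** The derivative of [G] at a moving point in a moving direction is a sum of partial
    derivatives, each of which is continuous. *)
Lemma derive_transport_continuous k v : continuous ('D_v (transport k)).
Proof.
elim: k v => [|k IH] v.
  have -> : 'D_v (transport 0) = 'D_(v.1) G \o fst.
    by apply/funext => z; exact: derive_comp_fst.
  by move=> z; apply: continuous_comp; [exact: cvg_fst|exact: cG].
have -> : 'D_v (transport k.+1) = fun z => \sum_(j < d)
   ('D_v (foot k) z) ord0 j *: 'D_(delta_mx ord0 j) G (foot k z).
  apply/funext => z; rewrite derive_transportS deriveE //.
  rewrite [X in 'd _ _ X]row_sum_delta linear_sum; apply: eq_bigr => j _.
  by rewrite linearZ /= -deriveE.
have cfoot : continuous (foot k).
  by move=> z; apply: differentiable_continuous; exact: differentiable_foot.
suff cj j : continuous (fun z => ('D_v (foot k) z) ord0 j *: 'D_(delta_mx ord0 j) G (foot k z)).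
  apply: (@continuous_big _ _ +%R 0 xpredT) => [|j _]; last exact: cj.
  exact: add_continuous.
move=> z; apply: cvgZ; last first.
  exact: (@continuous_comp _ _ _ (foot k) ('D_(delta_mx ord0 j) G) z (cfoot z) (@cG _ _)).
suff cD : {for z, continuous ('D_v (foot k))}.
  by apply: (@continuous_comp _ _ _ ('D_v (foot k)) (fun x => x ord0 j)); last exact: coord_continuous.
have -> : 'D_v (foot k) = fun w => v.1 - v.2 *: transport k w - w.2 *: 'D_v (transport k) w.
  by apply/funext => w; exact: derive_foot.
have ctr : {for z, continuous (transport k)} by apply: differentiable_continuous; exact: differentiable_transport.
apply: cvgB; last by apply: cvgZ; [exact: cvg_snd|exact: IH].
apply: cvgB; first exact: cvg_cst.
by apply: cvgZ; [exact: cvg_cst|exact: ctr].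
Qed.

Variable T1 : R.
Hypothesis TL : T1 * L <= 2^-1.

Lemma transport_step_le k z : 0 <= z.2 <= T1 ->
  `|transport k.+1 z - transport k z| <= 2 * B * 2^-1 ^+ k.
Proof.
move=> /andP[z0 zT]; elim: k => [|k IH].
  rewrite expr0 mulr1 (le_trans (ler_normB _ _)) // mulr2n mulrDl mul1r.
  by rewrite lerD ?transport_bound.
rewrite [transport k.+2 z]/= [X in _ - X]/= (le_trans (transport_lipschitz _ _)) //.
rewrite opprB addrC addrA subrK -scalerBr normrZ ger0_norm // distrC.
have -> : 2 * B * 2^-1 ^+ k.+1 = 2^-1 * (2 * B * 2^-1 ^+ k) by rewrite exprS; ring.
rewrite mulrA ler_pM // ?mulr_ge0 //.
by apply: le_trans TL; rewrite mulrC ler_wpM2r.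
Qed.

(** The bound reproduces itself because the step contracts by [T1 * L <= 1/2]. *)
Lemma derive_transport_le k z (v : E) : 0 <= z.2 <= T1 ->
  `|'D_v (transport k) z| <= 2 * L * (`|v.1| + `|v.2| * B).
Proof.
move=> /andP[z0 zT].
have vb : 0 <= `|v.1| + `|v.2| * B by rewrite addr_ge0 // mulr_ge0.
elim: k => [|k IH].
  have -> : 'D_v (transport 0) z = 'D_(v.1) G z.1.
    exact: derive_comp_fst.
  apply: le_trans (GL _ _) _; rewrite -mulrA.
  have : 0 <= L * `|v.1| by rewrite mulr_ge0.
  have : 0 <= L * (`|v.2| * B) by rewrite !mulr_ge0.
  by rewrite mulrDr; lra.
rewrite derive_transportS (le_trans (GL _ _)) // derive_foot.
have H1 : `|v.1 - v.2 *: transport k z| <= `|v.1| + `|v.2| * B.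
  by rewrite (le_trans (ler_normB _ _)) // lerD2l normrZ ler_wpM2l // transport_bound.
have H2 : `|z.2 *: 'D_v (transport k) z| <= z.2 * (2 * L * (`|v.1| + `|v.2| * B)).
  by rewrite normrZ ger0_norm // ler_wpM2l.
have H3 : z.2 * L <= 2^-1 by apply: le_trans TL; rewrite ler_wpM2r.
have H4 : z.2 * (2 * L * (`|v.1| + `|v.2| * B)) <= `|v.1| + `|v.2| * B.
  have -> : z.2 * (2 * L * (`|v.1| + `|v.2| * B)) = (2 * (z.2 * L)) * (`|v.1| + `|v.2| * B) by ring.
  by rewrite ler_piMl //; lra.
have -> : 2 * L * (`|v.1| + `|v.2| * B) = L * ((`|v.1| + `|v.2| * B) + (`|v.1| + `|v.2| * B)) by ring.
rewrite ler_wpM2l // (le_trans (ler_normB _ _)) // lerD // (le_trans H2) //.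
Qed.

(** The residual of the Burgers equation D_t W + (W . grad) W = 0. *)
Definition burgers (W : E -> 'rV[R]_d) (z : E) : 'rV[R]_d := 'D_((W z, 1)) W z.

(** The residual of an iterate is a contraction of the previous residual, up to the
    difference of the two iterates. *)
Lemma burgers_transportS k z :
  burgers (transport k.+1) z =
  'D_((transport k.+1 z - transport k z) - z.2 *: burgers (transport k) z -
      z.2 *: 'D_((transport k.+1 z - transport k z, 0)) (transport k) z) G (foot k z).
Proof.
have dk := differentiable_transport k z.
set w := transport k.+1 z.
have split_dir : 'D_((w, 1)) (transport k) z =
    burgers (transport k) z + 'D_((w - transport k z, 0)) (transport k) z.
  rewrite /burgers 3?deriveE //.
  rewrite -(linearD ('d (transport k) z)).
  by have -> : (w, 1) = (transport k z, 1) + (w - transport k z, 0) :> E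
    by congr pair; rewrite /= ?addr0 // subrKC.
rewrite {1}/burgers -/w derive_transportS derive_foot scale1r split_dir.
by rewrite scalerDr opprD addrA.
Qed.

Lemma burgers_transport_le : 0 <= T1 ->
  exists C, forall k z, 0 <= z.2 <= T1 ->
  `|burgers (transport k) z| <= C * (3 / 4) ^+ k.
Proof.
move=> T0.
pose C1 := L * (2 * B) + 2 * B.
have LB : 0 <= L * B by rewrite mulr_ge0.
have C10 : 0 <= C1 by rewrite addr_ge0 // ?mulr_ge0 ?mulr_ge0.
exists (8 * C1 + 2 * L * (B + B)) => k z zT; elim: k => [|k IH].
  rewrite expr0 mulr1 (le_trans (derive_transport_le _ _ zT)) //= normr1 mul1r.
  have : 2 * L * (`|G z.1| + B) <= 2 * L * (B + B) by rewrite ler_wpM2l ?mulr_ge0 // lerD2r.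
  by lra.
rewrite burgers_transportS (le_trans (GL _ _)) //.
case/andP: (zT) => z0 zT1.
have S := transport_step_le k zT.
set a := transport k.+1 z - transport k z in S *.
have zL : z.2 * L <= 2^-1 by apply: le_trans TL; rewrite ler_wpM2r.
have Da := derive_transport_le k (a, 0) zT; rewrite /= normr0 mul0r addr0 in Da.
set P := (3 / 4) ^+ k in IH *; set Q := 2^-1 ^+ k in S.
have QP : Q <= P by exact: half_le_three_quarters.
have Q0 : 0 <= Q by rewrite exprn_ge0.
set b := burgers _ _ in IH *; set D := 'D_(_) _ _ in Da *.
have N : `|a - z.2 *: b - z.2 *: D| <= `|a| + z.2 * `|b| + z.2 * `|D|.
  rewrite (le_trans (ler_normB _ _)) // lerD ?normrZ ?(ger0_norm z0) //.
  by rewrite (le_trans (ler_normB _ _)) // lerD ?normrZ ?(ger0_norm z0).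
apply: le_trans (ler_wpM2l L0 N) _; rewrite exprS -/P.
have h1 : L * `|a| <= L * (2 * B * Q) by rewrite ler_wpM2l.
have h2 : L * (z.2 * `|b|) <= 2^-1 * `|b| by rewrite mulrA [L * _]mulrC ler_wpM2r.
have P0 : 0 <= P by apply: le_trans QP.
have h4 : L * (2 * B * Q) <= 2 * (L * B * P).
  have -> : L * (2 * B * Q) = 2 * (L * B) * Q by ring.
  by rewrite [X in _ <= X]mulrA ler_wpM2l // mulr_ge0.
have h3 : L * (z.2 * `|D|) <= L * (2 * B * Q).
  have -> : L * (2 * B * Q) = 2^-1 * (2 * L * (2 * B * Q)) by field.
  have zL0 : 0 <= z.2 * L by rewrite mulr_ge0.
  have Da' : `|D| <= 2 * L * (2 * B * Q).
    by apply: le_trans Da _; apply: ler_wpM2l => //; rewrite mulr_ge0.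
  have -> : L * (z.2 * `|D|) = z.2 * L * `|D| by ring.
  exact: (ler_pM zL0 (normr_ge0 D) zL Da').
have h6 : 0 <= B * P by rewrite mulr_ge0.
have h7 : 0 <= L * B * P by rewrite mulr_ge0.
have C1E : C1 = 2 * (L * B) + 2 * B by rewrite /C1; ring.
have bE : 2^-1 * `|b| <= 2^-1 * ((8 * C1 + 2 * L * (B + B)) * P) by rewrite ler_wpM2l.
have E1 : (8 * C1 + 2 * L * (B + B)) * (3 / 4 * P) = 15 * (L * B * P) + 12 * (B * P).
  by rewrite C1E; field.
have E2 : 2^-1 * ((8 * C1 + 2 * L * (B + B)) * P) = 10 * (L * B * P) + 8 * (B * P).
  by rewrite C1E; field.
rewrite E1 [X in X <= _]mulrDr [X in X + _ <= _]mulrDr.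
apply: burgers_contraction => //.
- exact: le_trans h1 h4.
- by apply: le_trans h2 _; rewrite -E2.
- exact: le_trans h3 h4.
Qed.

End transport.

(** * A maximum principle on the boundary of a vanishing set *)

Section maximum_principle_arithmetic.
Context {R : realType}.

Lemma penalty_start (f0 f1 r1 q F m : R) : 0 < f0 -> 0 < F -> 0 < m -> f0 <= F ->
  f0 / 2 < f1 -> 0 < r1 -> r1 < f0 / (8 * (F / m)) -> 1 <= q <= 2 ->
  0 < f1 - F / m * (q * r1) -
    r1 * f0 / 16 * (q / Num.max r1 (r1 * f0 / 16 / (2 * F))).
Proof.
move=> f00 F0 m0 fF ff r10 rN /andP[q1 q2].
have N0 : 0 < F / m by rewrite divr_gt0.
move: (F / m) N0 rN => N N0; rewrite ltr_pdivlMr ?mulr_gt0 // => rN.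
have sr : r1 * f0 / 16 / (2 * F) <= r1.
  have -> : r1 * f0 / 16 / (2 * F) = r1 * (f0 / (32 * F)) by field; rewrite gt_eqF.
  by rewrite ler_piMr ?(ltW r10) // ler_pdivrMr; lra.
rewrite (max_idPl sr).
have -> : r1 * f0 / 16 * (q / r1) = f0 * q / 16 by field; rewrite gt_eqF.
have h1 : N * (q * r1) <= 2 * (r1 * N).
  by rewrite mulrCA [N * r1]mulrC ler_wpM2r // ltW // mulr_gt0.
have h2 : f0 * q <= f0 * 2 by rewrite ler_pM2l.
lra.
Qed.

Lemma penalty_floor (f F N q r d s : R) : f <= F -> 0 < N -> 0 < d -> 0 < s ->
  0 <= r -> r <= s -> 1 <= q ->
  f - N * (q * r) - d * (q / Num.max r s) <= F - d * (1 / s).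
Proof.
move=> fF N0 d0 s0 r0 rs q1; rewrite (max_idPr rs).
have h1 : 0 <= N * (q * r) by rewrite !mulr_ge0 ?(ltW N0) //; lra.
have h2 : d * (1 / s) <= d * (q / s) by rewrite ler_pM2l // ler_pM2r // invr_gt0.
lra.
Qed.

Lemma penalty_max (f F m q r d s : R) : 0 < F -> 0 < m -> f <= F -> 0 < d ->
  0 < r -> 1 <= q -> 0 < s ->
  0 < f - F / m * (q * r) - d * (q / s) -> 0 < f /\ r < m.
Proof.
move=> F0 m0 fF d0 r0 q1 s0 H.
have N0 : 0 < F / m by rewrite divr_gt0.
have h1 : 0 <= d * (q / s) by rewrite mulr_ge0 ?divr_ge0 ?(ltW d0) ?(ltW s0) //; lra.
have h2 : F / m * r <= F / m * (q * r) by rewrite ler_pM2l // ler_peMl // ltW.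
have h3 : 0 < F / m * r by rewrite mulr_gt0.
split; first lra.
have : F / m * r < F by lra.
have -> : F / m * r = r / m * F by ring.
by rewrite gtr_pMl // ltr_pdivrMr // mul1r.
Qed.

Lemma penalty_contradiction (Df N C q r Dr d : R) : Df < 0 -> 0 < N -> 0 < d ->
  0 < r -> 1 <= q <= 2 -> 0 <= C -> `|Dr| <= C * r ->
  - (Df - N * (q * Dr + r * (2 * C)) - d * (q * (- r ^- 2 * Dr) + r^-1 * (2 * C))) != 0.
Proof.
move=> Df0 N0 d0 r0 /andP[q1 q2] C0; rewrite ler_norml => /andP[h1 h2].
have q0 : 0 <= q by lra.
have a1 : - (2 * (C * r)) <= q * Dr <= 2 * (C * r).
  have Cr : 0 <= C * r by rewrite mulr_ge0 // ltW.
  have hq : q * (C * r) <= 2 * (C * r) by rewrite ler_wpM2r.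
  have h1' : q * - (C * r) <= q * Dr by rewrite ler_wpM2l.
  have h2' : q * Dr <= q * (C * r) by rewrite ler_wpM2l.
  by apply/andP; split; lra.
case/andP: a1 => a1 a2.
have b1 : 0 <= N * (q * Dr + r * (2 * C)) by rewrite mulr_ge0 ?(ltW N0) //; lra.
have b2 : 0 <= d * (q * (- r ^- 2 * Dr) + r^-1 * (2 * C)).
  rewrite mulr_ge0 ?(ltW d0) //.
  have -> : q * (- r ^- 2 * Dr) + r^-1 * (2 * C) = (2 * (C * r) - q * Dr) / r ^+ 2.
    by field; rewrite gt_eqF.
  by rewrite divr_ge0 ?sqr_ge0 // subr_ge0.
by rewrite gt_eqF //; lra.
Qed.

End maximum_principle_arithmetic.

Section maximum_principle.
Context {R : realType} {E : normedModType R}.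
Variables (K Y : set E) (f r tau : E -> R) (b : E -> E) (C m : R).
Hypotheses (cK : compact K) (oY : open Y) (YK : Y `<=` K).
Hypotheses (cf : {within K, continuous f}) (cr : {within K, continuous r}).
Hypothesis ctau : {within K, continuous tau}.
Hypotheses (r0 : forall z, K z -> 0 <= r z) (C0 : 0 <= C) (m0 : 0 < m).
Hypothesis tau0 : forall z, K z -> 0 <= tau z /\ C * tau z <= 2^-1.
Hypothesis fKY : forall z, K z -> ~ Y z -> f z <= 0.
Hypothesis df : forall z, Y z -> differentiable f z.
Hypothesis dr : forall z, Y z -> differentiable r z.
Hypothesis dtau : forall z, Y z -> differentiable tau z /\ 'D_(b z) tau z = 1.
Hypothesis r_transported : forall z, Y z -> `|'D_(b z) r z| <= C * r z.
Hypothesis f_decreasing : forall z, Y z -> 0 < r z < m -> 0 < f z -> 'D_(b z) f z < 0.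

(** The zero set of [r] is invariant under the flow of [b], but [f] is only known to
    decrease along the flow where [0 < r < m]. With F the maximum of [f], the penalty
    -d/r keeps the maximum of f - (F/m) q r - d q/r away from the zero set, the term
    (F/m) q r keeps it in [r < m], and the factor q = 1 + 2 C tau compensates the change
    of [r] along the flow. If [f z0] were positive then, for small d, this maximum would
    be positive, attained at an interior point, and the derivative along [b] would be
    negative there. That [z0] is in the closure of [r > 0] is what makes the penalized
    function positive somewhere. *)
Lemma max_principle_vanishing_set z0 : Y z0 -> r z0 = 0 ->
  closure [set z | 0 < r z] z0 -> f z0 <= 0.
Proof.
move=> Yz0 rz0 cz0; rewrite leNgt; apply/negP => fz0.
have [zF _ HF] := compact_EVT_max (ex_intro _ z0 (YK Yz0)) cK cf.
have {}HF z : K z -> f z <= f zF by move=> Kz; apply: HF; rewrite inE.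
set F := f zF in HF.
have F0 : 0 < F by apply: lt_le_trans fz0 (HF _ (YK Yz0)).
pose N := F / m; have N0 : 0 < N by rewrite divr_gt0.
have nY : \forall z \near z0, Y z by exact: open_nbhs_nbhs.
have cfz : f @ z0 --> f z0 by apply: differentiable_continuous; exact: df.
have crz : r @ z0 --> r z0 by apply: differentiable_continuous; exact: dr.
have n1 : \forall z \near z0, f z0 / 2 < f z.
  by apply: (cvgr_gt (f z0)) => //; rewrite ltr_pdivrMr // ltr_pMr // ltr1n.
have n2 : \forall z \near z0, r z < f z0 / (8 * N).
  by apply: (cvgr_lt (r z0)) => //; rewrite rz0 divr_gt0 // mulr_gt0.
have [z1 [rz1 [[Yz1 fz1] rz1']]] := cz0 _ (filterI (filterI nY n1) n2).
rewrite /= in rz1.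
(* The penalty is so weak that the penalized function is still positive at [z1]; below
   the level [s0] it is negative, so truncating [r] at [s0] gives a continuous function
   without moving the maximum. *)
pose dl := r z1 * f z0 / 16; have dl0 : 0 < dl by rewrite divr_gt0 // mulr_gt0.
pose s0 := dl / (2 * F); have s00 : 0 < s0 by rewrite divr_gt0 // mulr_gt0.
pose q z := 1 + 2 * (C * tau z).
have q12 z : K z -> 1 <= q z <= 2.
  move=> /tau0[t0 t1]; have : 0 <= C * tau z by rewrite mulr_ge0.
  by rewrite /q; move: t1; move: (C * tau z) => x; lra.
pose G' z := f z - N * (q z * r z) - dl * (q z / Num.max (r z) s0).
pose G z := f z - N * (q z * r z) - dl * (q z / r z).
have mx0 z : 0 < Num.max (r z) s0 by rewrite lt_max s00 orbT.
have cG' : {within K, continuous G'}.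
  apply/subspace_continuousP => z Kz.
  move/subspace_continuousP : cf => /(_ z Kz) cfz'.
  move/subspace_continuousP : cr => /(_ z Kz) crz'.
  move/subspace_continuousP : ctau => /(_ z Kz) ctz'.
  have cq : q @ within K (nbhs z) --> q z.
    apply: cvgD; first exact: cvg_cst.
    by apply: cvgM; [exact: cvg_cst|apply: cvgM => //; exact: cvg_cst].
  apply: cvgB; first apply: cvgB => //.
    by apply: cvgM; [exact: cvg_cst|exact: cvgM].
  apply: cvgM; first exact: cvg_cst.
  apply: cvgM => //; apply: cvgV; first by rewrite gt_eqF.
  have -> : (fun w => Num.max (r w) s0) = fun w => (r w + s0 + `|r w - s0|) / 2.
    by apply/funext => w; rewrite maxr_absE.
  rewrite [X in _ --> X]maxr_absE.
  apply: cvgM; last exact: cvg_cst.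
  apply: cvgD; first by apply: cvgD => //; exact: cvg_cst.
  by apply: cvg_norm; apply: cvgB => //; exact: cvg_cst.
have [z /set_mem Kz zmax] := compact_EVT_max (ex_intro _ z0 (YK Yz0)) cK cG'.
have {}zmax w : K w -> G' w <= G' z by move=> Kw; apply: zmax; rewrite inE.
have f2F : f z0 <= F by exact/HF/YK.
have G'z1 : 0 < G' z1 by exact: penalty_start (q12 _ (YK Yz1)).
have G'z : 0 < G' z by apply: lt_le_trans G'z1 (zmax _ (YK Yz1)).
have [q1 q2] := andP (q12 _ Kz); have rz := r0 Kz.
have rz_gt : s0 < r z.
  rewrite ltNge; apply/negP => rs.
  have : G' z <= F - dl * (1 / s0).
    exact: penalty_floor (HF _ Kz) N0 dl0 s00 rz rs q1.
  have -> : dl * (1 / s0) = 2 * F by rewrite /s0; field; rewrite !gt_eqF.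
  by move: G'z F0; lra.
have rz_pos : 0 < r z by exact: lt_trans rz_gt.
have fz_pos : 0 < f z /\ r z < m.
  exact: penalty_max F0 m0 (HF _ Kz) dl0 rz_pos q1 (mx0 z) G'z.
have [fz rzm] := fz_pos.
have Yz : Y z by apply: contrapT => /(fKY Kz); rewrite leNgt fz.
have nzY : \forall w \near z, Y w by exact: open_nbhs_nbhs.
have crz' : r @ z --> r z by apply: differentiable_continuous; exact: dr.
have nr : \forall w \near z, s0 < r w by exact: (cvgr_gt (r z)).
have [dt Dt] := dtau Yz.
have dfz := df Yz; have drz := dr Yz.
have rz_neq0 : r z != 0 by rewrite gt_eqF.
have qE : q = cst 1 + (2 * C) *: tau by apply/funext => w; rewrite /q mulrA.
have dq : differentiable q z.
  by rewrite qE; apply: differentiableD => //; exact: differentiableZ.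
have Dq : 'D_(b z) q z = 2 * C.
  rewrite qE deriveD //; [|exact/diff_derivable/differentiableZ].
  by rewrite derive_cst add0r deriveZ ?Dt; [rewrite [LHS]mulr1|exact: diff_derivable].
pose rV w := (r w)^-1.
have drV : differentiable rV z by apply: differentiableV.
have GE' : G = f - N *: (q * r) - dl *: (q * rV) by [].
have dqr : differentiable (q * r) z by exact: differentiableM.
have dqV : differentiable (q * rV) z by exact: differentiableM.
have dG : differentiable G z.
  rewrite GE'; apply: differentiableB; last exact: differentiableZ.
  by apply: differentiableB => //; exact: differentiableZ.
have : 'D_(b z) (- G) z = 0.
  apply: derive_local_min; first exact: differentiableN.
  apply: filterS2 nzY nr => w Yw rw; rewrite [leLHS]/= [leRHS]/= lerN2.
  have GE y : s0 < r y -> G y = G' y.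
    by move=> sy; rewrite /G /G' (max_idPl (ltW sy)).
  by rewrite !GE //; exact/zmax/YK.
rewrite deriveN; last exact: diff_derivable.
rewrite GE' deriveB; last 2 first.
- by apply: diff_derivable; apply: differentiableB => //; exact: differentiableZ.
- by apply: diff_derivable; exact: differentiableZ.
rewrite deriveB; last 2 first.
- exact: diff_derivable.
- by apply: diff_derivable; exact: differentiableZ.
rewrite deriveZ; last exact: diff_derivable.
rewrite deriveZ; last exact: diff_derivable.
rewrite deriveM; [|exact: diff_derivable|exact: diff_derivable].
rewrite deriveM; [|exact: diff_derivable|exact: diff_derivable].
rewrite Dq deriveV //; last exact: diff_derivable.
move/eqP; apply/negP.
apply: penalty_contradiction (f_decreasing Yz _ fz) N0 dl0 rz_pos (q12 _ Kz) C0 (r_transported Yz).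
by rewrite (lt_trans s00 rz_gt).
Qed.

End maximum_principle.

(** * Cutoff functions of class C^1 *)

Section cutoff.
Context {R : realType}.
Implicit Types (x s : R).

Definition pos_sq x := Num.max 0 x ^+ 2.

Lemma pos_sq_ge0 x : 0 <= pos_sq x. Proof. exact: sqr_ge0. Qed.

Lemma pos_sq_le0 x : x <= 0 -> pos_sq x = 0.
Proof. by move=> x0; rewrite /pos_sq (max_idPl x0) expr0n. Qed.

Lemma pos_sq_gt0 x : 0 < x -> pos_sq x = x ^+ 2.
Proof. by move=> x0; rewrite /pos_sq (max_idPr (ltW x0)). Qed.

Lemma is_derive_pos_sq x : is_derive x 1 pos_sq (2 * Num.max 0 x).
Proof.
have [x0|x0|->] := ltrgtP x 0.
- rewrite mulr0; apply: (near_eq_is_derive (f := cst 0)) => //.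
  have : \forall y \near x, y < 0 by exact: lt_nbhsl.
  by apply: filterS => y y0; rewrite pos_sq_le0 // ltW.
- apply: (near_eq_is_derive (f := fun y : R => y ^+ 2)).
    have : \forall y \near x, 0 < y by exact: lt_nbhsr.
    by apply: filterS => y y0; rewrite pos_sq_gt0.
  have [dx1 Dx] : derivable (fun y : R => y ^+ 2) x 1 /\ 'D_1 (fun y : R => y ^+ 2) x = 2 * x.
    split; first exact: exprn_derivable.
    by rewrite exp_derive /= expr1 /GRing.scale /= mulr1 mulr_natl.
  exact: DeriveDef.
- rewrite mulr0.
  have c0 : continuous (\0 : R -> R) by move=> y; exact: cvg_cst.
  have [|dp dpE] := @differentiable_of_littleo R R R pos_sq 0 (\0) c0.
    move=> e e0; have ne : \forall h \near (0 : R), `|h| < e.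
      by exists e => //= h; rewrite /ball_ /= sub0r normrN.
    near=> h.
    have -> : pos_sq (0 + h) - (pos_sq 0 + (\0 : R -> R) h) = pos_sq h.
      by rewrite add0r (@pos_sq_le0 0) //= addr0 subr0.
    rewrite ger0_norm ?pos_sq_ge0 //.
    have he : `|h| <= e by apply: ltW; near: h; exact: ne.
    have [h0|h0] := lerP h 0; first by rewrite pos_sq_le0 // mulr_ge0 // ltW.
    by rewrite pos_sq_gt0 // gtr0_norm // expr2 ler_pM2r // -[h]gtr0_norm.
  apply: DeriveDef; first exact: diff_derivable.
  by rewrite deriveE // dpE.
Unshelve. all: by end_near. Qed.

Lemma derivable_pos_sq x : derivable pos_sq x 1.
Proof. by have [] := is_derive_pos_sq x. Qed.

Lemma derive1_pos_sq : (pos_sq^`())%classic = fun x => 2 * Num.max 0 x.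
Proof. by apply/funext => x; rewrite derive1E; have [] := is_derive_pos_sq x. Qed.

Lemma continuous_max0 : continuous (fun x => Num.max 0 x).
Proof.
by move=> x; apply: (@continuous_max _ _ (cst 0) id); [exact: cvg_cst|exact: cvg_id].
Qed.

Lemma continuous_derive1_pos_sq : continuous (pos_sq^`())%classic.
Proof.
rewrite derive1_pos_sq => x; apply: cvgM; first exact: cvg_cst.
exact: continuous_max0.
Qed.

(** A cutoff of class C^1: 1 up to 1/2 and 0 from 1 on. *)
Definition step s := pos_sq (1 - pos_sq (2 * s - 1)).

Lemma step_ge0 s : 0 <= step s. Proof. exact: pos_sq_ge0. Qed.

Lemma step_le1 s : step s <= 1.
Proof.
rewrite /step /pos_sq expr_le1 // ?le_max ?lexx // ge_max ler01 /=.
by rewrite gerBl sqr_ge0.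
Qed.

Lemma step_eq1 s : s <= 2^-1 -> step s = 1.
Proof.
move=> s1; rewrite /step (@pos_sq_le0 (2 * s - 1)); last lra.
by rewrite subr0 pos_sq_gt0 // expr1n.
Qed.

Lemma step_eq0 s : 1 <= s -> step s = 0.
Proof.
move=> s1; rewrite /step pos_sq_le0 // subr_le0 pos_sq_gt0; last lra.
by rewrite exprn_ege1 //; lra.
Qed.

Lemma is_derive_step s : is_derive s 1 step
  (- (8 * Num.max 0 (1 - pos_sq (2 * s - 1)) * Num.max 0 (2 * s - 1))).
Proof.
have d1 : is_derive s (1 : R) (fun s => 2 * s - 1 : R) 2.
  have -> : (fun s => 2 * s - 1) = 2 *: (id : R -> R) - cst 1 by [].
  by apply: is_derive_eq; rewrite subr0 [LHS]mulr1.
have d2 : is_derive s 1 (pos_sq \o (fun s => 2 * s - 1)) (2 * (2 * Num.max 0 (2 * s - 1))).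
  have [dd _] := d1; have dp := @derivable_pos_sq (2 * s - 1).
  apply: DeriveDef.
    exact/derivable1_diffP/(@differentiable_chain _ _ _ _ (fun s => 2 * s - 1) pos_sq s ((derivable1_diffP _ _).1 dd) ((derivable1_diffP _ _).1 dp)).
  rewrite (@derive_comp R R pos_sq (fun s => 2 * s - 1) s 1 dp ((derivable1_diffP _ _).1 dd)).
  by have [_ ->] := d1; rewrite derive1_pos_sq mulrC.
have d3 : is_derive s 1 (fun s => 1 - pos_sq (2 * s - 1)) (- (2 * (2 * Num.max 0 (2 * s - 1)))).
  have -> : (fun s => 1 - pos_sq (2 * s - 1)) = cst 1 - (pos_sq \o (fun s => 2 * s - 1)) by [].
  by apply: is_derive_eq; rewrite sub0r.
have [dd3 D3] := d3; have dp := @derivable_pos_sq (1 - pos_sq (2 * s - 1)).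
apply: DeriveDef.
  exact/derivable1_diffP/(@differentiable_chain _ _ _ _ (fun s => 1 - pos_sq (2 * s - 1)) pos_sq s ((derivable1_diffP _ _).1 dd3) ((derivable1_diffP _ _).1 dp)).
rewrite [LHS](@derive_comp R R pos_sq (fun s => 1 - pos_sq (2 * s - 1)) s 1 dp ((derivable1_diffP _ _).1 dd3)).
by rewrite D3 derive1_pos_sq; ring.
Qed.

Lemma derivable_step s : derivable step s 1.
Proof. by have [] := is_derive_step s. Qed.

Lemma derive1_step : (step^`())%classic =
  fun s => - (8 * Num.max 0 (1 - pos_sq (2 * s - 1)) * Num.max 0 (2 * s - 1)).
Proof. by apply/funext => x; rewrite derive1E; have [] := is_derive_step x. Qed.

Lemma continuous_derive1_step : continuous (step^`())%classic.
Proof.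
rewrite derive1_step => s; apply: cvgN.
have c1 : {for s, continuous (fun s => 2 * s - 1)}.
  by apply: cvgB; [apply: cvgM; [exact: cvg_cst|exact: cvg_id]|exact: cvg_cst].
have c2 : {for s, continuous (fun s => Num.max 0 (2 * s - 1))}.
  exact: (@continuous_comp _ _ _ (fun s => 2 * s - 1) (fun x => Num.max 0 x) s c1 (@continuous_max0 _)).
apply: cvgM => //; apply: cvgM; first exact: cvg_cst.
have c3 : {for s, continuous (fun s => 1 - pos_sq (2 * s - 1))}.
  by apply: cvgB; [exact: cvg_cst|rewrite /pos_sq; apply: cvgM; exact: c2].
exact: (@continuous_comp _ _ _ (fun s => 1 - pos_sq (2 * s - 1)) (fun x => Num.max 0 x) s c3 (@continuous_max0 _)).
Qed.

Lemma derive1_step_le s : `|(step^`())%classic s| <= 8.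
Proof.
have m0 x : 0 <= Num.max 0 x by rewrite le_max lexx.
rewrite derive1_step normrN !normrM (ger0_norm (m0 _)) (ger0_norm (m0 (2 * s - 1))) normr_nat.
have [s1|s1] := lerP 1 s.
  have -> : Num.max 0 (1 - pos_sq (2 * s - 1)) = 0.
    apply/max_idPl; rewrite subr_le0 pos_sq_gt0; last lra.
    by rewrite exprn_ege1 //; lra.
  by rewrite mulr0 mul0r.
rewrite -mulrA ler_piMr // mulr_ile1 //.
  by rewrite ge_max ler01 gerBl pos_sq_ge0.
by rewrite ge_max ler01 /=; lra.
Qed.

End cutoff.

(** * Strong solutions and the vacuum *)

Section strong_solution.
Context {R : realType} {d : nat}.
Local Notation E := ('rV[R]_d * R)%type.
Variables (g T : R) (Omega : set 'rV[R]_d) (rs : E -> R) (us : E -> 'rV[R]_d).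

Definition cyl : set E := Omega `*` `]0, T[.
Definition ccyl : set E := Omega `*` `[0, T].

Lemma open_cyl : open Omega -> open cyl.
Proof.
move=> oO; have -> : cyl = (fst @^-1` Omega) `&` (snd @^-1` `]0, T[) by [].
apply: openI; apply: open_comp => //; first by move=> z _; exact: cvg_fst.
  by move=> z _; exact: cvg_snd.
Qed.

Lemma cyl_ccyl : cyl `<=` ccyl.
Proof.
by move=> z [Oz]; rewrite /= !in_itv /= => /andP[z0 zT]; split=> //=; rewrite in_itv /= !ltW.
Qed.

(** Moving the time towards the middle of the interval enters the open cylinder. *)
Lemma ccyl_closure : 0 < T -> ccyl `<=` closure cyl.
Proof.
move=> T0 [x t] [/= Ox]; rewrite in_itv /= => /andP[t0 tT] B /nbhs_ballP[e /= e0 eB].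
pose s : R := t + Num.min e T / 4 * (1 - 2 * (t / T)).
have m0 : 0 < Num.min e T by rewrite lt_min e0.
have me : Num.min e T <= e by rewrite ge_min lexx.
have mT : Num.min e T <= T by rewrite ge_min lexx orbT.
have tT01 : 0 <= t / T <= 1 by rewrite divr_ge0 ?(ltW T0) // ler_pdivrMr // mul1r.
exists (x, s); split.
  split=> //=; rewrite in_itv /= /s.
  have -> : t = T * (t / T) by rewrite mulrC divfK ?gt_eqF.
  rewrite [T * _ / T]mulrC mulKf ?gt_eqF //.
  move: (t / T) (Num.min e T) tT01 m0 mT => a m /andP[a0 a1] m0 mT.
  by apply/andP; split; nra.
apply: eB; split => /=; first exact: ballxx.
rewrite /ball /= /s opprD addrA subrr sub0r normrN normrM ger0_norm ?divr_ge0 ?(ltW m0) //.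
have a1 : `|1 - 2 * (t / T)| <= 1 by rewrite ler_norml; case/andP: tT01; lra.
apply: (@le_lt_trans _ _ (Num.min e T / 4 * 1)); first by rewrite ler_wpM2l // divr_ge0 // ltW.
lra.
Qed.

Hypotheses (oO : open Omega) (T0 : 0 < T) (g1 : 1 < g).
Hypothesis rsC : forall z, ccyl z -> C1at cyl ccyl rs z.
Hypothesis usC : forall z, ccyl z -> C1at cyl ccyl us z.
Hypothesis rs0 : forall z, ccyl z -> 0 <= rs z.
Hypothesis mass_eq : forall z, cyl z ->
  dt rs z + \sum_(j < d) dx j (fun w => rs w * us w ord0 j) z = 0.
Hypothesis momentum_eq : forall z, cyl z -> forall i : 'I_d,
  dt (fun w => rs w * us w ord0 i) z
  + \sum_(j < d) dx j (fun w => rs w * us w ord0 i * us w ord0 j) z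
  + dx i (fun w => rs w `^ g) z = 0.
Let gp : 0 < g - 1. Proof. by rewrite subr_gt0. Qed.
Let gn : g - 1 != 0. Proof. by rewrite gt_eqF. Qed.
Let g_ge1 : 1 <= g. Proof. exact: ltW. Qed.
Let g2E : g - 2 = g - 1 - 1. Proof. by ring. Qed.

Hypothesis vacuum_or_not : 2 <= g \/ forall z, ccyl z -> 0 < rs z.

Let oc : open cyl. Proof. exact: open_cyl. Qed.

(** The derivative of the pressure potential at the density [rs]. *)
Definition enthalpy (z : E) : R := g / (g - 1) * rs z `^ (g - 1).

Lemma rs_diff z : cyl z -> differentiable rs z.
Proof. by move=> cz; apply: C1at_differentiable cz (rsC (cyl_ccyl cz)). Qed.

Lemma us_diff z : cyl z -> differentiable us z.
Proof. by move=> cz; apply: C1at_differentiable cz (usC (cyl_ccyl cz)). Qed.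

Lemma usi_diff z i : cyl z -> differentiable (fun w => us w ord0 i) z.
Proof. by move=> cz; apply: differentiable_row_coord; exact: us_diff. Qed.

Let exponent_ok z : ccyl z -> 1 <= g - 1 \/ 0 < rs z.
Proof. by move=> cz; case: vacuum_or_not => [g2|/(_ _ cz)]; [left; rewrite lerBrDr|right]. Qed.

Lemma pressure_C1at z : ccyl z -> C1at cyl ccyl (fun w => rs w `^ g) z.
Proof.
by move=> cz; apply: C1at_powR => //; [exact: cyl_ccyl|left|exact: rsC].
Qed.

Lemma enthalpy_C1at z : ccyl z -> C1at cyl ccyl enthalpy z.
Proof.
move=> cz; have -> : enthalpy = cst (g / (g - 1)) * (fun w => rs w `^ (g - 1)) by [].
apply: C1atM; [exact: cyl_ccyl|exact: C1at_cst|].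
by apply: C1at_powR => //; [exact: cyl_ccyl|exact: exponent_ok|exact: rsC].
Qed.

Lemma derive_pressure z v : cyl z ->
  'D_v (fun w => rs w `^ g) z = g * rs z `^ (g - 1) * 'D_v rs z.
Proof.
move=> cz; have H : 1 <= g \/ 0 < rs z by left.
by have [_ ->] := powR_differentiable oc cyl_ccyl rs0 cz (rs_diff cz) H.
Qed.

Lemma derive_enthalpy z v : cyl z ->
  'D_v enthalpy z = g * rs z `^ (g - 2) * 'D_v rs z.
Proof.
move=> cz; have [d1 D1] := powR_differentiable oc cyl_ccyl rs0 cz (rs_diff cz) (exponent_ok (cyl_ccyl cz)).
have -> : enthalpy = (g / (g - 1)) *: (fun w => rs w `^ (g - 1)) by [].
rewrite deriveZ; last exact: diff_derivable.
rewrite D1 /GRing.scale /= -g2E.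
by field.
Qed.

Let rs_pow z : cyl z -> rs z * rs z `^ (g - 2) = rs z `^ (g - 1).
Proof.
move=> /cyl_ccyl/rs0 r0; rewrite g2E.
by rewrite mulr_powRB1.
Qed.

Lemma derive_pressure_enthalpy z v : cyl z ->
  'D_v (fun w => rs w `^ g) z = rs z * 'D_v enthalpy z.
Proof. by move=> cz; rewrite derive_pressure // derive_enthalpy // -rs_pow //; ring. Qed.

Definition divergence (V : E -> 'rV[R]_d) z := \sum_(j < d) dx j (fun w => V w ord0 j) z.

Lemma mass_transport z : cyl z -> 'D_((us z, 1)) rs z = - (rs z * divergence us z).
Proof.
move=> cz; have := mass_eq cz; rewrite derive_direction; last exact: rs_diff.
rewrite scale1r => /eqP; rewrite addr_eq0 => /eqP ->.
rewrite /divergence mulr_sumr -sumrN -[RHS]sumrN -big_split /=; apply: eq_bigr => j _.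
rewrite /dx (_ : (fun w => rs w * us w ord0 j) = rs * (fun w => us w ord0 j)) //.
rewrite deriveM; [|exact/diff_derivable/rs_diff|exact/diff_derivable/usi_diff].
by rewrite /GRing.scale /=; ring.
Qed.

(** [accel] is the residual of a velocity field [V] in the momentum balance divided by
    the density, and [mass_residual] its residual in the mass balance multiplied by the
    derivative of the enthalpy with respect to the density. The momentum residual of a
    strong solution vanishes only where the density is positive, see [strong_accel]. *)
Definition accel (V : E -> 'rV[R]_d) (z : E) (i : 'I_d) : R :=
  'D_((V z, 1)) (fun w => V w ord0 i) z + dx i enthalpy z.

Definition mass_residual (V : E -> 'rV[R]_d) (z : E) : R :=
  'D_((V z, 1)) enthalpy z + (g - 1) * enthalpy z * divergence V z.

Lemma strong_mass_residual z : cyl z -> mass_residual us z = 0.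
Proof.
move=> cz; rewrite /mass_residual derive_enthalpy // mass_transport // /enthalpy.
by rewrite -rs_pow //; field.
Qed.

Lemma strong_accel z i : cyl z -> 0 < rs z -> accel us z i = 0.
Proof.
move=> cz rz; have := momentum_eq cz i; rewrite /dx derive_pressure_enthalpy // -/(dx i enthalpy z).
have rd := rs_diff cz; have ud j := usi_diff j cz.
have rd' v : derivable rs z v by exact: diff_derivable.
have ud' j v : derivable (fun w => us w ord0 j) z v by exact: diff_derivable.
have rud v : derivable (rs * (fun w => us w ord0 i)) z v by exact: derivableM.
rewrite /dt (_ : (fun w => rs w * us w ord0 i) = rs * (fun w => us w ord0 i)) // deriveM //.
have -> : \sum_(j < d) 'D_((delta_mx ord0 j, 0)) (fun w => rs w * us w ord0 i * us w ord0 j) z =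
  us z ord0 i * (\sum_(j < d) dx j (fun w => rs w * us w ord0 j) z) +
  rs z * \sum_(j < d) us z ord0 j * dx j (fun w => us w ord0 i) z.
  rewrite !mulr_sumr -big_split /=; apply: eq_bigr => j _.
  rewrite (_ : (fun w => rs w * us w ord0 i * us w ord0 j) = rs * (fun w => us w ord0 i) * (fun w => us w ord0 j)) //.
  rewrite deriveM // deriveM // /dx (_ : (fun w => rs w * us w ord0 j) = rs * (fun w => us w ord0 j)) // deriveM //.
  have -> : (rs * (fun w => us w ord0 i)) z = rs z * us z ord0 i by [].
  by rewrite /GRing.scale /=; ring.
have := mass_eq cz; rewrite {1}/dt => /eqP; rewrite addr_eq0 => /eqP ->.
rewrite -/(dt _ z) /GRing.scale /= => H.
apply/eqP; rewrite -(mulrI_eq0 _ (mulfI (lt0r_neq0 rz))).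
rewrite /accel derive_direction // scale1r; apply/eqP.
have arith (a c e f s1 s2 : R) :
    c * e + a * - s2 + (a * s2 + c * s1) + c * f = 0 -> c * (e + s1 + f) = 0.
  by move=> <-; ring.
exact: arith H.
Qed.

(** At an interior vacuum point the density has a minimum. *)
Lemma vacuum_derive z v : cyl z -> rs z = 0 -> 'D_v rs z = 0.
Proof.
move=> cz rz; apply: derive_local_min; first exact: rs_diff.
have : \forall w \near z, cyl w by exact: open_nbhs_nbhs.
by apply: filterS => w cw; rewrite rz; exact/rs0/cyl_ccyl.
Qed.

Lemma vacuum_derive_enthalpy z v : cyl z -> rs z = 0 -> 'D_v enthalpy z = 0.
Proof. by move=> cz rz; rewrite derive_enthalpy // vacuum_derive // mulr0. Qed.

Lemma vacuum_enthalpy z : rs z = 0 -> enthalpy z = 0.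
Proof. by move=> rz; rewrite /enthalpy rz powR0 ?mulr0. Qed.

End strong_solution.

(** * Smallness near the vacuum *)

Section local_bounds.
Context {R : realType} {E W : normedModType R} (O A : set E).
Hypothesis OA : O `<=` A.

Lemma C1at_bounded (K : set E) (f : E -> W) : compact K -> K `<=` A ->
  (forall z, K z -> C1at O A f z) ->
  exists2 M : R, 0 <= M & forall z, K z -> `|f z| <= M.
Proof.
move=> cK KA fC.
have [||M HM] := @compact_near_uniform R E K (fun M w => A w -> `|f w| <= M) cK.
- by move=> M M' w MM' H Aw; apply: le_trans (H Aw) MM'.
- move=> z Kz; have [cf _ _] := fC z Kz; exists (`|f z| + 1).
  move/cvgrPdist_le : cf => /(_ 1 ltr01) H.
  have {}H : \forall w \near z, A w -> `|f z - f w| <= 1 by exact: H.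
  apply: filterS H => w Hw Aw; have := Hw Aw => h.
  have -> : f w = f z - (f z - f w) by rewrite opprB addrC subrK.
  by rewrite (le_trans (ler_normB _ _)) // lerD2l.
- exists (Num.max 0 M); first by rewrite le_max lexx.
  by move=> z Kz; rewrite (le_trans (HM _ Kz (KA _ Kz))) // le_max lexx orbT.
Qed.

Lemma C1at_bounded_derive (K : set E) (f : E -> W) v : compact K ->
  (forall z, K z -> C1at O A f z) ->
  exists2 M : R, 0 <= M & forall z, K z -> O z -> `|'D_v f z| <= M.
Proof.
move=> cK fC.
have [||M HM] := @compact_near_uniform R E K (fun M w => O w -> `|'D_v f w| <= M) cK.
- by move=> M M' w MM' H Aw; apply: le_trans (H Aw) MM'.
- move=> z Kz; have [_ _ /(_ v)/cvg_ex[/= l fl]] := fC z Kz; exists (`|l| + 1).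
  move/cvgrPdist_le : fl => /(_ 1 ltr01) H.
  have {}H : \forall w \near z, O w -> `|l - 'D_v f w| <= 1 by exact: H.
  apply: filterS H => w Hw Aw; have := Hw Aw => h.
  have -> : 'D_v f w = l - (l - 'D_v f w) by rewrite opprB addrC subrK.
  by rewrite (le_trans (ler_normB _ _)) // lerD2l.
- exists (Num.max 0 M); first by rewrite le_max lexx.
  by move=> z Kz Oz; rewrite (le_trans (HM _ Kz Oz)) // le_max lexx orbT.
Qed.

End local_bounds.

Section finite_minimum.
Context {R : realType}.

Lemma finite_small (d : nat) (P : 'I_d -> R -> Prop) :
  (forall i (m m' : R), 0 < m' -> m' <= m -> P i m -> P i m') ->
  (forall i, exists2 m : R, 0 < m & P i m) -> exists2 m : R, 0 < m & forall i, P i m.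
Proof.
move=> mP H.
have H1 : \forall m \near (0 : R)^'+, forall i, P i m.
  apply: filter_forall => i; have [m m0 Pm] := H i.
  near=> m'.
  have p0 : 0 < m' by near: m'; exact: nbhs_right_gt.
  by apply: (mP i m) => //; near: m'; exact: nbhs_right_le.
by near (0 : R)^'+ => m; exists m; near: m => //; exact: nbhs_right_gt.
Unshelve. all: by end_near. Qed.

Lemma finite_large (d : nat) (P : 'I_d -> R -> Prop) :
  (forall i (m m' : R), m <= m' -> P i m -> P i m') ->
  (forall i, exists2 m : R, 0 <= m & P i m) -> exists2 m : R, 0 <= m & forall i, P i m.
Proof.
move=> mP H.
pose m := fun i => sval (cid2 (H i)).
have mE i : 0 <= m i /\ P i (m i) by rewrite /m; case: cid2.
exists (\sum_i m i); first by apply: sumr_ge0 => i _; have [] := mE i.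
move=> i; apply: (mP i (m i)); last by have [] := mE i.
by rewrite (bigD1 i) //= lerDl sumr_ge0 // => j _; have [] := mE j.
Qed.

End finite_minimum.

Section gradient.
Context {R : realType} {d : nat}.
Local Notation E := ('rV[R]_d * R)%type.
Variables (T : R) (Omega : set 'rV[R]_d) (f : E -> R).
Local Notation O := (cyl T Omega).
Local Notation A := (ccyl T Omega).
Hypotheses (oO : open Omega).
Hypothesis f0 : forall z, A z -> 0 <= f z.

(** Otherwise [f] would become negative: near [z] the derivative is almost constant, so
    that moving a fixed distance against its sign lowers [f] by more than its value. *)
Lemma small_gradient z i (e : R) : A z -> C1at O A f z -> 0 < e ->
  exists2 m : R, 0 < m & \forall w \near z, O w -> f w < m -> `|dx i f w| <= e.
Proof.
move=> Az [_ df /(_ (delta_mx ord0 i, 0)) /cvg_ex[/= l fl]] e0.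
move/cvgrPdist_le : fl => /(_ (e / 4)); rewrite divr_gt0 // => /(_ isT) fl.
have {}fl : \forall w \near z, O w -> `|l - dx i f w| <= e / 4 by exact: fl.
have nO : \forall w \near z, Omega w.1.
  have : nbhs z.1 Omega by apply: open_nbhs_nbhs; split => //; case: Az.
  by move=> H; apply: cvg_fst.
have H0 : \forall w \near z,
    [/\ O w -> `|l - dx i f w| <= e / 4, O w -> differentiable f w & Omega w.1].
  by near=> w; split; near: w.
move/nbhs_normP : H0 => [sg /= sg0 H].
pose s := sg / 4; have s0 : 0 < s by rewrite divr_gt0.
pose v : E := (delta_mx ord0 i, 0).
have v1 : `|v| <= 1.
  rewrite prod_normE /= normr0 ge_max ler01 andbT row_norm_le // => j; rewrite mxE.
  by case: (_ && _); rewrite ?normr1 ?normr0.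
have near_dir w (t : R) : `|z - w| < sg / 2 -> `|t| <= s -> `|z - (w + t *: v)| < sg.
  move=> zw ts; rewrite opprD addrA (le_lt_trans (ler_normB _ _)) // normrZ.
  have : `|t| * `|v| <= s * 1 by rewrite ler_pM.
  by rewrite /s; lra.
have dir_O w (t : R) : O w -> `|z - w| < sg / 2 -> `|t| <= s -> O (w + t *: v).
  move=> Ow zw ts; have [_ _ O1] := H _ (near_dir w t zw ts).
  by split=> //; case: Ow => _ /=; rewrite scaler0 addr0.
have nz : \forall w \near z, `|z - w| < sg / 2.
  have cz : (fun w : E => w) @ z --> z by exact: cvg_id.
  by move/cvgrPdist_lt : cz; apply; rewrite divr_gt0.
exists (s * (e / 2)); first by rewrite mulr_gt0 // divr_gt0.
near=> w => Ow fw.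
have zw : `|z - w| < sg / 2.
  by near: w; exact: nz.
have [|Dw _ _] := H w; first by apply: lt_trans zw _; lra.
have {}Dw := Dw Ow.
have fA t : `|t| <= s -> 0 <= f (w + t *: v) by move=> ts; exact/f0/cyl_ccyl/dir_O.
(* Moving by [t] along the axis changes [f] by [t] times almost its derivative at [w];
   this is used for both signs of [t], whence the two-sided bound. *)
have mvt (t : R) : `|t| <= s ->
    exists2 D, `|dx i f w - D| <= e / 2 & f (w + t *: v) = f w + t * D.
  move=> ts.
  have ct c : 0 <= c <= 1 -> `|c * t| <= s.
    by move=> /andP[c0 c1]; rewrite normrM ger0_norm // (le_trans _ ts) // ler_piMl.
  have [|c c01 Hc] := @segment_mvt _ _ f w (t *: v).
    move=> c c01; rewrite scalerA.
    have [_ df' _] := H _ (near_dir w (c * t) zw (ct _ c01)); apply: df'.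
    exact: dir_O (ct _ c01).
  have cts := ct _ c01.
  have [Dc dc _] := H _ (near_dir w (c * t) zw cts).
  have Oc := dir_O w (c * t) Ow zw cts.
  exists (dx i f (w + (c * t) *: v)).
    have -> : dx i f w - dx i f (w + (c * t) *: v) =
      (l - dx i f (w + (c * t) *: v)) - (l - dx i f w) by ring.
    by rewrite (le_trans (ler_normB _ _)) //; have := Dc Oc; lra.
  rewrite scalerA in Hc; move/eqP: Hc; rewrite subr_eq => /eqP ->.
  rewrite addrC; congr (_ + _).
  by rewrite deriveE; [rewrite linearZ /= -deriveE //; exact: dc|exact: dc].
have arith (a D y t : R) : 0 < t -> y < t * (e / 2) -> `|a - D| <= e / 2 ->
   0 <= y + t * D -> - e <= a.
  move=> t0 yt; rewrite ler_norml => /andP[h1 h2] h3.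
  have : - (e / 2) < D.
    by rewrite -(ltr_pM2l t0) mulrN; lra.
  by lra.
have [D1 D1a D1E] := mvt s (ltac:(by rewrite gtr0_norm)).
have [D2 D2a D2E] := mvt (- s) (ltac:(by rewrite normrN gtr0_norm)).
have p1 := fA s (ltac:(by rewrite gtr0_norm)).
have p2 := fA (- s) (ltac:(by rewrite normrN gtr0_norm)).
rewrite D1E in p1; rewrite D2E mulNr -mulrN in p2.
rewrite ler_norml (arith _ D1 (f w) s) //= -lerN2.
by apply: (arith _ (- D2) (f w) s) => //; rewrite opprK addrC distrC.
Unshelve. all: by end_near.
Qed.
End gradient.

Section enthalpy_small.
Context {R : realType} {d : nat}.
Local Notation E := ('rV[R]_d * R)%type.
Variables (g T : R) (Omega : set 'rV[R]_d) (rs : E -> R).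
Local Notation O := (cyl T Omega).
Local Notation A := (ccyl T Omega).
Hypotheses (oO : open Omega) (g2 : 2 <= g).
Hypothesis rsC : forall z, A z -> C1at O A rs z.
Hypothesis rs0 : forall z, A z -> 0 <= rs z.

Lemma powR_le1 (s a : R) : 0 <= a -> 0 <= s <= 1 -> s `^ a <= 1.
Proof.
move=> a0 /andP[s0 s1].
suff : s `^ a <= 1 `^ a by rewrite powR1.
by apply: ge0_ler_powR; rewrite ?nnegrE.
Qed.

(** The gradient of the enthalpy is g rs^(g - 2) times that of [rs]. The power is
    bounded as [2 <= g], and the gradient of a nonnegative function is small where the
    function is. *)
Lemma enthalpy_small (K : set E) (e : R) : compact K -> K `<=` A -> 0 < e ->
  exists2 m : R, 0 < m & forall z, K z -> O z -> rs z < m ->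
    `|enthalpy g rs z| <= e /\ forall i, `|dx i (enthalpy g rs) z| <= e.
Proof.
move=> cK KA e0; have g2' := g2; have g0 : 0 < g by lra.
have g1 : 1 < g by lra.
have [||m m0 Hm] := @finite_small R d (fun i m => forall z, K z -> O z -> rs z < m -> `|dx i rs z| <= e / g).
- by move=> i m m' m0 mm H z Kz Oz rm; apply: H => //; apply: lt_le_trans mm.
- move=> i; apply: (@compact_near_small _ _ K (fun m z => O z -> rs z < m -> `|dx i rs z| <= e / g)) => //.
    by move=> m m' z m0 mm H Oz rm; apply: H => //; apply: lt_le_trans mm.
  move=> z Kz; apply: small_gradient => //; [exact: KA|exact/rsC/KA|exact: divr_gt0].
exists (Num.min m (Num.min 1 (e / 2))).
  by rewrite !lt_min m0 ltr01 divr_gt0.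
move=> z Kz Oz; rewrite !lt_min => /and3P[rm r1 re].
have r0 := rs0 (cyl_ccyl Oz).
have vac : 2 <= g \/ forall z, A z -> 0 < rs z by left.
split.
  have gg : 0 <= g / (g - 1) by rewrite divr_ge0; lra.
  rewrite /enthalpy ger0_norm; last by apply: mulr_ge0 => //; exact: powR_ge0.
  have : rs z `^ (g - 1) <= rs z.
    have [->|rn] := eqVneq (rs z) 0; first by rewrite powR0 //; lra.
    by apply: ge1r_powR; [rewrite lt0r rn r0 ltW|lra].
  have : g / (g - 1) <= 2 by rewrite ler_pdivrMr; lra.
  have : 0 <= rs z `^ (g - 1) by exact: powR_ge0.
  move: gg; move: (rs z `^ _) (g / _) => p q q0 p0 q2 pr.
  have : q * p <= 2 * rs z by rewrite ler_pM.
  by move: re; lra.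
move=> i; rewrite /dx (derive_enthalpy oO g1 rsC rs0 vac _ Oz).
have h1 := Hm i z Kz Oz rm.
have h2 : rs z `^ (g - 2) <= 1 by apply: powR_le1; [lra|rewrite r0 ltW].
rewrite normrM ger0_norm ?mulr_ge0 ?powR_ge0 //; last exact: ltW.
have -> : e = g * 1 * (e / g) by field; lra.
by rewrite ler_pM // ?mulr_ge0 ?powR_ge0 ?(ltW g0) // ler_wpM2l // ltW.
Qed.

End enthalpy_small.

Section square_distance.
Context {R : realType} {d : nat}.
Variable x0 : 'rV[R]_d.

(** The square of the Euclidean distance is smooth, as the level sets that bound the
    cones of dependence must be; the norm of the row vectors is the sup norm. *)
Definition sqdist (x : 'rV[R]_d) : R := dotv (x - x0) (x - x0).

Let sqc i (x : 'rV[R]_d) : R := (x ord0 i - x0 ord0 i) ^+ 2.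

Let sqdistE : sqdist = \sum_(i < d) sqc i.
Proof.
apply/funext => x; rewrite fct_sumE /sqdist /dotv; apply: eq_bigr => i _.
by rewrite /sqc !mxE expr2.
Qed.

Let dsub i (x : 'rV[R]_d) : differentiable (fun x : 'rV[R]_d => x ord0 i - x0 ord0 i : R) x.
Proof. by apply: differentiableB => //; exact: differentiable_coord. Qed.

Let dsqc i (x : 'rV[R]_d) : differentiable (sqc i) x.
Proof.
have -> : sqc i = (fun x : 'rV[R]_d => x ord0 i - x0 ord0 i : R) * (fun x : 'rV[R]_d => x ord0 i - x0 ord0 i : R).
  by apply/funext => y; rewrite /sqc expr2.
exact: differentiableM.
Qed.

Lemma differentiable_sqdist x : differentiable sqdist x.
Proof. by rewrite sqdistE; apply: differentiable_sum. Qed.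

Lemma derive_sqdist x v : 'D_v sqdist x = 2 * dotv (x - x0) v.
Proof.
rewrite sqdistE derive_sum; last by move=> i; exact: diff_derivable.
rewrite /dotv mulr_sumr; apply: eq_bigr => i _.
have -> : sqc i = (fun x : 'rV[R]_d => x ord0 i - x0 ord0 i : R) * (fun x : 'rV[R]_d => x ord0 i - x0 ord0 i : R).
  by apply/funext => y; rewrite /sqc expr2.
have D : 'D_v (fun x : 'rV[R]_d => x ord0 i - x0 ord0 i : R) x = v ord0 i.
  rewrite deriveB; [|exact/diff_derivable/differentiable_coord|exact: derivable_cst].
  by rewrite derive_cst subr0 derive_row_coord // derive_id.
rewrite deriveM; [|exact/diff_derivable/dsub|exact/diff_derivable/dsub].
by rewrite D /GRing.scale /= !mxE; ring.
Qed.

Lemma sqdist_ge0 x : 0 <= sqdist x.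
Proof. by apply: sumr_ge0 => i _; rewrite -expr2 sqr_ge0. Qed.

Lemma coord_sqdist (x : 'rV[R]_d) i : (x ord0 i - x0 ord0 i) ^+ 2 <= sqdist x.
Proof.
rewrite /sqdist /dotv (bigD1 i) //= !mxE -expr2 lerDl.
by apply: sumr_ge0 => j _; rewrite -expr2 sqr_ge0.
Qed.

Lemma norm_sqdist x r : 0 <= r -> sqdist x <= r ^+ 2 -> `|x - x0| <= r.
Proof.
move=> r0 xr; apply: row_norm_le => // i; rewrite !mxE.
rewrite -ler_sqr ?nnegrE // real_normK ?num_real //.
exact: le_trans (coord_sqdist x i) xr.
Qed.

Lemma compact_sqball r : 0 <= r -> compact [set x | sqdist x <= r ^+ 2].
Proof.
move=> r0; apply: bounded_closed_compact.
  exists (r + `|x0|); split; first exact: num_real.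
  move=> y ry x /= xr; have h := norm_sqdist r0 xr.
  have hx : `|x| <= `|x - x0| + `|x0| by rewrite -{1}[x](subrK x0) ler_normD.
  by rewrite (le_trans hx) // ltW // (le_lt_trans _ ry) // lerD2r.
have -> : [set x | sqdist x <= r ^+ 2] = sqdist @^-1` [set y | y <= r ^+ 2] by [].
apply: closed_comp; last exact: closed_le.
by move=> x _; apply: differentiable_continuous; exact: differentiable_sqdist.
Qed.

Lemma sqdist_le x : sqdist x <= d%:R * `|x - x0| ^+ 2.
Proof.
rewrite /sqdist /dotv.
apply: (@le_trans _ _ (\sum_(i < d) `|x - x0| ^+ 2)); last first.
  by rewrite sumr_const card_ord mulr_natl.
apply: ler_sum => i _; rewrite -expr2 -[X in X <= _]real_normK ?num_real //.
by rewrite lerXn2r ?nnegrE // coord_le_norm.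
Qed.

Lemma dotv_le (a b : 'rV[R]_d) : `|dotv a b| <= d%:R * (`|a| * `|b|).
Proof.
rewrite /dotv (le_trans (ler_norm_sum _ _ _)) //.
apply: (@le_trans _ _ (\sum_(i < d) (`|a| * `|b|))); last first.
  by rewrite sumr_const card_ord mulr_natl.
by apply: ler_sum => i _; rewrite normrM ler_pM // coord_le_norm.
Qed.

End square_distance.

(** * Initial data for the Burgers equation *)

Lemma near_constant_cvg {R : realType} {E W : normedModType R} (f : E -> W) (c : W) (z : E) :
  (\forall y \near z, f y = c) -> f @ z --> c.
Proof.
move=> fc; apply/cvgrPdist_le => e e0; near=> y.
have -> : f y = c by near: y; exact: fc.
by rewrite subrr normr0 ltW.
Unshelve. all: by end_near. Qed.

Section time_slice.
Context {R : realType} {d : nat}.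
Local Notation E := ('rV[R]_d * R)%type.
Implicit Types (x v : 'rV[R]_d) (t : R).

Lemma differentiable_at_time x t : differentiable (fun y : 'rV[R]_d => (y, t) : E) x.
Proof. exact: differentiable_pair. Qed.

Lemma derive_at_time x v t : 'D_v (fun y : 'rV[R]_d => (y, t) : E) x = (v, 0).
Proof.
rewrite deriveE; last exact: differentiable_at_time.
by rewrite diff_pair //= diff_val diff_cst.
Qed.

Lemma continuous_at_time t : continuous (fun y : 'rV[R]_d => (y, t) : E).
Proof. by move=> x; apply: differentiable_continuous; exact: differentiable_at_time. Qed.

Context {W : normedModType R}.
Implicit Types (f : E -> W).

Lemma differentiable_slice f x t : differentiable f (x, t) ->
  differentiable (fun y => f (y, t)) x.
Proof.
by move=> df; exact: (differentiable_chain (differentiable_at_time x t) df).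
Qed.

Lemma derive_slice f x t v : differentiable f (x, t) ->
  'D_v (fun y => f (y, t)) x = 'D_((v, 0)) f (x, t).
Proof.
move=> df; rewrite (derive_chain v (differentiable_at_time x t) df).
by rewrite derive_at_time.
Qed.

Lemma derive_space f z (v : 'rV[R]_d) : differentiable f z ->
  'D_((v, 0)) f z = \sum_(j < d) v ord0 j *: dx j f z.
Proof. by move=> df; rewrite derive_direction // scale0r add0r. Qed.

End time_slice.

Section localized_slice.
Context {R : realType} {d : nat}.
Local Notation E := ('rV[R]_d * R)%type.
Variables (T : R) (Omega : set 'rV[R]_d) (us : E -> 'rV[R]_d).
Local Notation O := (cyl T Omega).
Local Notation A := (ccyl T Omega).
Variables (x0 : 'rV[R]_d) (r B M : R).
Hypotheses (oO : open Omega) (r0 : 0 < r) (B0 : 0 <= B) (M0 : 0 <= M).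
Hypothesis ball_Omega : forall x, sqdist x0 x <= r ^+ 2 -> Omega x.
Hypothesis usC : forall z, A z -> C1at O A us z.
Hypothesis usB : forall z, A z -> sqdist x0 z.1 <= r ^+ 2 -> `|us z| <= B.
Hypothesis usM : forall z j, O z -> sqdist x0 z.1 <= r ^+ 2 -> `|dx j us z| <= M.
Variable t0 : R.
Hypothesis t0T : 0 < t0 < T.

Let q (x : 'rV[R]_d) : R := sqdist x0 x / r ^+ 2.
Let kappa (x : 'rV[R]_d) : R := step (q x).

(** Data on the whole space for [transport]. They are taken at a positive time [t0]
    because [us] is known to be differentiable only in the open cylinder. *)
Definition localized_slice (x : 'rV[R]_d) : 'rV[R]_d := kappa x *: us (x, t0).

Let r2 : 0 < r ^+ 2. Proof. by rewrite exprn_gt0. Qed.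

Let inO x : Omega x -> O (x, t0).
Proof. by move=> Ox; split=> //=; rewrite in_itv. Qed.

Let qE : q = (r ^+ 2)^-1 *: sqdist x0.
Proof. by apply/funext => x; rewrite /q mulrC. Qed.
Let dq x : differentiable q x.
Proof. by rewrite qE; apply: differentiableZ; exact: differentiable_sqdist. Qed.
Let Dq x v : 'D_v q x = 2 * dotv (x - x0) v / r ^+ 2.
Proof.
rewrite qE deriveZ; last exact/diff_derivable/differentiable_sqdist.
by rewrite derive_sqdist /GRing.scale /= mulrC.
Qed.

Let dkappa x : differentiable kappa x.
Proof.
have ds : differentiable step (q x) by exact/derivable1_diffP/derivable_step.
exact: (@differentiable_chain _ _ _ _ q step x (dq x) ds).
Qed.

Let Dkappa x v : 'D_v kappa x = (step^`())%classic (q x) * 'D_v q x.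
Proof. by rewrite (@derive_comp R _ step q x v) //; exact: derivable_step. Qed.

Lemma localized_slice_near0 x : r ^+ 2 < sqdist x0 x ->
  \forall y \near x, localized_slice y = 0.
Proof.
move=> rx.
have cs : sqdist x0 @ x --> sqdist x0 x.
  by apply: differentiable_continuous; exact: differentiable_sqdist.
have : \forall y \near x, r ^+ 2 < sqdist x0 y by exact: (cvgr_gt (sqdist x0 x) cs _ rx).
apply: filterS => y ry; rewrite /localized_slice /kappa step_eq0 ?scale0r //.
by rewrite ler_pdivlMr // mul1r ltW.
Qed.

Lemma localized_slice_eq x : sqdist x0 x <= r ^+ 2 / 2 -> localized_slice x = us (x, t0).
Proof.
move=> rx; rewrite /localized_slice /kappa step_eq1 ?scale1r //.
by rewrite ler_pdivrMr // mulrC.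
Qed.

Let dus x : Omega x -> differentiable us (x, t0).
Proof. by move=> /inO Ox; apply: C1at_differentiable Ox (usC (cyl_ccyl Ox)). Qed.

Lemma localized_slice_differentiable x : differentiable localized_slice x.
Proof.
have [rx|rx] := ltrP (r ^+ 2) (sqdist x0 x).
  apply: (near_eq_differentiable (f := cst 0)) => //.
  by apply: filterS (localized_slice_near0 rx) => y ->.
apply: (differentiable_scale (dkappa x)).
by apply: differentiable_slice; apply: dus; exact: ball_Omega.
Qed.

Let derive_localized x v : Omega x -> 'D_v localized_slice x =
  kappa x *: 'D_((v, 0)) us (x, t0) + 'D_v kappa x *: us (x, t0).
Proof.
move=> Ox; have dsl := differentiable_slice (dus Ox).
by rewrite -(derive_slice v (dus Ox)); exact: (derive_scale v (dkappa x) dsl).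
Qed.

Lemma localized_slice_C1 v : continuous ('D_v localized_slice).
Proof.
move=> x; have [rx|rx] := ltrP (r ^+ 2) (sqdist x0 x).
  have H : \forall y \near x, 'D_v localized_slice y = 0.
    have /near_join := localized_slice_near0 rx; apply: filterS => y Hy.
    have Hy' : \forall w \near y, localized_slice w = cst 0 w by exact: Hy.
    by rewrite (near_eq_derive v Hy') derive_cst.
  rewrite /continuous_at (nbhs_singleton H).
  exact: near_constant_cvg.
have Ox := ball_Omega rx.
have nO : \forall y \near x, Omega y by exact: open_nbhs_nbhs.
have ck : {for x, continuous kappa} by exact: differentiable_continuous.
have cD : {for x, continuous ('D_v kappa)}.
  have -> : 'D_v kappa = fun y => (step^`())%classic (q y) * (2 * dotv (y - x0) v / r ^+ 2).
    by apply/funext => y; rewrite Dkappa Dq.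
  have cq : {for x, continuous q} by exact: differentiable_continuous.
  apply: (continuous_at_mul (k := (step^`())%classic \o q)).
    by apply: continuous_comp => //; exact: continuous_derive1_step.
  have -> : (fun y => 2 * dotv (y - x0) v / r ^+ 2) = 'D_v q.
    by apply/funext => y; rewrite Dq.
  have -> : 'D_v q = fun y => \sum_(j < d) (2 * v ord0 j / r ^+ 2) * (y ord0 j - x0 ord0 j).
    apply/funext => y; rewrite Dq /dotv mulr_sumr mulr_suml; apply: eq_bigr => j _.
    by rewrite !mxE; ring.
  apply: continuous_at_sum => j; apply: continuous_at_mul; first exact: continuous_at_cst.
  by apply: continuous_at_sub; [exact: coord_continuous|exact: continuous_at_cst].
have cu : {for x, continuous (fun y => us (y, t0))}.
  by apply: differentiable_continuous; apply: differentiable_slice; exact: dus.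
have cDu : {for x, continuous (fun y => 'D_((v, 0)) us (y, t0))}.
  apply: (@continuous_comp _ _ _ (fun y : 'rV[R]_d => (y, t0) : E) ('D_((v, 0)) us)).
    exact: continuous_at_time.
  apply: C1at_derive_continuous (inO Ox) (usC (cyl_ccyl (inO Ox))).
  exact: open_cyl.
apply: (@continuous_at_eq _ _ _ (fun y => kappa y *: 'D_((v, 0)) us (y, t0) + 'D_v kappa y *: us (y, t0))).
  by apply: filterS nO => y Oy; rewrite derive_localized.
by apply: continuous_at_add; exact: continuous_at_scale.
Qed.

Lemma localized_slice_bound x : `|localized_slice x| <= B.
Proof.
have [rx|rx] := ltrP (r ^+ 2) (sqdist x0 x).
  by rewrite (nbhs_singleton (localized_slice_near0 rx)) normr0.
rewrite normrZ (ger0_norm (step_ge0 _)) -[leRHS]mul1r ler_pM ?step_ge0 ?step_le1 //.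
by apply: usB => //; exact/cyl_ccyl/inO/ball_Omega.
Qed.

(** The term with [B / r] is the gradient of the cutoff. *)
Lemma localized_slice_lipschitz x v :
  `|'D_v localized_slice x| <= (d%:R * M + 16 * d%:R * B / r) * `|v|.
Proof.
have C0 : 0 <= 16 * d%:R * B / r by rewrite divr_ge0 ?mulr_ge0 // ltW.
have [rx|rx] := ltrP (r ^+ 2) (sqdist x0 x).
  have Hy' : \forall w \near x, localized_slice w = cst 0 w by exact: localized_slice_near0.
  by rewrite (near_eq_derive v Hy') derive_cst normr0 mulr_ge0 // addr_ge0 // mulr_ge0.
have Ox := ball_Omega rx; rewrite derive_localized // mulrDl.
rewrite (le_trans (ler_normD _ _)) // lerD //.
  rewrite normrZ (ger0_norm (step_ge0 _)) -[leRHS]mul1r ler_pM ?step_ge0 ?step_le1 //.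
  rewrite derive_space ?(le_trans (ler_norm_sum _ _ _)) //; last exact: dus.
  apply: (@le_trans _ _ (\sum_(j < d) M * `|v|)); last first.
    by rewrite sumr_const card_ord -mulrA mulr_natl.
  apply: ler_sum => j _; rewrite normrZ mulrC ler_pM ?coord_le_norm //.
  by apply: usM => //; exact: inO.
have uB : `|us (x, t0)| <= B by apply: usB => //; exact/cyl_ccyl/inO.
rewrite normrZ Dkappa Dq normrM normrM normrM normfV.
rewrite (ger0_norm (ltW r2)) (normr_nat _ 2).
have xr : `|x - x0| <= r by apply: norm_sqdist => //; exact: ltW.
have h1 := derive1_step_le (q x); have h2 := dotv_le (x - x0) v.
have h3 : d%:R * (`|x - x0| * `|v|) <= d%:R * (r * `|v|).
  by rewrite ler_wpM2l // ler_wpM2r.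
have -> : 16 * d%:R * B / r * `|v| = 8 * (2 * (d%:R * (r * `|v|)) / r ^+ 2) * B.
  by field; rewrite gt_eqF.
have p1 : 0 <= 2 * `|dotv (x - x0) v| / r ^+ 2 by rewrite divr_ge0 ?mulr_ge0 // ltW.
have p2 : 2 * `|dotv (x - x0) v| / r ^+ 2 <= 2 * (d%:R * (r * `|v|)) / r ^+ 2.
  by rewrite ler_pM2r ?invr_gt0 // ler_pM2l // (le_trans h2).
by apply: ler_pM => //; [exact: mulr_ge0|exact: ler_pM].
Qed.

End localized_slice.

(** * The deviation of the velocity at the boundary of the vacuum *)

Section dot_calculus.
Context {R : realType} {E : normedModType R} {d : nat}.
Implicit Types (f : E -> 'rV[R]_d).

Let dotE f : (fun w => dotv (f w) (f w)) =
  \sum_(i < d) ((fun w => f w ord0 i) * (fun w => f w ord0 i)).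
Proof. by apply/funext => w; rewrite fct_sumE. Qed.

Lemma differentiable_dotv f z : differentiable f z ->
  differentiable (fun w => dotv (f w) (f w)) z.
Proof.
move=> df; rewrite dotE; apply: differentiable_sum => i.
by apply: differentiableM; exact: differentiable_row_coord.
Qed.

Lemma derive_dotv f z v : differentiable f z ->
  'D_v (fun w => dotv (f w) (f w)) z = 2 * dotv (f z) ('D_v f z).
Proof.
move=> df; have di i := differentiable_row_coord i df.
rewrite dotE derive_sum; last by move=> i; apply: derivableM; exact: diff_derivable.
rewrite /dotv mulr_sumr; apply: eq_bigr => i _.
rewrite deriveM; [|exact: diff_derivable|exact: diff_derivable].
by rewrite derive_row_coord // /GRing.scale /=; ring.
Qed.

Lemma dotv_ge0 (a : 'rV[R]_d) : 0 <= dotv a a.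
Proof. by apply: sumr_ge0 => i _; rewrite -expr2 sqr_ge0. Qed.

Lemma norm_sq_le_dotv (a : 'rV[R]_d) : `|a| ^+ 2 <= dotv a a.
Proof.
have := sqdist_ge0 0 a; rewrite /sqdist subr0 => a0.
have : `|a - 0| <= Num.sqrt (dotv a a).
  by apply: norm_sqdist; rewrite ?sqrtr_ge0 // sqr_sqrtr // /sqdist subr0.
rewrite subr0 => h; rewrite -[leRHS]sqr_sqrtr //.
by rewrite lerXn2r ?nnegrE // sqrtr_ge0.
Qed.

Lemma dotv_sq_le (a : 'rV[R]_d) : dotv a a <= d%:R * `|a| ^+ 2.
Proof. by have := sqdist_le 0 a; rewrite /sqdist subr0. Qed.

Lemma cvg_dotv f (F : set_system E) (l : 'rV[R]_d) : Filter F ->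
  f @ F --> l -> (fun w => dotv (f w) (f w)) @ F --> dotv l l.
Proof.
move=> FF fl; apply: cvg_big => [|i _]; first exact: add_continuous.
have c : (fun w => f w ord0 i) @ F --> l ord0 i.
  by apply: (@cvg_comp _ _ _ f (fun x : 'rV[R]_d => x ord0 i) _ _ _ fl); exact: coord_continuous.
exact: cvgM.
Qed.

End dot_calculus.

Section deviation_arithmetic.
Context {R : realType}.

(** The derivative along the flow of (1 - K1 t) sg gg - q (1 + 2 t) up to a term that is
    negative anyway, for a squared deviation gg that grows at most at the rate K1 and a
    cutoff sg of a shrinking cone. *)
Lemma deviation_decay (K1 t sg Dsg gg Dgg C2 q : R) :
  0 <= K1 -> 0 <= t -> K1 * t <= 2^-1 -> 0 <= sg -> Dsg <= 0 -> 0 <= gg -> 0 <= C2 ->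
  Dgg <= K1 * gg + C2 -> sg * C2 < q ->
  ((1 - K1 * t) * sg) * Dgg + gg * ((1 - K1 * t) * Dsg + sg * - K1) - q < 0.
Proof.
move=> K10 t0 Kt sg0 Dsg0 gg0 C20 hD hq.
have k0 : 0 <= K1 * t by rewrite mulr_ge0.
have a0 : 0 <= 1 - K1 * t by lra.
have h1 : (1 - K1 * t) * sg * Dgg <= (1 - K1 * t) * sg * (K1 * gg + C2).
  by rewrite ler_wpM2l // mulr_ge0.
have h2 : (1 - K1 * t) * (sg * (K1 * gg + C2)) <= sg * (K1 * gg + C2).
  by rewrite ler_piMl ?mulr_ge0 ?addr_ge0 ?mulr_ge0 //; lra.
have h3 : gg * ((1 - K1 * t) * Dsg) <= 0 by rewrite mulr_ge0_le0 // mulr_ge0_le0.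
move: h1 h2 h3; rewrite -mulrA; lra.
Qed.

Lemma deviation_conclusion (K1 t sg gg r4 q T1 : R) : 0 <= K1 -> 0 <= t -> K1 * t <= 2^-1 -> t <= 1 ->
  0 < r4 -> r4 / 4 <= sg -> 0 <= gg -> 0 <= q ->
  (1 - K1 * t) * sg * gg - q * (1 + 2 * t) <= 0 -> gg <= 24 * q / r4.
Proof.
move=> K10 t0 Kt t1 r40 sg4 gg0 q0 H.
rewrite ler_pdivlMr //.
have h1 : 2^-1 * (r4 / 4) <= (1 - K1 * t) * sg by rewrite ler_pM //; lra.
have h2 : 2^-1 * (r4 / 4) * gg <= (1 - K1 * t) * sg * gg by rewrite ler_wpM2r.
have h3 : q * (1 + 2 * t) <= q * 3 by rewrite ler_wpM2l //; lra.
lra.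
Qed.

End deviation_arithmetic.

Section vacuum_boundary.
Context {R : realType} {d : nat}.
Local Notation E := ('rV[R]_d * R)%type.
Variables (T : R) (Omega : set 'rV[R]_d) (rs : E -> R) (us W : E -> 'rV[R]_d).
Local Notation O := (cyl T Omega).
Local Notation A := (ccyl T Omega).
Variables (x0 : 'rV[R]_d) (r c B M T1 kap m : R).
Hypotheses (oO : open Omega) (r0 : 0 < r) (B0 : 0 <= B) (M0 : 0 <= M).
Hypothesis (cc : 2 * d%:R * r * B <= c) (c0 : 0 < c).
Hypotheses (T1E : T1 = r ^+ 2 / c) (T1T : T1 < T) (T11 : T1 <= 1).
Hypothesis (MT1 : 2 * d%:R * d%:R * M * T1 <= 2^-1) (MT2 : d%:R * M * T1 <= 2^-1).
Hypotheses (k0 : 0 < kap) (k1 : kap <= 1) (m0 : 0 < m).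
Hypothesis ball_Omega : forall x, sqdist x0 x <= r ^+ 2 -> Omega x.
Hypothesis rsC : forall z, A z -> C1at O A rs z.
Hypothesis usC : forall z, A z -> C1at O A us z.
Hypothesis rs0 : forall z, A z -> 0 <= rs z.
Hypothesis dW : forall z, differentiable W z.
Hypothesis usB : forall z, A z -> sqdist x0 z.1 <= r ^+ 2 -> `|us z| <= B.
Hypothesis WB : forall z, `|W z| <= B.
Hypothesis usM : forall z j, O z -> sqdist x0 z.1 <= r ^+ 2 -> `|dx j us z| <= M.
Hypothesis rs_transport : forall z, O z ->
  'D_((us z, 1)) rs z = - (rs z * divergence us z).
Hypothesis dev_transport : forall z, O z -> sqdist x0 z.1 <= r ^+ 2 -> z.2 <= T1 ->
  0 < rs z < m ->
  `|'D_((us z, 1)) (us - W) z| <= 2 * kap + d%:R * M * `|us z - W z|.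
Hypothesis dev_initial : forall x, sqdist x0 x <= r ^+ 2 -> `|us (x, 0) - W (x, 0)| <= kap.

Let s (z : E) : R := r ^+ 2 - sqdist x0 z.1 - c * z.2.
Let dev z := us z - W z.
Let K1 : R := 2 * d%:R * d%:R * M.
Let C1 : R := r ^+ 4 * (8 * d%:R * B + d%:R) + 1.
(* The squared deviation, cut off on a backward cone. The factor [1 - K1 * z.2]
   compensates its growth along the flow, the last term the errors of size [kap]. *)
Let f z := (1 - K1 * z.2) * pos_sq (s z) * dotv (dev z) (dev z) - C1 * kap * (1 + 2 * z.2).

Let r2 : 0 < r ^+ 2. Proof. by rewrite exprn_gt0. Qed.
Let T10 : 0 < T1. Proof. by rewrite T1E divr_gt0. Qed.
Let K10 : 0 <= K1. Proof. by rewrite !mulr_ge0. Qed.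
Let C10 : 0 < C1.
Proof. by rewrite ltr_wpDl // mulr_ge0 ?exprn_ge0 ?(ltW r0) // addr_ge0 // !mulr_ge0. Qed.

Let K : set E := [set x | sqdist x0 x <= r ^+ 2] `*` `[0, T1].
Let Y : set E := O `&` [set z | 0 < s z].

Let ds z : differentiable s z.
Proof.
apply: differentiableB; last by apply: differentiableZ; exact: differentiable_snd.
apply: differentiableB => //.
by apply: (differentiable_comp_fst (f := sqdist x0)); exact: differentiable_sqdist.
Qed.

Let Ds z (v : E) : 'D_v s z = - (2 * dotv (z.1 - x0) v.1) - c * v.2.
Proof.
have d1 : differentiable (fun w : E => sqdist x0 w.1) z.
  by apply: (differentiable_comp_fst (f := sqdist x0)); exact: differentiable_sqdist.
have d2 : differentiable (snd : E -> R) z by exact: differentiable_snd.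
have sE : s = (cst (r ^+ 2) - (fun w : E => sqdist x0 w.1)) - c *: (snd : E -> R) by [].
rewrite sE deriveB; last 2 first.
- by apply: diff_derivable; exact: differentiableB.
- by apply: diff_derivable; exact: differentiableZ.
rewrite deriveB; [|exact: derivable_cst|exact: diff_derivable].
rewrite derive_cst sub0r deriveZ; last exact: diff_derivable.
rewrite derive_snd (derive_comp_fst (f := sqdist x0)); last exact: differentiable_sqdist.
by rewrite derive_sqdist.
Qed.

Let KA : K `<=` A.
Proof.
move=> [x t] [/= xr]; rewrite in_itv /= => /andP[t0 t1]; split=> /=; first exact: ball_Omega.
by rewrite in_itv /= t0 (le_trans t1) // ltW.
Qed.

Let YK : Y `<=` K.
Proof.
move=> [x t] [[/= Ox]]; rewrite in_itv /= => /andP[t0 _] sz.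
have sd := sqdist_ge0 x0 x.
have ct : 0 < c * t by rewrite mulr_gt0.
move: sz; rewrite /s /= => sz; split => /=; first by lra.
by rewrite in_itv /= (ltW t0) T1E ler_pdivlMr // mulrC; lra.
Qed.

Let compactK : compact K.
Proof.
apply: compact_setX; last exact: segment_compact.
by apply: compact_sqball; exact: ltW.
Qed.

Let openY : open Y.
Proof.
apply: openI; first exact: open_cyl.
have -> : [set z | 0 < s z] = s @^-1` [set y | 0 < y] by [].
apply: open_comp; last exact: open_gt.
by move=> z _; apply: differentiable_continuous.
Qed.

Let usd z : O z -> differentiable us z.
Proof. by move=> Oz; apply: C1at_differentiable Oz (usC (cyl_ccyl Oz)). Qed.

Let dev_cvg z : K z -> dev @ within K (nbhs z) --> dev z.
Proof.
move=> Kz; have [cu _ _] := usC (KA Kz).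
have cu' : us @ within K (nbhs z) --> us z.
  by apply: cvg_trans cu; apply: cvg_app; exact: within_subset.
apply: cvgB => //; apply: cvg_within_filter.
exact: differentiable_continuous.
Qed.

Let cf : {within K, continuous f}.
Proof.
apply/subspace_continuousP => z Kz.
have ct : (fun w : E => w.2) @ within K (nbhs z) --> z.2.
  by apply: cvg_within_filter; exact: cvg_snd.
have cs : (fun w => pos_sq (s w)) @ within K (nbhs z) --> pos_sq (s z).
  apply: cvg_within_filter; apply: (@continuous_comp _ _ _ s pos_sq); first exact: differentiable_continuous.
  by apply: differentiable_continuous; exact/derivable1_diffP/derivable_pos_sq.
apply: cvgB.
  apply: cvgM; last by apply: cvg_dotv; exact: dev_cvg.
  by apply: cvgM => //; apply: cvgB; [exact: cvg_cst|apply: cvgM => //; exact: cvg_cst].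
apply: cvgM; first exact: cvg_cst.
by apply: cvgD; [exact: cvg_cst|apply: cvgM => //; exact: cvg_cst].
Qed.

Let dev_diff z : O z -> differentiable dev z.
Proof. by move=> Oz; apply: differentiableB; [exact: usd|exact: dW]. Qed.

Let df z : Y z -> differentiable f z.
Proof.
move=> [Oz _]; have d2 : differentiable (snd : E -> R) z by exact: differentiable_snd.
have dp : differentiable (fun w => pos_sq (s w)) z.
  apply: differentiable_chain; first exact: ds.
  exact/derivable1_diffP/derivable_pos_sq.
have da : differentiable (fun w : E => 1 - K1 * w.2) z.
  by apply: differentiableB => //; exact: differentiableZ.
have db : differentiable (fun w : E => 1 + 2 * w.2) z.
  by apply: differentiableD => //; exact: differentiableZ.
have dg : differentiable (fun w => dotv (dev w) (dev w)) z.
  by apply: differentiable_dotv; exact: dev_diff.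
apply: differentiableB; last exact: differentiableZ.
by apply: differentiableM => //; exact: differentiableM.
Qed.

Let Df z v : Y z -> 'D_v f z =
  ((1 - K1 * z.2) * pos_sq (s z)) * (2 * dotv (dev z) ('D_v dev z)) +
  dotv (dev z) (dev z) * ((1 - K1 * z.2) * (2 * Num.max 0 (s z) * 'D_v s z) +
     pos_sq (s z) * - (K1 * v.2)) - C1 * kap * (2 * v.2).
Proof.
move=> [Oz _]; have d2 : differentiable (snd : E -> R) z by exact: differentiable_snd.
have dps : derivable pos_sq (s z) 1 by exact: derivable_pos_sq.
pose sg := fun w => pos_sq (s w).
have dp : differentiable sg z.
  by apply: differentiable_chain; [exact: ds|exact/derivable1_diffP].
have Dp : 'D_v sg z = 2 * Num.max 0 (s z) * 'D_v s z.
  by rewrite (derive_comp v dps (ds z)) derive1_pos_sq.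
pose a := fun w : E => 1 - K1 * w.2; pose b := fun w : E => 1 + 2 * w.2.
have da : differentiable a z by apply: differentiableB => //; exact: differentiableZ.
have db : differentiable b z by apply: differentiableD => //; exact: differentiableZ.
have Da : 'D_v a z = - (K1 * v.2).
  have -> : a = cst 1 - K1 *: (snd : E -> R) by [].
  rewrite deriveB; [|exact: derivable_cst|exact/diff_derivable/differentiableZ].
  by rewrite derive_cst sub0r deriveZ ?derive_snd //; exact: diff_derivable.
have Db : 'D_v b z = 2 * v.2.
  have -> : b = cst 1 + 2 *: (snd : E -> R) by [].
  rewrite deriveD; [|exact: derivable_cst|exact/diff_derivable/differentiableZ].
  by rewrite derive_cst add0r deriveZ ?derive_snd //; exact: diff_derivable.
pose gg := fun w => dotv (dev w) (dev w).
have dg : differentiable gg z by apply: differentiable_dotv; exact: dev_diff.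
have Dg : 'D_v gg z = 2 * dotv (dev z) ('D_v dev z) by rewrite derive_dotv //; exact: dev_diff.
have -> : f = a * sg * gg - (C1 * kap) *: b by [].
rewrite deriveB; last 2 first.
- by apply: diff_derivable; apply: differentiableM => //; exact: differentiableM.
- by apply: diff_derivable; exact: differentiableZ.
rewrite deriveM; [|by apply: diff_derivable; exact: differentiableM|exact: diff_derivable].
rewrite deriveM; [|exact: diff_derivable|exact: diff_derivable].
rewrite deriveZ; last exact: diff_derivable.
by rewrite Dp Da Db Dg.
Qed.

Let sg_le z : Y z -> 0 <= pos_sq (s z) <= r ^+ 4.
Proof.
move=> [Oz sz]; rewrite pos_sq_ge0 /= pos_sq_gt0 // (exprM r 2 2).
rewrite lerXn2r ?nnegrE ?(ltW sz) ?(ltW r2) //.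
have sd := sqdist_ge0 x0 z.1; case: Oz => _ /=; rewrite in_itv /= => /andP[t0 _].
have ct : 0 <= c * z.2 by rewrite mulr_ge0 // ltW.
by rewrite /s; lra.
Qed.

(** Where the density is positive but small, [us - W] changes slowly along the flow of
    [us], and it is small at the initial time. The flow lines through the vacuum carry
    no information, since the momentum balance is void there; those in the closure of
    the region of positive density are reached by [max_principle_vanishing_set]. *)
Lemma deviation_small_at_vacuum_boundary z : O z -> r ^+ 2 / 2 <= s z ->
  rs z = 0 -> closure [set w | 0 < rs w] z ->
  dotv (dev z) (dev z) <= 24 * (C1 * kap) / r ^+ 4.
Proof.
move=> Oz sz rz cz.
have Yz : Y z by split => //=; apply: lt_le_trans sz; rewrite divr_gt0.
have K0A w : K w -> 0 <= w.2 by case=> _ /=; rewrite in_itv /= => /andP[].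
have KT w : K w -> w.2 <= T1 by case=> _ /=; rewrite in_itv /= => /andP[].
have Ks w : K w -> sqdist x0 w.1 <= r ^+ 2 by case.
have KK w : K w -> K1 * w.2 <= 2^-1.
  by move=> Kw; apply: le_trans MT1; rewrite /K1 ler_wpM2l // KT.
have Kz := YK Yz.
apply: (@deviation_conclusion _ K1 z.2 (pos_sq (s z))) => //.
- exact: K0A.
- exact: KK.
- exact: le_trans (KT _ Kz) T11.
- by rewrite exprn_gt0.
- rewrite pos_sq_gt0; last by case: Yz.
  have -> : r ^+ 4 / 4 = (r ^+ 2 / 2) ^+ 2 by field.
  by rewrite lerXn2r ?nnegrE ?divr_ge0 ?(ltW r2) // (le_trans _ sz) // divr_ge0 // ltW.
- exact: dotv_ge0.
- by rewrite mulr_ge0 // ltW.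
apply: (@max_principle_vanishing_set R E K Y f rs snd (fun w => (us w, 1)) (d%:R * M) m compactK openY YK cf) => //.
- apply/subspace_continuousP => w Kw; have [cr _ _] := rsC (KA Kw).
  by apply: cvg_trans cr; apply: cvg_app; exact: within_subset.
- by apply/subspace_continuousP => w Kw; apply: cvg_within_filter; exact: cvg_snd.
- by move=> w Kw; exact/rs0/KA.
- by rewrite mulr_ge0.
- move=> w Kw; split; first exact: K0A.
  by apply: le_trans MT2; rewrite ler_wpM2l ?mulr_ge0 // KT.
- move=> w Kw nY; rewrite /f.
  have C1k : 0 <= C1 * kap by rewrite mulr_ge0 // ltW.
  have t0 := K0A _ Kw.
  have [sw|sw] := lerP (s w) 0.
    by rewrite pos_sq_le0 // mulr0 mul0r sub0r oppr_le0 mulr_ge0 //; lra.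
  have w20 : w.2 = 0.
    apply/eqP; rewrite eq_le t0 andbT leNgt; apply/negP => w0; apply: nY; split => //.
    split; first by apply: ball_Omega; exact: Ks.
    by rewrite /= in_itv /= w0 (le_lt_trans (KT _ Kw)).
  have hd : dotv (dev w) (dev w) <= d%:R * kap.
    apply: le_trans (dotv_sq_le _) _; rewrite ler_wpM2l // expr2.
    have := dev_initial (Ks _ Kw); rewrite -w20 -surjective_pairing => h.
    by rewrite -[leRHS]mul1r ler_pM // (le_trans h).
  have hs : pos_sq (s w) <= r ^+ 4.
    rewrite pos_sq_gt0 // (exprM r 2 2) lerXn2r ?nnegrE ?(ltW sw) ?(ltW r2) //.
    by have := sqdist_ge0 x0 w.1; rewrite /s w20 mulr0; lra.
  rewrite w20 !mulr0 subr0 addr0 mul1r mulr1 subr_le0.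
  apply: (@le_trans _ _ (r ^+ 4 * (d%:R * kap))); first by rewrite ler_pM ?pos_sq_ge0 ?dotv_ge0.
  rewrite mulrA ler_pM2r // /C1 mulrDr; have : 0 <= r ^+ 4 * (8 * d%:R * B).
    by rewrite mulr_ge0 ?exprn_ge0 ?(ltW r0) // !mulr_ge0.
  by lra.
- by move=> w [Ow _]; apply: C1at_differentiable Ow (rsC (cyl_ccyl Ow)).
- by move=> w _; split; [exact: differentiable_snd|rewrite derive_snd].
- move=> w Yw; have [Ow _] := Yw; rewrite rs_transport // normrN normrM.
  rewrite ger0_norm; last exact/rs0/cyl_ccyl.
  rewrite mulrC ler_wpM2r ?rs0 //; first exact: cyl_ccyl.
  rewrite /divergence (le_trans (ler_norm_sum _ _ _)) //.
  apply: (@le_trans _ _ (\sum_(j < d) M)); last by rewrite sumr_const card_ord mulr_natl.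
  apply: ler_sum => j _; rewrite /dx derive_row_coord; last exact: usd.
  by rewrite (le_trans (coord_le_norm _ _)) //; apply: usM => //; exact/Ks/YK.
- move=> w Yw rw fw; have [Ow sw] := Yw; have Kw := YK Yw.
  have sgw := sg_le Yw; case/andP: sgw => sg0 sg4.
  rewrite Df // mulr1 [2 * 1]mulr1.
  apply: (@deviation_decay _ K1 w.2 _ _ _ _ (8 * d%:R * B * kap)) => //.
  + exact: K0A.
  + exact: KK.
  + have s0 : 0 <= 2 * Num.max 0 (s w) by rewrite mulr_ge0 // le_max lexx.
    rewrite mulr_ge0_le0 // Ds /= mulr1.
    have hd := dotv_le (w.1 - x0) (us w).
    have hx : `|w.1 - x0| <= r by apply: norm_sqdist; [exact: ltW|exact: Ks].
    have hu : `|us w| <= B by apply: usB; [exact: KA|exact: Ks].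
    have h2 : d%:R * (`|w.1 - x0| * `|us w|) <= d%:R * (r * B) by rewrite ler_wpM2l // ler_pM.
    have h3 : - dotv (w.1 - x0) (us w) <= `|dotv (w.1 - x0) (us w)| by rewrite -normrN ler_norm.
    have h4 : 2 * d%:R * r * B = 2 * (d%:R * (r * B)) by ring.
    by have := cc; rewrite h4; lra.
  + exact: dotv_ge0.
  + by rewrite !mulr_ge0 // ltW.
  + have hd := dotv_le (dev w) ('D_(us w, 1) dev w).
    have hD := dev_transport Ow (Ks _ Kw) (KT _ Kw) rw.
    have hn : `|dev w| <= 2 * B.
      rewrite (le_trans (ler_normB _ _)) // mulr2n mulrDl mul1r lerD //.
      by apply: usB; [exact: KA|exact: Ks].
    have h1 : d%:R * (`|dev w| * `|'D_(us w, 1) dev w|) <= d%:R * (`|dev w| * (2 * kap + d%:R * M * `|dev w|)).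
      by rewrite ler_wpM2l // ler_wpM2l.
    have h2 : d%:R * (`|dev w| * (2 * kap)) <= d%:R * (2 * B * (2 * kap)).
      by rewrite ler_wpM2l // ler_wpM2r // mulr_ge0 // ltW.
    have h3 : d%:R * d%:R * M * `|dev w| ^+ 2 <= d%:R * d%:R * M * dotv (dev w) (dev w).
      by rewrite ler_wpM2l ?norm_sq_le_dotv // !mulr_ge0.
    have h4 := ler_norm (dotv (dev w) ('D_(us w, 1) dev w)).
    rewrite /K1.
    have E1 : d%:R * (`|dev w| * (2 * kap + d%:R * M * `|dev w|)) =
       d%:R * (`|dev w| * (2 * kap)) + d%:R * d%:R * M * `|dev w| ^+ 2 by ring.
    rewrite E1 in h1.
    have E2 : 8 * d%:R * B * kap = 2 * (d%:R * (2 * B * (2 * kap))) by ring.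
    have E3 : 2 * d%:R * d%:R * M * dotv (dev w) (dev w) = 2 * (d%:R * d%:R * M * dotv (dev w) (dev w)) by ring.
    rewrite E2 E3; lra.
  + apply: (@le_lt_trans _ _ (r ^+ 4 * (8 * d%:R * B * kap))).
      by rewrite ler_wpM2r // !mulr_ge0 // ltW.
    have h1 : 0 < C1 * kap by rewrite mulr_gt0.
    have h2 : r ^+ 4 * (8 * d%:R * B * kap) <= C1 * kap.
      rewrite mulrA ler_pM2r // /C1 mulrDr.
      have : 0 <= r ^+ 4 * d%:R by rewrite mulr_ge0 // exprn_ge0 // ltW.
      by lra.
    by lra.
Qed.

End vacuum_boundary.

(** * A velocity field that also solves the equations in the vacuum *)

Section blending.
Context {R : realType} {d : nat} {E : normedModType R}.
Variables (rs : E -> R) (dev : E -> 'rV[R]_d) (dl e : R).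
Hypotheses (dl0 : 0 < dl) (e0 : 0 < e).

Let phi (z : E) : R := step (rs z / dl).
Let psi (z : E) : R := step (dotv (dev z) (dev z) / e ^+ 2).

(** Subtracting it from the velocity replaces the velocity by its approximation close to
    the boundary of the vacuum, and nowhere else. *)
Definition blend (z : E) : 'rV[R]_d := (phi z * psi z) *: dev z.

Lemma derive1_step_ge1 (s : R) : 1 <= s -> (step^`())%classic s = 0.
Proof.
move=> s1; rewrite derive1_step; have -> : Num.max 0 (1 - pos_sq (2 * s - 1)) = 0.
  apply/max_idPl; rewrite subr_le0 pos_sq_gt0; last lra.
  by rewrite exprn_ege1 //; lra.
by rewrite mulr0 mul0r oppr0.
Qed.

Let e2 : 0 < e ^+ 2. Proof. by rewrite exprn_gt0. Qed.

Lemma blend_near z : rs z <= dl / 2 -> dotv (dev z) (dev z) <= e ^+ 2 / 2 -> blend z = dev z.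
Proof.
move=> h1 h2; rewrite /blend /phi /psi !step_eq1 ?mulr1 ?scale1r //.
  by rewrite ler_pdivrMr // mulrC.
by rewrite ler_pdivrMr // mulrC.
Qed.

Let psi_or z : psi z = 0 /\ (step^`())%classic (dotv (dev z) (dev z) / e ^+ 2) = 0 \/ `|dev z| <= e.
Proof.
have [h|h] := lerP (e ^+ 2) (dotv (dev z) (dev z)).
  by left; rewrite /psi step_eq0 ?derive1_step_ge1 // ler_pdivlMr // mul1r.
right; rewrite -ler_sqr ?nnegrE ?(ltW e0) //.
by apply: le_trans (norm_sq_le_dotv _) _; exact: ltW.
Qed.

(** Where the deviation exceeds [e] the second cutoff vanishes. *)
Lemma blend_le z : `|blend z| <= e.
Proof.
rewrite /blend normrZ normrM !ger0_norm ?step_ge0 //.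
have [[-> _]|h] := psi_or z; first by rewrite mulr0 mul0r ltW.
apply: (@le_trans _ _ (1 * e)); last by rewrite mul1r.
apply: ler_pM => //; first by apply: mulr_ge0; exact: step_ge0.
by rewrite mulr_ile1 ?step_ge0 ?step_le1.
Qed.

Let dphi z : differentiable rs z -> differentiable phi z.
Proof.
move=> dr; have dq : differentiable (fun w => rs w / dl) z.
  have -> : (fun w => rs w / dl) = dl^-1 *: rs by apply/funext => w; rewrite mulrC.
  exact: differentiableZ.
exact: (@differentiable_chain _ _ _ _ _ step z dq (proj1 (derivable1_diffP _ _) (@derivable_step _ _))).
Qed.

Let Dphi z v : differentiable rs z ->
  'D_v phi z = (step^`())%classic (rs z / dl) * ('D_v rs z / dl).
Proof.
move=> dr; pose q := dl^-1 *: rs.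
have qE : (fun w => rs w / dl) = q by apply/funext => w; rewrite mulrC.
have dq : differentiable q z by exact: differentiableZ.
have -> : phi = step \o q by apply/funext => w; rewrite /phi /= -qE.
rewrite (@derive_comp _ _ step q z v (@derivable_step _ _) dq).
by rewrite deriveZ ?[dl^-1 *: _]mulrC -?qE //; exact: diff_derivable.
Qed.

Let dpsi z : differentiable dev z -> differentiable psi z.
Proof.
move=> dr; have dq : differentiable (fun w => dotv (dev w) (dev w) / e ^+ 2) z.
  have -> : (fun w => dotv (dev w) (dev w) / e ^+ 2) = (e ^+ 2)^-1 *: (fun w => dotv (dev w) (dev w)).
    by apply/funext => w; rewrite mulrC.
  by apply: differentiableZ; exact: differentiable_dotv.
exact: (@differentiable_chain _ _ _ _ _ step z dq (proj1 (derivable1_diffP _ _) (@derivable_step _ _))).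
Qed.

Let Dpsi z v : differentiable dev z -> 'D_v psi z =
  (step^`())%classic (dotv (dev z) (dev z) / e ^+ 2) * (2 * dotv (dev z) ('D_v dev z) / e ^+ 2).
Proof.
move=> dr; pose n := fun w => dotv (dev w) (dev w); pose q := (e ^+ 2)^-1 *: n.
have qE : (fun w => n w / e ^+ 2) = q by apply/funext => w; rewrite mulrC.
have dn : differentiable n z by exact: differentiable_dotv.
have dq : differentiable q z by exact: differentiableZ.
have -> : psi = step \o q by apply/funext => w; rewrite /psi /= -qE.
rewrite (@derive_comp _ _ step q z v (@derivable_step _ _) dq).
rewrite deriveZ ?[(e ^+ 2)^-1 *: _]mulrC -?qE //; last exact: diff_derivable.
by rewrite derive_dotv.
Qed.

Lemma differentiable_blend z : differentiable rs z -> differentiable dev z ->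
  differentiable blend z.
Proof.
move=> dr dd; apply: differentiable_scale => //.
by apply: differentiableM; [exact: dphi|exact: dpsi].
Qed.

Let derive_blend z v : differentiable rs z -> differentiable dev z ->
  'D_v blend z = (phi z * psi z) *: 'D_v dev z +
    (phi z * 'D_v psi z + psi z * 'D_v phi z) *: dev z.
Proof.
move=> dr dd; have d1 := dphi dr; have d2 := dpsi dd.
have dpp : differentiable (phi * psi) z by exact: differentiableM.
rewrite (derive_scale v dpp dd); congr (_ + _ *: _).
by rewrite deriveM //; exact: diff_derivable.
Qed.

Lemma derive_blend_far z v : differentiable rs z -> differentiable dev z ->
  dl <= rs z -> 'D_v blend z = 0.
Proof.
move=> dr dd h; have h1 : 1 <= rs z / dl by rewrite ler_pdivlMr // mul1r.
rewrite derive_blend // Dphi // (derive1_step_ge1 h1) {1 2}/phi (step_eq0 h1).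
by rewrite !mul0r mulr0 addr0 !scale0r addr0.
Qed.

(** The gradients of the cutoffs are large, of the orders 1/dl and 1/e, but they
    multiply a deviation of size at most [e]. The factors 8 and 16 come from the slope
    of [step]. *)
Lemma derive_blend_le z v : differentiable rs z -> differentiable dev z ->
  `|'D_v blend z| <= 8 * (`|'D_v rs z| / dl * e) + (16 * d%:R + 1) * `|'D_v dev z|.
Proof.
move=> dr dd; rewrite derive_blend //.
have b1 : `|(phi z * psi z) *: 'D_v dev z| <= `|'D_v dev z|.
  rewrite normrZ normrM !ger0_norm ?step_ge0 // ler_piMl // mulr_ile1 ?step_ge0 ?step_le1 //.
have rd0 : 0 <= `|'D_v rs z| / dl * e by rewrite !mulr_ge0 ?invr_ge0 ?(ltW dl0) ?(ltW e0).
have dd0 : 0 <= d%:R * `|'D_v dev z| by rewrite mulr_ge0.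
rewrite (le_trans (ler_normD _ _)) //.
suff b2 : `|(phi z * 'D_v psi z + psi z * 'D_v phi z) *: dev z| <=
    8 * (`|'D_v rs z| / dl * e) + 16 * (d%:R * `|'D_v dev z|).
  have -> : (16 * d%:R + 1) * `|'D_v dev z| = 16 * (d%:R * `|'D_v dev z|) + `|'D_v dev z| by ring.
  by move: b1 b2; lra.
have [[p0 s0]|h] := psi_or z.
  by rewrite Dpsi // p0 s0 !mul0r mulr0 addr0 scale0r normr0; apply: addr_ge0; apply: mulr_ge0.
rewrite normrZ.
have c1 : `|phi z * 'D_v psi z| * `|dev z| <= 16 * (d%:R * `|'D_v dev z|).
  rewrite Dpsi // (normrM (phi z)) (ger0_norm (step_ge0 _ : 0 <= phi z)) (normrM ((step^`())%classic _ : R)) (normrM (2 * _)) (normrM 2) normfV (ger0_norm (ltW e2)) (normr_nat _ 2).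
  have h1 := derive1_step_le (dotv (dev z) (dev z) / e ^+ 2).
  have h2 := dotv_le (dev z) ('D_v dev z).
  have h3 : 2 * `|dotv (dev z) ('D_v dev z)| / e ^+ 2 * `|dev z| <= 2 * (d%:R * `|'D_v dev z|).
    have -> : 2 * (d%:R * `|'D_v dev z|) = 2 * (d%:R * (e * `|'D_v dev z|)) / e ^+ 2 * e.
      by field; rewrite gt_eqF.
    apply: ler_pM => //; first by rewrite divr_ge0 ?mulr_ge0 // ltW.
    rewrite ler_pM2r ?invr_gt0 // ler_pM2l // (le_trans h2) // ler_wpM2l // ler_wpM2r //.
  have h4 : `|(step^`())%classic (dotv (dev z) (dev z) / e ^+ 2)| *
      (2 * `|dotv (dev z) ('D_v dev z)| / e ^+ 2 * `|dev z|) <= 8 * (2 * (d%:R * `|'D_v dev z|)).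
    by apply: ler_pM => //; rewrite mulr_ge0 // divr_ge0 ?mulr_ge0 // ltW.
  have h5 := step_le1 (rs z / dl); have h6 := step_ge0 (rs z / dl).
  apply: (@le_trans _ _ (1 * (8 * (2 * (d%:R * `|'D_v dev z|))))); last by rewrite mul1r; lra.
  have assoc (p s1 q n : R) : p * (s1 * (2 * q / e ^+ 2)) * n = p * (s1 * (2 * q / e ^+ 2 * n)) by ring.
  rewrite assoc; apply: ler_pM => //; first by rewrite !mulr_ge0 ?invr_ge0 // ltW.
have c2 : `|psi z * 'D_v phi z| * `|dev z| <= 8 * (`|'D_v rs z| / dl * e).
  rewrite Dphi // (normrM (psi z)) (ger0_norm (step_ge0 _ : 0 <= psi z)) (normrM ((step^`())%classic _ : R)) (normrM ('D_v rs z)) normfV (ger0_norm (ltW dl0)).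
  have h1 := derive1_step_le (rs z / dl).
  have h4 : `|(step^`())%classic (rs z / dl)| * (`|'D_v rs z| / dl * `|dev z|) <= 8 * (`|'D_v rs z| / dl * e).
    apply: ler_pM => //; first by rewrite !mulr_ge0 ?invr_ge0 ?(ltW dl0).
    by rewrite ler_wpM2l // mulr_ge0 ?invr_ge0 ?(ltW dl0).
  have h5 := step_le1 (dotv (dev z) (dev z) / e ^+ 2); have h6 := step_ge0 (dotv (dev z) (dev z) / e ^+ 2).
  have assoc (p s1 q n : R) : p * (s1 * q) * n = p * (s1 * (q * n)) by ring.
  rewrite assoc; apply: le_trans h4; rewrite ler_piMl //.
  by rewrite !mulr_ge0 ?invr_ge0 ?(ltW dl0).
have := ler_normD (phi z * 'D_v psi z) (psi z * 'D_v phi z) => hn.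
apply: le_trans (ler_wpM2r (normr_ge0 (dev z)) hn) _.
by rewrite mulrDl; move: c1 c2; lra.
Qed.

Lemma derive_blend_cases z v : differentiable rs z -> differentiable dev z ->
  'D_v blend z = 0 \/ (rs z < dl /\ `|dev z| <= e).
Proof.
move=> dr dd; have [h|h] := lerP dl (rs z).
  by left; exact: derive_blend_far.
have [[p0 s0]|h2] := psi_or z; last by right.
left; rewrite derive_blend // Dpsi // p0 s0.
by rewrite mulr0 mul0r mulr0 mul0r addr0 !scale0r addr0.
Qed.

Lemma C1at_blend (O A : set E) z : open O -> O `<=` A -> C1at O A rs z -> C1at O A dev z -> C1at O A blend z.
Proof.
move=> oO OA rC dC; apply: (proj2 (C1at_coord blend z oO OA)) => i.
have stepC (f : E -> R) : C1at O A f z -> C1at O A (step \o f) z.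
  move=> fC; refine (C1at_comp OA _ _ fC).
    by exists 1 => //= s _; exact: derivable_step.
  exact: continuous_derive1_step.
have dC' j := (C1at_coord dev z oO OA).1 dC j.
have pC : C1at O A phi z.
  have -> : phi = step \o (rs * cst dl^-1) by apply/funext => w.
  by apply: stepC; apply: (C1atM OA rC); exact: (C1at_cst O A (dl^-1 : R) z).
have nC : C1at O A (fun w => dotv (dev w) (dev w)) z.
  have -> : (fun w => dotv (dev w) (dev w)) = \sum_(j < d) (fun w => dev w ord0 j) * (fun w => dev w ord0 j).
    by apply/funext => w; rewrite fct_sumE.
  elim/big_ind: _ => [|f1 f2 h1 h2|j _]; first exact: (C1at_cst _ _ (0 : R)).
    exact: C1atD.
  by apply: (C1atM OA); exact: dC'.
have qC : C1at O A psi z.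
  have -> : psi = step \o ((fun w => dotv (dev w) (dev w)) * cst (e ^+ 2)^-1) by apply/funext => w.
  by apply: stepC; apply: (C1atM OA nC); exact: (C1at_cst O A ((e ^+ 2)^-1 : R) z).
have -> : (fun w => blend w ord0 i) = (phi * psi) * (fun w => dev w ord0 i).
  by apply/funext => w; rewrite /blend mxE.
apply: (C1atM OA); last exact: dC'.
exact: (C1atM OA).
Qed.

End blending.

Lemma derive_space_le {R : realType} {d : nat} {W : normedModType R}
    (F : 'rV[R]_d * R -> W) (z : 'rV[R]_d * R) (a : 'rV[R]_d) (m M : R) :
  differentiable F z -> `|a| <= m -> (forall j, `|dx j F z| <= M) ->
  `|'D_((a, 0)) F z| <= d%:R * (m * M).
Proof.
move=> dF am FM; rewrite derive_space // (le_trans (ler_norm_sum _ _ _)) //.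
apply: (@le_trans _ _ (\sum_(j < d) (m * M))); last by rewrite sumr_const card_ord mulr_natl.
apply: ler_sum => j _; rewrite normrZ; apply: ler_pM => //.
by rewrite (le_trans (coord_le_norm _ _)).
Qed.

Lemma derive_split_direction {R : realType} {d : nat} {W : normedModType R}
    (F : 'rV[R]_d * R -> W) (z : 'rV[R]_d * R) (a c : 'rV[R]_d) (s : R) :
  differentiable F z -> 'D_((a - c, s)) F z = 'D_((a, s)) F z - 'D_((c, 0)) F z.
Proof.
move=> dF; rewrite !deriveE // -linearB; congr ('d F z _).
by rewrite /= /GRing.opp /=; congr pair; rewrite /= oppr0 addr0.
Qed.

Section residual_arithmetic.
Context {R : realType}.
Implicit Types (a b c x y B e Mu Mr p q : R).

Lemma mass_residual_sub x y a b c q : x + a * b * c = 0 ->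
  x - y + a * b * (c - q) = - y - a * (b * q).
Proof. by move=> h; rewrite -[RHS]add0r -h; ring. Qed.

Lemma accel_sub x y a b : x + a = 0 -> x - y - b + a = - y - b.
Proof. by move=> h; rewrite -[RHS]add0r -h; ring. Qed.

Lemma sub_bound x y p q B Mr : 0 <= B -> 0 <= Mr -> x <= p -> y <= 8 * Mr + q ->
  x + y <= B + 1 + p + 8 * Mr + q.
Proof. by lra. Qed.

Lemma accel_bound x y p q a : x <= p -> y <= q -> 0 <= a -> x + y <= p + q + a.
Proof. by lra. Qed.

End residual_arithmetic.

Section deviation.
Context {R : realType} {d : nat}.
Local Notation E := ('rV[R]_d * R)%type.
Variables (g T : R) (Omega : set 'rV[R]_d) (rs : E -> R) (us : E -> 'rV[R]_d).
Local Notation O := (cyl T Omega).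
Local Notation A := (ccyl T Omega).
Hypotheses (oO : open Omega) (g1 : 1 < g).
Hypothesis rsC : forall z, A z -> C1at O A rs z.
Hypothesis usC : forall z, A z -> C1at O A us z.
Hypothesis rs0 : forall z, A z -> 0 <= rs z.
Hypothesis mass_eq : forall z, O z ->
  dt rs z + \sum_(j < d) dx j (fun w => rs w * us w ord0 j) z = 0.
Hypothesis momentum_eq : forall z, O z -> forall i : 'I_d,
  dt (fun w => rs w * us w ord0 i) z
  + \sum_(j < d) dx j (fun w => rs w * us w ord0 i * us w ord0 j) z
  + dx i (fun w => rs w `^ g) z = 0.
Hypothesis vac : 2 <= g \/ forall z, A z -> 0 < rs z.

(** The momentum balance turns the derivative of [us] along its flow into the enthalpy
    gradient, and the derivative of [W] along the flow of [us] differs from its Burgers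
    residual by the derivative of [W] in the direction of the deviation. *)
Lemma deviation_transport_le (W : E -> 'rV[R]_d) z (a k M : R) : O z -> 0 < rs z ->
  differentiable W z -> 0 <= a -> (forall i, `|dx i (enthalpy g rs) z| <= a) ->
  `|burgers W z| <= k -> (forall j, `|dx j W z| <= M) ->
  `|'D_((us z, 1)) us z - 'D_((us z, 1)) W z| <= a + k + d%:R * (`|us z - W z| * M).
Proof.
move=> Oz rz dW a0 hs Wk WM.
have dus : differentiable us z by exact: (C1at_differentiable Oz (usC (cyl_ccyl Oz))).
have uE : `|'D_((us z, 1)) us z| <= a.
  apply: row_norm_le => // i; rewrite -derive_row_coord //.
  have := strong_accel oO g1 rsC usC rs0 mass_eq momentum_eq vac i Oz rz.
  by rewrite /accel => /eqP; rewrite addr_eq0 => /eqP ->; rewrite normrN hs.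
rewrite (le_trans (ler_normB _ _)) // -addrA lerD //.
have := derive_split_direction (us z) (us z - W z) 1 dW.
rewrite {1}subKr => /eqP; rewrite eq_sym subr_eq => /eqP ->.
rewrite (le_trans (ler_normD _ _)) // lerD //.
by apply: derive_space_le => // j; exact: WM.
Qed.

End deviation.

Section blended_velocity.
Context {R : realType} {d : nat}.
Local Notation E := ('rV[R]_d * R)%type.
Variables (g T : R) (Omega : set 'rV[R]_d) (rs : E -> R) (us W : E -> 'rV[R]_d).
Local Notation O := (cyl T Omega).
Local Notation A := (ccyl T Omega).
Hypotheses (oO : open Omega) (g1 : 1 < g) (g2 : 2 <= g).
Hypothesis rsC : forall z, A z -> C1at O A rs z.
Hypothesis usC : forall z, A z -> C1at O A us z.
Hypothesis rs0 : forall z, A z -> 0 <= rs z.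
Hypothesis mass_eq : forall z, O z ->
  dt rs z + \sum_(j < d) dx j (fun w => rs w * us w ord0 j) z = 0.
Hypothesis momentum_eq : forall z, O z -> forall i : 'I_d,
  dt (fun w => rs w * us w ord0 i) z
  + \sum_(j < d) dx j (fun w => rs w * us w ord0 i * us w ord0 j) z
  + dx i (fun w => rs w `^ g) z = 0.
Hypothesis dW : forall z, differentiable W z.
Hypothesis cW : forall v, continuous ('D_v W).
Local Notation h := (enthalpy g rs).
Variables (P : set E) (dl e eta kap B Mu Mr Mh MW : R).
Hypotheses (dl0 : 0 < dl) (e0 : 0 < e) (edl : e <= dl) (e1 : e <= 1).
Hypotheses (eta0 : 0 <= eta) (kap0 : 0 <= kap).
Hypotheses (B0 : 0 <= B) (Mu0 : 0 <= Mu) (Mr0 : 0 <= Mr) (Mh0 : 0 <= Mh) (MW0 : 0 <= MW).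
Hypothesis usB : forall z, P z -> O z -> `|us z| <= B.
Hypothesis WB : forall z, `|W z| <= B.
Hypothesis usM : forall z j, P z -> O z -> `|dx j us z| <= Mu.
Hypothesis rsM : forall z j, P z -> O z -> `|dx j rs z| <= Mr.
Hypothesis hM : forall z j, P z -> O z -> `|dx j h z| <= Mh.
Hypothesis WM : forall z j, P z -> O z -> `|dx j W z| <= MW.
Hypothesis W_burgers : forall z, P z -> O z -> `|burgers W z| <= kap.
Hypothesis h_small : forall z, P z -> O z -> rs z < dl ->
  `|h z| <= eta /\ forall i, `|dx i h z| <= eta.
Hypothesis dev_small : forall z, P z -> A z -> rs z = 0 -> closure [set w | 0 < rs w] z ->
  dotv (us z - W z) (us z - W z) < e ^+ 2 / 2.

Let dev z := us z - W z.
Let b := blend rs dev dl e.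

(** Near the vacuum and its boundary this is [W], which is differentiable there; this is
    why the two cases fit together to a C^1 function although the velocity of the strong
    solution may differ from [W] inside the vacuum. *)
Definition blended (z : E) : 'rV[R]_d := if 0 < rs z then us z - b z else W z.
Local Notation V := blended.

Let oc : open O. Proof. exact: open_cyl. Qed.
Let OA : O `<=` A. Proof. exact: cyl_ccyl. Qed.
Let vac : 2 <= g \/ forall z, A z -> 0 < rs z. Proof. by left. Qed.

Let W_C1at z : C1at O A W z.
Proof.
split.
- by apply: cvg_within_filter; exact: differentiable_continuous.
- by near=> w.
- move=> v; apply/cvg_ex; exists ('D_v W z).
  by apply: cvg_within_filter; exact: cW.
Unshelve. all: by end_near. Qed.

Let dev_C1at z : A z -> C1at O A dev z.
Proof. by move=> Az; apply: C1atD; [exact: usC|apply: C1atN; exact: W_C1at]. Qed.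

Let near_pos z : A z -> 0 < rs z -> \forall w \near z, A w -> V w = (us - b) w.
Proof.
move=> Az rz; have [cr _ _] := rsC Az.
have : \forall w \near z, A w -> 0 < rs w by exact: (cvgr_gt (rs z) cr _ rz).
apply: filterS => w hw Aw.
by rewrite /blended (hw Aw).
Qed.

(* At the boundary of the vacuum the deviation is small by [dev_small], so both cutoffs
   are 1 nearby; in the interior there is nothing to compare. *)
Let near_vacuum z : P z -> A z -> rs z = 0 -> \forall w \near z, A w -> V w = W w.
Proof.
move=> Pz Az rz; have [cl|ncl] := pselect (closure [set w | 0 < rs w] z).
  have ds := dev_small Pz Az rz cl.
  have [cr _ _] := rsC Az; have [cd _ _] := dev_C1at Az.
  have n1 : \forall w \near z, A w -> rs w < dl / 2.
    by apply: (cvgr_lt (rs z) cr); rewrite rz divr_gt0.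
  have n2 : \forall w \near z, A w -> dotv (dev w) (dev w) < e ^+ 2 / 2.
    exact: (cvgr_lt _ (cvg_dotv _ cd) _ ds).
  move: n1 n2; apply: filterS2 => w h1 h2 Aw.
  rewrite /blended; case: ifP => // _; rewrite /b blend_near //.
  - by rewrite /dev opprB addrC subrK.
  - exact/ltW/h1.
  - exact/ltW/h2.
have : nbhs z (~` closure [set w | 0 < rs w]).
  by apply: open_nbhs_nbhs; split => //; rewrite openC; exact: closed_closure.
apply: filterS => w nw Aw; rewrite /blended; case: ifP => // rw.
by exfalso; apply: nw; exact: subset_closure.
Qed.

Lemma blended_C1at z : P z -> A z -> C1at O A V z.
Proof.
move=> Pz Az; have [rz|rz] := ltP 0 (rs z).
  apply: (@C1at_eq _ _ _ O A oc OA (us - b)) => //.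
    by apply: filterS (near_pos Az rz) => w hw Aw; rewrite hw.
  apply: C1atD; first exact: usC.
  by apply: C1atN; apply: C1at_blend => //; [exact: rsC|exact: dev_C1at].
have r0 : rs z = 0 by apply/eqP; rewrite eq_le rz rs0.
apply: (@C1at_eq _ _ _ O A oc OA W) => //.
by apply: filterS (near_vacuum Pz Az r0) => w hw Aw; rewrite hw.
Qed.

Lemma blended_near_us z : 0 < rs z -> `|V z - us z| <= e.
Proof.
move=> rz; rewrite /blended rz addrC addKr normrN.
exact: blend_le.
Qed.

(** A bound of the velocity and its gradient that is uniform in the smallness parameters
    [dl], [e], [eta] and [kap]. *)
Definition blended_bound := B + 1 + Mu + 8 * Mr + (16 * d%:R + 1) * (Mu + MW).
Local Notation K := blended_bound.

Let part0 : 0 <= (16 * d%:R + 1) * (Mu + MW).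
Proof. by apply: mulr_ge0; [rewrite addr_ge0 // mulr_ge0|rewrite addr_ge0]. Qed.

Lemma blended_bound_ge0 : 0 <= K.
Proof. by have := part0; have := B0; have := Mu0; have := Mr0; rewrite /blended_bound; lra. Qed.

Section at_a_point.
Variable z : E.
Hypotheses (Pz : P z) (Oz : O z).
Let Az : A z. Proof. exact: OA. Qed.

Let drs : differentiable rs z. Proof. exact: (C1at_differentiable Oz (rsC Az)). Qed.
Let dus : differentiable us z. Proof. exact: (C1at_differentiable Oz (usC Az)). Qed.
Let ddev : differentiable dev z. Proof. exact: (C1at_differentiable Oz (dev_C1at Az)). Qed.
Let db : differentiable b z. Proof. exact: (differentiable_blend _ _ drs ddev). Qed.
Let dh : differentiable h z.
Proof. by apply: (C1at_differentiable Oz (enthalpy_C1at oO rsC rs0 vac Az)). Qed.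
Let near_O (f1 f2 : E -> 'rV[R]_d) : (\forall w \near z, A w -> f1 w = f2 w) ->
  \forall w \near z, f1 w = f2 w.
Proof.
have nO : \forall w \near z, O w by exact: oc.
by apply: filterS2 nO => w Ow hw; apply: hw; exact: OA.
Qed.

Let derive_b v : `|'D_v b z| <= 8 * (`|'D_v rs z| / dl * e) + (16 * d%:R + 1) * `|'D_v dev z|.
Proof. exact: (derive_blend_le dl0 e0 v drs ddev). Qed.

Let derive_dev v : 'D_v dev z = 'D_v us z - 'D_v W z.
Proof. exact: (deriveB (diff_derivable dus) (diff_derivable (dW z))). Qed.

Let dxb j : `|dx j b z| <= 8 * Mr + (16 * d%:R + 1) * (Mu + MW).
Proof.
rewrite (le_trans (derive_b _)) // lerD //.
  rewrite ler_wpM2l //.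
  have h1 := rsM j Pz Oz.
  apply: (@le_trans _ _ (Mr / dl * dl)); last by rewrite divfK // gt_eqF.
  apply: ler_pM => //; first by apply: divr_ge0 => //; exact: ltW.
    exact: ltW.
  by rewrite ler_pM2r ?invr_gt0.
rewrite ler_wpM2l ?addr_ge0 ?mulr_ge0 // derive_dev (le_trans (ler_normB _ _)) // lerD //.
  exact: usM.
exact: WM.
Qed.

(** Along the flow the mass balance bounds the derivative of the density by the density
    itself, which compensates the slope 1/dl of the cutoff. *)
Let transport_b : 0 < rs z -> `|'D_((us z, 1)) b z| <=
  8 * (d%:R * Mu * e) + (16 * d%:R + 1) * (eta + kap + d%:R * (e * MW)).
Proof.
move=> rz.
have r0 : 0 <= 8 * (d%:R * Mu * e) + (16 * d%:R + 1) * (eta + kap + d%:R * (e * MW)).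
  by rewrite !(addr_ge0, mulr_ge0) // ltW.
have [->|[rd de]] := derive_blend_cases dl0 e0 ((us z, 1) : E) drs ddev; first by rewrite normr0.
rewrite (le_trans (derive_b _)) // lerD //.
  rewrite ler_wpM2l // ler_wpM2r // ?(ltW e0) //.
  rewrite (mass_transport rsC usC mass_eq Oz) // normrN normrM ger0_norm ?rs0 //.
  have hd : `|divergence us z| <= d%:R * Mu.
    rewrite (le_trans (ler_norm_sum _ _ _)) //.
    apply: (@le_trans _ _ (\sum_(j < d) Mu)); last by rewrite sumr_const card_ord mulr_natl.
    apply: ler_sum => j _; rewrite /dx derive_row_coord //.
    by rewrite (le_trans (coord_le_norm _ _)) // usM.
  rewrite ler_pdivrMr // mulrC; apply: ler_pM => //; first exact: rs0.
  exact: ltW.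
rewrite ler_wpM2l ?addr_ge0 ?mulr_ge0 //.
have [_ hs] := h_small Pz Oz rd.
rewrite derive_dev.
have := deviation_transport_le oO g1 rsC usC rs0 mass_eq momentum_eq vac Oz rz (dW z) eta0 hs
  (W_burgers Pz Oz) (fun j => WM j Pz Oz).
move/le_trans; apply; rewrite lerD2l ler_wpM2l // ler_wpM2r //.
Qed.

Let V_vac : rs z = 0 -> \forall w \near z, V w = W w.
Proof. by move=> rz; apply: near_O; exact: near_vacuum. Qed.

Let V_pos : 0 < rs z -> \forall w \near z, V w = (us - b) w.
Proof. by move=> rz; apply: near_O; exact: near_pos. Qed.

Let Vz_pos : 0 < rs z -> V z = us z - b z.
Proof. by rewrite /blended => ->. Qed.

Let pos_or : 0 < rs z \/ rs z = 0.
Proof.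
have [rz|rz] := ltP 0 (rs z); [by left|right].
by apply/eqP; rewrite eq_le rz rs0.
Qed.

Let b_le : `|b z| <= e. Proof. exact: blend_le. Qed.

Lemma blended_le : `|V z| <= K.
Proof.
have p0 := part0; have Mu0' := Mu0; have Mr0' := Mr0; have e1' := e1.
have [rz|rz] := pos_or.
  rewrite Vz_pos // (le_trans (ler_normB _ _)) //.
  by have := usB Pz Oz; have := b_le; rewrite /blended_bound; lra.
rewrite /blended rz ltxx; have := WB z; rewrite /blended_bound; lra.
Qed.

Lemma blended_dx_le j : `|dx j V z| <= K.
Proof.
have p0 := part0; have Mu0' := Mu0; have Mr0' := Mr0; have e1' := e1; have B0' := B0.
have [rz|rz] := pos_or.
  rewrite /dx (near_eq_derive _ (V_pos rz)).
  rewrite (deriveB (diff_derivable dus) (diff_derivable db)) (le_trans (ler_normB _ _)) //.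
  exact: (sub_bound B0 Mr0 (usM j Pz Oz) (dxb j)).
rewrite /dx (near_eq_derive _ (V_vac rz)).
have := WM j Pz Oz; rewrite /dx /blended_bound.
have dn : 0 <= 16 * d%:R * (Mu + MW) by rewrite !mulr_ge0 // addr_ge0.
by rewrite mulrDl mul1r; move: dn; lra.
Qed.

Let dV : differentiable V z.
Proof. by apply: (C1at_differentiable Oz); exact: blended_C1at. Qed.

(** Where the density is positive, [V] is the strong velocity, whose residual is zero,
    minus the blended part. In the vacuum [V] is [W] and the enthalpy gradient vanishes. *)
Lemma blended_accel_le i : `|accel g rs V z i| <=
  8 * (d%:R * Mu * e) + (16 * d%:R + 1) * (eta + kap + d%:R * (e * MW)) + d%:R * (e * K) + kap.
Proof.
have K0 := blended_bound_ge0.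
have [rz|rz] := pos_or; last first.
  rewrite /accel (_ : dx i h z = 0) ?addr0; last first.
    exact: (vacuum_derive_enthalpy oO g1 rsC rs0 vac _ Oz rz).
  rewrite derive_row_coord // (near_eq_derive _ (V_vac rz)).
  have -> : V z = W z by rewrite /blended rz ltxx.
  rewrite (le_trans (coord_le_norm _ _)) // -[leLHS]add0r lerD //; last exact: W_burgers.
  by rewrite !(addr_ge0, mulr_ge0) // ltW.
have Vi : 'D_((us z, 1)) V z = 'D_((us z, 1)) us z - 'D_((us z, 1)) b z.
  by rewrite (near_eq_derive _ (V_pos rz)) (deriveB (diff_derivable dus) (diff_derivable db)).
have aE : accel g rs V z i = - 'D_((us z, 1)) b z ord0 i - 'D_((b z, 0)) V z ord0 i.
  have := strong_accel oO g1 rsC usC rs0 mass_eq momentum_eq vac i Oz rz.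
  rewrite /accel !derive_row_coord // Vz_pos // derive_split_direction // Vi !mxE.
  exact: accel_sub.
rewrite aE (le_trans (ler_normB _ _)) // normrN.
have t1 := le_trans (coord_le_norm ('D_((us z, 1)) b z) i) (transport_b rz).
have t2 := le_trans (coord_le_norm ('D_((b z, 0)) V z) i) (derive_space_le dV b_le blended_dx_le).
exact: (accel_bound t1 t2 kap0).
Qed.

Lemma blended_mass_residual_le : `|mass_residual g rs V z| <=
  d%:R * (e * Mh) + (g - 1) * (eta * (d%:R * K)).
Proof.
have K0 := blended_bound_ge0; have g10 : 0 <= g - 1 by rewrite subr_ge0 ltW.
have r0 : 0 <= d%:R * (e * Mh) + (g - 1) * (eta * (d%:R * K)).
  apply: addr_ge0; first by rewrite !mulr_ge0 // ltW.
  by apply: mulr_ge0 => //; rewrite !mulr_ge0.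
have [rz|rz] := pos_or; last first.
  rewrite /mass_residual (vacuum_derive_enthalpy oO g1 rsC rs0 vac _ Oz rz).
  by rewrite (vacuum_enthalpy g1 rz) mulr0 mul0r addr0 normr0.
have divV : divergence V z = divergence us z - divergence b z.
  rewrite /divergence -sumrB; apply: eq_bigr => j _.
  rewrite /dx !derive_row_coord // (near_eq_derive _ (V_pos rz)).
  by rewrite (deriveB (diff_derivable dus) (diff_derivable db)) !mxE.
have mE : mass_residual g rs V z = - 'D_((b z, 0)) h z - (g - 1) * (h z * divergence b z).
  have := strong_mass_residual oO g1 rsC usC rs0 mass_eq vac Oz.
  rewrite /mass_residual divV Vz_pos // derive_split_direction //.
  exact: mass_residual_sub.
rewrite mE (le_trans (ler_normB _ _)) // normrN lerD //.
  by apply: derive_space_le => // j; exact: hM.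
rewrite normrM ger0_norm // ler_wpM2l //.
have divb0 : (forall j, dx j b z = 0) -> divergence b z = 0.
  by move=> hb; apply: big1 => j _; have := hb j; rewrite /dx derive_row_coord // => ->; rewrite mxE.
have [rd|rd] := ltP (rs z) dl; last first.
  rewrite divb0 ?mulr0 ?normr0 ?mulr_ge0 // => j.
  exact: (derive_blend_far e dl0 _ drs ddev rd).
rewrite normrM; apply: ler_pM => //; first exact: (h_small Pz Oz rd).1.
rewrite (le_trans (ler_norm_sum _ _ _)) //.
apply: (@le_trans _ _ (\sum_(j < d) K)); last by rewrite sumr_const card_ord mulr_natl.
apply: ler_sum => j _; rewrite /dx derive_row_coord // (le_trans (coord_le_norm _ _)) //.
rewrite (le_trans (dxb j)) // /blended_bound.
by have := B0; have := Mu0; lra.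
Qed.

End at_a_point.
End blended_velocity.

Section vacuum_approximation.
Context {R : realType} {d : nat}.
Local Notation E := ('rV[R]_d * R)%type.
Variables (g T : R) (Omega : set 'rV[R]_d) (rs : E -> R) (us : E -> 'rV[R]_d).
Local Notation O := (cyl T Omega).
Local Notation A := (ccyl T Omega).
Hypotheses (oO : open Omega) (T0 : 0 < T) (g1 : 1 < g) (g2 : 2 <= g).
Hypothesis rsC : forall z, A z -> C1at O A rs z.
Hypothesis usC : forall z, A z -> C1at O A us z.
Hypothesis rs0 : forall z, A z -> 0 <= rs z.
Hypothesis mass_eq : forall z, O z ->
  dt rs z + \sum_(j < d) dx j (fun w => rs w * us w ord0 j) z = 0.
Hypothesis momentum_eq : forall z, O z -> forall i : 'I_d,
  dt (fun w => rs w * us w ord0 i) z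
  + \sum_(j < d) dx j (fun w => rs w * us w ord0 i * us w ord0 j) z
  + dx i (fun w => rs w `^ g) z = 0.
Local Notation h := (enthalpy g rs).
Variables (x0 : 'rV[R]_d) (r2 B Mu Mr Mh : R).
Hypotheses (r20 : 0 < r2) (B0 : 0 <= B) (Mu0 : 0 <= Mu) (Mr0 : 0 <= Mr) (Mh0 : 0 <= Mh).
Hypothesis ball_Omega : forall x, sqdist x0 x <= r2 ^+ 2 -> Omega x.
Hypothesis usB : forall z, A z -> sqdist x0 z.1 <= r2 ^+ 2 -> `|us z| <= B.
Hypothesis usM : forall z j, O z -> sqdist x0 z.1 <= r2 ^+ 2 -> `|dx j us z| <= Mu.
Hypothesis rsM : forall z j, O z -> sqdist x0 z.1 <= r2 ^+ 2 -> `|dx j rs z| <= Mr.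
Hypothesis hM : forall z j, O z -> sqdist x0 z.1 <= r2 ^+ 2 -> `|dx j h z| <= Mh.

Let L := d%:R * Mu + 16 * d%:R * B / r2.
Let M := Mu + 2 * L.
Let r1 := r2 / 2.
(* The reciprocals of all the time scales in the argument are at most [Q]. *)
Let Q := 2 + 2 / T + 4 * d%:R * d%:R * M + 2 * d%:R * M + 2 * L.
Let c := 2 * d%:R * r1 * B + r1 ^+ 2 * Q.
Let T1 := r1 ^+ 2 / c.
Let C1 := r1 ^+ 4 * (8 * d%:R * B + d%:R) + 1.

Let L0 : 0 <= L.
Proof. by rewrite addr_ge0 ?mulr_ge0 // ?invr_ge0 // ltW. Qed.
Let M0 : 0 <= M. Proof. by rewrite addr_ge0 // mulr_ge0. Qed.
Let r10 : 0 < r1. Proof. by rewrite divr_gt0. Qed.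
Let r1sq : 0 < r1 ^+ 2. Proof. by rewrite exprn_gt0. Qed.
Let Qparts : [/\ 0 < 2 / T, 0 <= 4 * d%:R * d%:R * M & 0 <= 2 * d%:R * M].
Proof. by split; rewrite ?divr_gt0 ?mulr_ge0. Qed.
Let Q0 : 0 < Q.
Proof. by have [q1 q2 q3] := Qparts; have := L0; rewrite /Q; lra. Qed.
Let c0 : 0 < c.
Proof. by rewrite /c ltr_wpDl // ?mulr_gt0 // !mulr_ge0 // ltW. Qed.
Let T10 : 0 < T1. Proof. by rewrite divr_gt0. Qed.
Let T1Q : T1 * Q <= 1.
Proof.
rewrite /T1 mulrAC ler_pdivrMr // mul1r /c lerDr !mulr_ge0 //; exact: ltW.
Qed.
Let T1_le (a b : R) : 0 <= a -> 0 <= b -> a + b = Q -> T1 * a <= 1.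
Proof. by move=> a0 b0 ab; apply: le_trans T1Q; apply: ler_wpM2l; [exact: ltW|rewrite -ab lerDl]. Qed.

Let T1_small : [/\ T1 < T, T1 <= 1, 2 * d%:R * d%:R * M * T1 <= 2^-1,
  d%:R * M * T1 <= 2^-1 & T1 * L <= 2^-1].
Proof.
have [q1 q2 q3] := Qparts; have l0 := L0.
have h1 : T1 * (2 / T) <= 1.
  by apply: (@T1_le _ (Q - 2 / T)); [exact: ltW|rewrite /Q; lra|ring].
have h2 : T1 * 2 <= 1 by apply: (@T1_le _ (Q - 2)); [|rewrite /Q; lra|ring].
have h3 : T1 * (4 * d%:R * d%:R * M) <= 1.
  by apply: (@T1_le _ (Q - 4 * d%:R * d%:R * M)); [|rewrite /Q; lra|ring].
have h4 : T1 * (2 * d%:R * M) <= 1.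
  by apply: (@T1_le _ (Q - 2 * d%:R * M)); [|rewrite /Q; lra|ring].
have h5 : T1 * (2 * L) <= 1.
  by apply: (@T1_le _ (Q - 2 * L)); [lra|rewrite /Q; lra|ring].
have t0 := T10; have tt := T0; split.
- move: h1; rewrite mulrA ler_pdivrMr // mul1r; lra.
- lra.
- by move: h3; lra.
- by move: h4; lra.
- by move: h5; lra.
Qed.

Let ball12 x : sqdist x0 x <= r1 ^+ 2 -> sqdist x0 x <= r2 ^+ 2 / 2.
Proof. by move/le_trans; apply; rewrite /r1 expr_div_n; have := sqr_ge0 r2; lra. Qed.
Let ball2 x : sqdist x0 x <= r1 ^+ 2 -> sqdist x0 x <= r2 ^+ 2.
Proof. by move/ball12/le_trans; apply; have := sqr_ge0 r2; lra. Qed.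

Let C10 : 0 < C1.
Proof. by rewrite /C1 ltr_wpDl // mulr_ge0 ?exprn_ge0 ?(ltW r10) // addr_ge0 // mulr_ge0. Qed.

Let box_compact : compact ([set x | sqdist x0 x <= r2 ^+ 2] `*` `[0, T] : set E).
Proof. by apply: compact_setX; [apply: compact_sqball; exact: ltW|exact: segment_compact]. Qed.
Let box_sub : ([set x | sqdist x0 x <= r2 ^+ 2] `*` `[0, T] : set E) `<=` A.
Proof. by move=> [x t] [/= hx ht]; split => //=; exact: ball_Omega. Qed.

Let enthalpy_small_ball e : 0 < e -> exists2 m : R, 0 < m & forall z, O z ->
  sqdist x0 z.1 <= r2 ^+ 2 -> rs z < m -> `|h z| <= e /\ forall i, `|dx i h z| <= e.
Proof.
move=> e0; have [m m0 hm] := enthalpy_small oO g2 rsC rs0 box_compact box_sub e0.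
by exists m => // z Oz zr; apply: hm => //; split => //; case: (cyl_ccyl Oz).
Qed.

(* Uniform continuity of [us] up to the initial time on the compact ball. *)
Let short_time e : 0 < e -> exists2 t0 : R, 0 < t0 < T &
  forall x, sqdist x0 x <= r1 ^+ 2 -> `|us (x, 0) - us (x, t0)| <= e.
Proof.
move=> e0.
pose Pm (m : R) (x : 'rV[R]_d) := sqdist x0 x <= r1 ^+ 2 ->
  forall t, 0 <= t -> t < m -> t <= T -> `|us (x, 0) - us (x, t)| <= e.
have [m m0 hm] : exists2 m : R, 0 < m & forall x, [set x | sqdist x0 x <= r1 ^+ 2] x -> Pm m x.
  apply: compact_near_small.
  - by apply: compact_sqball; exact: ltW.
  - by move=> m m' x m'0 mm H xr t t0 tm tT; apply: (H xr) => //; exact: lt_le_trans tm mm.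
  - move=> x /= xr; have Ax : A (x, 0).
      by split => /=; [exact/ball_Omega/ball2|rewrite in_itv /= lexx ltW].
    have [cu _ _] := usC Ax.
    have e2 : 0 < e / 2 by rewrite divr_gt0.
    have := cvgr_dist_le us (us (x, 0)) cu _ e2.
    have FF : Filter (within A (nbhs ((x, 0) : E))) by exact: within_filter.
    move=> /(_ FF); rewrite /within /= => -[[U1 U2] /= [nU1 nU2] HU].
    have [m m0 mU] : exists2 m : R, 0 < m & forall t, `|t| < m -> U2 t.
      by move/nbhs_ballP : nU2 => [m m0 hm]; exists m => // t tm; apply: hm; rewrite /ball /= sub0r normrN.
    exists m => //; apply: filterS nU1 => y U1y yr t t0 tm tT.
    have Ay s : 0 <= s <= T -> A (y, s).
      by move=> sT; split => /=; [exact/ball_Omega/ball2|rewrite in_itv].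
    have a1 := HU (y, 0) (conj U1y (mU 0 _)) (Ay 0 _).
    have a2 := HU (y, t) (conj U1y (mU t _)) (Ay t _).
    have -> : us (y, 0) - us (y, t) = (us (x, 0) - us (y, t)) - (us (x, 0) - us (y, 0)).
      by rewrite opprB [RHS]addrC addrA subrK.
    rewrite (le_trans (ler_normB _ _)) // [e]splitr lerD //.
      by apply: a2; rewrite ?ger0_norm // t0 tT.
    by apply: a1; rewrite ?normr0 // lexx ltW.
exists (Num.min (m / 2) (T / 2)).
  by rewrite lt_min !divr_gt0 //= gt_min (_ : T / 2 < T) ?orbT //; have := T0; lra.
move=> x xr; apply: (hm x xr xr).
- by rewrite le_min !divr_ge0 // ltW.
- by rewrite gt_min; apply/orP; left; lra.
- by rewrite ge_min; apply/orP; right; have := T0; lra.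
Qed.

Section at_scale.
Variables (eta dl e kap m t0 : R) (k : nat).
Hypotheses (eta0 : 0 < eta) (dl0 : 0 < dl) (e0 : 0 < e) (edl : e <= dl) (e1 : e <= 1).
Hypotheses (k0 : 0 < kap) (k1 : kap <= 1) (kC : kap <= e ^+ 2 * r1 ^+ 4 / (96 * C1)).
Hypothesis small_dl : forall z, O z -> sqdist x0 z.1 <= r2 ^+ 2 -> rs z < dl ->
  `|h z| <= eta /\ forall i, `|dx i h z| <= eta.
Hypothesis m0 : 0 < m.
Hypothesis small_m : forall z, O z -> sqdist x0 z.1 <= r2 ^+ 2 -> rs z < m ->
  `|h z| <= kap /\ forall i, `|dx i h z| <= kap.
Hypothesis t0T : 0 < t0 < T.
Hypothesis us_t0 : forall x, sqdist x0 x <= r1 ^+ 2 -> `|us (x, 0) - us (x, t0)| <= kap.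

Local Notation G := (localized_slice us x0 r2 t0).
Local Notation W := (transport G k).
Hypothesis W_burgers : forall z, 0 <= z.2 <= T1 -> `|burgers W z| <= kap.

Let dG x : differentiable G x.
Proof. exact: (localized_slice_differentiable r20 ball_Omega usC t0T). Qed.
Let cG v : continuous ('D_v G).
Proof. exact: (localized_slice_C1 oO r20 ball_Omega usC t0T). Qed.
Let GL x v : `|'D_v G x| <= L * `|v|.
Proof. exact: (localized_slice_lipschitz r20 B0 Mu0 ball_Omega usC usB usM t0T). Qed.
Let GB x : `|G x| <= B.
Proof. exact: (localized_slice_bound r20 B0 ball_Omega usB t0T). Qed.

Let dW z : differentiable W z. Proof. exact: (differentiable_transport dG). Qed.
Let cW v : continuous ('D_v W). Proof. exact: (derive_transport_continuous dG cG). Qed.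
Let WB z : `|W z| <= B. Proof. exact: (transport_bound GB). Qed.
Let WM z j : 0 <= z.2 <= T1 -> `|dx j W z| <= 2 * L.
Proof.
have [_ _ _ _ TL] := T1_small.
move=> zT; rewrite (le_trans (derive_transport_le L0 B0 dG GL GB TL _ _ zT)) //=.
rewrite normr0 mul0r addr0 -[leRHS]mulr1 ler_wpM2l ?mulr_ge0 //.
apply: row_norm_le => // i; rewrite mxE; case: (_ && _); rewrite ?normr1 ?normr0 //.
Qed.

Let Wx0 x : sqdist x0 x <= r1 ^+ 2 -> W (x, 0) = us (x, t0).
Proof.
move=> xr; have -> : W (x, 0) = G x by case: k => //= n; rewrite scale0r subr0.
by apply: localized_slice_eq => //; exact: ball12.
Qed.

Let dev_boundary z : O z -> r1 ^+ 2 / 2 <= r1 ^+ 2 - sqdist x0 z.1 - c * z.2 -> rs z = 0 ->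
  closure [set w | 0 < rs w] z ->
  dotv (us z - W z) (us z - W z) <= 24 * (C1 * kap) / r1 ^+ 4.
Proof.
have [T1T T11 MT1 MT2 TL] := T1_small; have l0 := L0.
have MuM : Mu <= M by rewrite /M; lra.
have LM : 2 * L <= M by rewrite /M; have := Mu0; lra.
apply: (@deviation_small_at_vacuum_boundary R d T Omega rs us W x0 r1 c B M T1 kap m) => //.
- by rewrite /c lerDl mulr_ge0 // ltW.
- by move=> x /ball2; exact: ball_Omega.
- by move=> w Aw /ball2; exact: usB.
- by move=> w j Ow /ball2 wr; apply: le_trans MuM; exact: usM.
- by move=> w Ow; exact: (mass_transport rsC usC mass_eq Ow).
- move=> w Ow /ball2 wr wT /andP[rw rm].
  have wT1 : 0 <= w.2 <= T1.
    by case: Ow => _; rewrite /= in_itv /= => /andP[/ltW -> _].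
  have dus : differentiable us w by exact: (C1at_differentiable Ow (usC (cyl_ccyl Ow))).
  rewrite (deriveB (diff_derivable dus) (diff_derivable (dW w))).
  have := deviation_transport_le oO g1 rsC usC rs0 mass_eq momentum_eq (or_introl g2) Ow rw (dW w)
    (ltW k0) (small_m Ow wr rm).2 (W_burgers wT1) (fun j => WM j wT1).
  move/le_trans; apply; rewrite [2 * kap]mulr_natl mulr2n lerD2l -mulrA ler_wpM2l //.
  by rewrite mulrC ler_wpM2r.
- by move=> x xr; rewrite Wx0 //; exact: us_t0.
Qed.

Let P : set E := [set z | sqdist x0 z.1 <= (r1 / 2) ^+ 2 /\ z.2 < T1 / 4].

Let Pball z : P z -> sqdist x0 z.1 <= r1 ^+ 2.
Proof. by case=> h1 _; apply: le_trans h1 _; rewrite expr_div_n; have := r1sq; lra. Qed.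

Let PT z : P z -> O z -> 0 <= z.2 <= T1.
Proof.
case=> _ h1 [_]; rewrite /= in_itv /= => /andP[/ltW -> _] /=.
by have := T10; lra.
Qed.

(* At the initial time itself the maximum principle says nothing, but there [W] is the
   slice of [us] at the small time [t0]. *)
Let dev_small z : P z -> A z -> rs z = 0 -> closure [set w | 0 < rs w] z ->
  dotv (us z - W z) (us z - W z) < e ^+ 2 / 2.
Proof.
move=> Pz Az rz cl; have e20 : 0 < e ^+ 2 by rewrite exprn_gt0.
have r40 : 0 < r1 ^+ 4 by rewrite exprn_gt0.
have kC' : 24 * (C1 * kap) / r1 ^+ 4 <= e ^+ 2 / 4.
  rewrite ler_pdivrMr //; move: kC; rewrite ler_pdivlMr ?mulr_gt0 //; lra.
have [z0|z0] := ltP 0 z.2.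
  have Oz : O z.
    case: Az => Oz; rewrite /= in_itv /= => /andP[_ zT]; split => //=.
    rewrite in_itv /= z0 /=; have [T1T _ _ _ _] := T1_small.
    by case: Pz => _; have := T10; lra.
  have cz : c * z.2 <= r1 ^+ 2 / 4.
    case: Pz => _ /ltW hz; apply: (@le_trans _ _ (c * (T1 / 4))); first by rewrite ler_pM2l.
    by rewrite /T1 mulrA [c * _]mulrC divfK // gt_eqF.
  have sz : r1 ^+ 2 / 2 <= r1 ^+ 2 - sqdist x0 z.1 - c * z.2.
    by case: Pz => + _; rewrite expr_div_n; move: cz; lra.
  have := dev_boundary Oz sz rz cl; lra.
have z20 : z.2 = 0.
  by apply/eqP; rewrite eq_le z0 /=; case: Az => _; rewrite /= in_itv /= => /andP[].
have zE : z = (z.1, 0) by rewrite -z20 -surjective_pairing.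
have h1 := us_t0 (Pball Pz).
have h2 := dotv_sq_le (us z - W z).
have h3 : `|us z - W z| <= kap by rewrite zE Wx0 //; exact: Pball.
have h4 : d%:R * `|us z - W z| ^+ 2 <= d%:R * kap.
  rewrite ler_wpM2l // (le_trans (_ : _ <= kap ^+ 2)) //.
    by rewrite ler_sqr ?nnegrE // ltW.
  by rewrite expr2 ler_piMl // ltW.
have h5 : d%:R * kap <= 24 * (C1 * kap) / r1 ^+ 4.
  rewrite ler_pdivlMr // mulrAC mulrA ler_pM2r // /C1.
  have : 0 <= r1 ^+ 4 * (8 * d%:R * B) by rewrite !mulr_ge0 // ltW.
  have : 0 <= r1 ^+ 4 * d%:R by rewrite !mulr_ge0 // ltW.
  rewrite mulrDr; lra.
by move: kC' h2 h4 h5 e20; lra.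
Qed.

Let K := @blended_bound R d B Mu Mr (2 * L).

(** [kap] is the accuracy of [W], which has to be chosen after the scales [dl] and [e]
    of the cutoffs; hence [enthalpy_small] is used at the two thresholds [dl] and [m]. *)
Lemma scaled_approximation : exists V : E -> 'rV[R]_d,
  (forall z, A z -> P z -> C1at O A V z /\ (0 < rs z -> `|V z - us z| <= e)) /\
  (forall z, O z -> P z -> [/\ `|V z| <= K, (forall j, `|dx j V z| <= K),
     (forall i, `|accel g rs V z i| <= 8 * (d%:R * Mu * e) +
        (16 * d%:R + 1) * (eta + kap + d%:R * (e * (2 * L))) + d%:R * (e * K) + kap) &
     `|mass_residual g rs V z| <= d%:R * (e * Mh) + (g - 1) * (eta * (d%:R * K))]).
Proof.
have usB' z : P z -> O z -> `|us z| <= B.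
  by move=> /Pball/ball2 Pz Oz; apply: usB => //; exact: cyl_ccyl.
have usM' z j : P z -> O z -> `|dx j us z| <= Mu by move=> /Pball/ball2 Pz Oz; exact: usM.
have rsM' z j : P z -> O z -> `|dx j rs z| <= Mr by move=> /Pball/ball2 Pz Oz; exact: rsM.
have hM' z j : P z -> O z -> `|dx j h z| <= Mh by move=> /Pball/ball2 Pz Oz; exact: hM.
have WM' z j : P z -> O z -> `|dx j W z| <= 2 * L by move=> Pz Oz; apply: WM; exact: PT.
have Wb' z : P z -> O z -> `|burgers W z| <= kap by move=> Pz Oz; apply: W_burgers; exact: PT.
have hs' z : P z -> O z -> rs z < dl -> `|h z| <= eta /\ forall i, `|dx i h z| <= eta.
  by move=> /Pball/ball2 Pz Oz; exact: small_dl.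
have L20 : 0 <= 2 * L by rewrite mulr_ge0.
exists (blended rs us W dl e); split.
  move=> z Az Pz; split; first by apply: blended_C1at Pz Az.
  exact: blended_near_us.
move=> z Oz Pz; split.
- exact: (blended_le rs0 dl e0 e1 Mu0 Mr0 L20 usB' WB Pz Oz).
- exact: (blended_dx_le oO rsC usC rs0 dW cW dl0 e0 edl e1 B0 Mu0 Mr0 L20 usM' rsM' WM' dev_small Pz Oz).
- exact: (blended_accel_le oO g1 g2 rsC usC rs0 mass_eq momentum_eq dW cW dl0 e0 edl e1 (ltW eta0) (ltW k0)
    B0 Mu0 Mr0 L20 usM' rsM' WM' Wb' hs' dev_small Pz Oz).
- exact: (blended_mass_residual_le oO g1 g2 rsC usC rs0 mass_eq dW cW dl0 e0 edl (ltW eta0)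
    B0 Mu0 Mr0 Mh0 L20 usM' rsM' hM' WM' hs' dev_small Pz Oz).
Qed.

End at_scale.

(** The parameters are chosen in the order eta, dl, e, kap, m and t0, k: first the
    accuracy, then the density below which the enthalpy is negligible, the size of the
    deviation that is cut off, the accuracy of [W] that this size requires, and finally
    the data of [W]. *)
Lemma vacuum_approximation : exists r T1' K : R, [/\ 0 < r, 0 < T1' < T, 0 <= K,
  (forall x, sqdist x0 x <= r ^+ 2 -> Omega x) &
  forall eps : R, 0 < eps -> exists V : E -> 'rV[R]_d,
  (forall z, A z -> sqdist x0 z.1 <= r ^+ 2 -> z.2 < T1' ->
     C1at O A V z /\ (0 < rs z -> `|V z - us z| <= eps)) /\
  (forall z, O z -> sqdist x0 z.1 <= r ^+ 2 -> z.2 < T1' ->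
     [/\ `|V z| <= K, (forall j, `|dx j V z| <= K),
     (forall i, `|accel g rs V z i| <= eps) & `|mass_residual g rs V z| <= eps])].
Proof.
pose K := @blended_bound R d B Mu Mr (2 * L).
have K0 : 0 <= K by apply: blended_bound_ge0 => //; rewrite mulr_ge0.
have [T1T T11 MT1 MT2 TL] := T1_small.
exists (r1 / 2), (T1 / 4), K; split => //.
- by rewrite divr_gt0.
- by have := T10; lra.
- move=> x xr; apply/ball_Omega/ball2/(le_trans xr); rewrite expr_div_n; have := r1sq; lra.
move=> eps eps0.
pose N1 := 8 * (d%:R * Mu) + (16 * d%:R + 1) * (1 + 1 + d%:R * (2 * L)) + d%:R * K + 1.
pose N2 := d%:R * Mh + (g - 1) * (d%:R * K).
have gp : 0 <= g - 1 by rewrite subr_ge0 ltW.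
have N10 : 1 <= N1.
  rewrite /N1 lerDr; apply: addr_ge0; last by rewrite mulr_ge0.
  apply: addr_ge0; first by rewrite !mulr_ge0.
  by apply: mulr_ge0; rewrite ?addr_ge0 ?mulr_ge0.
have N20 : 0 <= N2 by rewrite /N2 addr_ge0 // mulr_ge0 // mulr_ge0.
pose N := N1 + N2.
have N0 : 0 < N by rewrite /N; lra.
pose eta := Num.min 1 (eps / N).
have eta0 : 0 < eta by rewrite lt_min ltr01 divr_gt0.
have etaN : eta * N <= eps by rewrite -ler_pdivlMr // ge_min lexx orbT.
have [dl dl0 sdl] := enthalpy_small_ball eta0.
pose e := Num.min eta dl.
have e0 : 0 < e by rewrite lt_min eta0.
have e_eta : e <= eta by rewrite ge_min lexx.
have edl : e <= dl by rewrite ge_min lexx orbT.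
have e1 : e <= 1 by rewrite (le_trans e_eta) // ge_min lexx.
pose kap := Num.min eta (e ^+ 2 * r1 ^+ 4 / (96 * C1)).
have kap0 : 0 < kap by rewrite lt_min eta0 divr_gt0 ?mulr_gt0 ?exprn_gt0.
have kap_eta : kap <= eta by rewrite ge_min lexx.
have kap1 : kap <= 1 by rewrite (le_trans kap_eta) // ge_min lexx.
have kC : kap <= e ^+ 2 * r1 ^+ 4 / (96 * C1) by rewrite ge_min lexx orbT.
have [m m0 sm] := enthalpy_small_ball kap0.
have [t0 t0T st] := short_time kap0.
pose G := localized_slice us x0 r2 t0.
have dG x : differentiable G x.
  exact: (localized_slice_differentiable r20 ball_Omega usC t0T).
have cG v : continuous ('D_v G).
  exact: (localized_slice_C1 oO r20 ball_Omega usC t0T).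
have GL x v : `|'D_v G x| <= L * `|v|.
  exact: (localized_slice_lipschitz r20 B0 Mu0 ball_Omega usC usB usM t0T).
have GB x : `|G x| <= B by exact: (localized_slice_bound r20 B0 ball_Omega usB t0T).
have [C hC] := burgers_transport_le L0 B0 dG GL GB TL (ltW T10).
have [k hk] : exists k, C * (3 / 4) ^+ k <= kap.
  have : @geometric R C (3 / 4) @ \oo --> 0.
    by apply: cvg_geometric; rewrite ger0_norm; lra.
  move=> /cvgrPdist_le /(_ _ kap0) [k _ hk]; exists k.
  by have := hk k (leqnn k); rewrite /geometric /= sub0r normrN => /(le_trans (ler_norm _)).
have Wb z : 0 <= z.2 <= T1 -> `|burgers (transport G k) z| <= kap.
  by move=> zT; exact: le_trans (hC k z zT) hk.
have [V [V1 V2]] := scaled_approximation eta0 dl0 e0 edl e1 kap0 kap1 kC sdl m0 sm t0T st Wb.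
have d0 : 0 <= d%:R :> R by [].
have eta_N1 : eta * N1 <= eps.
  by apply: le_trans etaN; rewrite ler_pM2l // /N lerDl.
have eta_N2 : eta * N2 <= eps.
  by apply: le_trans etaN; rewrite ler_pM2l // /N lerDr; lra.
exists V; split.
  move=> z Az zr zT; have [c1 c2] := V1 z Az (conj zr zT); split => // /c2 /le_trans; apply.
  rewrite (le_trans e_eta) // (le_trans _ eta_N1) // -[leLHS]mulr1 ler_pM2l //.
move=> z Oz zr zT; have [v1 v2 v3 v4] := V2 z Oz (conj zr zT); split => //.
  move=> i; rewrite (le_trans (v3 i)) // (le_trans _ eta_N1) //.
  have -> : eta * N1 = 8 * (d%:R * Mu * eta) + (16 * d%:R + 1) * (eta + eta + d%:R * (eta * (2 * L)))
     + d%:R * (eta * K) + eta by rewrite /N1; ring.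
  rewrite !lerD //.
  - by rewrite ler_wpM2l // ler_wpM2l // mulr_ge0.
  - rewrite ler_wpM2l ?addr_ge0 ?mulr_ge0 // !lerD // ler_wpM2l // ler_wpM2r // mulr_ge0 //.
  - by rewrite ler_wpM2l // ler_wpM2r.
rewrite (le_trans v4) // (le_trans _ eta_N2) //.
have -> : eta * N2 = d%:R * (eta * Mh) + (g - 1) * (eta * (d%:R * K)) by rewrite /N2; ring.
by rewrite lerD2r ler_wpM2l // ler_wpM2r.
Qed.

End vacuum_approximation.

Section velocity_approximation.
Context {R : realType} {d : nat}.
Local Notation E := ('rV[R]_d * R)%type.
Variables (g T : R) (Omega : set 'rV[R]_d) (rs : E -> R) (us : E -> 'rV[R]_d).
Local Notation O := (cyl T Omega).
Local Notation A := (ccyl T Omega).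
Hypotheses (oO : open Omega) (T0 : 0 < T) (g1 : 1 < g).
Hypothesis rsC : forall z, A z -> C1at O A rs z.
Hypothesis usC : forall z, A z -> C1at O A us z.
Hypothesis rs0 : forall z, A z -> 0 <= rs z.
Hypothesis mass_eq : forall z, O z ->
  dt rs z + \sum_(j < d) dx j (fun w => rs w * us w ord0 j) z = 0.
Hypothesis momentum_eq : forall z, O z -> forall i : 'I_d,
  dt (fun w => rs w * us w ord0 i) z
  + \sum_(j < d) dx j (fun w => rs w * us w ord0 i * us w ord0 j) z
  + dx i (fun w => rs w `^ g) z = 0.
Hypothesis vac : 2 <= g \/ forall z, A z -> 0 < rs z.
Variable x0 : 'rV[R]_d.
Hypothesis Ox0 : Omega x0.

Let ball_in : exists2 r : R, 0 < r & forall x, sqdist x0 x <= r ^+ 2 -> Omega x.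
Proof.
have /nbhs_ballP[e e0 he] : nbhs x0 Omega by exact: open_nbhs_nbhs.
have e20 : 0 < e / 2 by rewrite divr_gt0.
exists (e / 2) => // x xr; apply: he.
rewrite -ball_normE /= distrC (le_lt_trans (norm_sqdist (ltW e20) xr)) //.
by move: e0; rewrite /=; lra.
Qed.

Let dx_bound {W : normedModType R} (f : E -> W) r : 0 <= r ->
  (forall x, sqdist x0 x <= r ^+ 2 -> Omega x) -> (forall z, A z -> C1at O A f z) ->
  exists2 M : R, 0 <= M & forall z j, O z -> sqdist x0 z.1 <= r ^+ 2 -> `|dx j f z| <= M.
Proof.
move=> r0 bO fC.
have cK : compact ([set x | sqdist x0 x <= r ^+ 2] `*` `[0, T] : set E).
  by apply: compact_setX; [exact: compact_sqball|exact: segment_compact].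
pose Pj (j : 'I_d) (M : R) := forall z, O z -> sqdist x0 z.1 <= r ^+ 2 -> `|dx j f z| <= M.
have [M M0 HM] : exists2 M : R, 0 <= M & forall j, Pj j M.
  apply: finite_large => [j m m' mm' h z Oz zr|j].
    by rewrite (le_trans _ mm') // h.
  have [|M M0 hM] := @C1at_bounded_derive _ _ _ O A _ f (delta_mx ord0 j, 0) cK.
    by move=> [x t] [/= xr tT]; apply: fC; split => //=; exact: bO.
  by exists M => // z Oz zr; apply: hM => //; split => //; case: (cyl_ccyl Oz).
by exists M => // z j; exact: HM.
Qed.

(** In the vacuum the momentum balance says nothing about [us], whose momentum residual
    need not vanish there, although the weak solution may have mass at such points. A
    field with small residuals everywhere is obtained by replacing [us] in the vacuum,
    and the bound [K] of its gradient is uniform so that the energy estimate survives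
    the limit. Away from the vacuum [us] itself serves. *)
Lemma velocity_approximation : exists r T1 K : R, [/\ 0 < r, 0 < T1 < T, 0 <= K,
  (forall x, sqdist x0 x <= r ^+ 2 -> Omega x) &
  forall eps : R, 0 < eps -> exists V : E -> 'rV[R]_d,
  (forall z, A z -> sqdist x0 z.1 <= r ^+ 2 -> z.2 < T1 ->
     C1at O A V z /\ (0 < rs z -> `|V z - us z| <= eps)) /\
  (forall z, O z -> sqdist x0 z.1 <= r ^+ 2 -> z.2 < T1 ->
     [/\ `|V z| <= K, (forall j, `|dx j V z| <= K),
     (forall i, `|accel g rs V z i| <= eps) & `|mass_residual g rs V z| <= eps])].
Proof.
have [r r0 bO] := ball_in.
have cK : compact ([set x | sqdist x0 x <= r ^+ 2] `*` `[0, T] : set E).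
  by apply: compact_setX; [apply: compact_sqball; exact: ltW|exact: segment_compact].
have KA : ([set x | sqdist x0 x <= r ^+ 2] `*` `[0, T] : set E) `<=` A.
  by move=> [x t] [/= xr tT]; split => //=; exact: bO.
have [B B0 hB] := @C1at_bounded _ _ _ O A _ us cK KA (fun z kz => usC (KA z kz)).
have usB z : A z -> sqdist x0 z.1 <= r ^+ 2 -> `|us z| <= B.
  by move=> Az zr; apply: hB; split => //; case: Az.
have [Mu Mu0 usM] := dx_bound (ltW r0) bO usC.
have [g2|rsP] := vac.
  have [Mr Mr0 rsM] := dx_bound (ltW r0) bO rsC.
  have [Mh Mh0 hM] := dx_bound (ltW r0) bO (enthalpy_C1at oO rsC rs0 vac).
  exact: (vacuum_approximation oO T0 g1 g2 rsC usC rs0 mass_eq momentum_eq r0 B0 Mu0 Mr0 Mh0 bO usB usM rsM hM).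
exists r, (T / 2), (B + Mu); split => //.
- by have := T0; lra.
- by rewrite addr_ge0.
move=> eps e0; exists us; split => [z Az _ _|z Oz zr _].
  by split; [exact: usC|rewrite subrr normr0 ltW].
have Az := cyl_ccyl Oz; split.
- by rewrite (le_trans (usB _ Az zr)) // lerDl.
- by move=> j; rewrite (le_trans (usM _ _ Oz zr)) // lerDr.
- move=> i; rewrite (strong_accel oO g1 rsC usC rs0 mass_eq momentum_eq vac i Oz (rsP _ Az)).
  by rewrite normr0 ltW.
- by rewrite (strong_mass_residual oO g1 rsC usC rs0 mass_eq vac Oz) normr0 ltW.
Qed.

End velocity_approximation.

(** * Borel sets and boxes *)

Section borel_sets.
Context {R : realType} {d : nat}.
Local Notation E := ('rV[R]_d * R)%type.
Local Notation mE := ('rV[R]_d * measurableTypeR R)%type.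

Let side (n : nat) (k : int) : set R := `[k%:~R / n.+1%:R, (k + 1)%:~R / n.+1%:R[%classic.

(* Half-open cubes of the grids of mesh 1/(n + 1). There are countably many of them, and
   every point of an open set lies in one that is contained in the set. *)
Let cube (p : nat * ('rV[int]_d * int)) : set mE :=
  [set z | (forall i, side p.1 ((p.2.1 : 'rV[int]_d) ord0 i) ((z.1 : 'rV[R]_d) ord0 i)) /\ side p.1 p.2.2 z.2].

Let measurable_cube p : measurable (cube p).
Proof.
have -> : cube p = (\bigcap_(i in [set: 'I_d]) ((fun z : mE => (z.1 : 'rV[R]_d) ord0 i) @^-1` side p.1 ((p.2.1 : 'rV[int]_d) ord0 i)))
   `&` (snd @^-1` side p.1 p.2.2).
  by apply/seteqP; split=> z [h1 h2]; split => // i; [move=> _; exact: h1|exact: h1].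
apply: measurableI.
  apply: fin_bigcap_measurable => // i _.
  rewrite -[X in measurable X]setTI.
  have mc : measurable_fun [set: mE] (fun z : mE => (z.1 : 'rV[R]_d) ord0 i).
    by apply: (measurableT_comp (measurable_rV_coord i)); exact: measurable_fst.
  by apply: mc => //; exact: measurable_itv.
rewrite -[X in measurable X]setTI.
by apply: (@measurable_snd _ _ 'rV[R]_d (measurableTypeR R)) => //; exact: measurable_itv.
Qed.

Let side_floor n (x : R) : side n (Num.floor (n.+1%:R * x)) x.
Proof.
have /andP[h1 h2] := floor_itv (n.+1%:R * x).
by rewrite /side /= in_itv /= ler_pdivrMr // ltr_pdivlMr // ![x * _]mulrC h1.
Qed.

Let side_dist n k (x y : R) : side n k x -> side n k y -> `|x - y| <= n.+1%:R^-1.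
Proof.
have aux (q w a b : R) : q <= a < q + w -> q <= b < q + w -> `|a - b| <= w.
  by move=> /andP[h1 h2] /andP[h3 h4]; rewrite ler_norml; apply/andP; split; lra.
by rewrite /side /= !in_itv /= intrD mulrDl mul1r; exact: aux.
Qed.

Lemma open_measurable_xt (U : set E) : open U -> measurable (U : set mE).
Proof.
move=> oU.
have -> : (U : set mE) = \bigcup_p (if `[< cube p `<=` U >] then cube p else set0).
  apply/seteqP; split=> [z Uz|z [p _]]; last first.
    by case: asboolP => // h hz; exact: h.
  have /nbhs_ballP[e e0 he] : nbhs z U by exact: open_nbhs_nbhs.
  have [n _ hn] := near_infty_natSinv_lt (PosNum e0).
  have {}hn := hn n (leqnn n).
  pose p := (n, (\row_i Num.floor (n.+1%:R * z.1 ord0 i), Num.floor (n.+1%:R * z.2))).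
  have zp : cube p z by split => [i|]; rewrite ?mxE; exact: side_floor.
  exists p => //; case: asboolP => // -[] w [w1 w2]; apply: he; case: zp => z1 z2.
  have n0 : 0 <= n.+1%:R^-1 :> R by rewrite invr_ge0.
  split; rewrite -ball_normE /=; apply: (le_lt_trans _ hn).
    apply: row_norm_le => // i; rewrite !mxE.
    exact: (side_dist (z1 i) (w1 i)).
  exact: side_dist z2 w2.
apply: countable_bigcupT_measurable; first exact: countableP.
by move=> p; case: asboolP => _ //; exact: measurable_cube.
Qed.

Lemma open_measurable_x (U : set 'rV[R]_d) : open U -> measurable U.
Proof.
move=> oU; have mU : measurable (U `*` setT : set mE).
  apply: open_measurable_xt; rewrite (_ : _ `*` _ = (fst : E -> 'rV[R]_d) @^-1` U).
    by apply: open_comp => // z _; apply: differentiable_continuous; exact: differentiable_fst.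
  by apply/seteqP; split => z; rewrite /= => h; [case: h|].
have := measurable_ysection (0 : R) mU.
suff -> : ysection (U `*` setT : set mE) (0 : R) = U by [].
by apply/seteqP; split => x; rewrite /ysection /= inE /=; [case|].
Qed.

Lemma open_continuous_measurable_xt (U : set E) (f : E -> R) : open U ->
  (forall z, U z -> {for z, continuous f}) -> measurable_fun (U : set mE) f.
Proof.
move=> oU cf; apply: (measurability _ (RGenOpens.measurableE R)).
move=> _ [_ [a [b ->] <-]]; apply: open_measurable_xt.
rewrite openE => z [Uz fz]; apply: filterI; first exact: open_nbhs_nbhs.
by apply: cf => //; apply: open_nbhs_nbhs; split => //; exact: interval_open.
Qed.

Lemma open_continuous_measurable_x (U : set 'rV[R]_d) (f : 'rV[R]_d -> R) : open U ->
  (forall z, U z -> {for z, continuous f}) -> measurable_fun U f.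
Proof.
move=> oU cf; apply: (measurability _ (RGenOpens.measurableE R)).
move=> _ [_ [a [b ->] <-]]; apply: open_measurable_x.
rewrite openE => z [Uz fz]; apply: filterI; first exact: open_nbhs_nbhs.
by apply: cf => //; apply: open_nbhs_nbhs; split => //; exact: interval_open.
Qed.

Definition box (b : R) : set 'rV[R]_d := [set x | forall i, `[- b, b]%classic (x ord0 i)].

Lemma measurable_box b : measurable (box b).
Proof.
have -> : box b = \bigcap_(i in [set: 'I_d]) ((fun x : 'rV[R]_d => x ord0 i) @^-1` `[- b, b]).
  by apply/seteqP; split=> z h i; [move=> _; exact: h|exact: h].
apply: fin_bigcap_measurable => // i _.
rewrite -[X in measurable X]setTI.
by apply: measurable_rV_coord => //; exact: measurable_itv.
Qed.

Lemma box_finite b : (lebesgue_rV R d (box b) < +oo)%E.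
Proof.
rewrite (lebesgue_rV_box (A := fun=> `[- b, b]%classic)); last by move=> i; exact: measurable_itv.
rewrite -ge0_fin_numE; last by apply: prode_ge0 => i _.
elim/big_ind: _ => // [x y|i _]; first exact: fin_numM.
by rewrite /= lebesgue_measure_itv /=; case: ifP.
Qed.

Definition box_xt (b : R) : set mE := box b `*` `[- b, b].

Lemma measurable_box_xt b : measurable (box_xt b).
Proof. by apply: measurableX; [exact: measurable_box|exact: measurable_itv]. Qed.

Lemma box_xt_finite b : (lebesgue_xt R d (box_xt b) < +oo)%E.
Proof.
rewrite /lebesgue_xt /box_xt /= product_measure1E; [|exact: measurable_box|exact: measurable_itv].
apply: lte_mul_pinfty => //; last by rewrite /= lebesgue_measure_itv /=; case: ifP; rewrite ltry.
by rewrite ge0_fin_numE //; exact: box_finite.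
Qed.

Lemma norm_box (b : R) (x : 'rV[R]_d) : `|x| <= b -> box b x.
Proof. by move=> xb i; rewrite /= in_itv /= -ler_norml (le_trans (coord_le_norm _ _)). Qed.

Lemma compact_box_xt (K : set E) : compact K -> exists b, K `<=` box_xt b.
Proof.
move=> /compact_bounded[M [_ hM]]; exists (M + 1) => z Kz.
have := hM (M + 1) _ z Kz; rewrite ltrDl ltr01 => /(_ isT).
rewrite /= prod_normE ge_max => /andP[z1 z2]; split; first exact: norm_box.
by rewrite /= in_itv /= -ler_norml.
Qed.

End borel_sets.

Section bounded_support.
Context {R : realType} {dsp : measure_display} {X : measurableType dsp}.
Variable mu : {measure set X -> \bar R}.

Lemma integrable_bounded_support (D B : set X) (f : X -> R) (M : R) :
  measurable D -> measurable B -> (mu B < +oo)%E -> measurable_fun D f -> 0 <= M ->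
  (\forall x \ae mu, D x -> `|f x| <= M * \1_B x) -> mu.-integrable D (EFin \o f).
Proof.
move=> mD mB Bfin mf M0 fM; apply/integrableP; split; first exact/measurable_EFinP.
have m1 : measurable_fun D (fun x => (\1_B x)%:E : \bar R).
  by apply/measurable_EFinP; exact: measurable_funTS.
apply: (@le_lt_trans _ _ (\int[mu]_(x in D) (M%:E * (\1_B x)%:E))%E).
  apply: ae_ge0_le_integral => //.
  - by apply: measurableT_comp => //; exact/measurable_EFinP.
  - by move=> x _; rewrite mule_ge0 ?lee_fin.
  - exact: emeasurable_funM.
rewrite ge0_integralZl //.
rewrite integral_indic //; apply: lte_mul_pinfty => //.
by rewrite (le_lt_trans _ Bfin) // le_measure ?inE //; exact: measurableI.
Qed.

End bounded_support.

(** * Integrals of derivatives of compactly supported functions *)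

Section cons_derivative.
Context {R : realType} {n : nat}.
Implicit Types (f : 'rV[R]_n.+1 -> R) (a : R) (x : 'rV[R]_n).

Let cons_shift0 (h a : R) x : rV_cons (h *: 1 + a, x) = h *: delta_mx ord0 ord0 + rV_cons (a, x).
Proof.
apply/rowP => i; rewrite [RHS]mxE; have [j ->|->] := unliftP ord0 i.
  by rewrite !rV_consS /= 2!mxE /= mulr0 add0r.
by rewrite !rV_cons0 /= 2!mxE.
Qed.

Let cons_shiftS (h a : R) x (j : 'I_n) : rV_cons (a, h *: delta_mx ord0 j + x) =
  h *: delta_mx ord0 (lift ord0 j) + rV_cons (a, x).
Proof.
apply/rowP => i; rewrite [RHS]mxE; have [k ->|->] := unliftP ord0 i.
  by rewrite !rV_consS /= !mxE (inj_eq lift_inj).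
by rewrite !rV_cons0 /= 2!mxE /= mulr0 add0r.
Qed.

Let quotient0 f a x :
  (fun h : R => h^-1 *: (((fun b : R => f (rV_cons (b, x))) \o shift a) (h *: 1) - f (rV_cons (a, x)))) =
  (fun h : R => h^-1 *: ((f \o shift (rV_cons (a, x))) (h *: delta_mx ord0 ord0) - f (rV_cons (a, x)))).
Proof. by apply/funext => h /=; rewrite cons_shift0. Qed.

Let quotientS f a x (j : 'I_n) :
  (fun h : R => h^-1 *: (((fun y : 'rV[R]_n => f (rV_cons (a, y))) \o shift x) (h *: delta_mx ord0 j) - f (rV_cons (a, x)))) =
  (fun h : R => h^-1 *: ((f \o shift (rV_cons (a, x))) (h *: delta_mx ord0 (lift ord0 j)) - f (rV_cons (a, x)))).
Proof. by apply/funext => h /=; rewrite cons_shiftS. Qed.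

Lemma derivable_cons0 f a x : derivable f (rV_cons (a, x)) (delta_mx ord0 ord0) ->
  derivable (fun b : R => f (rV_cons (b, x))) a 1.
Proof. by rewrite /derivable quotient0. Qed.

Lemma derive_cons0 f a x : 'D_1 (fun b : R => f (rV_cons (b, x))) a =
  'D_(delta_mx ord0 ord0) f (rV_cons (a, x)).
Proof. by rewrite /derive quotient0. Qed.

Lemma derivable_consS f a x (j : 'I_n) : derivable f (rV_cons (a, x)) (delta_mx ord0 (lift ord0 j)) ->
  derivable (fun y : 'rV[R]_n => f (rV_cons (a, y))) x (delta_mx ord0 j).
Proof. by rewrite /derivable quotientS. Qed.

Lemma derive_consS f a x (j : 'I_n) : 'D_(delta_mx ord0 j) (fun y : 'rV[R]_n => f (rV_cons (a, y))) x =
  'D_(delta_mx ord0 (lift ord0 j)) f (rV_cons (a, x)).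
Proof. by rewrite /derive quotientS. Qed.

Lemma continuous_cons0 x : continuous (fun a : R => rV_cons (a, x)).
Proof.
apply: continuous_row => i; have [j ->|->] := unliftP ord0 i.
  by under eq_fun do rewrite rV_consS; move=> a; exact: cvg_cst.
by under eq_fun do rewrite rV_cons0 /=; move=> a; exact: cvg_id.
Qed.

Lemma continuous_consS a : continuous (fun x : 'rV[R]_n => rV_cons (a, x)).
Proof.
apply: continuous_row => i; have [j ->|->] := unliftP ord0 i.
  by under eq_fun do rewrite rV_consS /=; exact: coord_continuous.
have -> : (fun w : 'rV[R]_n => rV_cons (a, w) ord0 ord0) = cst a.
  by apply/funext => w; rewrite rV_cons0.
by move=> y; exact: continuous_at_cst.
Qed.

End cons_derivative.

Section divergence_space.
Context {R : realType}.

Lemma integral_rV_cons n (g : 'rV[R]_n.+1 -> R) : measurable_fun setT g ->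
  (lebesgue_measure \x lebesgue_rV R n)%E.-integrable setT
    (EFin \o (g \o @rV_cons R n)) ->
  (\int[lebesgue_rV R n.+1]_x (g x)%:E =
   \int[(lebesgue_measure \x lebesgue_rV R n)]_p (g (rV_cons p))%:E)%E.
Proof.
move=> mg ig; have mg' : measurable_fun setT (EFin \o g) by exact/measurable_EFinP.
have iP := integral_pushforward (@measurable_rV_cons R n) mg' ig measurableT.
rewrite -[RHS]iP; exact: (@eq_measure_integral _ _ _ setT (pushforward _ _) (lebesgue_rV R n.+1) (EFin \o g) (fun A _ _ => erefl)).
Qed.

Lemma cube_bounded n (g : 'rV[R]_n -> R) b : continuous g ->
  (forall x, ~ box b x -> g x = 0) -> exists2 M, 0 <= M & forall x, `|g x| <= M * \1_(box b) x.
Proof.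
move=> cg g0.
have cK : compact (@box R n b).
  by apply: (@rV_compact _ _ (fun=> `[- b, b]%classic)) => i; exact: segment_compact.
have [M [_ hM]] : bounded_set (g @` box b).
  by apply: compact_bounded; apply: continuous_compact => //; exact: continuous_subspaceT.
exists (`|M| + 1) => [|x]; first by rewrite addr_ge0.
have [bx|nbx] := pselect (box b x); last by rewrite g0 // normr0 mulr_ge0 // addr_ge0.
rewrite indicE mem_set // mulr1; apply: hM; first by rewrite (le_lt_trans (ler_norm _)) // ltrDl.
by exists x.
Qed.

Lemma integrable_cube_cons n (g : 'rV[R]_n.+1 -> R) b : continuous g ->
  (forall x, ~ box b x -> g x = 0) ->
  (lebesgue_measure \x lebesgue_rV R n)%E.-integrable setT (EFin \o (g \o @rV_cons R n)).
Proof.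
move=> cg g0; have [M M0 hM] := cube_bounded cg g0.
apply: (integrable_bounded_support (mu := (lebesgue_measure \x lebesgue_rV R n)%E)
  (B := (`[- b, b]%classic `*` box b : set (measurableTypeR R * 'rV[R]_n))) (M := M)) => //.
- by apply: measurableX; [exact: measurable_itv|exact: measurable_box].
- rewrite /= product_measure1E; [|exact: measurable_itv|exact: measurable_box].
  rewrite muleC; apply: lte_mul_pinfty => //; last by rewrite /= lebesgue_measure_itv /=; case: ifP; rewrite ltry.
  by rewrite ge0_fin_numE //; exact: box_finite.
- apply: (@measurableT_comp _ _ _ _ _ _ g); last exact: measurable_rV_cons.
  by apply: open_continuous_measurable_x => [|z _]; [exact: openT|exact: cg].
- apply: aeW => -[a x] _ /=; rewrite (le_trans (hM _)) // ler_wpM2l //.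
  rewrite !indicE; case: (asboolP (box b (rV_cons (a, x)))) => hb; last by rewrite memNset.
  rewrite mem_set // mem_set //=; split => /= [|i].
    by have := hb ord0; rewrite rV_cons0.
  by have := hb (lift ord0 i); rewrite rV_consS.
Qed.

Lemma integral_derive1_eq0 (f : R -> R) (b : R) : 0 < b -> (forall x, derivable f x 1) ->
  continuous ('D_1 f) -> (forall x, b <= `|x| -> f x = 0) ->
  (\int[lebesgue_measure]_x ('D_1 f x)%:E = 0)%E.
Proof.
move=> b0 df cf f0.
have cf0 : continuous f.
  by move=> x; apply: differentiable_continuous; apply/derivable1_diffP.
have bb : - (b + 1) < b + 1 by lra.
have D0 x : b < `|x| -> 'D_1 f x = 0.
  move=> bx; have : \forall y \near x, f y = cst 0 y.
    have : \forall y \near x, b < `|y|.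
      exact: (cvgr_gt `|x| (@norm_continuous _ _ x) _ bx).
    by apply: filterS => y /ltW; exact: f0.
  by move=> h; rewrite (near_eq_derive _ h) derive_cst.
transitivity (\int[lebesgue_measure]_(x in `[(- (b + 1))%R, (b + 1)%R]) ('D_1 f x)%:E)%E.
  rewrite [RHS]integral_mkcond; apply: eq_integral => x _.
  rewrite /patch; case: ifPn => // /negP; rewrite inE /= in_itv /= -ler_norml => h.
  by rewrite D0 // (lt_trans (_ : b < b + 1)) ?ltrDl // ltNge; exact/negP.
rewrite (@continuous_FTC2 _ _ f) //.
- rewrite !f0 ?subee // ?normrN ger0_norm; lra.
- exact: continuous_subspaceT.
- split => [x _||].
  + exact: df.
  + by apply: cvg_at_right_filter; exact: cf0.
  + by apply: cvg_at_left_filter; exact: cf0.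
- by move=> x _; rewrite derive1E.
Qed.

(** By induction on the dimension: Fubini's theorem isolates the variable of
    differentiation or reduces the dimension, and in one variable this is the
    fundamental theorem of calculus. *)
Lemma integral_derive_eq0 n (j : 'I_n) (f : 'rV[R]_n -> R) (b : R) : 0 < b ->
  (forall x, derivable f x (delta_mx ord0 j)) -> continuous ('D_(delta_mx ord0 j) f) ->
  (forall (x : 'rV[R]_n) i, b <= `|x ord0 i| -> f x = 0) ->
  (\int[lebesgue_rV R n]_x ('D_(delta_mx ord0 j) f x)%:E = 0)%E.
Proof.
elim: n j f => [[]//|n IH j f b0 df cf f0].
have D0 x : ~ box b x -> 'D_(delta_mx ord0 j) f x = 0.
  move=> nb; have [i bx] : exists i, b < `|x ord0 i|.
    apply: contrapT => h; apply: nb => i; rewrite /= in_itv /= -ler_norml leNgt.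
    by apply/negP => hi; apply: h; exists i.
  have h : \forall y \near x, f y = cst 0 y.
    have cc : {for x, continuous (fun y : 'rV[R]_n.+1 => `|y ord0 i|)}.
      apply: (@continuous_comp _ _ _ (fun y : 'rV[R]_n.+1 => y ord0 i) (fun a : R => `|a|)).
        exact: coord_continuous.
      exact: norm_continuous.
    have : \forall y \near x, b < `|(y : 'rV[R]_n.+1) ord0 i| by exact: (cvgr_gt `|x ord0 i| cc _ bx).
    by apply: filterS => y /ltW; exact: f0.
  by rewrite (near_eq_derive _ h) derive_cst.
have mD : measurable_fun setT ('D_(delta_mx ord0 j) f).
  by apply: open_continuous_measurable_x => [|z _]; [exact: openT|exact: cf].
have iD := integrable_cube_cons cf D0.
rewrite (integral_rV_cons mD iD).
have [k jE|jE] := unliftP ord0 j.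
  rewrite -(integral12_prod_meas1 iD) /fubini_F /=.
  have inner a : (\int[lebesgue_rV R n]_x ('D_(delta_mx ord0 j) f (rV_cons (a, x)))%:E = 0)%E.
    rewrite -(IH k (fun y => f (rV_cons (a, y))) b0).
    - by apply: eq_integral => x _; rewrite derive_consS jE.
    - by move=> x; apply: derivable_consS; rewrite -jE.
    - rewrite (_ : 'D_(delta_mx ord0 k) _ = fun x => 'D_(delta_mx ord0 j) f (rV_cons (a, x))).
        move=> x; apply: (@continuous_comp _ _ _ (fun y => rV_cons (a, y)) ('D_(delta_mx ord0 j) f)).
          exact: continuous_consS.
        exact: cf.
      by apply/funext => x; rewrite derive_consS -jE.
    - by move=> x i bx; apply: (f0 _ (lift ord0 i)); rewrite rV_consS.
  by rewrite (eq_integral (cst 0%E)) ?integral0 // => a _; exact: inner.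
rewrite -(integral21_prod_meas1 iD) /fubini_G /=.
have inner x : (\int[lebesgue_measure]_a ('D_(delta_mx ord0 j) f (rV_cons (a, x)))%:E = 0)%E.
  rewrite -(@integral_derive1_eq0 (fun a => f (rV_cons (a, x))) b b0).
  - by apply: eq_integral => a _; rewrite derive_cons0 jE.
  - by move=> a; apply: derivable_cons0; rewrite -jE.
  - have -> : 'D_(1 : R) (fun a : R => f (rV_cons (a, x))) = (fun a : R => 'D_(delta_mx ord0 j) f (rV_cons (a, x))).
      by apply/funext => a; rewrite derive_cons0 -jE.
    move=> a; apply: (@continuous_comp _ _ _ (fun b => rV_cons (b, x)) ('D_(delta_mx ord0 j) f)).
      exact: continuous_cons0.
    exact: cf.
  - by move=> a ba; apply: (f0 _ ord0); rewrite rV_cons0.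
by rewrite (eq_integral (cst 0%E)) ?integral0 // => x _; exact: inner.
Qed.

End divergence_space.

(** * The divergence theorem for test functions *)

Section test_functions.
Context {R : realType} {d : nat}.
Local Notation E := ('rV[R]_d * R)%type.
Local Notation mE := ('rV[R]_d * measurableTypeR R)%type.
Local Notation mux := (lebesgue_rV R d).
Local Notation muxt := (lebesgue_xt R d).
Variables (T : R) (Omega : set 'rV[R]_d).
Local Notation O := (cyl T Omega).
Local Notation A := (ccyl T Omega).
Hypotheses (oO : open Omega) (T0 : 0 < T).

Let oc : open O. Proof. exact: open_cyl. Qed.
Let OA : O `<=` A. Proof. exact: cyl_ccyl. Qed.

Lemma C1c_C1at {W : normedModType R} (f : E -> W) z : C1c Omega T f -> A z -> C1at O A f z.
Proof. by move=> [fC _]; exact: (C1_upto_C1at OA fC). Qed.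

Lemma C1at_C1c {W : normedModType R} (f : E -> W) (K : set E) : (forall z, A z -> C1at O A f z) ->
  compact K -> K `<=` A -> (forall z, A z -> ~ K z -> f z = 0) -> C1c Omega T f.
Proof.
move=> fC cK KA fK; split; last by exists K.
by apply: C1at_C1_upto => //; exact: ccyl_closure.
Qed.

Section one_function.
Variables (f : E -> R) (K : set E).
Hypothesis fC : forall z, A z -> C1at O A f z.
Hypotheses (cK : compact K) (KA : K `<=` A) (fK : forall z, A z -> ~ K z -> f z = 0).

Let Kc : closed K. Proof. by apply: compact_closed => //; exact: norm_hausdorff. Qed.

(** The set [K] is closed, so that [f] vanishes near [z]. *)
Lemma test_derive_outside v z : O z -> ~ K z -> 'D_v f z = 0.
Proof.
move=> Oz nK; have h : \forall w \near z, f w = cst 0 w.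
  have nz : nbhs z (O `&` ~` K).
    by apply: open_nbhs_nbhs; split => //; apply: openI => //; rewrite openC.
  by apply: filterS nz => w [Ow nw]; apply: fK => //; exact: OA.
by rewrite (near_eq_derive _ h) derive_cst.
Qed.

Lemma test_bounded : exists2 M : R, 0 <= M & forall z, A z -> `|f z| <= M * \1_K z.
Proof.
have [M M0 hM] := C1at_bounded cK KA (fun z kz => fC (KA kz)).
exists M => // z Az; have [Kz|nK] := pselect (K z).
  by rewrite indicE mem_set // mulr1 hM.
by rewrite fK // normr0 mulr_ge0.
Qed.

Lemma test_derive_bounded v : exists2 M : R, 0 <= M & forall z, O z -> `|'D_v f z| <= M * \1_K z.
Proof.
have [M M0 hM] := C1at_bounded_derive v cK (fun z kz => fC (KA kz)).
exists M => // z Oz; have [Kz|nK] := pselect (K z).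
  by rewrite indicE mem_set // mulr1 hM.
by rewrite test_derive_outside // normr0 mulr_ge0.
Qed.

Lemma test_measurable : measurable_fun (O : set mE) f.
Proof.
apply: open_continuous_measurable_xt => // z Oz.
exact: (differentiable_continuous (C1at_differentiable Oz (fC (OA Oz)))).
Qed.

Lemma test_derive_measurable v : measurable_fun (O : set mE) ('D_v f).
Proof.
apply: open_continuous_measurable_xt => // z Oz.
exact: (C1at_derive_continuous oc Oz (fC (OA Oz))).
Qed.

Variable tau : R.
Hypothesis tauT : 0 < tau < T.
Let Q : set mE := Omega `*` `]0, tau[.

Let QO : Q `<=` O.
Proof.
move=> [x t] [/= xO]; rewrite in_itv /= => /andP[t0 tt]; split => //=.
by rewrite in_itv /= t0 (lt_trans tt) //; case/andP: tauT.
Qed.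

Lemma measurable_cylinder : measurable Q.
Proof. by apply: measurableX; [exact: open_measurable_x|exact: measurable_itv]. Qed.
Local Notation mQ := measurable_cylinder.

Let mOmega : measurable Omega. Proof. exact: open_measurable_x. Qed.

Let box_K : exists2 b : R, 0 < b & forall z, K z -> `|z.1| < b.
Proof.
have [M [_ hM]] := compact_bounded cK.
exists (`|M| + 2) => [|z Kz]; first by rewrite ltr_pwDr.
have := hM (`|M| + 1) _ z Kz; rewrite (le_lt_trans (ler_norm _)) ?ltrDl // => /(_ isT).
by rewrite /= prod_normE ge_max => /andP[h _]; rewrite (le_lt_trans h) // ltrD2l ltr1n.
Qed.

Lemma test_derive_integrable v : muxt.-integrable Q (EFin \o 'D_v f).
Proof.
have [M M0 hM] := test_derive_bounded v; have [b Kb] := compact_box_xt cK.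
apply: (@integrable_bounded_support _ _ _ _ Q (box_xt b) _ M) => //.
- exact: mQ.
- exact: measurable_box_xt.
- exact: box_xt_finite.
- by apply: measurable_funS (test_derive_measurable v) => //; exact: open_measurable_xt.
- apply: aeW => z Qz; rewrite (le_trans (hM _ (QO Qz))) // ler_wpM2l //.
  rewrite !indicE; have [Kz|nK] := pselect (K z); last by rewrite memNset.
  by rewrite mem_set // mem_set //; exact: Kb.
Qed.

(* the integrand of [test_derive_integrable], extended by zero *)
Let ext v : mE -> \bar R := (EFin \o 'D_v f) \_ Q.

Let ext_integrable v : (mux \x @lebesgue_measure R)%E.-integrable setT (ext v).
Proof. by have := test_derive_integrable v; rewrite integrable_mkcond //; exact: mQ. Qed.

Let ext_inE v x t : ext v (x, t) = if (x \in Omega) && (t \in `]0, tau[%R) then ('D_v f (x, t))%:E else 0%E.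
Proof.
rewrite /ext /patch; case: ifPn => [|/negP].
  by rewrite inE => -[/= xO tt]; rewrite mem_set //= tt.
rewrite inE /Q /= => h; case: ifP => // /andP[xO tt]; exfalso; apply: h; split => //=.
by move: xO; rewrite inE.
Qed.

(** Each time slice, extended by zero, is a compactly supported function on the whole
    space. *)
Lemma integral_test_space (j : 'I_d) : (\int[muxt]_(z in Q) (dx j f z)%:E = 0)%E.
Proof.
rewrite integral_mkcond -/(ext _) -(integral21_prod_meas1 (ext_integrable _)) /fubini_G.
rewrite (eq_integral (cst 0%E)) ?integral0 // => t _ /=.
have [tt|nt] := boolP (t \in `]0, tau[%R); last first.
  by rewrite (eq_integral (cst 0%E)) ?integral0 // => x _; rewrite ext_inE (negbTE nt) andbF.
pose ft (x : 'rV[R]_d) := if x \in Omega then f (x, t) else 0.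
have tT : `]0, T[%classic t.
  by move: tt; rewrite /= !in_itv /= => /andP[-> tt]; rewrite (lt_trans tt) //; case/andP: tauT.
have Oxt x : Omega x -> O (x, t) by [].
have near_in x : Omega x -> \forall y \near x, Omega y by move=> xO; exact: open_nbhs_nbhs.
have near_f x : Omega x -> \forall y \near x, f (y, t) = ft y.
  by move=> /near_in; apply: filterS => y yO; rewrite /ft mem_set.
have near_0 x : ~ Omega x -> \forall y \near x, cst 0 y = ft y.
  move=> nx; have nK : nbhs x ((fun y => (y, t) : E) @^-1` ~` K).
    apply: open_nbhs_nbhs; split => [|/KA[]//].
    apply: open_comp; last by rewrite openC.
    by move=> y _; exact: continuous_at_time.
  apply: filterS nK => y nK; rewrite /ft; case: ifPn => //; rewrite inE => yO.
  by rewrite fK //; exact: OA.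
have dfx x : Omega x -> differentiable f (x, t).
  by move=> xO; exact: (C1at_differentiable (Oxt _ xO) (fC (OA (Oxt _ xO)))).
have dft x : differentiable ft x.
  have [xO|nx] := pselect (Omega x).
    apply: near_eq_differentiable (near_f _ xO) _; apply: differentiable_slice; exact: dfx.
  by apply: near_eq_differentiable (near_0 _ nx) _.
have D_in x : Omega x -> 'D_(delta_mx ord0 j) ft x = dx j f (x, t).
  move=> xO; have <- := near_eq_derive (delta_mx ord0 j) (near_f _ xO).
  by rewrite derive_slice //; exact: dfx.
have D_out x : ~ Omega x -> 'D_(delta_mx ord0 j) ft x = 0.
  by move=> nx; have <- := near_eq_derive (delta_mx ord0 j) (near_0 _ nx); rewrite derive_cst.
have [b b0 Kb] := box_K.
rewrite -(@integral_derive_eq0 _ _ j ft b b0).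
- apply: eq_integral => x _; rewrite ext_inE tt andbT; case: ifPn => [|/negP]; rewrite inE.
    by move=> /D_in ->.
  by move=> /D_out ->.
- by move=> x; exact: diff_derivable.
- move=> x; have [xO|nx] := pselect (Omega x).
    have cD : {for x, continuous (fun y => dx j f (y, t))}.
      apply: (@continuous_comp _ _ _ (fun y : 'rV[R]_d => (y, t) : E) (dx j f)).
        exact: continuous_at_time.
      exact: (C1at_derive_continuous oc (Oxt _ xO) (fC (OA (Oxt _ xO)))).
    apply: continuous_at_eq cD; apply: filterS (near_in _ xO) => y yO; by rewrite D_in.
  apply: (continuous_at_eq (f := cst 0)); last exact: continuous_at_cst.
  have /near_join := near_0 _ nx; apply: filterS => y hy.
  by have <- := near_eq_derive (delta_mx ord0 j) hy; rewrite derive_cst.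
- move=> x i bx; rewrite /ft; case: ifPn => //; rewrite inE => xO; apply: fK; first exact/OA/Oxt.
  move=> /Kb /=; rewrite ltNge => /negP; apply.
  by rewrite (le_trans bx) // coord_le_norm.
Qed.

Let time_integral x : Omega x ->
  (\int[lebesgue_measure]_(t in `]0%R, tau[) (dt f (x, t))%:E = (f (x, tau) - f (x, 0%R))%:E)%E.
Proof.
have /andP[t0 tT] := tauT.
move=> xO; have AO : A `<=` closure O by exact: ccyl_closure.
have [cf df /(_ (0, 1)) [g [cg gE]]] := C1at_C1_extension oc OA AO fC.
have slice (h : E -> R) t : {within A, continuous h} -> 0 <= t <= T ->
    (fun s => h (x, s)) @ within `[0, T] (nbhs t) --> h (x, t).
  move=> /subspace_continuousP ch tt; have Axt : A (x, t) by split => //=; rewrite in_itv.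
  move=> U /(ch _ Axt); rewrite /within /= => -[[U1 U2] /= [nU1 nU2] HU].
  by apply: filterS nU2 => s U2s sT; apply: (HU (x, s)); split => //=; exact: nbhs_singleton.
have sub : `[0, tau]%classic `<=` `[0, T]%classic.
  by move=> s /=; rewrite !in_itv /= => /andP[-> h]; rewrite (le_trans h) // ltW.
have slice' (h : E -> R) t : {within A, continuous h} -> 0 <= t <= tau ->
    (fun s => h (x, s)) @ within `[0, tau] (nbhs t) --> h (x, t).
  move=> ch /andP[h1 h2]; have tt : 0 <= t <= T by rewrite h1 (le_trans h2) // ltW.
  by apply: cvg_trans (slice _ _ ch tt); apply: cvg_app; exact: within_subset.
have Oxt t : 0 < t < tau -> O (x, t).
  by move=> /andP[h1 h2]; split => //=; rewrite in_itv /= h1 (lt_trans h2).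
have quotient t : (fun h : R => h^-1 *: (((fun s => f (x, s)) \o shift t) (h *: 1) - f (x, t))) =
    (fun h : R => h^-1 *: ((f \o shift (x, t)) (h *: (0, 1)) - f (x, t))).
  apply/funext => h; transitivity (h^-1 *: (f (h *: 0 + x, h *: 1 + t) - f (x, t))); last by [].
  by rewrite scaler0 add0r.
have dtx t : O (x, t) -> derivable (fun s => f (x, s)) t 1 /\ 'D_1 (fun s => f (x, s)) t = dt f (x, t).
  move=> Ot; split; last by rewrite /dt /derive quotient.
  by rewrite /derivable quotient; exact: (diff_derivable (df _ Ot)).
have wc (h : E -> R) : {within A, continuous h} -> {within `[0, tau], continuous (fun t => h (x, t))}.
  by move=> ch; apply/subspace_continuousP => t /=; rewrite in_itv => tt; exact: slice'.
transitivity (\int[lebesgue_measure]_(t in `]0%R, tau[) (g (x, t))%:E)%E.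
  by apply: eq_integral => t; rewrite inE /= in_itv /= => tt; rewrite gE //; exact: Oxt.
rewrite -(@integral_itv_bndoo _ 0 tau (fun t => (g (x, t))%:E) true false); last first.
  apply/measurable_EFinP; apply: (@measurable_funS _ _ _ _ `[0, tau]%classic).
  - exact: measurable_itv.
  - exact: subset_itv_oo_cc.
  - by apply: subspace_continuous_measurable_fun; [exact: measurable_itv|exact: wc].
rewrite (@continuous_FTC2 _ (fun t => g (x, t)) (fun t => f (x, t))) //.
- exact: wc.
- have /(continuous_within_itvP _ t0)[_ c1 c2] := wc _ cf.
  by split => // t; rewrite in_itv /= => tt; have [] := dtx t (Oxt _ tt).
- move=> t; rewrite in_itv /= => tt; rewrite derive1E.
  by have [_ ->] := dtx t (Oxt _ tt); rewrite gE //; exact: Oxt.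
Qed.

Let time_ext : fubini_F lebesgue_measure (ext (0, 1)) =
  (fun x => (f (x, tau) - f (x, 0))%:E) \_ Omega.
Proof.
apply/funext => x; rewrite /fubini_F /patch; case: ifPn => [|/negP]; rewrite inE => xO.
  rewrite -time_integral // [RHS]integral_mkcond; apply: eq_integral => t _.
  by rewrite ext_inE mem_set //= /patch mem_setE.
rewrite (eq_integral (cst 0%E)) ?integral0 // => t _.
by rewrite ext_inE memNset.
Qed.

(** The fundamental theorem of calculus on [0, tau] for every fixed point of space. *)
Lemma integral_test_time : (\int[muxt]_(z in Q) (dt f z)%:E =
  \int[mux]_(x in Omega) (f (x, tau) - f (x, 0%R))%:E)%E.
Proof.
rewrite integral_mkcond -/(ext _) -(integral12_prod_meas1 (ext_integrable _)) time_ext.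
by rewrite -integral_mkcond.
Qed.

Lemma test_slice_integrable :
  mux.-integrable Omega (EFin \o (fun x => f (x, 0) - f (x, tau))).
Proof.
have := integrable_fubini_F (ext_integrable (0, 1)); rewrite time_ext -integrable_mkcond //.
move=> /integrableN; apply: eq_integrable => // x _.
by rewrite /= -(opprB (f (x, tau))) EFinN.
Qed.

End one_function.

(** The divergence theorem on the cylinder; there is no flux through its lateral
    boundary. *)
Lemma test_balance (F : E -> R) (G : 'I_d -> E -> R) tau : 0 < tau < T ->
  C1c Omega T F -> (forall j, C1c Omega T (G j)) ->
  let Q : set mE := (Omega `*` `]0, tau[) in
  let I z := dt F z + \sum_(j < d) dx j (G j) z in
  let D x := F (x, 0) - F (x, tau) in
  [/\ muxt.-integrable Q (EFin \o I), mux.-integrable Omega (EFin \o D) &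
      \int[muxt]_(z in Q) I z + \int[mux]_(x in Omega) D x = 0].
Proof.
move=> tT cF cG Q I D; have mQ : measurable Q by exact: measurable_cylinder.
have mO : measurable Omega by exact: open_measurable_x.
have FC z := C1c_C1at (z := z) cF; have [_ [K [cK KA FK]]] := cF.
have iF : muxt.-integrable Q (EFin \o dt F) by exact: (test_derive_integrable FC cK).
have iG j : muxt.-integrable Q (EFin \o dx j (G j)).
  by have [_ [Kj [cKj KjA GK]]] := cG j; exact: (test_derive_integrable (fun z => C1c_C1at (z := z) (cG j)) cKj).
have iS : muxt.-integrable Q (fun z => (\sum_(j < d) (dx j (G j) z)%:E)%E).
  by apply: integrable_sum => // j _; exact: iG.
have sE z : ((dt F z + \sum_(j < d) dx j (G j) z)%:E = (dt F z)%:E + \sum_(j < d) (dx j (G j) z)%:E)%E.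
  by rewrite EFinD sumEFin.
split.
- have := integrableD mQ iF iS; apply: eq_integrable => // z _.
  by rewrite /= sE.
- exact: (test_slice_integrable FC cK).
have iD : mux.-integrable Omega (EFin \o D) by exact: (test_slice_integrable FC cK).
have eI : (\int[muxt]_(z in Q) (I z)%:E = \int[mux]_(x in Omega) ((-1)%:E * (D x)%:E))%E.
  transitivity (\int[muxt]_(z in Q) ((dt F z)%:E + \sum_(j < d) (dx j (G j) z)%:E))%E.
    by apply: eq_integral => z _; rewrite /I sE.
  rewrite integralD // integral_sum // (integral_test_time FC cK) // big1 ?adde0; last first.
    move=> j _; have [_ [Kj [cKj KjA GK]]] := cG j.
    exact: (integral_test_space (fun z => C1c_C1at (z := z) (cG j)) cKj).
  by apply: eq_integral => x _; rewrite -EFinM mulN1r /D opprB.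
rewrite /Rintegral eI integralZl // fineM //; last exact: integrable_fin_num.
by rewrite /= mulN1r addNr.
Qed.

End test_functions.

(** * The energy argument for general test functions *)

Section almost_everywhere.
Context {R : realType} {dsp : measure_display} {X : measurableType dsp}.
Variable mu : {measure set X -> \bar R}.

Lemma ae_imply (P S : X -> Prop) : (forall x, P x -> S x) ->
  (\forall x \ae mu, P x) -> \forall x \ae mu, S x.
Proof. by move=> PS; apply: filterS. Qed.

Lemma ae_imply2 (P1 P2 S : X -> Prop) : (forall x, P1 x -> P2 x -> S x) ->
  (\forall x \ae mu, P1 x) -> (\forall x \ae mu, P2 x) -> \forall x \ae mu, S x.
Proof. by move=> PS; apply: filterS2. Qed.

Lemma ae_le_integral (D : set X) (f g : X -> \bar R) : measurable D ->
  mu.-integrable D f -> mu.-integrable D g ->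
  (\forall x \ae mu, D x -> (f x <= g x)%E) ->
  (\int[mu]_(x in D) f x <= \int[mu]_(x in D) g x)%E.
Proof.
move=> mD fi gi [N [mN N0 hN]].
rewrite (negligible_integral mN mD fi N0) (negligible_integral mN mD gi N0).
have mDN : measurable (D `\` N) by exact: measurableD.
have fi' : mu.-integrable (D `\` N) f by apply: integrableS fi => // x [].
have gi' : mu.-integrable (D `\` N) g by apply: integrableS gi => // x [].
apply: le_integral => // x; rewrite inE => -[Dx nx]; apply: contrapT => h; apply: nx; apply: hN.
by move=> /(_ Dx).
Qed.

Lemma ae_le_Rintegral (D : set X) (f g : X -> R) : measurable D ->
  mu.-integrable D (EFin \o f) -> mu.-integrable D (EFin \o g) ->
  (\forall x \ae mu, D x -> f x <= g x) ->
  \int[mu]_(x in D) f x <= \int[mu]_(x in D) g x.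
Proof.
move=> mD fi gi fg; apply: fine_le; [exact: integrable_fin_num|exact: integrable_fin_num|].
exact: ae_le_integral.
Qed.

Lemma integrable_scale (D : set X) (c : R) (f : X -> R) : measurable D ->
  mu.-integrable D (EFin \o f) -> mu.-integrable D (EFin \o (fun x => c * f x)).
Proof. by move=> mD fi; have := integrableZl mD c fi; apply: eq_integrable. Qed.

Lemma integrable_add (D : set X) (f g : X -> R) : measurable D ->
  mu.-integrable D (EFin \o f) -> mu.-integrable D (EFin \o g) ->
  mu.-integrable D (EFin \o (fun x => f x + g x)).
Proof. by move=> mD fi gi; have := integrableD mD fi gi; apply: eq_integrable. Qed.

Lemma integrable_sub (D : set X) (f g : X -> R) : measurable D ->
  mu.-integrable D (EFin \o f) -> mu.-integrable D (EFin \o g) ->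
  mu.-integrable D (EFin \o (fun x => f x - g x)).
Proof. by move=> mD fi gi; have := integrableB mD fi gi; apply: eq_integrable. Qed.

End almost_everywhere.

Lemma integrable_section {R : realType} d1 d2 (X1 : measurableType d1) (X2 : measurableType d2)
    (m1 : {sigma_finite_measure set X1 -> \bar R}) (m2 : {sigma_finite_measure set X2 -> \bar R})
    (f : X1 * X2 -> \bar R) : (m1 \x m2)%E.-integrable setT f ->
  m2.-integrable setT (fubini_G m1 f).
Proof.
move=> fi; have mf := measurable_int _ fi; apply/integrableP; split.
  exact: (measurable_fubini_G fi).
apply: (@le_lt_trans _ _ (\int[m2]_y \int[m1]_x `|f (x, y)|)%E); last exact: ((@integrable21ltyP _ _ _ _ _ m1 m2 f mf).1 fi).
apply: ge0_le_integral => //.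
- by apply: measurableT_comp => //; exact: (measurable_fubini_G fi).
- by apply: (measurable_fun_fubini_tonelli_G (abse \o f)) => //=; exact: measurableT_comp.
- move=> x _; apply: le_abse_integral => //.
  by apply: measurableT_comp mf _; exact: measurable_pair2.
Qed.

Lemma balance_arithmetic {R : realType} (i1 i2 i3 i4 j1 j2 j3 j3' j4 : R) :
  i1 + j1 = 0 -> i2 + j2 = 0 -> j3 <= j3' + i3 -> i4 + j4 = 0 ->
  j3 - j3' + j2 - j1 - j4 <= i3 - i2 + i1 + i4.
Proof. by lra. Qed.

Section energy_argument.
Context {R : realType} {d : nat}.
Local Notation E := ('rV[R]_d * R)%type.
Local Notation mE := ('rV[R]_d * measurableTypeR R)%type.
Local Notation mux := (lebesgue_rV R d).
Local Notation muxt := (lebesgue_xt R d).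
Variables (g T : R) (Omega : set 'rV[R]_d) (rho : E -> R) (u : E -> 'rV[R]_d).
Variables (rho0 : 'rV[R]_d -> R) (u0 : 'rV[R]_d -> 'rV[R]_d).
Local Notation O := (cyl T Omega).
Local Notation A := (ccyl T Omega).
Hypotheses (oO : open Omega) (T0 : 0 < T) (g1 : 1 < g).
Hypotheses (mrho : measurable_fun (A : set mE) rho) (mu_ : measurable_fun (A : set mE) u).
Variables (rmax v : R).
Hypothesis bounds : \forall z \ae muxt, O z -> 0 <= rho z <= rmax /\ `|u z| <= v.
Hypothesis weak : \forall tau \ae @lebesgue_measure R, 0 < tau < T ->
  (forall psi : E -> R, C1c Omega T psi -> mass_balance Omega tau rho u rho0 psi) /\
  (forall eta : E -> 'rV[R]_d, C1c Omega T eta ->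
     momentum_balance g Omega tau rho u rho0 u0 eta).
Hypothesis energy : \forall tau \ae @lebesgue_measure R, 0 < tau < T ->
  forall chi : E -> R, C1c Omega T chi -> (forall z, A z -> 0 <= chi z) ->
    energy_inequality g Omega tau rho u rho0 u0 chi.

Variable K : set E.
Hypotheses (cK : compact K) (KA : K `<=` A).
(** The class [C1c] pointwise and with a support that all test functions share. *)
Definition test_on {W : normedModType R} (f : E -> W) :=
  (forall z, A z -> C1at O A f z) /\ (forall z, A z -> ~ K z -> f z = 0).

Variables (chi psi pi : E -> R) (eta : E -> 'rV[R]_d) (G : 'I_d -> E -> R).
Hypotheses (chiC : test_on chi) (psiC : test_on psi) (piC : test_on pi) (etaC : test_on eta).
Hypothesis GC : forall j, test_on (G j).
Hypothesis chi0 : forall z, A z -> 0 <= chi z.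

Let rel (s : R) (w : 'rV[R]_d) (z : E) : R :=
  2^-1 * chi z * s * dotv w w + (g - 1)^-1 * chi z * s `^ g
  - dotv (eta z) (s *: w) + psi z * s + pi z.
(** The integrand at a time tau when the energy inequality, the two balances and the
    divergence theorem are added with these test functions. For the tests of the
    relative energy method it is [chi] times the relative energy, see [rel_energyE]. *)
Definition rel_energy (z : E) : R := rel (rho z) (u z) z.
Local Notation e := rel_energy.
Definition rel_energy0 (x : 'rV[R]_d) : R := rel (rho0 x) (u0 x) (x, 0).
Local Notation e0 := rel_energy0.

Let Fen z := dt chi z * (rho z * dotv (u z) (u z) / 2 + rho z `^ g / (g - 1))
    + (rho z * dotv (u z) (u z) / 2 + g / (g - 1) * rho z `^ g)
      * \sum_(j < d) dx j chi z * u z ord0 j.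
Let Fmom z := dotv (dt eta z) (rho z *: u z)
    + \sum_(i < d) \sum_(j < d)
        dx j eta z ord0 i * (rho z * u z ord0 i * u z ord0 j)
    + rho z `^ g * \sum_(i < d) dx i eta z ord0 i.
Let Fmass z := dt psi z * rho z + \sum_(j < d) dx j psi z * (rho z * u z ord0 j).
Let Fpi z := dt pi z + \sum_(j < d) dx j (G j) z.

(** The space-time integrand that belongs to [rel_energy]. The divergence theorem for
    [pi] and [G] contributes the terms that do not involve the weak solution. *)
Definition rel_rate (z : E) : R := Fen z - Fmom z + Fmass z + Fpi z.
Local Notation I := rel_rate.

Variables (C a T' : R).
Hypotheses (C0 : 0 <= C) (a0 : 0 <= a) (T'T : 0 < T' < T) (CT : C * T' <= 2^-1).
Hypothesis e_ge0 : \forall z \ae muxt, O z -> 0 <= e z.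
Hypothesis rate_le : \forall z \ae muxt, O z -> I z <= C * e z + a * chi z.
Hypothesis e0_le : forall x, Omega x -> e0 x <= a * chi (x, 0).

Let oc : open O. Proof. exact: open_cyl. Qed.
Let OA : O `<=` A. Proof. exact: cyl_ccyl. Qed.
Let mO : measurable Omega. Proof. exact: open_measurable_x. Qed.
Let mA : measurable (A : set mE).
Proof. by apply: measurableX => //; exact: measurable_itv. Qed.
Let mOc : measurable (O : set mE). Proof. exact: open_measurable_xt. Qed.

Let test_C1c {W : normedModType R} (f : E -> W) : test_on f -> C1c Omega T f.
Proof. by move=> [fC fK]; exact: (C1at_C1c oO T0 fC cK KA fK). Qed.

Let Q (tau : R) : set mE := Omega `*` `]0, tau[.
Let mQ tau : measurable (Q tau). Proof. exact: measurable_cylinder. Qed.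
Let QO tau : tau <= T -> Q tau `<=` O.
Proof.
move=> tT [x t] [/= xO]; rewrite in_itv /= => /andP[t0 tt]; split => //=.
by rewrite in_itv /= t0 (lt_le_trans tt).
Qed.

Let balance tau : 0 < tau < T ->
  (forall psi : E -> R, C1c Omega T psi -> mass_balance Omega tau rho u rho0 psi) /\
  (forall eta : E -> 'rV[R]_d, C1c Omega T eta ->
     momentum_balance g Omega tau rho u rho0 u0 eta) ->
  (forall chi : E -> R, C1c Omega T chi -> (forall z, A z -> 0 <= chi z) ->
    energy_inequality g Omega tau rho u rho0 u0 chi) ->
  [/\ muxt.-integrable (Q tau) (EFin \o I),
      mux.-integrable Omega (EFin \o (fun x => e (x, tau) - e0 x)) &
      \int[mux]_(x in Omega) (e (x, tau) - e0 x) <= \int[muxt]_(z in Q tau) I z].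
Proof.
move=> tT [hmass hmom] hen.
have [i1 j1 b1] := hmass psi (test_C1c psiC).
have [i2 j2 b2] := hmom eta (test_C1c etaC).
have [j3 j3' i3 b3] := hen chi (test_C1c chiC) chi0.
have [i4 j4 b4] := test_balance oO T0 tT (test_C1c piC) (fun j => test_C1c (GC j)).
set P3 := (fun x => _) in j3 b3; set P3' := (fun x => _) in j3' b3.
set P1 := (fun x => _) in j1 b1; set P2 := (fun x => _) in j2 b2; set P4 := (fun x => _) in j4 b4.
have mt := mQ tau.
have k1 : muxt.-integrable (Q tau) (EFin \o (fun z => Fen z - Fmom z)) by exact: integrable_sub.
have k2 : muxt.-integrable (Q tau) (EFin \o (fun z => Fen z - Fmom z + Fmass z)) by exact: integrable_add.
have k3 : muxt.-integrable (Q tau) (EFin \o I) by exact: integrable_add.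
have l1 : mux.-integrable Omega (EFin \o (fun x => P3 x - P3' x)) by exact: integrable_sub.
have l2 : mux.-integrable Omega (EFin \o (fun x => P3 x - P3' x + P2 x)) by exact: integrable_add.
have l3 : mux.-integrable Omega (EFin \o (fun x => P3 x - P3' x + P2 x - P1 x)) by exact: integrable_sub.
have l4 : mux.-integrable Omega (EFin \o (fun x => P3 x - P3' x + P2 x - P1 x - P4 x)) by exact: integrable_sub.
have DE : (fun x => e (x, tau) - e0 x) = (fun x => P3 x - P3' x + P2 x - P1 x - P4 x).
  apply/funext => x; rewrite /rel_energy /rel_energy0 /rel /P1 /P2 /P3 /P3' /P4.
  move: (dotv _ _) (dotv _ _) (dotv _ _) (dotv _ _) (_ `^ _) (_ `^ _) => *; ring.
split => //; first by rewrite DE.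
rewrite DE.
have -> : \int[mux]_(x in Omega) (P3 x - P3' x + P2 x - P1 x - P4 x) =
  \int[mux]_(x in Omega) P3 x - \int[mux]_(x in Omega) P3' x + \int[mux]_(x in Omega) P2 x
   - \int[mux]_(x in Omega) P1 x - \int[mux]_(x in Omega) P4 x.
  by rewrite RintegralB // RintegralB // RintegralD // RintegralB.
have -> : \int[muxt]_(z in Q tau) I z = \int[muxt]_(z in Q tau) Fen z - \int[muxt]_(z in Q tau) Fmom z
   + \int[muxt]_(z in Q tau) Fmass z + \int[muxt]_(z in Q tau) Fpi z.
  by rewrite RintegralD // RintegralD // RintegralB.
exact: (balance_arithmetic b1 b2 b3 b4).
Qed.

Let measurable_rho : measurable_fun (O : set mE) rho.
Proof. exact: measurable_funS mA (@OA) mrho. Qed.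

Let measurable_u i : measurable_fun (O : set mE) (fun z => u z ord0 i).
Proof.
apply: (@measurableT_comp _ _ _ _ _ _ (fun x : 'rV[R]_d => x ord0 i)); first exact: measurable_rV_coord.
exact: measurable_funS mA (@OA) mu_.
Qed.

Let measurable_uu : measurable_fun (O : set mE) (fun z => dotv (u z) (u z)).
Proof. by apply: measurable_sum => i; apply: measurable_funM; exact: measurable_u. Qed.

Let measurable_test (f : E -> R) : test_on f -> measurable_fun (O : set mE) f.
Proof. by move=> [fC _]; exact: test_measurable. Qed.

Let measurable_eta_u : measurable_fun (O : set mE) (fun z => dotv (eta z) (rho z *: u z)).
Proof.
apply: measurable_sum => i; apply: measurable_funM.
  apply: open_continuous_measurable_xt => // z Oz; have Az := OA Oz.
  apply: differentiable_continuous; apply: differentiable_row_coord.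
  exact: (C1at_differentiable Oz (etaC.1 _ Az)).
rewrite (_ : (fun z => _) = (fun z => rho z * u z ord0 i)); last by apply/funext => z; rewrite mxE.
by apply: measurable_funM.
Qed.

Lemma measurable_rel_energy : measurable_fun (O : set mE) e.
Proof.
have mr := measurable_rho; have mc := measurable_test chiC.
apply: measurable_funD; last exact: measurable_test.
apply: measurable_funD; last by apply: measurable_funM => //; exact: measurable_test.
apply: measurable_funB => //; apply: measurable_funD.
  apply: measurable_funM => //; apply: measurable_funM => //; exact: measurable_funM.
apply: measurable_funM; first exact: measurable_funM.
by apply: (@measurableT_comp _ _ _ _ _ _ (fun s : R => s `^ g)) => //; exact: measurable_powR.
Qed.

Let bound_of {W : normedModType R} (f : E -> W) : test_on f ->
  exists2 M : R, 0 <= M & forall z, A z -> `|f z| <= M.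
Proof.
move=> [fC fK]; have [M M0 hM] := C1at_bounded cK KA (fun z kz => fC z (KA kz)).
exists M => // z Az; have [Kz|nK] := pselect (K z); first exact: hM.
by rewrite fK // normr0.
Qed.

(* Only the positive part needs a bound, since the energy is nonnegative. *)
Let e_bounded : exists2 M : R, 0 <= M & \forall z \ae muxt, O z -> `|e z| <= M * \1_K z.
Proof.
have [M1 M10 h1] := bound_of chiC; have [M2 M20 h2] := bound_of psiC.
have [M3 M30 h3] := bound_of piC; have [M4 M40 h4] := bound_of etaC.
pose r : R := `|rmax|; pose w : R := `|v|.
pose N := 2^-1 * M1 * r * (d%:R * w ^+ 2) + (g - 1)^-1 * M1 * r `^ g + d%:R * (M4 * (r * w)) + M2 * r + M3.
have gp : 0 <= (g - 1)^-1 by rewrite invr_ge0 subr_ge0 ltW.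
exists N.
  have r0 : 0 <= r := normr_ge0 _; have w0 : 0 <= w := normr_ge0 _.
  apply: addr_ge0 => //; apply: addr_ge0; last exact: mulr_ge0.
  apply: addr_ge0; last by apply: mulr_ge0 => //; apply: mulr_ge0 => //; exact: mulr_ge0.
  apply: addr_ge0; apply: mulr_ge0; [|by apply: mulr_ge0 => //; exact: exprn_ge0|exact: mulr_ge0|exact: powR_ge0].
  by apply: mulr_ge0 => //; apply: mulr_ge0 => //; rewrite invr_ge0.
apply: ae_imply2 bounds e_ge0 => z hb he Oz; have Az := OA Oz.
have [/andP[r0 rr] uv] := hb Oz; have {}he := he Oz.
have [Kz|nK] := pselect (K z); last first.
  rewrite /rel_energy /rel (chiC.2 _ Az nK) (psiC.2 _ Az nK) (piC.2 _ Az nK) (etaC.2 _ Az nK).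
  have -> : dotv 0 (rho z *: u z) = 0 by apply: big1 => i _; rewrite mxE mul0r.
  by rewrite !(mulr0, mul0r, subr0, addr0) normr0 indicE memNset // mulr0.
rewrite ger0_norm // indicE mem_set // mulr1.
have rr' : rho z <= r by rewrite (le_trans rr) // ler_norm.
have uw : `|u z| <= w by rewrite (le_trans uv) // ler_norm.
have gp2 : 0 <= g by rewrite (le_trans ler01) // ltW.
have cM : chi z <= M1 by rewrite (le_trans (ler_norm _)) // h1.
have c0 := chi0 Az; have uu0 := dotv_ge0 (u z).
have uuw : dotv (u z) (u z) <= d%:R * w ^+ 2.
  rewrite (le_trans (dotv_sq_le _)) // ler_wpM2l // ler_sqr ?nnegrE //; exact: normr_ge0.
have t1 : 2^-1 * chi z * rho z * dotv (u z) (u z) <= 2^-1 * M1 * r * (d%:R * w ^+ 2).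
  by rewrite !ler_pM // ?mulr_ge0 ?invr_ge0.
have t2 : (g - 1)^-1 * chi z * rho z `^ g <= (g - 1)^-1 * M1 * r `^ g.
  apply: ler_pM => //; [by rewrite mulr_ge0|exact: powR_ge0|by rewrite ler_wpM2l|].
  apply: ge0_ler_powR; rewrite ?nnegrE //; exact: normr_ge0.
have t3 : - dotv (eta z) (rho z *: u z) <= d%:R * (M4 * (r * w)).
  rewrite (le_trans (ler_norm _)) // normrN (le_trans (dotv_le _ _)) // ler_wpM2l //.
  by rewrite ler_pM // ?h4 // normrZ ger0_norm // ler_pM.
have t4 : psi z * rho z <= M2 * r.
  by rewrite (le_trans (ler_norm _)) // normrM ler_pM // ?h2 // ger0_norm.
have t5 : pi z <= M3 by rewrite (le_trans (ler_norm _)) // h3.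
by rewrite /rel_energy /rel /N !lerD.
Qed.

Lemma rel_energy_integrable tau : tau <= T -> muxt.-integrable (Q tau) (EFin \o e).
Proof.
move=> tT; have [M M0 hM] := e_bounded; have [b Kb] := compact_box_xt cK.
apply: (@integrable_bounded_support _ _ _ _ (Q tau) (box_xt b) _ M) => //.
- exact: measurable_box_xt.
- exact: box_xt_finite.
- exact: (measurable_funS mOc (QO tT) measurable_rel_energy).
- apply: ae_imply hM => z hM Qz; rewrite (le_trans (hM (QO tT Qz))) // ler_wpM2l //.
  rewrite !indicE; have [Kz|nK] := pselect (K z); last by rewrite memNset.
  by rewrite mem_set // mem_set //; exact: Kb.
Qed.

Lemma cutoff_integrable tau : tau <= T -> muxt.-integrable (Q tau) (EFin \o chi).
Proof.
move=> tT; have [M M0 hM] := test_bounded chiC.1 cK KA chiC.2; have [b Kb] := compact_box_xt cK.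
apply: (@integrable_bounded_support _ _ _ _ (Q tau) (box_xt b) _ M) => //.
- exact: measurable_box_xt.
- exact: box_xt_finite.
- exact: (measurable_funS mOc (QO tT) (measurable_test chiC)).
- apply: aeW => z Qz; rewrite (le_trans (hM z (OA (QO tT Qz)))) // ler_wpM2l //.
  rewrite !indicE; have [Kz|nK] := pselect (K z); last by rewrite memNset.
  by rewrite mem_set // mem_set //; exact: Kb.
Qed.

Let chi0_integrable : mux.-integrable Omega (EFin \o (fun x => chi (x, 0))).
Proof.
have [M M0 hM] := test_bounded chiC.1 cK KA chiC.2; have [b Kb] := compact_box_xt cK.
have A0 x : Omega x -> A (x, 0) by move=> xO; split => //=; rewrite in_itv /= lexx ltW.
apply: (@integrable_bounded_support _ _ _ _ Omega (box b) _ M) => //.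
- exact: measurable_box.
- exact: box_finite.
- apply: open_continuous_measurable_x => // x xO.
  have [cc _ _] := chiC.1 _ (A0 _ xO); move=> U /cc; rewrite /within /= => -[[U1 U2] /= [nU1 nU2] HU].
  have nO : nbhs x Omega by exact: open_nbhs_nbhs.
  apply: filterS2 nU1 nO => y U1y Oy; apply: (HU (y, 0)); last exact: A0.
  by split => //=; exact: nbhs_singleton.
- apply: aeW => x xO; rewrite (le_trans (hM _ (A0 _ xO))) // ler_wpM2l //.
  rewrite !indicE; have [Kz|nK] := pselect (K (x, 0)); last by rewrite memNset.
  by rewrite mem_set // mem_set //; have [] := Kb _ Kz.
Qed.

Let T'0 : 0 < T'. Proof. by case/andP: T'T. Qed.
Let T'leT : T' <= T. Proof. by case/andP: T'T => _ /ltW. Qed.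
Let y := \int[muxt]_(z in Q T') e z.
Let X := \int[muxt]_(z in Q T') chi z.
Let X0 := \int[mux]_(x in Omega) chi (x, 0).

Let Q_le tau (f : E -> R) : tau <= T' -> muxt.-integrable (Q T') (EFin \o f) ->
  (\forall z \ae muxt, O z -> 0 <= f z) ->
  \int[muxt]_(z in Q tau) f z <= \int[muxt]_(z in Q T') f z.
Proof.
move=> tT fi f0; have QQ : Q tau `<=` Q T'.
  by move=> [x t] [/= xO]; rewrite in_itv /= => /andP[t0 tt]; split => //=; rewrite in_itv /= t0 (lt_le_trans tt).
have -> : Q tau = Q T' `&` Q tau by rewrite setIC; apply/esym/setIidl.
rewrite Rintegral_mkcondr; apply: ae_le_Rintegral => //.
  have h : muxt.-integrable (Q tau) (EFin \o f) by apply: integrableS fi.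
  have h' : muxt.-integrable setT (EFin \o (f \_ (Q tau))).
    by rewrite -restrict_EFin -integrable_mkcond.
  exact: (integrableS measurableT (mQ _) (@subsetT _ _) h').
apply: ae_imply f0 => z fz Qz; rewrite /patch; case: ifPn => // _.
by apply: fz; exact: (QO T'leT).
Qed.

(* The balance at almost every time, with its right-hand side estimated by the integrals
   over the whole time interval. *)
Let slice_bound : \forall tau \ae @lebesgue_measure R, 0 < tau < T' ->
  mux.-integrable Omega (EFin \o (fun x => e (x, tau))) ->
  \int[mux]_(x in Omega) e (x, tau) <= C * y + a * X + a * X0.
Proof.
apply: ae_imply2 weak energy => tau hw he /andP[t0 tT'] ei.
have tT : 0 < tau < T by rewrite t0 (lt_le_trans tT').
have [iI iD le1] := balance tT (hw tT) (he tT).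
have tT2 : tau <= T by case/andP: tT => _ /ltW.
have ie := rel_energy_integrable tT2; have ic := cutoff_integrable tT2.
have le2 : \int[muxt]_(z in Q tau) I z <= C * y + a * X.
  apply: (@le_trans _ _ (\int[muxt]_(z in Q tau) (C * e z + a * chi z))).
    apply: ae_le_Rintegral => //; first by apply: integrable_add => //; exact: integrable_scale.
    by apply: ae_imply rate_le => z hz /(QO tT2); exact: hz.
  rewrite RintegralD //; [|exact: integrable_scale|exact: integrable_scale].
  rewrite !RintegralZl // lerD // ler_wpM2l //.
    by apply: Q_le => //; [exact: ltW|exact: rel_energy_integrable].
  apply: Q_le => //; [exact: ltW|exact: cutoff_integrable|].
  by apply: aeW => z Oz; apply: chi0; exact: OA.
have sc0 := integrable_scale a mO chi0_integrable.
apply: (@le_trans _ _ (\int[mux]_(x in Omega) ((e (x, tau) - e0 x) + a * chi (x, 0)))).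
  apply: le_Rintegral => //; first exact: integrable_add.
  by move=> x xO; rewrite -addrA lerDl addrC subr_ge0 e0_le.
by rewrite RintegralD // RintegralZl ?chi0_integrable // lerD // (le_trans le1).
Qed.

(** Integrating the balance over the time interval gives y <= T' (C y + a X + a X0), and
    [C * T' <= 2^-1] absorbs the first term. Short times make Gronwall's inequality
    unnecessary. *)
Lemma rel_energy_small : y <= 2 * T' * a * (X + X0).
Proof.
pose ext : mE -> \bar R := (EFin \o e) \_ (Q T').
have iext : (mux \x @lebesgue_measure R)%E.-integrable setT ext.
  by have := rel_energy_integrable T'leT; rewrite integrable_mkcond.
have extE x t : ext (x, t) = if (x \in Omega) && (t \in `]0, T'[%R) then (e (x, t))%:E else 0%E.
  rewrite /ext /patch; case: ifPn => [|/negP].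
    by rewrite inE => -[/= xO tt]; rewrite mem_set //= tt.
  rewrite inE /Q /= => h; case: ifP => // /andP[xO tt]; exfalso; apply: h; split => //=.
  by move: xO; rewrite inE.
pose B := C * y + a * X + a * X0.
have yE : (y%:E = \int[@lebesgue_measure R]_t fubini_G mux ext t)%E.
  rewrite (integral21_prod_meas1 iext) /y /Rintegral fineK.
    by rewrite integral_mkcond.
  exact: (integrable_fin_num (mQ T') (rel_energy_integrable T'leT)).
have iG := integrable_section iext.
have mI : measurable (`]0, T'[%classic : set (measurableTypeR R)) by exact: measurable_itv.
pose Gt : measurableTypeR R -> \bar R := (EFin \o cst B) \_ `]0, T'[.
have leI : @lebesgue_measure R `]0, T'[%classic = T'%:E.
  by rewrite lebesgue_measure_itv /= lte_fin T'0 oppr0 adde0.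
have iGt : (@lebesgue_measure R).-integrable setT Gt.
  have : (@lebesgue_measure R).-integrable `]0, T'[ (EFin \o cst B).
    apply: (integrable_bounded_support (B := (`]0, T'[%classic : set (measurableTypeR R))) (M := `|B|)) => //.
    + by have := ltry T'; rewrite -leI.
    + by apply: aeW => t tt; rewrite indicE mem_set // mulr1.
  by rewrite integrable_mkcond.
have yB : y <= B * T'.
  have -> : B * T' = fine (\int[@lebesgue_measure R]_t Gt t)%E.
    rewrite -integral_mkcond (_ : EFin \o cst B = cst B%:E) // integral_cst //.
    by move: leI => /= ->.
  rewrite -lee_fin [leRHS]fineK; last exact: (integrable_fin_num measurableT iGt).
  rewrite yE; apply: ae_le_integral => //.
  apply: ae_imply2 slice_bound (ae_integrable2 iext) => t h1 h2 _.
  have [tt|nt] := boolP (t \in `]0, T'[%R); last first.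
    rewrite /fubini_G (eq_integral (cst 0%E)) ?integral0 /Gt /patch.
      by rewrite mem_setE (negbTE nt).
    by move=> x _; rewrite extE (negbTE nt) andbF.
  have extt : (fun x => ext (x, t)) = (EFin \o (fun x => e (x, t))) \_ Omega.
    by apply/funext => x; rewrite extE tt andbT.
  have ie : mux.-integrable Omega (EFin \o (fun x => e (x, t))).
    by rewrite integrable_mkcond // -extt.
  have tt' : 0 < t < T' by move: tt; rewrite in_itv.
  rewrite /fubini_G extt -integral_mkcond /Gt /patch mem_setE tt /=.
  rewrite -[leLHS]fineK; last exact: (integrable_fin_num mO ie).
  by rewrite lee_fin; exact: (h1 tt' ie).
have y0 : 0 <= y.
  have e0' : 0 = \int[muxt]_(z in Q T') (0 * e z).
    by rewrite RintegralZl ?mul0r // rel_energy_integrable.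
  rewrite e0'; apply: ae_le_Rintegral => //; [exact/integrable_scale/rel_energy_integrable|exact: rel_energy_integrable|].
  by apply: ae_imply e_ge0 => z hz /(QO T'leT) /hz; rewrite mul0r.
have c1 := ler_wpM2r y0 CT.
move: yB; rewrite /B => yB.
have -> : 2 * T' * a * (X + X0) = 2 * ((C * y + a * X + a * X0) * T' - C * T' * y) by ring.
by move: yB c1; lra.
Qed.

End energy_argument.

(** * The relative energy identity *)

Section rate_algebra.
Context {R : realType} {d : nat}.
Variables (U V X H Vt : 'I_d -> R) (D : 'I_d -> 'I_d -> R).
Variables (g rho r pr p h ht c ct : R).
Hypotheses (gn : g - 1 != 0) (hr : h * r * (g - 1) = g * p).

Let split2 (F G : 'I_d -> R) (a b : R) :
  \sum_i (a * F i + b * G i) = a * (\sum_i F i) + b * (\sum_i G i).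
Proof. by rewrite !mulr_sumr -big_split. Qed.

Let split3 (F G L : 'I_d -> R) (a b e : R) :
  \sum_i (a * F i + b * G i + e * L i) = a * (\sum_i F i) + b * (\sum_i G i) + e * (\sum_i L i).
Proof. by rewrite !mulr_sumr -!big_split. Qed.

Let split4 (F G L N : 'I_d -> R) (a b e k : R) :
  \sum_i (a * F i + b * G i + e * L i + k * N i) =
  a * (\sum_i F i) + b * (\sum_i G i) + e * (\sum_i L i) + k * (\sum_i N i).
Proof. by rewrite !mulr_sumr -!big_split. Qed.

Let UU := \sum_i U i * U i.
Let UV := \sum_i U i * V i.
Let VV := \sum_i V i * V i.
Let UVt := \sum_i U i * Vt i.
Let VVt := \sum_i V i * Vt i.
Let XU := \sum_i X i * U i.
Let XV := \sum_i X i * V i.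
Let HU := \sum_i H i * U i.
Let HV := \sum_i H i * V i.
Let Dv := \sum_i D i i.
Let UUD := \sum_i \sum_j U i * U j * D i j.
Let VUD := \sum_i \sum_j V i * U j * D i j.
Let UVD := \sum_i \sum_j U i * V j * D i j.
Let VVD := \sum_i \sum_j V i * V j * D i j.

Let E := 2^-1 * rho * (\sum_i (U i - V i) * (U i - V i)) + (pr / (g - 1) - h * rho + p).

(** The algebra behind [rel_rateE] at one point: [U] and [V] are the velocities, [X] and
    [H] the gradients of the cutoff and the enthalpy, [D i j] the derivative of [V i] in
    the direction j, [Vt], [ht] and [ct] time derivatives, [pr] and [p] the pressures.
    Naming the scalar products beforehand reduces it to an identity of polynomials. *)
Lemma rate_algebra :
  (ct * (rho * UU / 2 + pr / (g - 1)) + (rho * UU / 2 + g / (g - 1) * pr) * XU)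
  - (\sum_i (c * Vt i + ct * V i) * (rho * U i)
     + \sum_i \sum_j (c * D i j + X j * V i) * (rho * U i * U j)
     + pr * \sum_i (c * D i i + X i * V i))
  + ((c * (VVt - ht) + ct * (2^-1 * VV - h)) * rho
     + \sum_j (c * ((\sum_i V i * D i j) - H j) + X j * (2^-1 * VV - h)) * (rho * U j))
  + ((c * (r * ht) + ct * p)
     + \sum_j (c * (r * H j) * V j + c * p * D j j + X j * p * V j))
  = ct * E + \sum_j X j * (U j * E + (pr - p) * (U j - V j))
    + c * (rho * (\sum_i (V i - U i) * (Vt i + (\sum_j V j * D i j) + H i))
       - rho * (\sum_i \sum_j (V i - U i) * (V j - U j) * D i j)
       - (g - 1) * (pr / (g - 1) - h * rho + p) * Dv
       - (rho - r) * (ht + HV + (g - 1) * h * Dv)).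
Proof.
have e1 : \sum_i (c * Vt i + ct * V i) * (rho * U i) = (rho * c) * UVt + (rho * ct) * UV.
  by rewrite -split2; apply: eq_bigr => i _; ring.
have e2 : \sum_i \sum_j (c * D i j + X j * V i) * (rho * U i * U j) = (rho * c) * UUD + rho * (UV * XU).
  rewrite /UV /XU big_distrlr /= -split2; apply: eq_bigr => i _; rewrite -split2.
  by apply: eq_bigr => j _; ring.
have e3 : \sum_i (c * D i i + X i * V i) = c * Dv + 1 * XV.
  by rewrite -split2; apply: eq_bigr => i _; ring.
have e4 : \sum_j (c * ((\sum_i V i * D i j) - H j) + X j * (2^-1 * VV - h)) * (rho * U j) =
    (rho * c) * VUD + (- (rho * c)) * HU + (rho * (2^-1 * VV - h)) * XU.
  rewrite /VUD exchange_big /= -split3; apply: eq_bigr => j _.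
  have -> : \sum_i V i * U j * D i j = U j * \sum_i V i * D i j.
    by rewrite mulr_sumr; apply: eq_bigr => i _; ring.
  by move: (\sum_i _) => q; ring.
have e5 : \sum_j (c * (r * H j) * V j + c * p * D j j + X j * p * V j) =
    (c * r) * HV + (c * p) * Dv + p * XV.
  by rewrite -split3; apply: eq_bigr => i _; ring.
have e6 : \sum_i (U i - V i) * (U i - V i) = 1 * UU + (- 2) * UV + 1 * VV.
  by rewrite -split3; apply: eq_bigr => i _; ring.
have e7 F : \sum_j X j * (U j * F + (pr - p) * (U j - V j)) = (F + (pr - p)) * XU + (- (pr - p)) * XV.
  by rewrite -split2; apply: eq_bigr => i _; ring.
have e8 : \sum_i (V i - U i) * (Vt i + (\sum_j V j * D i j) + H i) =
   (1 * VVt + (-1) * UVt) + (1 * VVD + (-1) * UVD) + (1 * HV + (-1) * HU).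
  rewrite -!split2 -!big_split; apply: eq_bigr => i _ /=.
  have -> : \sum_j V i * V j * D i j = V i * \sum_j V j * D i j.
    by rewrite mulr_sumr; apply: eq_bigr => j _; ring.
  have -> : \sum_j U i * V j * D i j = U i * \sum_j V j * D i j.
    by rewrite mulr_sumr; apply: eq_bigr => j _; ring.
  by move: (\sum_j _) => q; ring.
have e9 : \sum_i \sum_j (V i - U i) * (V j - U j) * D i j =
   1 * VVD + (-1) * VUD + 1 * UUD + (-1) * UVD.
  rewrite -split4; apply: eq_bigr => i _; rewrite -split4; apply: eq_bigr => j _; ring.
rewrite /E e1 e2 e3 e4 e5 e6 e7 e8 e9.
have gp : g * p = h * r * (g - 1) by rewrite hr.
apply/eqP; rewrite -subr_eq0; apply/eqP.
rewrite [LHS](_ : _ = c * Dv * (g * p - h * r * (g - 1))); last by field.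
by rewrite gp subrr mulr0.
Qed.

End rate_algebra.

Lemma C1at_constant_derive {R : realType} {E W : normedModType R} (O A : set E) (f : E -> W) z :
  (forall w, differentiable f w) -> (forall v w, 'D_v f w = 'D_v f z) -> C1at O A f z.
Proof.
move=> df Df; split.
- by apply: cvg_within_filter; exact: differentiable_continuous.
- by near=> w.
- move=> v; apply/cvg_ex; exists ('D_v f z); rewrite (_ : 'D_v f = cst ('D_v f z)); last exact/funext/Df.
  exact: cvg_cst.
Unshelve. all: by end_near. Qed.

Section cone.
Context {R : realType} {d : nat}.
Local Notation E := ('rV[R]_d * R)%type.
Variables (x0 : 'rV[R]_d) (r c : R).

(** The zero set bounds a backward cone: the balls on which it is positive shrink with
    time. *)
Definition cone (z : E) : R := r ^+ 2 - sqdist x0 z.1 - c * z.2.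
Definition cone_cutoff (z : E) : R := pos_sq (cone z).

Lemma differentiable_cone z : differentiable cone z.
Proof.
have d1 : differentiable (fun w : E => sqdist x0 w.1) z.
  by apply: (differentiable_comp_fst (f := sqdist x0)); exact: differentiable_sqdist.
have d2 : differentiable (snd : E -> R) z by exact: differentiable_snd.
have -> : cone = (cst (r ^+ 2) - (fun w : E => sqdist x0 w.1)) - c *: (snd : E -> R) by [].
by apply: differentiableB; [exact: differentiableB|exact: differentiableZ].
Qed.

Lemma derive_cone z (v : E) : 'D_v cone z = - (2 * dotv (z.1 - x0) v.1) - c * v.2.
Proof.
have d1 : differentiable (fun w : E => sqdist x0 w.1) z.
  by apply: (differentiable_comp_fst (f := sqdist x0)); exact: differentiable_sqdist.
have d2 : differentiable (snd : E -> R) z by exact: differentiable_snd.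
have -> : cone = (cst (r ^+ 2) - (fun w : E => sqdist x0 w.1)) - c *: (snd : E -> R) by [].
rewrite deriveB; last 2 first.
- by apply: diff_derivable; exact: differentiableB.
- by apply: diff_derivable; exact: differentiableZ.
rewrite deriveB; [|exact: derivable_cst|exact: diff_derivable].
rewrite derive_cst sub0r deriveZ; last exact: diff_derivable.
rewrite derive_snd (derive_comp_fst (f := sqdist x0)); last exact: differentiable_sqdist.
by rewrite derive_sqdist.
Qed.

Lemma differentiable_cutoff z : differentiable cone_cutoff z.
Proof.
apply: (@differentiable_chain _ _ _ _ _ pos_sq z (differentiable_cone z)).
exact/derivable1_diffP/derivable_pos_sq.
Qed.

Lemma derive_cutoff z (v : E) : 'D_v cone_cutoff z =
  2 * Num.max 0 (cone z) * (- (2 * dotv (z.1 - x0) v.1) - c * v.2).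
Proof.
have := @derive_comp R _ pos_sq cone z v (@derivable_pos_sq R (cone z)) (differentiable_cone z).
by rewrite derive1_pos_sq derive_cone.
Qed.

Lemma cutoff_ge0 z : 0 <= cone_cutoff z. Proof. exact: pos_sq_ge0. Qed.

Lemma near_cutoff0 z : cone z < 0 -> \forall w \near z, cone_cutoff w = 0.
Proof.
move=> sz; have cs : {for z, continuous cone} by exact: (differentiable_continuous (differentiable_cone z)).
have : \forall w \near z, cone w < 0 by exact: (cvgr_lt (cone z) cs _ sz).
by apply: filterS => w /ltW; exact: pos_sq_le0.
Qed.

Lemma cutoff_C1at (O A : set E) z : O `<=` A -> C1at O A cone_cutoff z.
Proof.
move=> OA; pose q i (w : E) : R := w.1 ord0 i - x0 ord0 i.
have dfst i w : differentiable (fun w : E => w.1 ord0 i) w.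
  by apply: (@differentiable_row_coord _ _ _ (fst : E -> 'rV[R]_d)); exact: differentiable_fst.
have Dfst i w v : 'D_v (fun w : E => w.1 ord0 i) w = v.1 ord0 i.
  by rewrite (@derive_row_coord _ _ _ (fst : E -> 'rV[R]_d)) ?derive_fst //; exact: differentiable_fst.
have qC i : C1at O A (q i) z.
  have -> : q i = (fun w : E => w.1 ord0 i) + cst (- x0 ord0 i) by [].
  apply: C1atD; last exact: (C1at_cst O A (- x0 ord0 i : R) z).
  by apply: C1at_constant_derive => [w|v w]; [exact: dfst|rewrite !Dfst].
have coneC : C1at O A cone z.
  have -> : cone = (cst (r ^+ 2) - \sum_(i < d) (q i * q i)) + cst (- c) * (snd : E -> R).
    have <- : (fun w : E => sqdist x0 w.1) = \sum_(i < d) (q i * q i).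
      by apply/funext => w; rewrite fct_sumE; apply: eq_bigr => i _; rewrite !mxE.
    by apply/funext => w; rewrite /cone -mulNr.
  apply: C1atD; last first.
    apply: (C1atM OA); first exact: (C1at_cst O A (- c : R) z).
    by apply: C1at_constant_derive => [w|v w]; [exact: differentiable_snd|rewrite !derive_snd].
  apply: C1atD; first exact: (C1at_cst O A (r ^+ 2 : R) z).
  apply: C1atN; elim/big_ind: _ => [|f1 f2 h1 h2|j _]; first exact: (C1at_cst O A (0 : R) z).
    exact: C1atD.
  exact: (C1atM OA).
refine (C1at_comp OA _ _ coneC); first by exists 1 => //= s _; exact: derivable_pos_sq.
exact: continuous_derive1_pos_sq.
Qed.

End cone.

(** * The relative energy in a backward cone *)

Section rate_bounds.
Context {R : realType} {d : nat}.
Implicit Types (y u V : 'rV[R]_d).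

(** The flux of relative energy through the boundary of the cone is beaten by the speed
    [c] at which the cone shrinks. *)
Lemma cone_flux_le (y u V : 'rV[R]_d) (m r c v CF dp Er : R) :
  0 <= m -> 0 <= r -> 0 <= v -> 0 <= CF -> 0 <= Er -> `|y| <= r -> `|u| <= v ->
  `|dp| * `|u - V| <= CF * Er -> 2 * d%:R * r * (v + CF) <= c ->
  2 * m * (- (2 * 0) - c * 1) * Er +
    \sum_(j < d) 2 * m * (- (2 * y ord0 j) - c * 0) *
      (u ord0 j * Er + dp * (u ord0 j - V ord0 j)) <= 0.
Proof.
move=> m0 r0 v0 CF0 Er0 yr uv flux cc.
have -> : \sum_(j < d) 2 * m * (- (2 * y ord0 j) - c * 0) *
      (u ord0 j * Er + dp * (u ord0 j - V ord0 j)) =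
   2 * m * (- 2 * (Er * dotv y u + dp * dotv y (u - V))).
  rewrite /dotv !mulr_sumr -big_split !mulr_sumr; apply: eq_bigr => j _ /=.
  by rewrite !mxE; ring.
have h1 : `|dotv y u| <= d%:R * (r * v).
  by rewrite (le_trans (dotv_le _ _)) // ler_wpM2l // ler_pM.
have h2 : `|dp * dotv y (u - V)| <= d%:R * r * (CF * Er).
  rewrite normrM; apply: (@le_trans _ _ (`|dp| * (d%:R * (r * `|u - V|)))).
    by rewrite ler_wpM2l // (le_trans (dotv_le _ _)) // ler_wpM2l // ler_wpM2r.
  have -> : `|dp| * (d%:R * (r * `|u - V|)) = d%:R * r * (`|dp| * `|u - V|) by ring.
  by rewrite ler_wpM2l // mulr_ge0.
have h3 : `|Er * dotv y u| <= Er * (d%:R * (r * v)) by rewrite normrM ger0_norm // ler_wpM2l.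
rewrite -mulrA -mulrDr; apply: mulr_ge0_le0; first by rewrite mulr_ge0.
have h4 := ler_wpM2r Er0 cc.
move: h2 h3; rewrite !ler_norml => /andP[h2 _] /andP[h3 _].
have -> : (- (2 * 0) - c * 1) * Er = - (c * Er) by ring.
have e5 : 2 * d%:R * r * (v + CF) * Er = 2 * (Er * (d%:R * (r * v))) + 2 * (d%:R * r * (CF * Er)) by ring.
by move: h4; rewrite e5; move: h2 h3; lra.
Qed.

(** The quadratic term and the term with [re] are controlled by the energy and the
    gradient of [V]; the residuals enter linearly, multiplied by bounded quantities
    only, and stay small. *)
Lemma source_le (u V A : 'rV[R]_d) (D : 'I_d -> 'I_d -> R) (s r rmax Kv k eps g Er re S : R) :
  0 <= s <= rmax -> 0 <= r <= rmax -> 0 <= Kv -> 0 <= eps -> 1 <= g -> 0 <= re ->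
  `|u - V| <= k -> (forall i, `|A ord0 i| <= eps) -> (forall i j, `|D i j| <= Kv) -> `|S| <= eps ->
  Er = 2^-1 * s * dotv (u - V) (u - V) + re ->
  s * (\sum_i (V ord0 i - u ord0 i) * A ord0 i)
  - s * (\sum_i \sum_j (V ord0 i - u ord0 i) * (V ord0 j - u ord0 j) * D i j)
  - (g - 1) * re * (\sum_i D i i) - (s - r) * S
  <= (2 * d%:R ^+ 2 * Kv + (g - 1) * (d%:R * Kv)) * Er + eps * (rmax * (d%:R * k + 1)).
Proof.
move=> /andP[s0 sr] /andP[r0 rr] Kv0 eps0 g1 re0 uk Ae DK Se ErE.
have k0 : 0 <= k by apply: le_trans uk.
have rm0 : 0 <= rmax by apply: le_trans sr.
have gp : 0 <= g - 1 by lra.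
have sumd (F : 'I_d -> R) (M : R) : (forall i, `|F i| <= M) -> `|\sum_i F i| <= d%:R * M.
  move=> FM; rewrite (le_trans (ler_norm_sum _ _ _)) //.
  apply: (@le_trans _ _ (\sum_(j < d) M)); last by rewrite sumr_const card_ord mulr_natl.
  exact: ler_sum.
have co i : `|V ord0 i - u ord0 i| <= `|u - V|.
  by rewrite distrC; have := coord_le_norm (u - V) i; rewrite !mxE.
have t1 : `|s * (\sum_i (V ord0 i - u ord0 i) * A ord0 i)| <= eps * (rmax * (d%:R * k)).
  rewrite normrM ger0_norm // (_ : eps * _ = rmax * (d%:R * (k * eps))); last by ring.
  apply: ler_pM => //; apply: sumd => i; rewrite normrM; apply: ler_pM => //.
  exact: le_trans (co i) uk.
have n2 := norm_sq_le_dotv (u - V).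
have t2 : `|s * (\sum_i \sum_j (V ord0 i - u ord0 i) * (V ord0 j - u ord0 j) * D i j)| <=
    2 * d%:R ^+ 2 * Kv * (2^-1 * s * dotv (u - V) (u - V)).
  rewrite normrM ger0_norm //.
  have : `|\sum_i \sum_j (V ord0 i - u ord0 i) * (V ord0 j - u ord0 j) * D i j| <=
     d%:R * (d%:R * (`|u - V| * `|u - V| * Kv)).
    apply: (sumd (fun i => \sum_j _)) => i; apply: (sumd (fun j => _ * _)) => j; rewrite !normrM.
    by rewrite ler_pM // ?mulr_ge0 // ler_pM.
  move=> h; apply: (le_trans (ler_wpM2l s0 h)).
  have -> : s * (d%:R * (d%:R * (`|u - V| * `|u - V| * Kv))) = s * (d%:R ^+ 2 * Kv) * `|u - V| ^+ 2 by ring.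
  have -> : 2 * d%:R ^+ 2 * Kv * (2^-1 * s * dotv (u - V) (u - V)) = s * (d%:R ^+ 2 * Kv) * dotv (u - V) (u - V).
    by field.
  by rewrite ler_wpM2l // mulr_ge0 // mulr_ge0 // exprn_ge0.
have t3 : `|(g - 1) * re * (\sum_i D i i)| <= (g - 1) * (d%:R * Kv) * re.
  rewrite normrM ger0_norm ?mulr_ge0 // (_ : _ * (d%:R * Kv) * re = (g - 1) * re * (d%:R * Kv)); last by ring.
  by rewrite ler_wpM2l ?mulr_ge0 // sumd.
have t4 : `|(s - r) * S| <= eps * rmax.
  rewrite normrM mulrC ler_pM // ler_norml; apply/andP; split; lra.
have t5 : 0 <= 2 * d%:R ^+ 2 * Kv * re by rewrite !mulr_ge0 // exprn_ge0.
have t6 : 0 <= (g - 1) * (d%:R * Kv) * (2^-1 * s * dotv (u - V) (u - V)).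
  by apply: mulr_ge0; [rewrite !mulr_ge0|rewrite !mulr_ge0 ?invr_ge0 // dotv_ge0].
have -> : (2 * d%:R ^+ 2 * Kv + (g - 1) * (d%:R * Kv)) * Er + eps * (rmax * (d%:R * k + 1)) =
  2 * d%:R ^+ 2 * Kv * (2^-1 * s * dotv (u - V) (u - V)) + 2 * d%:R ^+ 2 * Kv * re +
  ((g - 1) * (d%:R * Kv) * (2^-1 * s * dotv (u - V) (u - V)) + (g - 1) * (d%:R * Kv) * re) +
  eps * (rmax * (d%:R * k)) + eps * rmax by rewrite ErE; ring.
move: t1 t2 t3 t4; rewrite !ler_norml => /andP[_ t1] /andP[t2 _] /andP[t3 _] /andP[t4 _].
by move: t1 t2 t3 t4 t5 t6; lra.
Qed.

End rate_bounds.

Section pointwise_rate.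
Context {R : realType} {d : nat}.
Local Notation E := ('rV[R]_d * R)%type.
Variables (g T : R) (Omega : set 'rV[R]_d) (rs rho : E -> R) (V u : E -> 'rV[R]_d).
Variables (x0 : 'rV[R]_d) (r c T1 : R).
Local Notation O := (cyl T Omega).
Local Notation A := (ccyl T Omega).
Hypotheses (oO : open Omega) (T0 : 0 < T) (g1 : 1 < g).
Hypothesis rsC : forall z, A z -> C1at O A rs z.
Hypothesis rs0 : forall z, A z -> 0 <= rs z.
Hypothesis vac : 2 <= g \/ forall z, A z -> 0 < rs z.
Hypotheses (r0 : 0 < r) (c0 : 0 < c) (cT : r ^+ 2 / c < T1) (T1T : T1 < T).
Hypothesis ball_Omega : forall x, sqdist x0 x <= r ^+ 2 -> Omega x.
Let region (z : E) := sqdist x0 z.1 <= r ^+ 2 /\ z.2 < T1.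
Hypothesis VC : forall z, A z -> sqdist x0 z.1 <= r ^+ 2 -> z.2 < T1 -> C1at O A V z.

Local Notation h := (enthalpy g rs).
Local Notation chi := (cone_cutoff x0 r c).
Let s := cone x0 r c.

(** The test functions of the relative energy method: the momentum balance is tested
    with [V], the mass balance with |V|^2/2 - h, and the divergence theorem is applied
    to the pressure rs^g and its flux rs^g V, everything cut off by [chi]. *)
Definition eta_test (z : E) : 'rV[R]_d := chi z *: V z.
Definition psi_test (z : E) : R := chi z * (2^-1 * dotv (V z) (V z) - h z).
Definition pi_test (z : E) : R := chi z * rs z `^ g.
Definition flux_test (j : 'I_d) (z : E) : R := chi z * (rs z `^ g * V z ord0 j).
Definition cone_base : set E := [set x | sqdist x0 x <= r ^+ 2] `*` `[0, r ^+ 2 / c].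

Let oc : open O. Proof. exact: open_cyl. Qed.
Let OA : O `<=` A. Proof. exact: cyl_ccyl. Qed.

Lemma compact_cone_base : compact cone_base.
Proof. by apply: compact_setX; [apply: compact_sqball; exact: ltW|exact: segment_compact]. Qed.

Lemma cone_base_sub : cone_base `<=` A.
Proof.
move=> [x t] [/= xr]; rewrite in_itv /= => /andP[t0 tc]; split => /=; first exact: ball_Omega.
by rewrite in_itv /= t0 (le_trans tc) // ltW // (lt_trans cT).
Qed.

Lemma cone_in_base z : A z -> 0 <= s z -> cone_base z.
Proof.
move=> [_ /=]; rewrite in_itv /= => /andP[t0 _] sz.
have sd := sqdist_ge0 x0 z.1; have ct : 0 <= c * z.2 by rewrite mulr_ge0 // ltW.
move: sz; rewrite /s /cone => sz; split => /=; first by lra.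
by rewrite in_itv /= t0 ler_pdivlMr // mulrC; lra.
Qed.

Let base_region z : cone_base z -> region z.
Proof. by move=> [/= h1]; rewrite in_itv /= => /andP[_ h2]; split => //; exact: le_lt_trans cT. Qed.

Lemma chi_outside z : A z -> ~ cone_base z -> chi z = 0.
Proof.
move=> Az nb; apply: pos_sq_le0; rewrite leNgt; apply/negP => sz; apply: nb.
by apply: cone_in_base => //; exact: ltW.
Qed.

Lemma chi_test : test_on T Omega cone_base chi.
Proof. by split => [z _|z Az]; [exact: cutoff_C1at|exact: chi_outside]. Qed.

Lemma cut_test (f : E -> R) : (forall z, A z -> region z -> C1at O A f z) ->
  test_on T Omega cone_base (fun z => chi z * f z).
Proof.
move=> fC; split => [z Az|z Az nb]; last by rewrite chi_outside // mul0r.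
have [sz|sz] := leP 0 (s z).
  apply: (@C1atM _ _ O A OA chi f); first exact: cutoff_C1at.
  by apply: fC => //; apply: base_region; exact: cone_in_base.
apply: (@C1at_eq _ _ _ O A oc OA (cst 0)) => //; last exact: (C1at_cst O A (0 : R) z).
by apply: filterS (near_cutoff0 sz) => w -> _; rewrite mul0r.
Qed.

Let Vi_C1at z i : A z -> region z -> C1at O A (fun w => V w ord0 i) z.
Proof.
by move=> Az [h1 h2]; exact: (proj1 (C1at_coord V z oc OA) (VC Az h1 h2) i).
Qed.

Lemma eta_is_test : test_on T Omega cone_base eta_test.
Proof.
split => [z Az|z Az nb]; last by rewrite /eta_test chi_outside // scale0r.
apply: (proj2 (C1at_coord eta_test z oc OA)) => i.
have -> : (fun z => eta_test z ord0 i) = (fun z => chi z * V z ord0 i).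
  by apply/funext => w; rewrite mxE.
by apply: (proj1 (cut_test _)) => // w Aw; exact: Vi_C1at.
Qed.

Lemma psi_is_test : test_on T Omega cone_base psi_test.
Proof.
apply: cut_test => z Az rz.
have -> : (fun w => 2^-1 * dotv (V w) (V w) - h w) =
  cst 2^-1 * (\sum_(i < d) ((fun w => V w ord0 i) * (fun w => V w ord0 i))) - h.
  by apply/funext => w; rewrite -[RHS]/(2^-1 * (\sum_(i < d) _) w - h w) fct_sumE.
apply: C1atD; last by apply: C1atN; exact: (enthalpy_C1at oO rsC rs0 vac Az).
apply: (C1atM OA); first exact: (C1at_cst O A (2^-1 : R) z).
elim/big_ind: _ => [|f1 f2 h1 h2|j _]; first exact: (C1at_cst O A (0 : R) z).
  exact: C1atD.
by apply: (C1atM OA); exact: Vi_C1at.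
Qed.

Let pC z : A z -> C1at O A (fun w => rs w `^ g) z.
Proof. by move=> Az; exact: (pressure_C1at oO g1 rsC rs0 Az). Qed.

Lemma pi_is_test : test_on T Omega cone_base pi_test.
Proof. by apply: cut_test => z Az _; exact: pC. Qed.

Lemma flux_is_test j : test_on T Omega cone_base (flux_test j).
Proof.
apply: cut_test => z Az rz.
by apply: (@C1atM _ _ O A OA (fun w => rs w `^ g) (fun w => V w ord0 j)); [exact: pC|exact: Vi_C1at].
Qed.

Let hr z : A z -> h z * rs z * (g - 1) = g * rs z `^ g.
Proof.
move=> Az; have gn : g - 1 != 0 by have := g1; lra.
have -> : rs z `^ g = rs z `^ (g - 1) * rs z.
  have [rz|rz] := eqVneq (rs z) 0; first by rewrite rz mulr0 powR0 //; have := g1; lra.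
  by rewrite -{3}(powRr1 (rs0 Az)) -powRD ?subrK // rz implybT.
by rewrite /enthalpy; field.
Qed.

Let dotv_sub (a b : 'rV[R]_d) : dotv (a - b) (a - b) = dotv a a - 2 * dotv b a + dotv b b.
Proof.
rewrite /dotv -mulNr mulr_sumr -!big_split; apply: eq_bigr => i _ /=.
by rewrite !mxE; ring.
Qed.

(** The terms with [V] complete the square of the velocity difference, and those with
    the enthalpy, which is the slope of the pressure potential at [rs], complete [relP]. *)
Lemma localized_energy_eq (sg : R) (w : 'rV[R]_d) (z : E) :
  2^-1 * chi z * sg * dotv w w + (g - 1)^-1 * chi z * sg `^ g
  - dotv (eta_test z) (sg *: w) + psi_test z * sg + pi_test z =
  chi z * (2^-1 * sg * dotv (w - V z) (w - V z) + relP g sg (rs z)).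
Proof.
have -> : dotv (eta_test z) (sg *: w) = chi z * sg * dotv (V z) w.
  by rewrite /dotv mulr_sumr; apply: eq_bigr => i _; rewrite !mxE; ring.
by rewrite dotv_sub /relP /psi_test /pi_test /enthalpy; field; have := g1; lra.
Qed.

Local Notation e := (rel_energy g rho u chi psi_test pi_test eta_test).
Local Notation I := (rel_rate g rho u chi psi_test pi_test eta_test flux_test).

Lemma rel_energyE z : e z = chi z * (2^-1 * rho z * dotv (u z - V z) (u z - V z) + relP g (rho z) (rs z)).
Proof. exact: localized_energy_eq. Qed.

Lemma relP_diag z : A z -> relP g (rs z) (rs z) = 0.
Proof.
move=> Az; have := hr Az; have gp : 0 < g - 1 by rewrite subr_gt0.
have -> : relP g (rs z) (rs z) = ((g * rs z `^ g) - h z * rs z * (g - 1)) / (g - 1).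
  by rewrite /relP /enthalpy; field; rewrite gt_eqF.
by move=> ->; rewrite subrr mul0r.
Qed.

Lemma rel_energy0E (us : E -> 'rV[R]_d) x : Omega x ->
  rel_energy0 g (fun x => rs (x, 0)) (fun x => us (x, 0)) chi psi_test pi_test eta_test x =
  chi (x, 0) * (2^-1 * rs (x, 0) * dotv (us (x, 0) - V (x, 0)) (us (x, 0) - V (x, 0))).
Proof.
move=> xO; have Ax : A (x, 0) by split => //=; rewrite in_itv /= lexx ltW.
have := relP_diag Ax => h0.
have := @localized_energy_eq (rs (x, 0)) (us (x, 0)) (x, 0); rewrite h0 addr0 => <-.
by [].
Qed.

Section inside_cone.
Variable z : E.
Hypotheses (Oz : O z) (sz : 0 <= s z).
Let Az : A z. Proof. exact: OA. Qed.
Let rz : region z. Proof. by apply: base_region; exact: cone_in_base. Qed.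

Let dV : differentiable V z.
Proof. by case: rz => h1 h2; exact: (C1at_differentiable Oz (VC Az h1 h2)). Qed.
Let dh : differentiable h z.
Proof. exact: (C1at_differentiable Oz (enthalpy_C1at oO rsC rs0 vac Az)). Qed.
Let dp : differentiable (fun w => rs w `^ g) z.
Proof. exact: (C1at_differentiable Oz (pC Az)). Qed.
Let dchi : differentiable chi z. Proof. exact: differentiable_cutoff. Qed.

Let derive_mul (a b : E -> R) w : differentiable a z -> differentiable b z ->
  'D_w (fun y => a y * b y) z = a z * 'D_w b z + 'D_w a z * b z.
Proof.
move=> da db; have -> : (fun y => a y * b y) = a * b by [].
rewrite deriveM; [|exact: diff_derivable|exact: diff_derivable].
by rewrite /GRing.scale /= [X in _ + X]mulrC.
Qed.

Let D_p w : 'D_w (fun y => rs y `^ g) z = rs z * 'D_w h z.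
Proof. exact: (derive_pressure_enthalpy oO g1 rsC rs0 vac). Qed.

Let D_eta w : 'D_w eta_test z = chi z *: 'D_w V z + 'D_w chi z *: V z.
Proof. exact: (derive_scale w dchi dV). Qed.

Let D_psi w : 'D_w psi_test z =
  chi z * ((\sum_i V z ord0 i * 'D_w V z ord0 i) - 'D_w h z) +
  'D_w chi z * (2^-1 * dotv (V z) (V z) - h z).
Proof.
have dVV : differentiable (fun y => dotv (V y) (V y)) z by exact: differentiable_dotv.
have d2 : differentiable (2^-1 *: (fun y => dotv (V y) (V y))) z by exact: differentiableZ.
have fE : (fun y => 2^-1 * dotv (V y) (V y) - h y) = 2^-1 *: (fun y => dotv (V y) (V y)) - h by [].
have df : differentiable (fun y => 2^-1 * dotv (V y) (V y) - h y) z by rewrite fE; exact: differentiableB.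
rewrite (derive_mul w dchi df) fE deriveB; [|exact: diff_derivable|exact: diff_derivable].
rewrite deriveZ; last exact: diff_derivable.
rewrite derive_dotv //; congr (_ * (_ - _) + _).
by rewrite /GRing.scale /= mulrA mulVf ?mul1r // pnatr_eq0.
Qed.

Let D_pi w : 'D_w pi_test z = chi z * (rs z * 'D_w h z) + 'D_w chi z * rs z `^ g.
Proof. by rewrite (derive_mul w dchi dp) D_p. Qed.

Let D_flux j w : 'D_w (flux_test j) z =
  chi z * (rs z * 'D_w h z) * V z ord0 j + chi z * rs z `^ g * 'D_w V z ord0 j
  + 'D_w chi z * rs z `^ g * V z ord0 j.
Proof.
have dVj : differentiable (fun y => V y ord0 j) z by exact: differentiable_row_coord.
have dpV : differentiable (fun y => rs y `^ g * V y ord0 j) z.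
  exact: (@differentiableM _ _ (fun y => rs y `^ g) (fun y => V y ord0 j)).
rewrite (derive_mul w dchi dpV) (derive_mul w dp dVj) D_p derive_row_coord //.
by move: ('D_w V z ord0 j) => q; ring.
Qed.

(** All terms without derivatives of [chi] combine to the two residuals of [V], the
    strain of [V] and its divergence; in particular the gradients of the weak solution
    drop out. *)
Lemma rel_rateE : let Er := 2^-1 * rho z * dotv (u z - V z) (u z - V z) + relP g (rho z) (rs z) in
  I z = dt chi z * Er + \sum_(j < d) dx j chi z *
     (u z ord0 j * Er + (rho z `^ g - rs z `^ g) * (u z ord0 j - V z ord0 j)) +
  chi z * (rho z * (\sum_i (V z ord0 i - u z ord0 i) * accel g rs V z i)
    - rho z * (\sum_i \sum_j (V z ord0 i - u z ord0 i) * (V z ord0 j - u z ord0 j) * dx j V z ord0 i)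
    - (g - 1) * relP g (rho z) (rs z) * (\sum_i dx i V z ord0 i)
    - (rho z - rs z) * mass_residual g rs V z).
Proof.
move=> Er; have gn : g - 1 != 0 by have := g1; lra.
have PE : relP g (rho z) (rs z) = rho z `^ g / (g - 1) - h z * rho z + rs z `^ g by [].
have aE i : accel g rs V z i = dt V z ord0 i + (\sum_j V z ord0 j * dx j V z ord0 i) + dx i h z.
  rewrite /accel derive_row_coord // derive_direction // scale1r mxE summxE.
  by congr (_ + _ + _); apply: eq_bigr => j _; rewrite mxE.
have mE : mass_residual g rs V z = dt h z + (\sum_j dx j h z * V z ord0 j) + (g - 1) * h z * \sum_i dx i V z ord0 i.
  rewrite /mass_residual derive_direction // /divergence; congr (_ + _ + _ * _).
  - by rewrite /GRing.scale /= mul1r.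
  - by apply: eq_bigr => j _; rewrite mulrC.
  - by apply: eq_bigr => j _; rewrite /dx derive_row_coord.
have ErE : Er = 2^-1 * rho z * (\sum_i (u z ord0 i - V z ord0 i) * (u z ord0 i - V z ord0 i)) +
    (rho z `^ g / (g - 1) - h z * rho z + rs z `^ g).
  by rewrite /Er PE; congr (_ * _ + _); apply: eq_bigr => i _; rewrite !mxE.
rewrite ErE mE PE; under [X in chi z * (rho z * X - _ - _ - _)]eq_bigr => i _ do rewrite aE.
rewrite -(@rate_algebra R d (fun i => u z ord0 i) (fun i => V z ord0 i) (fun j => dx j chi z)
  (fun j => dx j h z) (fun i => dt V z ord0 i) (fun i j => dx j V z ord0 i) g (rho z) (rs z)
  (rho z `^ g) (rs z `^ g) (h z) (dt h z) (chi z) (dt chi z) gn (hr Az)).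
rewrite /rel_rate; congr (_ - (_ + _ + _ * _) + (_ * _ + _) + (_ + _)).
- by apply: eq_bigr => i _; rewrite [dt _ _]D_eta !mxE.
- by apply: eq_bigr => i _; apply: eq_bigr => j _; rewrite [dx _ _ _]D_eta !mxE.
- by apply: eq_bigr => i _; rewrite [dx _ _ _]D_eta !mxE.
- exact: D_psi.
- by apply: eq_bigr => j _; rewrite [dx _ _ _]D_psi.
- exact: D_pi.
- by apply: eq_bigr => j _; rewrite [dx _ _ _]D_flux.
Qed.

End inside_cone.

Lemma rel_rate_outside z : s z < 0 -> I z = 0.
Proof.
move=> sz; have nz := near_cutoff0 sz.
have D0 (W' : normedModType R) (f : E -> W') w : (\forall y \near z, f y = 0) -> 'D_w f z = 0.
  by move=> f0; have -> : 'D_w f z = 'D_w (cst 0) z; [exact: near_eq_derive|rewrite derive_cst].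
have c1 w : 'D_w chi z = 0 by exact: D0.
have c2 w : 'D_w eta_test z = 0.
  by apply: D0; apply: filterS nz => y hy; rewrite /eta_test hy scale0r.
have c3 w : 'D_w psi_test z = 0.
  by apply: D0; apply: filterS nz => y hy; rewrite /psi_test hy mul0r.
have c4 w : 'D_w pi_test z = 0.
  by apply: D0; apply: filterS nz => y hy; rewrite /pi_test hy mul0r.
have c5 j w : 'D_w (flux_test j) z = 0.
  by apply: D0; apply: filterS nz => y hy; rewrite /flux_test hy mul0r.
rewrite /rel_rate /dt /dx c1 c2 c3 c4.
rewrite !big1 => [|j _|j _|j _|i _|j _]; rewrite ?c1 ?c2 ?c3 ?c5 ?mul0r ?mxE ?mul0r //.
  rewrite (_ : dotv 0 _ = 0); last by apply: big1 => i _; rewrite mxE mul0r.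
  by rewrite !(mul0r, mulr0, addr0, subr0).
by apply: big1 => j _; rewrite c2 mxE mul0r.
Qed.

End pointwise_rate.

(** * Sets and functions almost everywhere *)

Section open_sets.
Context {R : realType} {d : nat}.
Local Notation E := ('rV[R]_d * R)%type.
Local Notation mE := ('rV[R]_d * measurableTypeR R)%type.
Local Notation muxt := (lebesgue_xt R d).

Lemma open_box (z : E) (U : set E) : open U -> U z ->
  exists2 B : set mE, measurable B /\ B `<=` U & (0 < muxt B)%E.
Proof.
move=> oU Uz; have /nbhs_ballP[e' e'0 he] : nbhs z U by exact: open_nbhs_nbhs.
pose e : R := e' / 2; have e0 : 0 < e by rewrite divr_gt0.
have ee : e < e' by rewrite ltr_pdivrMr // mulr_natr mulr2n ltrDl.
pose side (a : R) : set (measurableTypeR R) := `]a - e, a + e[%classic.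
pose Bx : set 'rV[R]_d := [set x | forall i, side (z.1 ord0 i) (x ord0 i)].
have mside a : measurable (side a) by exact: measurable_itv.
have mBx : measurable Bx.
  have -> : Bx = \bigcap_(i in [set: 'I_d]) ((fun x : 'rV[R]_d => x ord0 i) @^-1` side (z.1 ord0 i)).
    by apply/seteqP; split=> w h i; [move=> _; exact: h|exact: h].
  apply: fin_bigcap_measurable => // i _; rewrite -[X in measurable X]setTI.
  exact: (measurable_rV_coord i measurableT (mside _)).
have side_gt a : (0 < @lebesgue_measure R (side a))%E.
  have ae : a - e < a + e by move: e0; lra.
  by rewrite lebesgue_measure_itv /= lte_fin ae -EFinB lte_fin; lra.
exists (Bx `*` side z.2); first split.
- exact: measurableX.
- have sd (a b : R) : side a b -> `|a - b| <= e.
    by rewrite /side /= in_itv /= => /andP[h1 h2]; rewrite ler_norml; apply/andP; split; lra.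
  move=> [x t] [/= hx ht]; apply: he; split; rewrite -ball_normE /=; apply: (le_lt_trans _ ee).
    by apply: row_norm_le => [|i]; [exact: ltW|rewrite !mxE; exact: sd].
  exact: sd.
- rewrite /lebesgue_xt /= product_measure1E //; apply: mule_gt0; last exact: (side_gt z.2).
  have bE := @lebesgue_rV_box R d (fun i => side (z.1 ord0 i)) (fun i => mside _).
  have p0 : (0 < \prod_(i < d) @lebesgue_measure R (side (z.1 ord0 i)))%E.
    by elim/big_ind: _ => // a b; exact: mule_gt0.
  by rewrite -bE in p0.
Qed.

(** A nonempty open set contains a box, which has positive measure. *)
Lemma open_not_null (z : E) (U : set E) (P : E -> Prop) : open U -> U z ->
  (\forall w \ae muxt, P w) -> exists2 w, U w & P w.
Proof.
move=> oU Uz [N [mN N0 hN]]; have [B [mB BU] B0] := open_box oU Uz.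
have [w Bw nN] : exists2 w, B w & ~ N w.
  apply: contrapT => h; have BN : B `<=` N.
    by move=> w Bw; apply: contrapT => nN; apply: h; exists w.
  have BN0 := le_measure muxt (mem_set mB) (mem_set mN) BN.
  have : (muxt B <= 0)%E by rewrite -N0.
  by rewrite leNgt B0.
by exists w; [exact: BU|apply: contrapT => nP; apply: nN; exact: hN].
Qed.

(** Balls are connected as unions of segments that start at the centre. *)
Lemma ball_domain (x : 'rV[R]_d) (e : R) : 0 < e -> is_domain (ball x e).
Proof.
move=> e0; split; first by exists x; exact: ballxx.
  exact: ball_open.
have -> : ball x e = \bigcup_(y in ball x e) ((fun s : R => x + s *: (y - x)) @` `[0, 1]).
  apply/seteqP; split => [y By|y [w Bw [s]]].
    exists y => //; exists 1; first by rewrite /= in_itv /= ler01 lexx.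
    by rewrite scale1r addrC subrK.
  rewrite /= in_itv /= => /andP[s0 s1] <-.
  move: Bw; rewrite -ball_normE /= => Bw.
  rewrite opprD addNKr normrN normrZ ger0_norm // (le_lt_trans _ Bw) // -[leRHS]mul1r distrC.
  by rewrite ler_wpM2r.
apply: bigcup_connected.
  exists x => y By; exists 0; first by rewrite /= in_itv /= lexx ler01.
  by rewrite scale0r addr0.
move=> y By; apply: connected_continuous_connected; first exact: segment_connected.
apply: continuous_subspaceT => s.
apply: (@continuousD _ _ _ (fun=> x) (fun s : R => s *: (y - x))); first exact: cvg_cst.
by apply: (@continuousZr_tmp); exact: cvg_id.
Qed.

End open_sets.

Section almost_everywhere_domination.
Context {R : realType} {dsp : measure_display} {X : measurableType dsp}.
Variable mu : {measure set X -> \bar R}.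

Lemma integrable_ae_le (D : set X) (f g : X -> R) : measurable D -> measurable_fun D f ->
  mu.-integrable D (EFin \o g) -> (\forall x \ae mu, D x -> `|f x| <= `|g x|) ->
  mu.-integrable D (EFin \o f).
Proof.
move=> mD mf gi fg; have /integrableP[mg gfin] := gi.
apply/integrableP; split; first exact/measurable_EFinP.
apply: le_lt_trans gfin; apply: ae_ge0_le_integral => //.
- by apply: measurableT_comp => //; exact/measurable_EFinP.
- exact: measurableT_comp.
Qed.

Lemma ae_zero_of_small (D : set X) (f : X -> R) (M : R) : measurable D ->
  mu.-integrable D (EFin \o f) -> (\forall x \ae mu, D x -> 0 <= f x) ->
  (forall e : R, 0 < e <= 1 -> \int[mu]_(x in D) f x <= e * M) ->
  \forall x \ae mu, D x -> f x = 0.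
Proof.
move=> mD fi f0 small.
have mf := measurable_int _ fi.
have le0 : \int[mu]_(x in D) f x <= 0.
  rewrite leNgt; apply/negP => I0.
  have M0 : 0 < M by have := small 1; rewrite mul1r ltr01 lexx => /(_ isT); exact: lt_le_trans.
  pose e := Num.min 1 (\int[mu]_(x in D) f x / (2 * M)).
  have e0 : 0 < e by rewrite lt_min ltr01 divr_gt0 // mulr_gt0.
  have e1 : e <= 1 by rewrite ge_min lexx.
  have e2 : e * M <= \int[mu]_(x in D) f x / 2.
    have : e <= \int[mu]_(x in D) f x / (2 * M) by rewrite ge_min lexx orbT.
    rewrite -(ler_pM2r M0) => /le_trans; apply; rewrite le_eqVlt; apply/orP; left; apply/eqP.
    by field; rewrite gt_eqF.
  by have := small e; rewrite e0 e1 => /(_ isT); lra.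
have abs0 : (\int[mu]_(x in D) `|(EFin \o f) x| = 0)%E.
  apply/eqP; rewrite eq_le integral_ge0 ?andbT //.
  apply: (@le_trans _ _ (\int[mu]_(x in D) (EFin \o f) x)%E).
    apply: ae_le_integral => //.
      have /integrableP[_ fin] := fi; apply/integrableP; split; first exact: measurableT_comp.
      by under eq_integral do rewrite abse_id.
    by apply: ae_imply f0 => x hx Dx; rewrite /= lee_fin ger0_norm // hx.
  rewrite -[leLHS]fineK; last exact: (integrable_fin_num mD fi).
  by rewrite lee_fin.
have := (ae_eq_integral_abs mu mD mf).1 abs0.
by apply: ae_imply => x hx Dx; have := hx Dx => -[].
Qed.

End almost_everywhere_domination.

(** * The relative energy vanishes *)

Section relative_energy_vanishes.
Context {R : realType} {d : nat}.
Local Notation E := ('rV[R]_d * R)%type.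
Local Notation mE := ('rV[R]_d * measurableTypeR R)%type.
Local Notation mux := (lebesgue_rV R d).
Local Notation muxt := (lebesgue_xt R d).
Variables (g T : R) (Omega : set 'rV[R]_d).
Variables (rs : E -> R) (us : E -> 'rV[R]_d) (rho : E -> R) (u : E -> 'rV[R]_d).
Variables (rmin rmax v : R).
Local Notation O := (cyl T Omega).
Local Notation A := (ccyl T Omega).
Hypotheses (oO : open Omega) (T0 : 0 < T) (g1 : 1 < g).
Hypothesis rsC : forall z, A z -> C1at O A rs z.
Hypothesis usC : forall z, A z -> C1at O A us z.
Hypothesis rs0 : forall z, A z -> 0 <= rs z.
Hypothesis vac : 2 <= g \/ forall z, A z -> 0 < rs z.
Hypotheses (rmin0 : 0 <= rmin) (rmm : rmin < rmax) (v0 : 0 < v).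
Hypothesis rs_bounds : forall z, A z -> rmin <= rs z <= rmax.
Hypotheses (mrho : measurable_fun (A : set mE) rho) (mu_ : measurable_fun (A : set mE) u).
Hypothesis bounds : \forall z \ae muxt, O z -> rmin <= rho z <= rmax /\ `|u z| <= v.
Hypothesis weak : \forall tau \ae @lebesgue_measure R, 0 < tau < T ->
  (forall psi : E -> R, C1c Omega T psi ->
     mass_balance Omega tau rho u (fun x => rs (x, 0)) psi) /\
  (forall eta : E -> 'rV[R]_d, C1c Omega T eta ->
     momentum_balance g Omega tau rho u (fun x => rs (x, 0)) (fun x => us (x, 0)) eta).
Hypothesis energy : \forall tau \ae @lebesgue_measure R, 0 < tau < T ->
  forall chi : E -> R, C1c Omega T chi -> (forall z, A z -> 0 <= chi z) ->
    energy_inequality g Omega tau rho u (fun x => rs (x, 0)) (fun x => us (x, 0)) chi.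

Variables (x0 : 'rV[R]_d) (r T1 Kv : R).
Hypotheses (r0 : 0 < r) (T1T : 0 < T1 < T) (Kv0 : 0 <= Kv).
Hypothesis ball_Omega : forall x, sqdist x0 x <= r ^+ 2 -> Omega x.
Hypothesis approx : forall eps : R, 0 < eps -> exists V : E -> 'rV[R]_d,
  (forall z, A z -> sqdist x0 z.1 <= r ^+ 2 -> z.2 < T1 ->
     C1at O A V z /\ (0 < rs z -> `|V z - us z| <= eps)) /\
  (forall z, O z -> sqdist x0 z.1 <= r ^+ 2 -> z.2 < T1 ->
     [/\ `|V z| <= Kv, (forall j, `|dx j V z| <= Kv),
     (forall i, `|accel g rs V z i| <= eps) & `|mass_residual g rs V z| <= eps]).

Let OA : O `<=` A. Proof. exact: cyl_ccyl. Qed.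
Let rmax0 : 0 < rmax. Proof. exact: le_lt_trans rmm. Qed.
Let k : R := v + Kv.
Let k0 : 0 < k. Proof. by rewrite ltr_pwDl. Qed.
Let C1 : R := 2 * d%:R ^+ 2 * Kv + (g - 1) * (d%:R * Kv).
Let C10 : 0 <= C1.
Proof.
have gp : 0 <= g - 1 by rewrite subr_ge0 ltW.
by rewrite addr_ge0 // !mulr_ge0 // exprn_ge0.
Qed.
(* Collects both sources of error: the residuals of [V] in [rate_le], and the distance
   of [V] from [us] at the initial time and in [gap_le]. *)
Let N : R := rmax * (d%:R * k + 1) + 2^-1 * rmax * d%:R.

Section at_speed.
Variables (CF c : R).
Hypothesis CF0 : 0 < CF.
Hypothesis flux : forall s1 s2 w, rmin <= s1 <= rmax -> rmin <= s2 <= rmax -> 0 <= w <= k ->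
  `|s1 `^ g - s2 `^ g| * w <= CF * (2^-1 * s1 * w ^+ 2 + relP g s1 s2).
Hypotheses (c0 : 0 < c) (cc : 2 * d%:R * r * (v + CF) <= c) (cT : r ^+ 2 / c < T1).
Let T1T' : T1 < T. Proof. by case/andP: T1T. Qed.
Local Notation chi := (cone_cutoff x0 r c).
Variable T' : R.
Hypotheses (T'T : 0 < T' < T) (CT : C1 * T' <= 2^-1).
Let Q : set mE := Omega `*` `]0, T'[.
Let M : R := 2 * T' * N * (\int[muxt]_(z in Q) chi z + \int[mux]_(x in Omega) chi (x, 0)).

Let QO : Q `<=` O.
Proof.
move=> [x t] [/= xO]; rewrite in_itv /= => /andP[t0 tt]; split => //=.
by rewrite in_itv /= t0 (lt_trans tt) //; case/andP: T'T.
Qed.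
Let mQ : measurable Q. Proof. exact: measurable_cylinder. Qed.
Let mOc : measurable (O : set mE). Proof. by apply: open_measurable_xt; exact: open_cyl. Qed.

(** A distance of the two solutions that does not depend on [V]. The factor [rs]
    switches the comparison of the velocities off in the vacuum of the strong solution. *)
Definition gap (z : E) : R := chi z * (relP g (rho z) (rs z) +
  (4 * rmax)^-1 * rs z * rho z * dotv (u z - us z) (u z - us z)).

Let measurable_rs : measurable_fun (O : set mE) rs.
Proof. exact: test_measurable. Qed.

Let measurable_rho : measurable_fun (O : set mE) rho.
Proof.
apply: (measurable_funS _ (@OA) mrho).
by apply: measurableX; [exact: open_measurable_x|exact: measurable_itv].
Qed.

Let measurable_pow (f : mE -> R) (a : R) : measurable_fun (O : set mE) f ->
  measurable_fun (O : set mE) (fun z => f z `^ a).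
Proof.
move=> mf; apply: (@measurableT_comp _ _ _ _ _ _ (fun s : R => s `^ a)) => //.
Qed.

Let measurable_gap : measurable_fun (O : set mE) gap.
Proof.
apply: measurable_funM.
  apply: open_continuous_measurable_xt => [|z _]; first exact: open_cyl.
  exact: (differentiable_continuous (differentiable_cutoff _ _ _ z)).
apply: measurable_funD.
  apply: measurable_funD; last exact: measurable_pow.
  apply: measurable_funB; apply: measurable_funM => //; first exact: measurable_pow.
  by apply: measurable_funM => //; exact: measurable_pow.
apply: measurable_funM; first by apply: measurable_funM => //; exact: measurable_funM.
apply: measurable_sum => i.
have mi : measurable_fun (O : set mE) (fun z => (u z - us z) ord0 i).
  rewrite (_ : (fun z => _) = (fun z => u z ord0 i - us z ord0 i)); last first.
    by apply/funext => z; rewrite !mxE.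
  apply: measurable_funB.
    apply: (@measurableT_comp _ _ _ _ _ _ (fun x : 'rV[R]_d => x ord0 i)); first exact: measurable_rV_coord.
    apply: (measurable_funS _ (@OA) mu_).
    by apply: measurableX; [exact: open_measurable_x|exact: measurable_itv].
  apply: open_continuous_measurable_xt => [|z Oz]; first exact: open_cyl.
  apply: differentiable_continuous; apply: differentiable_row_coord.
  exact: (C1at_differentiable Oz (usC (OA Oz))).
exact: measurable_funM.
Qed.

Let rho0' s1 : rmin <= s1 <= rmax -> 0 <= s1 <= rmax.
Proof. by case/andP => h1 ->; rewrite (le_trans rmin0). Qed.

Lemma gap_ge0 : \forall z \ae muxt, O z -> 0 <= gap z.
Proof.
apply: ae_imply bounds => z hb Oz; have [/rho0'/andP[p0 pr] _] := hb Oz.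
have s0 := rs0 (OA Oz).
apply: mulr_ge0; first exact: cutoff_ge0.
apply: addr_ge0; first exact: relP_ge0.
by rewrite !mulr_ge0 ?dotv_ge0 // invr_ge0 mulr_ge0 // ltW.
Qed.

Let dotv_tri (a b e : 'rV[R]_d) : dotv (a - e) (a - e) <= 2 * dotv (a - b) (a - b) + 2 * dotv (b - e) (b - e).
Proof.
rewrite /dotv !mulr_sumr -big_split; apply: ler_sum => i _; rewrite !mxE /=.
have := sqr_ge0 ((a ord0 i - b ord0 i) - (b ord0 i - e ord0 i)).
by rewrite -subr_ge0; congr (0 <= _); ring.
Qed.

Section at_precision.
Variables (eps : R) (V : E -> 'rV[R]_d).
Hypotheses (eps0 : 0 < eps) (eps1 : eps <= 1).
Hypothesis VC : forall z, A z -> sqdist x0 z.1 <= r ^+ 2 -> z.2 < T1 ->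
     C1at O A V z /\ (0 < rs z -> `|V z - us z| <= eps).
Hypothesis VB : forall z, O z -> sqdist x0 z.1 <= r ^+ 2 -> z.2 < T1 ->
     [/\ `|V z| <= Kv, (forall j, `|dx j V z| <= Kv),
     (forall i, `|accel g rs V z i| <= eps) & `|mass_residual g rs V z| <= eps].

Let VC1 z : A z -> sqdist x0 z.1 <= r ^+ 2 -> z.2 < T1 -> C1at O A V z.
Proof. by move=> Az h1 h2; have [] := VC Az h1 h2. Qed.

Local Notation eta := (eta_test V x0 r c).
Local Notation psi := (psi_test g rs V x0 r c).
Local Notation pi := (pi_test g rs x0 r c).
Local Notation G := (flux_test g rs V x0 r c).
Local Notation e := (rel_energy g rho u chi psi pi eta).
Local Notation I := (rel_rate g rho u chi psi pi eta G).
Local Notation e0 := (rel_energy0 g (fun x => rs (x, 0)) (fun x => us (x, 0)) chi psi pi eta).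

Let in_cone z : A z -> chi z != 0 -> [/\ 0 <= cone x0 r c z, sqdist x0 z.1 <= r ^+ 2 & z.2 < T1].
Proof.
move=> Az cz; have sz : 0 <= cone x0 r c z.
  by rewrite leNgt; apply: contra cz => /ltW /pos_sq_le0 /eqP.
have [/= h1] := cone_in_base c0 Az sz; rewrite in_itv /= => /andP[_ h2].
by split => //; exact: le_lt_trans cT.
Qed.

Let e_ge0 : \forall z \ae muxt, O z -> 0 <= e z.
Proof.
apply: ae_imply bounds => z hb Oz; have [/rho0'/andP[p0 pr] _] := hb Oz.
rewrite (rel_energyE rs rho V u x0 r c g1); apply: mulr_ge0; first exact: cutoff_ge0.
apply: addr_ge0; last by apply: relP_ge0 => //; exact/rs0/OA.
by rewrite !mulr_ge0 ?invr_ge0 ?dotv_ge0.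
Qed.

Let rate_le : \forall z \ae muxt, O z -> I z <= C1 * e z + (eps * N) * chi z.
Proof.
apply: ae_imply bounds => z hb Oz; have [rb uv] := hb Oz; have Az := OA Oz.
have /andP[p0 pr] := rho0' rb; have /andP[s0 sr] := rho0' (rs_bounds Az).
have [sz|sz] := ltP (cone x0 r c z) 0.
  rewrite (rel_rate_outside g rs rho V u sz) (rel_energyE rs rho V u x0 r c g1).
  by rewrite /cone_cutoff (pos_sq_le0 (ltW sz)) mul0r !mulr0 addr0.
have [/= h1] := cone_in_base c0 Az sz; rewrite in_itv /= => /andP[_ h2].
have h3 : z.2 < T1 by exact: le_lt_trans cT.
have [b1 b2 b3 b4] := VB Oz h1 h3.
have rateE := rel_rateE rho u oO g1 rsC rs0 vac c0 cT VC1 Oz sz.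
rewrite rateE (rel_energyE rs rho V u x0 r c g1).
set Er := 2^-1 * _ * _ + _.
have relP0 : 0 <= relP g (rho z) (rs z) by exact: relP_ge0.
have Er0 : 0 <= Er by rewrite addr_ge0 // !mulr_ge0 ?invr_ge0 ?dotv_ge0.
have uV : `|u z - V z| <= k by rewrite (le_trans (ler_normB _ _)) // lerD.
have fl : `|rho z `^ g - rs z `^ g| * `|u z - V z| <= CF * Er.
  apply: (le_trans (flux rb (rs_bounds Az) _)); first by rewrite normr_ge0.
  rewrite ler_pM2l // lerD2r ler_wpM2l ?mulr_ge0 ?invr_ge0 //; exact: norm_sq_le_dotv.
have yr : `|z.1 - x0| <= r by apply: norm_sqdist h1; exact: ltW.
have m0 : 0 <= Num.max 0 (cone x0 r c z) by rewrite le_max lexx.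
have t1 := cone_flux_le m0 (ltW r0) (ltW v0) (ltW CF0) Er0 yr uv fl cc.
have dtE : dt chi z = 2 * Num.max 0 (cone x0 r c z) * (- (2 * 0) - c * 1).
  rewrite /dt derive_cutoff /= /dotv [\sum_i _]big1 // => i _.
  by rewrite [X in _ * X]mxE mulr0.
have dxE j : dx j chi z = 2 * Num.max 0 (cone x0 r c z) * (- (2 * (z.1 - x0) ord0 j) - c * 0).
  rewrite /dx derive_cutoff /= /dotv (bigD1 j) //= big1 => [|i ij]; last first.
    by rewrite [X in _ * X]mxE (negbTE ij) andbF mulr0.
  by rewrite [X in _ * X + 0]mxE !eqxx mulr1 addr0.
rewrite dtE; under eq_bigr do rewrite dxE.
pose Ac : 'rV[R]_d := \row_i accel g rs V z i.
have acE : \sum_(i < d) (V z ord0 i - u z ord0 i) * accel g rs V z i =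
    \sum_(i < d) (V z ord0 i - u z ord0 i) * Ac ord0 i.
  by apply: eq_bigr => i _; rewrite mxE.
have b3' i : `|Ac ord0 i| <= eps by rewrite mxE.
have b2' i j : `|dx j V z ord0 i| <= Kv by rewrite (le_trans (coord_le_norm _ _)).
have t2 := @source_le R d (u z) (V z) Ac (fun i j => dx j V z ord0 i) (rho z) (rs z) rmax Kv k eps g Er
  (relP g (rho z) (rs z)) (mass_residual g rs V z) (rho0' rb) (rho0' (rs_bounds Az)) Kv0 (ltW eps0)
  (ltW g1) relP0 uV b3' b2' b4 erefl.
have cg := cutoff_ge0 x0 r c z.
have {}t2 := ler_wpM2l cg t2.
rewrite acE -[leRHS]add0r; apply: lerD => //; apply: (le_trans t2).
rewrite mulrDr [X in X + _ <= _]mulrCA lerD2l mulrC ler_wpM2r // ler_wpM2l ?(ltW eps0) // /N lerDl.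
by rewrite !mulr_ge0 ?invr_ge0 // ltW.
Qed.

Let sq_small (w : 'rV[R]_d) : `|w| <= eps -> dotv w w <= d%:R * eps.
Proof.
move=> we; apply: (le_trans (dotv_sq_le _)); apply: ler_wpM2l => //.
rewrite expr2; apply: (le_trans (ler_pM (normr_ge0 _) (normr_ge0 _) we we)).
by rewrite ler_piMl // ltW.
Qed.

Let init_le x : Omega x -> e0 x <= (eps * N) * chi (x, 0).
Proof.
move=> xO; have Ax : A (x, 0) by split => //=; rewrite in_itv /= lexx ltW.
rewrite (rel_energy0E V x0 r c T0 g1 rs0 us xO) mulrC.
have /andP[s0 sr] := rho0' (rs_bounds Ax).
have cg := cutoff_ge0 x0 r c (x, 0).
have [cz|cz] := eqVneq (chi (x, 0)) 0; first by rewrite cz !mulr0.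
have [_ h1 h2] := in_cone Ax cz; rewrite ler_wpM2r //.
have NN : 2^-1 * rmax * d%:R <= N.
  by rewrite /N lerDr mulr_ge0 ?(ltW rmax0) // addr_ge0 // mulr_ge0 // ltW.
have [rz|rz] := ltP 0 (rs (x, 0)); last first.
  have -> : rs (x, 0) = 0 by apply/eqP; rewrite eq_le rz s0.
  rewrite mulr0 mul0r mulr_ge0 ?(ltW eps0) // (le_trans _ NN) //.
  by rewrite !mulr_ge0 ?invr_ge0 // ltW.
have [_ /(_ rz) VE] := VC Ax h1 h2.
have q : dotv (us (x, 0) - V (x, 0)) (us (x, 0) - V (x, 0)) <= d%:R * eps.
  by apply: sq_small; rewrite distrC.
apply: (@le_trans _ _ (2^-1 * rmax * (d%:R * eps))).
  by apply: ler_pM => //; rewrite ?mulr_ge0 ?invr_ge0 ?dotv_ge0 // ler_wpM2l // invr_ge0.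
by rewrite mulrA [leLHS]mulrC ler_pM2l.
Qed.

(* The factor [(4 * rmax)^-1] makes room for the triangle inequality between [u], [V]
   and [us]. *)
Let gap_le : \forall z \ae muxt, O z -> gap z <= e z + (eps * N) * chi z.
Proof.
apply: ae_imply bounds => z hb Oz; have [rb uv] := hb Oz; have Az := OA Oz.
have /andP[p0 pr] := rho0' rb; have /andP[s0 sr] := rho0' (rs_bounds Az).
rewrite (rel_energyE rs rho V u x0 r c g1) /gap.
have cg := cutoff_ge0 x0 r c z.
have [cz|cz] := eqVneq (chi z) 0; first by rewrite cz !mul0r mulr0 addr0.
have [_ h1 h2] := in_cone Az cz.
rewrite [X in _ <= _ + X]mulrC -mulrDr ler_wpM2l // [X in _ <= X + _]addrC -[leRHS]addrA lerD2l.
have NN : 2^-1 * rmax * d%:R <= N.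
  by rewrite /N lerDr mulr_ge0 ?(ltW rmax0) // addr_ge0 // mulr_ge0 // ltW.
have N0 : 0 <= N by apply: le_trans NN; rewrite !mulr_ge0 ?invr_ge0 // ltW.
have [rz|rz] := ltP 0 (rs z); last first.
  have -> : rs z = 0 by apply/eqP; rewrite eq_le rz s0.
  rewrite mulr0 !mul0r addr_ge0 // ?mulr_ge0 ?invr_ge0 ?dotv_ge0 //; exact: ltW.
have [_ /(_ rz) VE] := VC Az h1 h2.
have q : dotv (V z - us z) (V z - us z) <= d%:R * eps.
  exact: sq_small.
have tri := dotv_tri (u z) (V z) (us z).
have q1 : (4 * rmax)^-1 * rs z <= 4^-1.
  by rewrite invfM -mulrA ler_piMr ?invr_ge0 // mulrC ler_pdivrMr // mul1r.
have q2 : (4 * rmax)^-1 * rs z * rho z * dotv (u z - us z) (u z - us z) <=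
   4^-1 * rho z * (2 * dotv (u z - V z) (u z - V z) + 2 * (d%:R * eps)).
  apply: ler_pM => //; rewrite ?dotv_ge0 //.
  - by rewrite !mulr_ge0 // invr_ge0 mulr_ge0 // ltW.
  - by rewrite ler_wpM2r.
  - by rewrite (le_trans tri) // lerD2l ler_pM2l.
rewrite (le_trans q2) //.
have -> : 4^-1 * rho z * (2 * dotv (u z - V z) (u z - V z) + 2 * (d%:R * eps)) =
  2^-1 * rho z * dotv (u z - V z) (u z - V z) + eps * (2^-1 * rho z * d%:R) by field.
rewrite lerD2l ler_pM2l // (le_trans _ NN) // ler_wpM2r // ler_wpM2l // invr_ge0 //.
Qed.

Let cK : compact (cone_base x0 r c) := compact_cone_base r0.
Let KA : cone_base x0 r c `<=` A := @cone_base_sub R d T Omega x0 r c T1 cT T1T' ball_Omega.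

Let abs_bounds : \forall z \ae muxt, O z -> 0 <= rho z <= rmax /\ `|u z| <= v.
Proof. by apply: ae_imply bounds => z hb Oz; have [/rho0' h1 h2] := hb Oz. Qed.

Let N0 : 0 <= N.
Proof.
by rewrite addr_ge0 // !mulr_ge0 ?invr_ge0 ?addr_ge0 ?mulr_ge0 // ltW.
Qed.

Let chiT : test_on T Omega (cone_base x0 r c) chi := chi_test T Omega x0 r c0.
Let psiT := psi_is_test oO rsC rs0 vac c0 cT VC1.
Let piT := pi_is_test x0 oO g1 rsC rs0 c0 cT.
Let etaT := eta_is_test oO c0 cT VC1.
Let chi_ge0 z (_ : A z) : 0 <= chi z. Proof. exact: cutoff_ge0. Qed.
Let T'le : T' <= T. Proof. by case/andP: T'T => _ /ltW. Qed.

Let i1 : muxt.-integrable Q (EFin \o chi) := cutoff_integrable oO cK KA chiT T'le.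
Let i2 : muxt.-integrable Q (EFin \o e) :=
  rel_energy_integrable oO g1 mrho mu_ abs_bounds cK KA chiT psiT piT etaT chi_ge0 e_ge0 T'le.
Let i3 : muxt.-integrable Q (EFin \o (fun z => e z + eps * N * chi z)) :=
  integrable_add mQ i2 (integrable_scale (eps * N) mQ i1).

Lemma gap_integral_le : muxt.-integrable Q (EFin \o gap) /\
  \int[muxt]_(z in Q) gap z <= eps * (M + N * \int[muxt]_(z in Q) chi z).
Proof.
have i4 : muxt.-integrable Q (EFin \o gap).
  apply: (integrable_ae_le mQ _ i3); first exact: measurable_funS mOc QO measurable_gap.
  apply: ae_imply2 gap_ge0 gap_le => z h1 h2 Qz.
  have {}h1 := h1 (QO Qz); have {}h2 := h2 (QO Qz).
  by rewrite !ger0_norm // (le_trans h1 h2).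
split => //.
have small := rel_energy_small oO T0 g1 mrho mu_ abs_bounds weak energy cK KA chiT psiT piT
  etaT (flux_is_test oO g1 rsC rs0 c0 cT VC1) chi_ge0 C10 (mulr_ge0 (ltW eps0) N0) T'T CT
  e_ge0 rate_le init_le.
have le1 : \int[muxt]_(z in Q) gap z <= \int[muxt]_(z in Q) (e z + eps * N * chi z).
  apply: ae_le_Rintegral => //; apply: ae_imply gap_le => z h Qz; exact: (h (QO Qz)).
apply: (le_trans le1).
rewrite RintegralD //; last exact: integrable_scale.
rewrite RintegralZl // [leRHS]mulrDr [eps * (N * _)]mulrA lerD // (le_trans small) // /M.
by rewrite le_eqVlt; apply/orP; left; apply/eqP; rewrite /Q; ring.
Qed.

End at_precision.

(** The bound of [gap_integral_le] tends to zero with the precision of the approximating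
    velocity. *)
Lemma gap_eq0 : \forall z \ae muxt, Q z -> gap z = 0.
Proof.
have ge0 : \forall z \ae muxt, Q z -> 0 <= gap z.
  by apply: ae_imply gap_ge0 => z h /QO; exact: h.
have step (eps : R) : 0 < eps <= 1 -> muxt.-integrable Q (EFin \o gap) /\
    \int[muxt]_(z in Q) gap z <= eps * (M + N * \int[muxt]_(z in Q) chi z).
  by case/andP => e0 e1; have [V [VC VB]] := approx e0; exact: gap_integral_le VC VB.
have [gi _] := step 1 ltac:(by rewrite ltr01 lexx).
apply: (ae_zero_of_small (M := M + N * \int[muxt]_(z in Q) chi z) mQ gi ge0) => eps he.
exact: (step eps he).2.
Qed.

End at_speed.
End relative_energy_vanishes.

(** * Coincidence of the solutions *)

Section coincidence.
Context {R : realType} {d : nat}.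
Local Notation E := ('rV[R]_d * R)%type.
Local Notation muxt := (lebesgue_xt R d).

(** If the condition failed at [z], it would fail in a nonempty open subset of [O],
    which has positive measure. *)
Lemma ae_closed_extension (O A : set E) (f : E -> R) (F : set R) (z : E) :
  open O -> A `<=` closure O -> O `<=` A -> closed F ->
  (\forall w \ae muxt, O w -> F (f w)) -> A z ->
  f w @[w --> within A (nbhs z)] --> f z -> F (f z).
Proof.
move=> oO AO OA cF hF Az cf; apply: contrapT => nF.
have nU : nbhs z [set w | A w -> ~ F (f w)].
  have : nbhs (f z) (~` F) by apply: open_nbhs_nbhs; split => //; exact: closed_openC.
  by move=> /cf.
have [w [Ow Uw]] := AO z Az _ (nbhs_interior nU).
have oOU : open (O `&` [set w | A w -> ~ F (f w)]°) by apply: openI => //; exact: open_interior.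
have [y [Oy /interior_subset Uy] Fy] := open_not_null oOU (conj Ow Uw) hF.
exact: (Uy (OA _ Oy) (Fy Oy)).
Qed.

Lemma norm_le_euclid (a : 'rV[R]_d) : `|a| <= euclid_norm a.
Proof.
rewrite /euclid_norm -(ger0_norm (normr_ge0 a)) -sqrtr_sqr ler_wsqrtr //.
exact: norm_sq_le_dotv.
Qed.

(** Both summands are nonnegative, hence zero. In the vacuum [s2 = 0] the first one is
    s1^g/(g - 1); otherwise it is coercive, and then the second one compares the
    velocities. *)
Lemma gap_zero_coincide (g rmin rmax s1 s2 : R) (w1 w2 : 'rV[R]_d) : 1 < g -> 0 <= rmin ->
  (g < 2 -> 0 < rmin) -> rmin < rmax -> rmin <= s1 <= rmax -> rmin <= s2 <= rmax ->
  relP g s1 s2 + (4 * rmax)^-1 * s2 * s1 * dotv (w1 - w2) (w1 - w2) = 0 ->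
  (s2 = 0 /\ s1 = 0) \/ (s2 = s1 /\ w2 = w1).
Proof.
move=> g1 rmin0 rmin_gt0 rmm b1 b2 h.
have [c c0 coer] := relP_coercive rmax g1 rmin0 rmin_gt0.
have gp : 0 < g - 1 by rewrite subr_gt0.
have rmax0 : 0 < rmax by exact: le_lt_trans rmm.
have s10 : 0 <= s1 by case/andP: b1 => h1 _; exact: le_trans h1.
have s20 : 0 <= s2 by case/andP: b2 => h1 _; exact: le_trans h1.
have P0 := relP_ge0 g1 s10 s20.
have D0 := dotv_ge0 (w1 - w2).
have m0 : 0 <= (4 * rmax)^-1 * s2 * s1.
  by rewrite !mulr_ge0 // invr_ge0 mulr_ge0 // ltW.
move/eqP: h; rewrite (paddr_eq0 P0 (mulr_ge0 m0 D0)) => /andP[/eqP Pz /eqP Dz].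
have [s2z|s2z] := eqVneq s2 0.
  left; split => //; move: Pz; rewrite s2z /relP !powR0 ?gt_eqF //; last exact: lt_trans g1.
  rewrite mulr0 mul0r subr0 addr0 => /eqP; rewrite mulf_eq0 invr_eq0 (gt_eqF gp) orbF.
  by rewrite powR_eq0 => /andP[/eqP].
have {}s2z : 0 < s2 by rewrite lt_neqAle eq_sym s2z.
right; have := coer _ _ b1 b2; rewrite Pz mulr0.
have q0 : 0 < c * s2 `^ (g - 1) by rewrite mulr_gt0 // powR_gt0.
rewrite mulrA pmulr_rle0 // => sq.
have sE : s1 = s2.
  apply/eqP; rewrite -subr_eq0 -sqrf_eq0; apply/eqP/le_anti; rewrite sq sqr_ge0 //.
split => //; apply/eqP; rewrite eq_sym -subr_eq0 -normr_eq0 -sqrf_eq0; apply/eqP/le_anti.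
rewrite sqr_ge0 andbT (le_trans (norm_sq_le_dotv _)) //.
move/eqP: Dz; rewrite mulf_eq0 => /orP[|/eqP -> //].
by rewrite sE !mulf_eq0 invr_eq0 mulf_eq0 pnatr_eq0 /= !gt_eqF.
Qed.

End coincidence.

(** The cone must contract faster than the flux speed [b] and be empty before [T1], and
    the time interval must be short compared with the rate [C1] and the height of the
    cone. *)
Lemma speed_and_time {R : realType} (r T T1 b C1 : R) : 0 < r -> 0 < T1 < T -> 0 <= b -> 0 <= C1 ->
  exists c T' : R, [/\ 0 < c, b <= c, r ^+ 2 / c < T1 & [/\ 0 < T' < T, C1 * T' <= 2^-1 & c * T' <= r ^+ 2 / 4]].
Proof.
move=> r0 /andP[T10 T1T] b0 C10.
pose c := b + 2 * r ^+ 2 / T1.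
have q0 : 0 < 2 * r ^+ 2 / T1 by rewrite divr_gt0 // mulr_gt0 // exprn_gt0.
have c0 : 0 < c by rewrite ltr_wpDl.
have cT : r ^+ 2 / c < T1.
  rewrite ltr_pdivrMr // /c mulrDr [T1 * (_ / _)]mulrC divfK ?gt_eqF //.
  by have := mulr_ge0 (ltW T10) b0; have := exprn_gt0 2 r0; lra.
pose T' := Num.min (r ^+ 2 / (4 * c)) (2 * (C1 + 1))^-1.
have C11 : 0 < C1 + 1 by rewrite ltr_wpDl.
have s0 : 0 < r ^+ 2 / (4 * c) by rewrite divr_gt0 ?exprn_gt0 ?mulr_gt0.
have T'0 : 0 < T' by rewrite lt_min s0 invr_gt0 mulr_gt0.
have h1 : T' <= r ^+ 2 / (4 * c) by rewrite ge_min lexx.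
have h2 : T' <= (2 * (C1 + 1))^-1 by rewrite ge_min lexx orbT.
have cT' : c * T' <= r ^+ 2 / 4.
  apply: (le_trans (ler_wpM2l (ltW c0) h1)); rewrite le_eqVlt; apply/orP; left; apply/eqP.
  by field; rewrite gt_eqF.
exists c, T'; split => //; first by rewrite lerDl ltW.
split => //.
  rewrite T'0 (le_lt_trans _ (lt_trans cT T1T)) // ler_pdivlMr // mulrC (le_trans cT') //.
  by have := exprn_gt0 2 r0; lra.
apply: (@le_trans _ _ ((C1 + 1) * (2 * (C1 + 1))^-1)).
  by rewrite ler_pM // ?lerDl // ltW.
by rewrite invfM mulrCA divff ?mulr1 // gt_eqF.
Qed.

Theorem theorem4p4 (R : realType) (d : nat) (gamma T : R)
    (Omega : set 'rV[R]_d)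
    (rs : 'rV[R]_d * R -> R) (us : 'rV[R]_d * R -> 'rV[R]_d)
    (rho : 'rV[R]_d * R -> R) (u : 'rV[R]_d * R -> 'rV[R]_d)
    (rmin rmax v : R) :
  1 < gamma -> 0 < T -> is_domain Omega ->
  local_strong_solution gamma Omega T rs us ->
  admissible_weak_solution gamma Omega T rho u
    (fun x => rs (x, 0)) (fun x => us (x, 0)) ->
  0 <= rmin -> rmin < rmax -> (gamma < 2 -> 0 < rmin) -> 0 < v ->
  (\forall z \ae lebesgue_xt R d, (Omega `*` `]0, T[) z ->
    [/\ rmin <= rs z <= rmax, rmin <= rho z <= rmax,
        euclid_norm (us z) <= v & euclid_norm (u z) <= v]) ->
  forall x0, Omega x0 ->
  exists (Omega' : set 'rV[R]_d) (T' : R),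
    [/\ is_domain Omega', Omega' `<=` Omega, Omega' x0, 0 < T' <= T &
      \forall z \ae lebesgue_xt R d, (Omega' `*` `]0, T'[) z ->
        (rs z = 0 /\ rho z = 0) \/ (rs z = rho z /\ us z = u z)].
Proof.
move=> g1 T0 [_ oO _] [[rsU usU] rs0 mass_eq momentum_eq] [_ [mrho mu_ _ _ _] weak energy].
move=> rmin0 rmm rmin_gt0 v0 bounds x0 Ox0.
have OA := @cyl_ccyl R d T Omega; have AO := @ccyl_closure R d T Omega T0.
have oC : open (cyl T Omega) by exact: open_cyl.
have AcA : ccyl T Omega `<=` closure (ccyl T Omega) by exact: subset_closure.
have OcA : cyl T Omega `<=` closure (ccyl T Omega) by exact: subset_trans OA AcA.
have rsC z : ccyl T Omega z -> C1at (cyl T Omega) (ccyl T Omega) rs z.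
  by move=> Az; apply: (C1at_subset (@subset_refl _ _) AcA); apply: (C1_upto_C1at OcA rsU); exact: AcA.
have usC z : ccyl T Omega z -> C1at (cyl T Omega) (ccyl T Omega) us z.
  by move=> Az; apply: (C1at_subset (@subset_refl _ _) AcA); apply: (C1_upto_C1at OcA usU); exact: AcA.
have rs_bounds z : ccyl T Omega z -> rmin <= rs z <= rmax.
  move=> Az; have [cz _ _] := rsC z Az.
  have F : closed (`[rmin, rmax]%classic : set R) by exact: interval_closed.
  have := ae_closed_extension oC AO OA F _ Az cz; rewrite /= in_itv /=; apply.
  by apply: ae_imply bounds => w h /h[]; rewrite in_itv.
have vac : 2 <= gamma \/ forall z, ccyl T Omega z -> 0 < rs z.
  have [g2|g2] := leP 2 gamma; [by left|right => z /rs_bounds/andP[h _]].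
  by apply: lt_le_trans h; exact: rmin_gt0.
have abs_bounds : \forall z \ae lebesgue_xt R d, cyl T Omega z ->
    rmin <= rho z <= rmax /\ `|u z| <= v.
  apply: ae_imply bounds => w h /h[_ ? _ uv]; split => //.
  exact: le_trans (norm_le_euclid _) uv.
have [r [T1 [K [r0 T1T K0 ball_Omega approx]]]] :=
  velocity_approximation oO T0 g1 rsC usC rs0 mass_eq momentum_eq vac Ox0.
have vK : 0 < v + K by rewrite ltr_wpDr.
have [CF CF0 flux] := pressure_flux_le rmax g1 rmin0 rmin_gt0 vK.
have gp : 0 <= gamma - 1 by rewrite subr_ge0 ltW.
have b0 : 0 <= 2 * d%:R * r * (v + CF) by rewrite !mulr_ge0 // ?addr_ge0 // ltW.
have C0 : 0 <= 2 * (d%:R : R) ^+ 2 * K + (gamma - 1) * (d%:R * K) by rewrite addr_ge0 // !mulr_ge0 ?exprn_ge0.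
have [c [T' [c0 cc cT [T'T CT cT']]]] := speed_and_time r0 T1T b0 C0.
have gap0 := gap_eq0 oO T0 g1 rsC usC rs0 vac rmin0 rmm v0 rs_bounds mrho mu_ abs_bounds weak energy
  r0 T1T K0 ball_Omega approx CF0 flux c0 cc cT T'T CT.
(* The sup norm ball of radius [delta] lies in the Euclidean ball of radius r/2, over
   which the cone is at least as high as [T']. *)
pose delta : R := r / (2 * (d%:R + 1)).
have d1 : 0 < (d%:R + 1 : R) by rewrite ltr_wpDl.
have delta0 : 0 < delta by rewrite divr_gt0 // mulr_gt0.
have dd : d%:R * delta ^+ 2 <= r ^+ 2 / 4.
  have -> : d%:R * delta ^+ 2 = (d%:R / (d%:R + 1) ^+ 2) * (r ^+ 2 / 4).
    by rewrite /delta; field; rewrite gt_eqF.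
  rewrite ler_piMl ?divr_ge0 ?exprn_ge0 ?(ltW r0) // ler_pdivrMr ?exprn_gt0 // mul1r.
  by have := ler0n R d; nra.
have sq x : ball x0 delta x -> sqdist x0 x <= r ^+ 2 / 4.
  rewrite -ball_normE /= distrC => /ltW hx; apply: le_trans (sqdist_le _ _) (le_trans _ dd).
  by rewrite ler_wpM2l // ler_sqr ?nnegrE // ltW.
have bO : ball x0 delta `<=` Omega.
  by move=> x /sq hx; apply: ball_Omega; apply: (le_trans hx); have := exprn_gt0 2 r0; lra.
exists (ball x0 delta), T'; split.
- exact: ball_domain.
- exact: bO.
- exact: ballxx.
- by case/andP: T'T => -> /ltW.
apply: ae_imply2 gap0 abs_bounds => -[x t] h1 h2 [/= hx]; rewrite in_itv /= => /andP[t0 tT'].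
have Oz : cyl T Omega (x, t).
  by split; [exact: bO|rewrite /= in_itv /= t0 (lt_trans tT') //; case/andP: T'T].
have Qz : (Omega `*` `]0, T'[) (x, t) by split; [exact: bO|rewrite /= in_itv /= t0].
have [rb _] := h2 Oz; have := h1 Qz; rewrite /gap => /eqP.
have cone0 : 0 < cone x0 r c (x, t).
  have := ltr_pM2l c0 t T'; rewrite tT' /cone /= => ct.
  by have := sq x hx; have := exprn_gt0 2 r0; lra.
rewrite mulf_eq0 => /orP[|/eqP h].
  by rewrite /cone_cutoff /pos_sq sqrf_eq0 max_r ?(ltW cone0) // gt_eqF.
exact: (gap_zero_coincide g1 rmin0 rmin_gt0 rmm rb (rs_bounds _ (OA _ Oz)) h).
Qed.
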